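(* Let $f_0\in L^\infty(\mathbb{R}^d\times\mathbb{R}^d)$ be a probability density with $\int\big(V(x)+\frac{|v|^2}{2}\big)f_0(x,v)\,dx\,dv<\infty$, assume (H2)–(H5) and (M) of the context, suppose that $\Sigma$ is radially symmetric and that $(\nabla V)^{-1}(\{0\})\subset B(0,R)$ for some $R\ge0$. Let $(q_{k,0},p_{k,0})_{k\in\mathbb{N}}$ be independent random variables identically distributed according to $f_0$, and for $N\ge1$ let $(q_k(t),p_k(t))_{1\le k\le N}$ be the solution of the $N$-particle system (P) of the context with initial data $(q_{k,0},p_{k,0})_{1\le k\le N}$. Let $$\Theta=\begin{cases}\frac{d}{d+1}\Big[\big(\omega_d^2(d+1)(R+1)^d\|f_0\|_{L^\infty}\big)^{-1/d}\wedge1\Big]&\text{if }R>0,\\[2mm]\frac{2d}{2d+1}\Big[\big(\omega_{2d}(2d+1)\|f_0\|_{L^\infty}\big)^{-1/(2d)}\wedge1\Big]&\text{if }R=0.\end{cases}$$ 1. Almost surely, for all $t\ge0$, $\ \liminf_{N\to\infty}D^N\big((q_k(t),p_k(t))_{1\le k\le N},Eq^N\big)\ge\Theta$. 2. If $\nabla^2V\in L^\infty(\mathbb{R}^d)$, then with $C(t)$ defined in the context, for all $N\ge1$, $t\ge0$ and $\epsilon\in(0,\Theta)$: (i) $\displaystyle\mathbb{E}\Big[D^N\big((q_k(t),p_k(t))_{1\le k\le N},Eq^N\big)\Big]\ge\Theta-\frac{C(t)}{\sqrt N}$; (ii) $\displaystyle\mathbb{P}\Big[D^N\big((q_k(t),p_k(t))_{1\le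 k\le N},Eq^N\big)\le\Theta-\epsilon\Big]\le\frac{1+C(t)}{\epsilon\sqrt N}$.
   Context: $N$-particle system (P): for $t\ge0$ and all $k\in\{1,\dots,N\}$, $$\dot q_k(t)=p_k(t),\qquad \dot p_k(t)=-\nabla_x\big(V+\Phi_0(t)\big)(q_k(t))+\int_0^tp(t-s)\Big(\frac1N\sum_{j=1}^N\nabla_x\Sigma(q_k(t)-q_j(s))\Big)ds .$$ (The scalar function $p$ is the memory kernel, extended to $\mathbb{R}$ by $p(-t)=-p(t)$; $p_k$ is the velocity of particle $k$.) Fourier transforms are $\hat h(\omega)=\int h(t)e^{-i\omega t}\,dt$ (in the sense of tempered distributions when needed). $\omega_d$ is the volume of the unit ball of $\mathbb{R}^d$; $B(0,R)$ is the ball of center $0$ and radius $R$, closed, so $B(0,0)=\{0\}$. $a\wedge b$ denotes $\min(a,b)$. With $\kappa=-P(0)$, $$Eq^N=\Big\{(x_k,v_k)_{1\le k\le N}\ \Big|\ \nabla V(x_k)-\frac{\kappa}{N}\sum_{j=1}^N\nabla\Sigma(x_k-x_j)=0\ \text{and}\ v_k=0\ \text{for all }k\Big\}.$$ For $Z_i=(x^i_k,v^i_k)_{1\le k\le N}\in(\mathbb{R}^d\times\mathbb{R}^d)^N$, $i=1,2$, $$D^N(Z_1,Z_2)=\frac1N\sum_{k=1}^N\Big[\big(|x^1_k-x^2_k|^2+|v^1_k-v^2_k|^2\big)^{1/2}\wedge1\Big],$$ and $D^N(Z,Eq^N)=\inf_{Y\in Eq^N}D^N(Z,Y)$. Constant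 $C$: for $T\ge0$, $$C(T)=3\|\nabla\Sigma\|_{L^\infty(\mathbb{R}^d)}\int_0^T\|p\|_{L^1(0,t)}\Big(1+\int_t^T\exp\Big(\int_s^Tr_2(\tau)\,d\tau\Big)ds\Big)dt,$$ $$r_2(t)=1+\|\nabla^2V\|_{L^\infty(\mathbb{R}^d)}+\|\nabla^2\Phi_0\|_{L^\infty([0,t]\times\mathbb{R}^d)}+2\|\nabla^2\Sigma\|_{L^\infty(\mathbb{R}^d)}\|p\|_{L^1(0,t)}.$$ Assumptions. (H2): $\Phi_0\in C(\mathbb{R}_+,W^{2,\infty}(\mathbb{R}^d))$, $p\in L^1_{loc}(\mathbb{R})$, $\Sigma\in C^2_0(\mathbb{R}^d)$ (real-valued, with derivatives up to order 2 continuous and vanishing at infinity), $V\in W^{2,\infty}_{loc}(\mathbb{R}^d)$, $V\ge0$. (H3): $\nabla_x\Phi_0\in L^1(\mathbb{R}_+,L^\infty(\mathbb{R}^d))$, $p=P'$ with $P\in L^1(\mathbb{R})$, $\hat P\le0$, $\hat\Sigma\ge0$. (H4): $\nabla_x\Phi_0\in L^\infty(\mathbb{R}_+\times\mathbb{R}^d)$, $P\in L^\infty(\mathbb{R})$, $|\nabla V|\le\alpha+\beta V$ for some constants $\alpha,\beta$. (H5): $\hat P(\omega)\ne0$ for all $\omega\neq0$, and $\mathrm{supp}(\hat\Sigma)=\mathbb{R}^d$. (M): $\lim_{|x|\to\infty}V(x)=+\infty$, and $x\cdot\nabla V(x)\ge0$, $x\cdot\nabla\Sigma(x)\le0$ for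 all $x\in\mathbb{R}^d$. *)

(* Defs.v *)
From HB Require Import structures.
From mathcomp Require Import all_boot all_order all_algebra.
From mathcomp Require Import all_classical all_reals all_analysis.
From mathcomp Require Import complex.

Set Implicit Arguments.
Unset Strict Implicit.
Unset Printing Implicit Defensive.

Import Order.TTheory GRing.Theory Num.Theory.
Import numFieldNormedType.Exports.

Local Open Scope classical_set_scope.
Local Open Scope ring_scope.

Definition rV_display : measure_display -> measure_display.
Proof. exact. Qed.

Section measurable_rV.
Context {d : measure_display} {T : measurableType d}.
Variable n : nat.

Definition rV_coor (i : 'I_n) (x : 'rV[T]_n) : T := x ord0 i.

Let rV_set0 : g_sigma_preimage rV_coor set0.
Proof. exact: sigma_algebra0. Qed.

Let rV_setC A : g_sigma_preimage rV_coor A -> g_sigma_preimage rV_coor (~` A).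
Proof. exact: sigma_algebraC. Qed.

Let rV_bigcup (F : _^nat) : (forall i, g_sigma_preimage rV_coor (F i)) ->
  g_sigma_preimage rV_coor (\bigcup_i (F i)).
Proof. exact: sigma_algebra_bigcup. Qed.

HB.instance Definition _ := @isMeasurable.Build (rV_display d)
  'rV[T]_n (g_sigma_preimage rV_coor) rV_set0 rV_setC rV_bigcup.

Lemma measurable_rV_coor (i : 'I_n) :
  measurable_fun [set: 'rV[T]_n] (rV_coor i).
Proof.
move=> _ Y mY; rewrite setTI; apply: sub_sigma_algebra => /=.
rewrite -bigcup_seq/=; exists i => /=; first by rewrite mem_index_enum.
by exists Y => //; rewrite setTI.
Qed.

Lemma measurable_fun_rV d' (T' : measurableType d') (f : T' -> 'rV[T]_n) :
  (forall i, measurable_fun [set: T'] (rV_coor i \o f)) ->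
  measurable_fun [set: T'] f.
Proof.
move=> mf _ A mA; rewrite setTI.
have : g_sigma_preimage rV_coor `<=` [set A | measurable (f @^-1` A)].
  apply: smallest_sub.
    split => /=; first by rewrite preimage_set0.
    - by move=> B mB; rewrite setTD preimage_setC; apply: measurableC.
    - by move=> F mF; rewrite preimage_bigcup; apply: bigcup_measurable.
  move=> B; rewrite -bigcup_seq/= => -[i _ [C mC <-]] /=.
  by rewrite setTI -comp_preimage -[X in measurable X]setTI; exact: mf.
by apply.
Qed.

End measurable_rV.

Section vcons.
Context {T : pointedType}.
Variable n : nat.

Definition vcons (z : T * 'rV[T]_n) : 'rV[T]_n.+1 :=
  \row_i (if unlift ord0 i is Some j then z.2 ord0 j else z.1).

Definition vuncons (x : 'rV[T]_n.+1) : T * 'rV[T]_n :=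
  (x ord0 ord0, \row_j x ord0 (lift ord0 j)).

Lemma vunconsK : cancel vuncons vcons.
Proof.
move=> x; apply/rowP => i; rewrite mxE.
by case: unliftP => [j ->|->] //=; rewrite mxE.
Qed.

Lemma vconsK : cancel vcons vuncons.
Proof.
move=> [a x]; rewrite /vuncons mxE unlift_none /=; congr (_, _).
by apply/rowP => j; rewrite !mxE liftK.
Qed.

End vcons.

Section measurable_vcons.
Context {d : measure_display} {T : measurableType d}.
Variable n : nat.

Lemma measurable_vcons : measurable_fun setT (@vcons T n).
Proof.
apply: measurable_fun_rV => i.
case: (unliftP ord0 i) => [j ->|->].
  rewrite (_ : _ \o _ = rV_coor j \o snd).
    by apply: measurableT_comp => //; exact: measurable_rV_coor.
  by apply/funext => z; rewrite /rV_coor /= mxE liftK.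
rewrite (_ : _ \o _ = fst) //.
by apply/funext => z; rewrite /rV_coor /= mxE unlift_none.
Qed.

Lemma measurable_vuncons : measurable_fun setT (@vuncons T n).
Proof.
apply/measurable_fun_pairP; split; first exact: measurable_rV_coor.
apply: measurable_fun_rV => j.
rewrite (_ : _ \o _ = rV_coor (lift ord0 j)); first exact: measurable_rV_coor.
by apply/funext => z; rewrite /rV_coor /= mxE.
Qed.

End measurable_vcons.

Section leb_step.
Context {R : realType}.
Variable n : nat.
Variable mu : {sigma_finite_measure set 'rV[R]_n -> \bar R}.
Local Open Scope ereal_scope.

Definition leb_step (A : set 'rV[R]_n.+1) : \bar R :=
  (@lebesgue_measure R \x mu) (@vcons R n @^-1` A).

Let mvcons (A : set 'rV[R]_n.+1) :
  measurable A -> measurable (@vcons R n @^-1` A).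
Proof. by move=> mA; rewrite -[X in measurable X]setTI; exact: measurable_vcons. Qed.

Let leb_step0 : leb_step set0 = 0.
Proof. by rewrite /leb_step preimage_set0 measure0. Qed.

Let leb_step_ge0 A : 0 <= leb_step A.
Proof. exact: measure_ge0. Qed.

Let leb_step_sigma_additive : semi_sigma_additive leb_step.
Proof.
move=> F mF tF mUF; rewrite /leb_step preimage_bigcup.
apply: measure_semi_sigma_additive.
- by move=> k; exact: mvcons.
- apply/trivIsetP => /= i j _ _ ij; rewrite -preimage_setI.
  by move/trivIsetP : tF => /(_ _ _ _ _ ij) ->//; rewrite preimage_set0.
- by rewrite -preimage_bigcup; exact: mvcons.
Qed.

HB.instance Definition _ := isMeasure.Build _ _ _
  leb_step leb_step0 leb_step_ge0 leb_step_sigma_additive.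

Let leb_step_sigma_finite : sigma_finite setT leb_step.
Proof.
have /sigma_finiteP[F [TF ndF Foo]] := sigma_finiteT (@lebesgue_measure R).
have /sigma_finiteP[G [TG ndG Goo]] := sigma_finiteT mu.
exists (fun k => @vuncons R n @^-1` (F k `*` G k)).
  rewrite -preimage_bigcup; apply/esym; rewrite -[RHS](@preimage_setT _ _ (@vuncons R n)).
  congr (_ @^-1` _); apply/seteqP; split => // -[x y] _.
  have : [set: R] x by []. have : [set: 'rV[R]_n] y by [].
  rewrite TF TG => -[l _ Gly] [k _ Fkx]; exists (maxn k l) => //; split => /=.
  - by move: x Fkx; exact/subsetPset/ndF/leq_maxl.
  - by move: y Gly; exact/subsetPset/ndG/leq_maxr.
move=> k; have [mFk Fkoo] := Foo k; have [mGk Gkoo] := Goo k; split.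
  rewrite -[X in measurable X]setTI; apply: measurable_vuncons => //.
  exact: measurableX.
rewrite /leb_step -comp_preimage (_ : _ \o _ = id).
  by rewrite preimage_id product_measure1E// lte_mul_pinfty// ge0_fin_numE.
by apply/funext => z /=; rewrite vconsK.
Qed.

HB.instance Definition _ := Measure_isSigmaFinite.Build _ _ _
  leb_step leb_step_sigma_finite.

End leb_step.

(* Lebesgue measure on R^n, as the iterated product of the one-dimensional
   one; R^0 is a point of mass 1. *)
Fixpoint leb (R : realType) (n : nat) :
    {sigma_finite_measure set 'rV[R]_n -> \bar R} :=
  match n with
  | 0 => (\d_ (0 : 'rV[R]_0) : {measure set 'rV[R]_0 -> \bar R})
  | m.+1 => leb_step (leb R m)
  end.

Section calculus.
Context {R : realType} {d : nat}.
Implicit Types (x y : 'rV[R]_d) (f g phi : 'rV[R]_d -> R) (i j : 'I_d).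

Definition dot x y : R := \sum_i x ord0 i * y ord0 i.

(* The library norm of 'rV[R]_d is the sup norm. *)
Definition enorm x : R := Num.sqrt (dot x x).

Definition eball (r : R) : set 'rV[R]_d := [set x | enorm x <= r].

Definition opnorm (A : 'M[R]_d) : R :=
  sup [set enorm (x *m A) | x in eball 1].

Definition partial i f x : R := 'D_(delta_mx ord0 i) f x.

Definition grad f x : 'rV[R]_d := \row_i partial i f x.

Definition hess f x : 'M[R]_d := \matrix_(i, j) partial i (partial j f) x.

Definition partials (s : seq 'I_d) f : 'rV[R]_d -> R := foldr partial f s.

Definition C1 f : Prop :=
  forall i, (forall x, derivable f x (delta_mx ord0 i)) /\
            continuous (partial i f).

Definition smooth f : Prop :=
  forall s : seq 'I_d, continuous (partials s f) /\
    forall i x, derivable (partials s f) x (delta_mx ord0 i).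

Definition vanishes_at_infty f : Prop :=
  forall e, 0 < e -> exists M, forall x, M < enorm x -> `|f x| < e.

Definition C20 f : Prop :=
  forall s : seq 'I_d, (size s <= 2)%N ->
    [/\ continuous (partials s f), vanishes_at_infty (partials s f) &
        (size s < 2)%N ->
        forall i x, derivable (partials s f) x (delta_mx ord0 i)].

Definition supp f : set 'rV[R]_d := closure [set x | f x != 0].

Definition test_function phi : Prop :=
  smooth phi /\ exists M, supp phi `<=` eball M.

Definition radial f : Prop := forall x y, enorm x = enorm y -> f x = f y.

Definition normLoo f : \bar R := 'N[leb R d]_+oo[EFin \o f]%E.

Definition Loo f : Prop :=
  measurable_fun [set: 'rV[R]_d] f /\ (normLoo f < +oo)%E.

Definition Loo_loc f : Prop :=
  measurable_fun [set: 'rV[R]_d] f /\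
  forall M : R, (normLoo (f \* \1_(eball M))%R < +oo)%E.

Definition is_weak_partial i f g : Prop :=
  [/\ measurable_fun [set: 'rV[R]_d] g,
      forall M : R, (leb R d).-integrable (eball M) (EFin \o g) &
      forall phi, test_function phi ->
        \int[leb R d]_x (f x * partial i phi x) =
        - \int[leb R d]_x (g x * phi x)].

(* a representative of the weak derivative, which is unique up to null sets *)
Definition weak_partial i f : 'rV[R]_d -> R :=
  xget (fun=> 0) [set g | is_weak_partial i f g].

Definition has_weak_partial i f : Prop := exists g, is_weak_partial i f g.

Definition weak_grad f x : 'rV[R]_d := \row_i weak_partial i f x.

Definition weak_hess f x : 'M[R]_d :=
  \matrix_(i, j) weak_partial i (weak_partial j f) x.

Definition Sobolev2 (L : ('rV[R]_d -> R) -> Prop) f : Prop :=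
  [/\ L f,
      forall i, has_weak_partial i f /\ L (weak_partial i f) &
      forall i j, has_weak_partial i (weak_partial j f) /\
                  L (weak_partial i (weak_partial j f))].

Definition W2oo : ('rV[R]_d -> R) -> Prop := Sobolev2 Loo.

Definition W2oo_loc : ('rV[R]_d -> R) -> Prop := Sobolev2 Loo_loc.

Definition normW2oo f : \bar R :=
  (normLoo f + normLoo (enorm \o weak_grad f)
   + normLoo (opnorm \o weak_hess f))%E.

End calculus.

Section fourier.
Context {R : realType}.

Definition expi (t : R) : R[i] := (cos t +i* sin t)%C.

Definition Cintegral dT (T : measurableType dT)
    (mu : {measure set T -> \bar R}) (F : T -> R[i]) : R[i] :=
  ((\int[mu]_x complex.Re (F x)) +i* (\int[mu]_x complex.Im (F x)))%C.

Definition fourier1 (h : R -> R) (w : R) : R[i] :=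
  Cintegral (@lebesgue_measure R) (fun t => (h t)%:C%C * expi (- (t * w))).

Definition fourier (d : nat) (h : 'rV[R]_d -> R) (xi : 'rV[R]_d) : R[i] :=
  Cintegral (leb R d) (fun x => (h x)%:C%C * expi (- dot x xi)).

(* The tempered distribution [fourier S] of a bounded function [S], as
   <fourier S, phi> = <S, fourier phi>. Being C-linear, it is determined by its
   values on real-valued test functions. *)
Definition dist_fourier (d : nat) (S : 'rV[R]_d -> R) (phi : 'rV[R]_d -> R) :
    R[i] :=
  Cintegral (leb R d) (fun x => (S x)%:C%C * fourier phi x).

Definition dist_ge0 (d : nat) (T : ('rV[R]_d -> R) -> R[i]) : Prop :=
  forall phi, test_function phi -> (forall x, 0 <= phi x) -> 0 <= T phi.

Definition dist_supp (d : nat) (T : ('rV[R]_d -> R) -> R[i]) :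
    set 'rV[R]_d :=
  [set x | forall U : set 'rV[R]_d, open U -> U x ->
     exists phi, [/\ test_function phi, supp phi `<=` U & T phi != 0]].

Definition test_function1 (phi : R -> R) : Prop :=
  (forall (n : nat) (t : R), derivable (derive1n n phi) t 1) /\
  exists M, forall t, M < `|t| -> phi t = 0.

Definition weak_derivative1 (P p : R -> R) : Prop :=
  forall phi, test_function1 phi ->
    \int[@lebesgue_measure R]_t (P t * derive1 phi t) =
    - \int[@lebesgue_measure R]_t (p t * phi t).

End fourier.

Section assumptions.
Context {R : realType} {d : nat}.
Variables (V Sigma : 'rV[R]_d -> R) (Phi0 : R -> 'rV[R]_d -> R).
Variables p P : R -> R.

Local Notation leb1 := (@lebesgue_measure R).

(* [V] and [Phi0 t] denote the C^1 representatives of their classes, so that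
   their gradients are defined pointwise. [p] is the odd extension to R of the
   memory kernel. *)
Definition H2 : Prop :=
  [/\ [/\ forall t, 0 <= t -> W2oo (Phi0 t) /\ C1 (Phi0 t) &
          forall t, 0 <= t ->
            normW2oo (Phi0 s \- Phi0 t)
              @[s --> within [set s | 0 <= s] (nbhs t)] --> 0%E],
      locally_integrable setT p /\ (forall t, 0 < t -> p (- t) = - p t),
      C20 Sigma &
      [/\ W2oo_loc V, C1 V & forall x, 0 <= V x]].

(* [P] denotes its continuous representative, so that [P 0] makes sense. *)
Definition H3 : Prop :=
  [/\ (\int[leb1]_(t in `[0%R, +oo[)
         normLoo (enorm \o grad (Phi0 t)) < +oo)%E,
      [/\ continuous P, leb1.-integrable setT (EFin \o P) &
          weak_derivative1 P p],
      forall w, fourier1 P w <= 0 &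
      dist_ge0 (dist_fourier Sigma)].

(* |grad Phi0| on R_+ x R^d, extended by 0 to R x R^d *)
Definition grad_Phi0_norm (z : R * 'rV[R]_d) : R :=
  \1_([set t : R | 0 <= t]) z.1 * enorm (grad (Phi0 z.1) z.2).

Definition H4 : Prop :=
  [/\ ('N[leb1 \x leb R d]_+oo[EFin \o grad_Phi0_norm] < +oo)%E,
      ('N[leb1]_+oo[EFin \o P] < +oo)%E &
      exists alpha beta : R, forall x, enorm (grad V x) <= alpha + beta * V x].

Definition H5 : Prop :=
  (forall w, w != 0 -> fourier1 P w != 0) /\
  dist_supp (dist_fourier Sigma) = [set: 'rV[R]_d].

Definition HM : Prop :=
  [/\ forall A : R, exists M : R, forall x, M < enorm x -> A < V x,
      forall x, 0 <= dot x (grad V x) &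
      forall x, dot x (grad Sigma x) <= 0].

End assumptions.

Section particles.
Context {R : realType} {d : nat}.
Variables (V Sigma : 'rV[R]_d -> R) (Phi0 : R -> 'rV[R]_d -> R).
Variables p P : R -> R.

Definition phase : Type := ('rV[R]_d * 'rV[R]_d)%type.

(* derivative on [0, +oo[, one-sided at 0 *)
Definition is_derive_ge0 (f : R -> 'rV[R]_d) (t : R) (l : 'rV[R]_d) : Prop :=
  (h^-1 *: (f (t + h) - f t))
    @[h --> within [set h | 0 <= t + h] (0 : R)^'] --> l.

Definition memory_force (N : nat) (q : 'I_N -> R -> 'rV[R]_d)
    (k : 'I_N) (t : R) : 'rV[R]_d :=
  \row_i \int[@lebesgue_measure R]_(s in `[0, t])
    (p (t - s) * (N%:R^-1 * \sum_j grad Sigma (q k t - q j s) ord0 i)).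

Definition is_solution (N : nat) (z0 : 'I_N -> phase)
    (q v : 'I_N -> R -> 'rV[R]_d) : Prop :=
  (forall k, (q k 0, v k 0) = z0 k) /\
  forall t, 0 <= t -> forall k,
    is_derive_ge0 (q k) t (v k t) /\
    is_derive_ge0 (v k) t
      (- grad (V \+ Phi0 t) (q k t) + memory_force q k t).

Definition kappa : R := - P 0.

Definition EqN {N : nat} : set ('I_N -> phase) :=
  [set z | forall k,
     grad V (z k).1
       - (kappa / N%:R) *: \sum_j grad Sigma ((z k).1 - (z j).1) = 0 /\
     (z k).2 = 0].

Definition DN (N : nat) (z1 z2 : 'I_N -> phase) : R :=
  N%:R^-1 * \sum_k Num.min
    (Num.sqrt (enorm ((z1 k).1 - (z2 k).1) ^+ 2
             + enorm ((z1 k).2 - (z2 k).2) ^+ 2)) 1.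

Definition DNEq (N : nat) (z : 'I_N -> phase) : \bar R :=
  ereal_inf [set (DN z y)%:E | y in EqN].

Local Open Scope ereal_scope.

Definition normL1 (t : R) : \bar R :=
  \int[@lebesgue_measure R]_(s in `]0%R, t[) `|p s|%:E.

(* For a map in C(R_+, W^{2,oo}) the L^oo norm on [0, t] x R^d is the supremum
   over [0, t] of the L^oo norms in space. *)
Definition normLoo_hess_Phi0 (t : R) : \bar R :=
  ereal_sup [set normLoo (opnorm \o weak_hess (Phi0 s)) | s in `[0%R, t]].

Definition r2 (t : R) : \bar R :=
  1 + normLoo (opnorm \o weak_hess V) + normLoo_hess_Phi0 t
  + 2%:E * normLoo (opnorm \o hess Sigma) * normL1 t.

Definition Cst (T : R) : \bar R :=
  3%:E * normLoo (enorm \o grad Sigma) *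
  \int[@lebesgue_measure R]_(t in `[0%R, T])
    (normL1 t * (1 + \int[@lebesgue_measure R]_(s in `[t, T])
       expeR (\int[@lebesgue_measure R]_(tau in `[s, T]) r2 tau))).

End particles.

Section data.
Context {R : realType} {d : nat}.

Definition leb_phase : {measure set (@phase R d) -> \bar R} :=
  (leb R d \x leb R d)%E.

Definition prob_density (f : @phase R d -> R) : Prop :=
  [/\ measurable_fun [set: @phase R d] f,
      {ae leb_phase, forall z, 0 <= f z} &
      (\int[leb_phase]_z (f z)%:E = 1)%E].

Definition normLoo_phase (f : @phase R d -> R) : \bar R :=
  'N[leb_phase]_+oo[EFin \o f]%E.

Definition mutually_independent dO (Omega : measurableType dO)
    (Pr : probability Omega R) dT (T : measurableType dT)
    (X : nat -> {RV Pr >-> T}) : Prop :=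
  forall (J : seq nat) (A : nat -> set T), uniq J ->
    (forall k, measurable (A k)) ->
    Pr (\bigcap_(k in [set` J]) (X k @^-1` A k)) =
    (\prod_(k <- J) Pr (X k @^-1` A k))%E.

Definition has_density dO (Omega : measurableType dO)
    (Pr : probability Omega R) (X : {RV Pr >-> @phase R d})
    (f : @phase R d -> R) : Prop :=
  forall A, measurable A ->
    distribution Pr X A = (\int[leb_phase]_(z in A) (f z)%:E)%E.

End data.

Definition omega (R : realType) (n : nat) : R := fine (leb R n (eball 1)).

Definition Theta (R : realType) (d : nat) (r : R) (f0 : @phase R d -> R) : R :=
  let M := fine (normLoo_phase f0) in
  if 0 < r then
    d%:R / d.+1%:R *
    Num.min ((omega R d ^+ 2 * d.+1%:R * (r + 1) ^+ d * M) `^ (- d%:R^-1)) 1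
  else
    (2 * d)%:R / (2 * d).+1%:R *
    Num.min ((omega R (2 * d) * (2 * d).+1%:R * M) `^ (- (2 * d)%:R^-1)) 1.

(* Main.v *)
Require Import Defs.
From HB Require Import structures.
From mathcomp Require Import all_boot all_order all_algebra.
From mathcomp Require Import all_classical all_reals all_analysis.
From mathcomp Require Import lebesgue_integral_under measurable_realfun ess_sup_inf.
From mathcomp Require Import complex perm.
From mathcomp Require Import ring lra.

(** Every equilibrium lies in the rest set {|x| <= r, v = 0}: along the position of an
    outermost particle the confining force and the interaction have opposite signs
    (here kappa >= 0 enters, which the sign of the Fourier transform of P gives by Fejer
    summation), so both vanish and that particle sits at a critical point of V
    ([memory_nonpos], [equilibrium_in_ball]). Hence the distance to the equilibria is at
    least the mean over the particles of [cutdist], the distance to the rest set cut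
    at 1. The rest set has small neighbourhoods, so a density that stays bounded keeps
    the particles away from it: if a slab of width s around the rest set carries at
    most the mass c, the mean of [cutdist] is at least s (1 - c), and [Theta] is the
    best such value ([Theta_split]). What is needed is that the law of each
    particle keeps this bound up to a small error, although the particles interact.

    This is done without a mean-field limit. Given the motion of all the others, one
    particle moves in an external force field, whose flow preserves the phase volume.
    To get explicit, measurable flows, time is discretised: a kick followed by a drift
    is a composition of two shears, hence preserves volume ([kick_drift_volume]), and
    the scheme converges to any solution as the step goes to 0 ([scheme_at_cvg]). All
    comparisons of runs of the scheme come from one stability estimate
    ([kick_drift_stability]).

    Quantitative bounds. When V has a bounded Hessian, let the k-th particle lose its
    influence on the others. All trajectories move by at most C(t)/(3N), up to a term
    that vanishes with the step ([leave_one_out_bound]), and now the field felt by the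
    k-th particle is independent of its own datum, so its mean cut distance is at least
    Theta. Averaging over k gives the bound on the expectation. The same comparison
    shows that changing one datum changes the mean cut distance by at most
    (1 + 2C(t)/3)/N, so its variance is at most (1 + 2C(t)/3)^2/N ([efron_stein]); with
    the deficit C(t)/(3N) of the mean this gives the probability bound, by Markov's
    inequality. The time step goes to 0 at the end.

    Almost sure bound. Here V is only locally regular. Particles of bounded initial
    energy stay, uniformly in N, in one ball, where the forces are Lipschitz
    ([energy_growth]); so each follows a map of phase space that preserves volume and
    has a Lipschitz constant independent of N ([tracking]). Cover most of the phase
    space by finitely many tiny balls. Those containing the datum of a particle that
    comes close to rest are sent by this map into a slab, hence carry at most the mass
    c; and by the law of large numbers, applied to the countably many unions of balls
    that can occur ([freq_limsup]), the frequency of the data in their union is at most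
    c in the limit. Hence almost surely, at all times, a fraction close to 1 - c or
    more of the particles is nearly at distance s from rest, or farther ([mean_cut_liminf]).

    The forces enter only through Lipschitz bounds on their gradients, with the L^oo
    norms of the weak Hessians as constants ([grad_lip_weak]): second differences of a
    function, averaged against smooth bumps, are averages of its weak Hessian. *)

Set Implicit Arguments.
Unset Strict Implicit.
Unset Printing Implicit Defensive.

Import Order.TTheory GRing.Theory Num.Theory.
Import numFieldNormedType.Exports.

Local Open Scope classical_set_scope.
Local Open Scope ring_scope.

(** * Euclidean geometry *)

Section euclid.
Context {R : realType} {d : nat}.
Implicit Types (x y z : 'rV[R]_d).

Lemma dotC x y : dot x y = dot y x.
Proof. by rewrite /dot; apply: eq_bigr => i _; rewrite mulrC. Qed.

Lemma dotDl x y z : dot (x + y) z = dot x z + dot y z.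
Proof. by rewrite /dot -big_split; apply: eq_bigr => i _ /=; rewrite mxE mulrDl. Qed.

Lemma dotZl a x y : dot (a *: x) y = a * dot x y.
Proof. by rewrite /dot mulr_sumr; apply: eq_bigr => i _; rewrite mxE mulrA. Qed.

Lemma dotNl x y : dot (- x) y = - dot x y.
Proof. by rewrite -scaleN1r dotZl mulN1r. Qed.

Lemma dotDr x y z : dot x (y + z) = dot x y + dot x z.
Proof. by rewrite dotC dotDl !(dotC x). Qed.

Lemma dotZr a x y : dot x (a *: y) = a * dot x y.
Proof. by rewrite dotC dotZl dotC. Qed.

Lemma dotNr x y : dot x (- y) = - dot x y.
Proof. by rewrite dotC dotNl dotC. Qed.

Lemma dot0l y : dot 0 y = 0.
Proof. by rewrite -(scale0r y) dotZl mul0r. Qed.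

Lemma dot0r y : dot y 0 = 0.
Proof. by rewrite dotC dot0l. Qed.

Lemma dot_suml (I : Type) (r : seq I) (P : pred I) (F : I -> 'rV[R]_d) y :
  dot (\sum_(i <- r | P i) F i) y = \sum_(i <- r | P i) dot (F i) y.
Proof.
by elim/big_rec2: _ => [|i a b _ <-]; rewrite ?dot0l// dotDl.
Qed.

Lemma dot_ge0 x : 0 <= dot x x.
Proof. by apply: sumr_ge0 => i _; rewrite -expr2 sqr_ge0. Qed.

Lemma dot_eq0 x : dot x x = 0 -> x = 0.
Proof.
move=> /eqP; rewrite psumr_eq0; last by move=> i _; rewrite -expr2 sqr_ge0.
move=> /allP h; apply/rowP => i; rewrite mxE; apply/eqP.
by have := h i (mem_index_enum _); rewrite -expr2 sqrf_eq0.
Qed.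

Lemma enorm_ge0 x : 0 <= enorm x.
Proof. exact: sqrtr_ge0. Qed.

Lemma enorm2 x : enorm x ^+ 2 = dot x x.
Proof. by rewrite sqr_sqrtr// dot_ge0. Qed.

Lemma enorm0 : enorm (0 : 'rV[R]_d) = 0.
Proof. by rewrite /enorm dot0l sqrtr0. Qed.

Lemma enorm0_eq0 x : enorm x = 0 -> x = 0.
Proof. by move=> x0; apply: dot_eq0; rewrite -enorm2 x0 expr0n. Qed.

Lemma enormZ a x : enorm (a *: x) = `|a| * enorm x.
Proof.
by rewrite /enorm dotZl dotZr mulrA -expr2 sqrtrM ?sqr_ge0// sqrtr_sqr.
Qed.

Lemma enormN x : enorm (- x) = enorm x.
Proof. by rewrite -scaleN1r enormZ normrN1 mul1r. Qed.

Lemma enormB x y : enorm (x - y) = enorm (y - x).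
Proof. by rewrite -enormN opprB. Qed.

Lemma dot_le x y : dot x y <= enorm x * enorm y.
Proof.
have [x0|x0] := eqVneq (enorm x) 0.
  by rewrite (enorm0_eq0 x0) dot0l enorm0 mul0r.
have [y0|y0] := eqVneq (enorm y) 0.
  by rewrite (enorm0_eq0 y0) dot0r enorm0 mulr0.
have xp : 0 < enorm x by rewrite lt_neqAle eq_sym x0 enorm_ge0.
have yp : 0 < enorm y by rewrite lt_neqAle eq_sym y0 enorm_ge0.
have := dot_ge0 (enorm y *: x - enorm x *: y).
rewrite dotDl !dotDr !(dotNr, dotNl) !(dotZl, dotZr) -!enorm2 opprK (dotC y x).
move=> h; rewrite -(ler_pM2l (mulr_gt0 xp yp)) -subr_ge0.
have -> : enorm x * enorm y * (enorm x * enorm y) - enorm x * enorm y * dot x y =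
  (enorm y * (enorm y * enorm x ^+ 2) - enorm y * (enorm x * dot x y) +
    (- (enorm x * (enorm y * dot x y)) + enorm x * (enorm x * enorm y ^+ 2))) / 2.
  by field.
by rewrite mulr_ge0// invr_ge0.
Qed.

Lemma normr_dot_le x y : `|dot x y| <= enorm x * enorm y.
Proof.
by rewrite ler_norml lerNl dot_le andbT -dotNl (le_trans (dot_le _ _))// enormN.
Qed.

Lemma enormD x y : enorm (x + y) <= enorm x + enorm y.
Proof.
rewrite -(@ler_pXn2r _ 2)// ?nnegrE ?addr_ge0 ?enorm_ge0//.
rewrite enorm2 dotDl !dotDr sqrrD !enorm2 (dotC y x).
by have := dot_le x y; lra.
Qed.

Lemma ler_enorm_sub x y : `|enorm x - enorm y| <= enorm (x - y).
Proof.
rewrite ler_norml; apply/andP; split.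
  by rewrite lerNl opprB lerBlDr enormB (le_trans _ (enormD _ _))// subrK.
by rewrite lerBlDr (le_trans _ (enormD _ _))// subrK.
Qed.

Lemma enorm_sum (I : Type) (r : seq I) (P : pred I) (F : I -> 'rV[R]_d) :
  enorm (\sum_(i <- r | P i) F i) <= \sum_(i <- r | P i) enorm (F i).
Proof.
elim/big_rec2: _ => [|i a b _ h]; first by rewrite enorm0.
by rewrite (le_trans (enormD _ _))// lerD2l.
Qed.

Lemma ler_coord_enorm x i : `|x ord0 i| <= enorm x.
Proof.
rewrite -sqrtr_sqr ler_wsqrtr// /dot (bigD1 i)//= -expr2 lerDl.
by apply: sumr_ge0 => j _; rewrite -expr2 sqr_ge0.
Qed.

Lemma enorm_delta (i : 'I_d) : enorm (delta_mx ord0 i : 'rV[R]_d) = 1.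
Proof.
rewrite /enorm /dot (bigD1 i)//= mxE !eqxx mulr1 big1 ?addr0 ?sqrtr1// => j ji.
by rewrite mxE eqxx (negbTE ji) mulr0.
Qed.

Lemma row_sum_deltaE x : x = \sum_i x ord0 i *: delta_mx ord0 i.
Proof. exact: row_sum_delta. Qed.

Lemma enorm_le_sum x : enorm x <= \sum_i `|x ord0 i|.
Proof.
rewrite {1}(row_sum_deltaE x) (le_trans (enorm_sum _ _ _))//.
by apply: ler_sum => i _; rewrite enormZ enorm_delta mulr1.
Qed.

Lemma ler_coord_norm x i : `|x ord0 i| <= `|x|.
Proof.
rewrite [leRHS]/Num.norm/= mx_normrE.
by rewrite (le_bigmax _ (fun ij : 'I_1 * 'I_d => `|x ij.1 ij.2|) (ord0, i)).
Qed.

Lemma enorm_le_norm x : enorm x <= d%:R * `|x|.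
Proof.
rewrite (le_trans (enorm_le_sum x))// (@le_trans _ _ (\sum_(i < d) `|x|))//.
  by apply: ler_sum => i _; exact: ler_coord_norm.
by rewrite sumr_const card_ord mulr_natl.
Qed.

Lemma norm_le_enorm x : `|x| <= enorm x.
Proof.
rewrite [leLHS]/Num.norm/= mx_normrE; apply/bigmax_leP; split.
  exact: enorm_ge0.
by move=> [i j] _ /=; rewrite (ord1 i) ler_coord_enorm.
Qed.

Lemma lipschitz_continuous (f : 'rV[R]_d -> R) (L : R) :
  (forall x y, `|f x - f y| <= L * enorm (x - y)) -> continuous f.
Proof.
move=> fL x; apply/(@cvgrPdist_le _ _ _ (nbhs x)) => e e0 /=.
have K0 : 0 < `|L| * d%:R + 1 by rewrite ltr_pwDr// mulr_ge0.
near=> y; rewrite (le_trans (fL _ _))//.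
rewrite (@le_trans _ _ ((`|L| * d%:R + 1) * `|x - y|))//.
  rewrite mulrDl mul1r (@le_trans _ _ (`|L| * d%:R * `|x - y|)) ?lerDl//.
  rewrite -mulrA (@le_trans _ _ (`|L| * enorm (x - y)))//.
    by rewrite ler_wpM2r ?enorm_ge0// ler_norm.
  by rewrite ler_wpM2l// enorm_le_norm.
rewrite -ler_pdivlMl//; near: y.
by apply: cvgr_dist_le => //; rewrite mulr_gt0// invr_gt0.
Unshelve. all: by end_near. Qed.

Lemma continuous_enorm : continuous (@enorm R d).
Proof.
by apply: (@lipschitz_continuous _ 1) => x y; rewrite mul1r ler_enorm_sub.
Qed.

Lemma opnorm_has_sup (A : 'M[R]_d) :
  has_sup [set enorm (x *m A) | x in eball 1].
Proof.
split; first by exists (enorm ((0 : 'rV[R]_d) *m A)), 0 => //; rewrite /eball/= enorm0.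
exists (\sum_i enorm (row i A)) => _ [x x1 <-].
rewrite mulmx_sum_row (le_trans (enorm_sum _ _ _))//.
apply: ler_sum => i _; rewrite enormZ ler_piMl ?enorm_ge0//.
exact: le_trans (ler_coord_enorm _ _) _.
Qed.

Lemma opnorm_ge0 (A : 'M[R]_d) : 0 <= opnorm A.
Proof.
apply: sup_upper_bound; first exact: opnorm_has_sup.
by exists 0; rewrite ?mul0mx ?enorm0//; rewrite /eball/= enorm0.
Qed.

Lemma enorm_mul_le (A : 'M[R]_d) x : enorm (x *m A) <= opnorm A * enorm x.
Proof.
have [x0|x0] := eqVneq (enorm x) 0.
  by rewrite (enorm0_eq0 x0) mul0mx enorm0 mulr0.
have xp : 0 < enorm x by rewrite lt_neqAle eq_sym x0 enorm_ge0.
rewrite -ler_pdivrMr// mulrC.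
have -> : (enorm x)^-1 * enorm (x *m A) = enorm (((enorm x)^-1 *: x) *m A).
  by rewrite -scalemxAl enormZ gtr0_norm// invr_gt0.
apply: sup_upper_bound; first exact: opnorm_has_sup.
exists ((enorm x)^-1 *: x) => //; rewrite /eball/= enormZ gtr0_norm ?invr_gt0//.
by rewrite mulVf.
Qed.

Lemma opnorm_le_sum (A : 'M[R]_d) : opnorm A <= \sum_i \sum_j `|A i j|.
Proof.
apply: ge_sup; first by case: (opnorm_has_sup A).
move=> _ [x x1 <-]; rewrite mulmx_sum_row (le_trans (enorm_sum _ _ _))//.
apply: ler_sum => i _; rewrite enormZ.
rewrite (@le_trans _ _ (enorm (row i A)))//.
  rewrite ler_piMl ?enorm_ge0//; exact: le_trans (ler_coord_enorm _ _) _.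
rewrite (le_trans (enorm_le_sum _))//; apply: ler_sum => j _.
by rewrite mxE.
Qed.

(** Norm bounds on vector-valued increments are reduced by duality to bounds on scalar
    functions, to which the mean value theorem applies. *)
Lemma enorm_le_dual x (K : R) : 0 <= K ->
  (forall y, dot x y <= K * enorm y) -> enorm x <= K.
Proof.
move=> K0 h; have [->//|x0] := eqVneq (enorm x) 0.
have xp : 0 < enorm x by rewrite lt_neqAle eq_sym x0 enorm_ge0.
by have := h x; rewrite -enorm2 expr2 ler_pM2r.
Qed.
End euclid.

(** * Continuously differentiable functions *)

Section calculus1.
Context {R : realType}.

(** The difference quotient in terms of epsilon and delta, the form that also serves
    one-sided derivatives. *)
Lemma is_derive_dist (f : R -> R) (t l : R) :
  is_derive t 1 f l <->
  forall e, 0 < e -> exists2 r, 0 < r & forall h, h != 0 -> `|h| < r ->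
     `|h^-1 * (f (t + h) - f t) - l| <= e.
Proof.
split.
- move=> [df <-] e e0; move: df => /cvg_ex[/= l' hl'].
  have -> : 'D_1 f t = l' by apply: cvg_lim.
  move/cvgrPdist_le : hl' => /(_ _ e0); rewrite near_withinE => /nbhs_ballP[r/= r0 hr].
  exists r => // h h0 hl; have := hr h; rewrite /ball/= sub0r normrN => /(_ hl h0).
  by rewrite distrC /= [_%:A]mulr1 (addrC h).
- move=> H.
  have hl : h^-1 *: ((f \o shift t) (h *: 1) - f t) @[h --> 0^'] --> l.
    apply/cvgrPdist_le => e e0; rewrite near_withinE; apply/nbhs_ballP.
    have [r r0 hr] := H _ e0; exists r => //= h; rewrite /ball/= sub0r normrN => hl h0.
    by rewrite distrC /= [_%:A]mulr1 (addrC h); exact: hr.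
  split; last exact: cvg_lim.
  by apply/cvg_ex; exists l.
Qed.

Lemma is_derive_cont (f : R -> R) (t l : R) : is_derive t 1 f l -> {for t, continuous f}.
Proof. by move=> [df _]; apply: differentiable_continuous; apply/derivable1_diffP. Qed.

(** The sign of s is free, so that one statement serves both orientations of a segment. *)
Lemma mvt_signed (g g' : R -> R) (s : R) :
  (forall t : R, is_derive t 1 g (g' t)) ->
  exists2 xi : R, `|xi| <= `|s| & g s - g 0 = g' xi * s.
Proof.
move=> dg.
have cg : continuous g by move=> t; exact: is_derive_cont (dg t).
have [s0|s0] := leP 0 s.
  have [|c] := @MVT_segment R g g' 0 s s0 (fun x _ => dg x).
    exact: continuous_subspaceT.
  rewrite in_itv/= => /andP[c0 cs] E; exists c; last by rewrite E subr0.
  by rewrite !ger0_norm.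
have [|c] := @MVT_segment R g g' s 0 (ltW s0) (fun x _ => dg x).
  exact: continuous_subspaceT.
rewrite in_itv/= => /andP[c0 cs] E; exists c.
  by rewrite !ler0_norm ?lerN2// ltW.
by rewrite -opprB E sub0r mulrN opprK.
Qed.

Context {d : nat}.
Implicit Types (x y a : 'rV[R]_d) (f : 'rV[R]_d -> R).

Lemma is_derive_line_delta f x (i : 'I_d) (t : R) :
  derivable f (x + t *: delta_mx ord0 i) (delta_mx ord0 i) ->
  is_derive t 1 (fun s => f (x + s *: delta_mx ord0 i))
    (partial i f (x + t *: delta_mx ord0 i)).
Proof.
move=> df; set e := delta_mx ord0 i in df *.
have E : (fun h : R => h^-1 *: (((fun s => f (x + s *: e)) \o shift t) (h *: 1)
            - f (x + t *: e))) =
   (fun h : R => h^-1 *: ((f \o shift (x + t *: e)) (h *: e) - f (x + t *: e))).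
  apply/funext => h /=; congr (_ *: (f _ - _)).
  by rewrite [h%:A]mulr1 scalerDl addrCA.
by split; rewrite /derivable /derive/partial E.
Qed.

Lemma partial_near_uniform f x (e : R) : C1 f -> 0 < e ->
  exists2 r, 0 < r & forall i y, `|y - x| < r ->
    `|partial i f y - partial i f x| <= e.
Proof.
move=> hf e0.
have H i : exists2 r, 0 < r & forall y, `|y - x| < r ->
    `|partial i f y - partial i f x| <= e.
  have [_ /(_ x)] := hf i.
  move=> /(@cvgrPdist_le _ _ _ (nbhs x)) /(_ _ e0) /nbhs_ballP[r /= r0 hr].
  exists r => // y yr; rewrite distrC; apply: hr.
  by rewrite -ball_normE /= distrC.
pose r i := sval (cid2 (H i)).
have r0 i : 0 < r i by rewrite /r; case: cid2.
have hr i y : `|y - x| < r i -> `|partial i f y - partial i f x| <= e.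
  by rewrite /r; case: cid2 => /= r' _; apply.
exists (\big[Num.min/1]_i r i).
  by apply: lt_bigmin => // i _.
by move=> i y yr; apply: hr; apply: lt_le_trans yr _; exact: bigmin_le.
Qed.

Let trunc (h : 'rV[R]_d) (k : nat) : 'rV[R]_d :=
  \row_j (if (j < k)%N then h ord0 j else 0).

(** The increment is decomposed along the axes (the path through the truncations of h),
    and the mean value theorem is applied on each leg. *)
Lemma C1_expand f x (e : R) : C1 f -> 0 < e ->
  exists2 r, 0 < r & forall h, `|h| < r ->
    `|f (x + h) - f x - dot (grad f x) h| <= e * enorm h.
Proof.
move=> hf e0.
have e1 : 0 < e / (d%:R + 1) by rewrite divr_gt0// ltr_wpDl.
have [r r0 hr] := partial_near_uniform x hf e1.
exists r => // h hh.
have step (k : 'I_d) : exists2 y, `|y - x| < r &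
    f (x + trunc h k.+1) - f (x + trunc h k) = partial k f y * h ord0 k.
  have tE : trunc h k.+1 = trunc h k + h ord0 k *: delta_mx ord0 k.
    apply/rowP => j; rewrite !mxE eqxx/= ltnS leq_eqVlt.
    have [->|jk] := eqVneq j k; first by rewrite eqxx ltnn mulr1 add0r.
    by rewrite [X in X || _](negbTE _)//= mulr0 addr0.
  have := @mvt_signed (fun s => f (x + trunc h k + s *: delta_mx ord0 k))
    (fun s => partial k f (x + trunc h k + s *: delta_mx ord0 k)) (h ord0 k).
  case=> [t|xi xik].
    by apply: is_derive_line_delta; case: (hf k).
  rewrite scale0r addr0 tE addrA => ->.
  exists (x + trunc h k + xi *: delta_mx ord0 k) => //.
  apply: le_lt_trans hh.
  rewrite (_ : _ - x = trunc h k + xi *: delta_mx ord0 k); last first.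
    by apply/rowP => j; rewrite !mxE; ring.
  rewrite [leLHS]/Num.norm/= mx_normrE.
  apply/bigmax_leP; split => // -[i j] _ /=; rewrite (ord1 i) !mxE eqxx/=.
  have [->|jk] := eqVneq j k.
    by rewrite ltnn add0r mulr1 (le_trans xik)// ler_coord_norm.
  by rewrite mulr0 addr0; case: ifPn => _; rewrite ?normr0// ler_coord_norm.
have -> : f (x + h) - f x = \sum_(k < d) (f (x + trunc h k.+1) - f (x + trunc h k)).
  rewrite -(big_mkord xpredT (fun k => f (x + trunc h k.+1) - f (x + trunc h k))).
  rewrite telescope_sumr//; congr (f (_ + _) - f _).
    by apply/rowP => j; rewrite mxE ltn_ord.
  rewrite (_ : trunc h 0 = 0) ?addr0//.
  by apply/rowP => j; rewrite !mxE.
rewrite /dot -sumrB (le_trans (ler_norm_sum _ _ _))//.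
apply: (@le_trans _ _ (\sum_(i < d) e / (d%:R + 1) * enorm h)).
  apply: ler_sum => k _; have [y yr ->] := step k.
  rewrite mxE -mulrBl normrM ler_pM// ?hr//.
  exact: ler_coord_enorm.
rewrite sumr_const card_ord -[leLHS]mulr_natl mulrA ler_wpM2r ?enorm_ge0//.
by rewrite mulrCA ger_pMr// ler_pdivrMr ?ltr_wpDl// mul1r lerDl.
Qed.

Lemma is_derive_coord_norm (c : R -> 'rV[R]_d) (t : R) (l : 'rV[R]_d) (e : R) :
  (forall i, is_derive t 1 (fun s => c s ord0 i) (l ord0 i)) -> 0 < e ->
  exists2 r, 0 < r & forall h, h != 0 -> `|h| < r ->
    enorm (h^-1 *: (c (t + h) - c t) - l) <= e.
Proof.
move=> dc e0.
have e1 : 0 < e / (d%:R + 1) by rewrite divr_gt0// ltr_wpDl.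
have H i := (is_derive_dist _ _ _).1 (dc i) _ e1.
pose r i := sval (cid2 (H i)).
have r0 i : 0 < r i by rewrite /r; case: cid2.
have hr i h : h != 0 -> `|h| < r i ->
    `|h^-1 * (c (t + h) ord0 i - c t ord0 i) - l ord0 i| <= e / (d%:R + 1).
  by rewrite /r; case: cid2 => /= r' _; apply.
exists (\big[Num.min/1]_i r i); first by apply: lt_bigmin => // i _.
move=> h h0 hh; rewrite (le_trans (enorm_le_sum _))//.
apply: (@le_trans _ _ (\sum_(i < d) e / (d%:R + 1))).
  apply: ler_sum => i _; rewrite !mxE; apply: hr => //.
  by apply: lt_le_trans hh _; exact: bigmin_le.
rewrite sumr_const card_ord -[leLHS]mulr_natl.
by rewrite mulrCA ger_pMr// ler_pdivrMr ?ltr_wpDl// mul1r lerDl.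
Qed.

(** The first-order expansion of f at c t is evaluated on the increments of c, for which
    only coordinatewise derivatives are given. *)
Lemma is_derive_curve f (c : R -> 'rV[R]_d) (t : R) (l : 'rV[R]_d) : C1 f ->
  (forall i, is_derive t 1 (fun s => c s ord0 i) (l ord0 i)) ->
  is_derive t 1 (f \o c) (dot (grad f (c t)) l).
Proof.
move=> hf dc; apply/is_derive_dist => e e0.
set g := grad f (c t).
pose K := enorm l + 1 + enorm g.
have K0 : 0 < K.
  by rewrite /K -addrA ltr_wpDl ?enorm_ge0// ltr_pwDl ?enorm_ge0//.
have e1 : 0 < e / (K + K) by rewrite divr_gt0// addr_gt0.
have [r r0 hr] := C1_expand (c t) hf e1.
pose e2 := Num.min 1 (e / (K + K)).
have e20 : 0 < e2 by rewrite lt_min ltr01.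
have [r' r'0 hr'] := is_derive_coord_norm dc e20.
pose r2 := Num.min r' (r / K).
exists r2; first by rewrite lt_min r'0 divr_gt0.
move=> h h0; rewrite lt_min => /andP[hr1 hr2].
have := hr' h h0 hr1; set k := c (t + h) - c t => hk.
have hk1 : enorm (h^-1 *: k) <= K.
  rewrite -(subrK l (h^-1 *: k)) (le_trans (enormD _ _))// addrC.
  rewrite /K -addrA lerD2l (le_trans hk)// (@le_trans _ _ 1) ?ge_min ?lexx//.
  by rewrite lerDl enorm_ge0.
have kE : enorm k = `|h| * enorm (h^-1 *: k).
  by rewrite -enormZ scalerA divff// scale1r.
have kr : `|k| < r.
  rewrite (le_lt_trans (norm_le_enorm _))// kE.
  rewrite (@le_lt_trans _ _ (`|h| * K)) ?ler_wpM2l//.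
  by rewrite -ltr_pdivlMr.
have := hr k kr; rewrite /= /k subrKC -/k => h1.
have -> : h^-1 * (f (c (t + h)) - f (c t)) - dot g l =
  h^-1 * (f (c (t + h)) - f (c t) - dot g k) + dot g (h^-1 *: k - l).
  rewrite [dot g (_ - l)]dotDr dotNr [dot g (_ *: _)]dotZr; ring.
rewrite (le_trans (ler_normD _ _))//.
rewrite (@le_trans _ _ (e / (K + K) * K + enorm g * (e / (K + K))))//.
  apply: lerD.
    rewrite normrM normfV ler_pdivrMl ?normr_gt0// (le_trans h1)//.
    by rewrite mulrCA ler_pM2l// kE ler_wpM2l.
  rewrite (le_trans (normr_dot_le _ _))// ler_wpM2l ?enorm_ge0//.
  by rewrite (le_trans hk)// ge_min lexx orbT.
rewrite [leLHS](_ : _ = e * ((K + enorm g) / (K + K))); last by field; lra.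
have gK : enorm g <= K by rewrite /K lerDr addr_ge0 ?enorm_ge0.
have : (K + enorm g) / (K + K) <= 1.
  by rewrite ler_pdivrMr; [move: gK; clearbody K; lra|exact: addr_gt0].
by move=> H; rewrite -[leRHS]mulr1 ler_pM2l.
Qed.

Lemma is_derive_line f x a (t : R) : C1 f ->
  is_derive t 1 (fun s => f (x + s *: a)) (dot (grad f (x + t *: a)) a).
Proof.
move=> hf; apply: (@is_derive_curve f (fun s => x + s *: a)) => // i.
apply/is_derive_dist => e e0; exists 1 => // h h0 _.
rewrite !mxE [_ - (x ord0 i + _)](_ : _ = h * a ord0 i); last by ring.
by rewrite mulKf// subrr normr0 ltW.
Qed.

Lemma mvt_line f x y : C1 f ->
  exists2 s, `|s| <= 1 & f y - f x = dot (grad f (x + s *: (y - x))) (y - x).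
Proof.
move=> hf.
have [s] := mvt_signed 1 (fun t : R => is_derive_line x (y - x) t hf).
by rewrite normr1 scale1r scale0r addr0 subrKC mulr1 => s1 E; exists s.
Qed.

(** By duality, from the mean value theorem for each scalar product of the gradient with
    a fixed vector. *)
Lemma grad_lip_of_hess f (L : R) : (forall j, C1 (partial j f)) ->
  (forall y, opnorm (hess f y) <= L) ->
  forall x y, enorm (grad f x - grad f y) <= L * enorm (x - y).
Proof.
move=> hf hL x y.
have L0 : 0 <= L by rewrite (le_trans (opnorm_ge0 _) (hL 0)).
apply: enorm_le_dual => [|b]; first by rewrite mulr_ge0 ?enorm_ge0.
pose g t := \sum_j b ord0 j * partial j f (y + t *: (x - y)).
pose g' t := \sum_j b ord0 j * dot (grad (partial j f) (y + t *: (x - y))) (x - y).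
have dg (t : R) : is_derive t 1 g (g' t).
  apply: is_derive_eq; last first.
    rewrite /g'; apply: eq_bigr => j _.
    by rewrite -[RHS]/(b ord0 j *: dot (grad (partial j f) (y + t *: (x - y))) (x - y)).
  rewrite /g.
  have -> : (fun t0 : R => \sum_j b ord0 j * partial j f (y + t0 *: (x - y))) =
     \sum_j (fun t0 : R => b ord0 j *: partial j f (y + t0 *: (x - y))).
    by apply/funext => s; rewrite fct_sumE.
  apply: is_derive_sum => j.
  apply: is_deriveZ; exact: is_derive_line.
have [s _] := mvt_signed 1 dg.
rewrite mulr1 /g scale1r scale0r addr0 subrKC => E.
have -> : dot (grad f x - grad f y) b = g' s.
  rewrite -E -sumrB /dot; apply: eq_bigr => j _; rewrite !mxE; ring.
have -> : g' s = dot ((x - y) *m hess f (y + s *: (x - y))) b.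
  rewrite /g' /dot; apply: eq_bigr => j _; rewrite mulrC; congr (_ * _).
  rewrite mxE; apply: eq_bigr => i _; rewrite !mxE mulrC; congr (_ * _).
rewrite (le_trans (dot_le _ _))// ler_wpM2r ?enorm_ge0//.
by rewrite (le_trans (enorm_mul_le _ _))// ler_wpM2r ?enorm_ge0.
Qed.

(** A step of length lam along the gradient changes f by at least lam |grad f| - |L|
    lam^2, which cannot exceed the oscillation 2m. *)
Lemma grad_interp f (m L lam : R) : C1 f -> 0 < lam ->
  (forall y, `|f y| <= m) ->
  (forall x y, enorm (grad f x - grad f y) <= L * enorm (x - y)) ->
  forall x, enorm (grad f x) * lam <= m + m + `|L| * lam ^+ 2.
Proof.
move=> hf lam0 hm hL x; set g := grad f x.
have m0 : 0 <= m by rewrite (le_trans (normr_ge0 _) (hm 0)).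
have [g0|g0] := eqVneq (enorm g) 0.
  by rewrite g0 mul0r !addr_ge0// mulr_ge0// sqr_ge0.
have gp : 0 < enorm g by rewrite lt_neqAle eq_sym g0 enorm_ge0.
pose a := (lam / enorm g) *: g.
have aE : enorm a = lam.
  by rewrite enormZ gtr0_norm ?divr_gt0// divfK.
have [s s1 E] := mvt_line x (x + a) hf.
rewrite [x + a - x]addrC addKr in E.
have ga : dot g a = enorm g * lam.
  by rewrite dotZr -enorm2; field.
rewrite -ga -(subrK (dot (grad f (x + s *: a)) a) (dot g a)) addrC -E.
apply: lerD; first by rewrite (le_trans (ler_norm _))// (le_trans (ler_normB _ _))// lerD.
rewrite E -dotNl -dotDl (le_trans (dot_le _ _))// aE expr2 mulrA ler_wpM2r ?(ltW lam0)//.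
rewrite (le_trans (hL _ _))// opprD addrA subrr sub0r enormN enormZ aE.
rewrite (@le_trans _ _ (`|L| * (`|s| * lam)))//.
  by rewrite ler_wpM2r ?ler_norm// mulr_ge0// ltW.
by rewrite ler_wpM2l// ler_piMl// ltW.
Qed.

End calculus1.

(** * Lebesgue measure on R^n *)

Section push.
Context d1 d2 (T1 : measurableType d1) (T2 : measurableType d2) (R : realType).
Variables (m : {measure set T1 -> \bar R}) (f : T1 -> T2).
Hypothesis mf : measurable_fun setT f.

Definition pushm : {measure set T2 -> \bar R} :=
  measure_function_pushforward__canonical__measure_function_Measure m mf.

Lemma ge0_integral_pushm (h : T2 -> \bar R) : measurable_fun setT h ->
  (forall x, 0 <= h x)%E -> (\int[pushm]_x h x = \int[m]_x h (f x))%E.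
Proof. by move=> mh h0; rewrite ge0_integral_pushforward. Qed.

Lemma measurable_preimage (A : set T2) : measurable A -> measurable (f @^-1` A).
Proof. by move=> mA; rewrite -[X in measurable X]setTI; exact: mf. Qed.
End push.

Section leb1.
Context {R : realType}.
Local Notation lam := (@lebesgue_measure R).
Local Notation mR := (measurableTypeR R).

Let shift1 (c : R) : mR -> mR := fun x => (x : R) + c.
Let reflect1 (c : R) : mR -> mR := fun x => c - (x : R).
Let scale1 (s : R) : mR -> mR := fun x => s * (x : R).

Let mshift1 c : measurable_fun setT (shift1 c).
Proof. exact: measurable_funD. Qed.

Let mreflect1 c : measurable_fun setT (reflect1 c).
Proof. exact: measurable_funB. Qed.

Let mscale1 s : measurable_fun setT (scale1 s).
Proof. exact: measurable_funM. Qed.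

Lemma lebesgue_shift (c : R) (A : set R) : measurable A ->
  lam [set x | A (x + c)] = lam A.
Proof.
move=> mA; rewrite [RHS](@lebesgue_measure_unique R (pushm lam (mshift1 c)))//.
move=> X [[a b] _ <-]; rewrite /= /pushforward.
rewrite (_ : _ @^-1` _ = [set` `]a - c, b - c]]); last first.
  by apply/seteqP; split => x; rewrite /= !in_itv/= ltrBlDr lerBrDr.
rewrite !lebesgue_measure_itv/= !lte_fin ltrD2r; case: ifP => // _.
by rewrite -!EFinB opprB addrA subrK.
Qed.

Lemma lebesgue_reflect (c : R) (A : set R) : measurable A ->
  lam [set x | A (c - x)] = lam A.
Proof.
move=> mA; rewrite [RHS](@lebesgue_measure_unique R (pushm lam (mreflect1 c)))//.
move=> X [[a b] _ <-]; rewrite /= /pushforward.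
rewrite (_ : _ @^-1` _ = [set` `[c - b, c - a[]); last first.
  apply/seteqP; split => x; rewrite /= /reflect1 !in_itv/=.
    by move=> /andP[h1 h2]; apply/andP; split; lra.
  by move=> /andP[h1 h2]; apply/andP; split; lra.
rewrite !lebesgue_measure_itv/= !lte_fin ltrD2l ltrN2; case: ifP => // _.
by rewrite -!EFinB; congr EFin; ring.
Qed.

Lemma lebesgue_scale (s : R) (A : set R) : 0 < s -> measurable A ->
  lam [set x | A (s * x)] = (s^-1%:E * lam A)%E.
Proof.
move=> s0 mA; have s0' : 0 <= s by exact: ltW.
pose m2 : {measure set mR -> \bar R} := mscale (NngNum s0') (pushm lam (mscale1 s)).
rewrite [X in (_ * X)%E](@lebesgue_measure_unique R m2)//.
  by rewrite /m2/= /mscale/= muleA -EFinM mulVf ?mul1e ?gt_eqF.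
move=> X [[a b] _ <-]; rewrite /m2/= /mscale/= /pushforward.
rewrite (_ : _ @^-1` _ = [set` `](s^-1 * a), (s^-1 * b)]]); last first.
  by apply/seteqP; split => x; rewrite /= /scale1 !in_itv/= ltr_pdivrMl// ler_pdivlMl.
rewrite !lebesgue_measure_itv/= !lte_fin ltr_pM2l ?invr_gt0//; case: ifP => _; last first.
  by rewrite mule0.
by rewrite -!EFinB -EFinM; congr EFin; field; rewrite gt_eqF.
Qed.

Lemma ge0_integral_shift (c : R) (f : R -> \bar R) : measurable_fun setT f ->
  (forall x, 0 <= f x)%E ->
  (\int[lam]_x f ((x : R) + c)%R = \int[lam]_x f x)%E.
Proof.
move=> mf f0; rewrite -(ge0_integral_pushm lam (mshift1 c))//.
by apply: eq_measure_integral => A mA _; exact: (lebesgue_shift c mA).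
Qed.

Lemma ge0_integral_reflect (c : R) (f : R -> \bar R) : measurable_fun setT f ->
  (forall x, 0 <= f x)%E ->
  (\int[lam]_x f (c - (x : R))%R = \int[lam]_x f x)%E.
Proof.
move=> mf f0; rewrite -(ge0_integral_pushm lam (mreflect1 c))//.
by apply: eq_measure_integral => A mA _; exact: (lebesgue_reflect c mA).
Qed.

Lemma ge0_integral_scale (s : R) (f : R -> \bar R) : 0 < s -> measurable_fun setT f ->
  (forall x, 0 <= f x)%E ->
  (\int[lam]_x f (s * (x : R))%R = s^-1%:E * \int[lam]_x f x)%E.
Proof.
move=> s0 mf f0; rewrite -(ge0_integral_pushm lam (mscale1 s))//.
have s0' : 0 <= s^-1 by rewrite invr_ge0 ltW.
rewrite -(@ge0_integral_mscale _ _ _ lam setT measurableT (NngNum s0') f)//.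
by apply: eq_measure_integral => A mA _; rewrite /= /pushforward (lebesgue_scale s0 mA).
Qed.
End leb1.

Section lebn.
Context {R : realType}.
Local Notation lam := (@lebesgue_measure R).
Local Open Scope ereal_scope.

Lemma measurable_leb_sect n (A : set 'rV[R]_n.+1) : measurable A ->
  measurable_fun [set: R] (fun x => leb R n [set y | A (vcons (x, y))]).
Proof.
move=> mA.
have mA' : measurable (@vcons R n @^-1` A).
  by rewrite -[X in measurable X]setTI; exact: measurable_vcons.
have := measurable_fun_xsection (leb R n) mA'.
by apply: eq_measurable_fun => x _ /=; congr (leb R n _); apply/seteqP; split => y;
  rewrite /xsection/= inE.
Qed.

Lemma lebS n (A : set 'rV[R]_n.+1) :
  leb R n.+1 A = \int[lam]_x leb R n [set y | A (vcons (x, y))].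
Proof.
rewrite /= /leb_step /product_measure1; apply: eq_integral => x _ /=.
by congr (leb R n _); apply/seteqP; split => y; rewrite /xsection/= inE.
Qed.

Lemma measurable_leb_vcons n (A : set 'rV[R]_n.+1) x : measurable A ->
  measurable [set y | A (vcons (x, y))].
Proof.
move=> mA; rewrite -[X in measurable X]setTI.
have mp : measurable_fun setT (fun y : 'rV[R]_n => (x, y)) by exact: pair1_measurable.
exact: (measurableT_comp (@measurable_vcons _ R n) mp).
Qed.

Lemma ge0_integral_lebS n (f : 'rV[R]_n.+1 -> \bar R) : measurable_fun setT f ->
  (forall x, 0 <= f x) ->
  \int[leb R n.+1]_z f z = \int[lam]_x \int[leb R n]_y f (vcons (x, y)).
Proof.
move=> mf f0.
rewrite (@eq_measure_integral _ _ _ setT (pushm (lam \x leb R n) (@measurable_vcons _ R n)))//.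
rewrite ge0_integral_pushm// fubini_tonelli1//.
exact: (measurableT_comp mf (@measurable_vcons _ R n)).
Qed.

Lemma measurable_rV_add n (c : 'rV[R]_n) : measurable_fun setT (fun y : 'rV[R]_n => y + c)%R.
Proof.
apply: measurable_fun_rV => i; rewrite (_ : _ \o _ = (fun y : 'rV[R]_n => (rV_coor i y : R) + c ord0 i)%R).
  by apply: measurable_funD => //; exact: measurable_rV_coor.
by apply/funext => y; rewrite /rV_coor/= mxE.
Qed.

Lemma measurable_rV_scale n (s : R) : measurable_fun setT (fun y : 'rV[R]_n => s *: y)%R.
Proof.
apply: measurable_fun_rV => i; rewrite (_ : _ \o _ = (fun y : 'rV[R]_n => s * (rV_coor i y : R))%R).
  by apply: measurable_funM => //; exact: measurable_rV_coor.
by apply/funext => y; rewrite /rV_coor/= mxE.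
Qed.

Lemma vconsD n (x a : R) (y b : 'rV[R]_n) :
  (vcons (x, y) + vcons (a, b) = vcons (x + a, y + b))%R.
Proof. by apply/rowP => i; rewrite !mxE; case: unliftP => [j|] _ /=; rewrite ?mxE. Qed.

Lemma vconsZ n (s x : R) (y : 'rV[R]_n) :
  (s *: vcons (x, y) = vcons (s * x, s *: y))%R.
Proof. by apply/rowP => i; rewrite !mxE; case: unliftP => [j|] _ /=; rewrite ?mxE. Qed.

Lemma leb_shift n (c : 'rV[R]_n) (A : set 'rV[R]_n) : measurable A ->
  leb R n [set y | A (y + c)%R] = leb R n A.
Proof.
elim: n c A => [|n IH] c A mA.
  by rewrite (_ : [set y | _] = A)//; apply/seteqP; split => y /=;
    rewrite (thinmx0 c) addr0.
rewrite !lebS.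
transitivity (\int[lam]_x leb R n [set y | A (vcons (x + (vuncons c).1, y)%R)]).
  apply: eq_integral => x _; rewrite -[RHS](IH (vuncons c).2); last exact: measurable_leb_vcons.
  have E (y : 'rV[R]_n) : (vcons ((x : R), y) + c)%R =
      vcons ((x : R) + (vuncons c).1, y + (vuncons c).2)%R.
    by rewrite -[in LHS](vunconsK c); case: (vuncons c) => a b; exact: vconsD.
  by congr (leb R n _); apply/seteqP; split => y /=; rewrite E.
by rewrite (ge0_integral_shift _ (measurable_leb_sect mA)).
Qed.

(** By induction on the dimension, one coordinate at a time. *)
Lemma leb_scale n (s : R) (A : set 'rV[R]_n) : (0 < s)%R -> measurable A ->
  leb R n [set y | A (s *: y)%R] = ((s ^+ n)^-1)%:E * leb R n A.
Proof.
move=> s0; elim: n A => [|n IH] A mA.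
  rewrite expr0 invr1 mul1e (_ : [set y | _] = A)//; apply/seteqP; split => y /=;
    by rewrite (thinmx0 y) scaler0.
rewrite !lebS.
transitivity (\int[lam]_x (((s ^+ n)^-1)%:E * leb R n [set y | A (vcons (s * x, y)%R)])).
  apply: eq_integral => x _; rewrite -IH; last exact: measurable_leb_vcons.
  congr (leb R n _); apply/seteqP; split => y /=;
    by rewrite vconsZ.
have mg := measurable_leb_sect mA.
rewrite ge0_integralZl//; last first.
- by rewrite lee_fin invr_ge0 exprn_ge0// ltW.
- have ms : measurable_fun [set: R] (fun x : R => s * x)%R by exact: measurable_funM.
  exact: (measurableT_comp mg ms).
rewrite (ge0_integral_scale s0 mg)// muleA -EFinM.
by rewrite exprS invfM mulrC.
Qed.

Lemma measurable_row_mx m n : measurable_fun setT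
  (fun z : 'rV[R]_m * 'rV[R]_n => row_mx z.1 z.2).
Proof.
apply: measurable_fun_rV => i; case: (split_ordP i) => j ->.
  rewrite (_ : _ \o _ = rV_coor j \o fst).
    by apply: measurableT_comp => //; exact: measurable_rV_coor.
  by apply/funext => z; rewrite /rV_coor/= row_mxEl.
rewrite (_ : _ \o _ = rV_coor j \o snd).
  by apply: measurableT_comp => //; exact: measurable_rV_coor.
by apply/funext => z; rewrite /rV_coor/= row_mxEr.
Qed.

Lemma prod_leb_row_mx m n (A : set 'rV[R]_(m + n)) : measurable A ->
  (leb R m \x leb R n) [set z | A (row_mx z.1 z.2)] =
  \int[leb R m]_u leb R n [set b | A (row_mx u b)].
Proof.
move=> mA; rewrite /product_measure1; apply: eq_integral => x _ /=.
by congr (leb R n _); apply/seteqP; split => y; rewrite /xsection/= inE.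
Qed.

Lemma measurable_leb_row_mx m n (A : set 'rV[R]_(m + n)) : measurable A ->
  measurable_fun setT (fun u : 'rV[R]_m => leb R n [set b | A (row_mx u b)]).
Proof.
move=> mA.
have mA' : measurable [set z : 'rV[R]_m * 'rV[R]_n | A (row_mx z.1 z.2)].
  exact: (measurable_preimage (@measurable_row_mx m n) mA).
have := measurable_fun_xsection (leb R n) mA'.
by apply: eq_measurable_fun => x _ /=; congr (leb R n _); apply/seteqP; split => y;
  rewrite /xsection/= inE.
Qed.

Lemma vcons_row_mx m n (x : R) (a : 'rV[R]_m) (b : 'rV[R]_n) :
  vcons (x, row_mx a b) = row_mx (vcons (x, a)) b.
Proof.
apply/rowP => i; case: (@split_ordP m.+1 n i) => j ->.
  rewrite [RHS]row_mxEl mxE [RHS]mxE.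
  case: (unliftP ord0 j) => [k|] ->.
    rewrite (_ : lshift n (lift ord0 k) = lift ord0 (lshift n k)); last exact: val_inj.
    by rewrite liftK /= row_mxEl.
  by rewrite (_ : lshift n ord0 = ord0) ?unlift_none//; exact: val_inj.
rewrite [RHS]row_mxEr mxE.
rewrite (_ : rshift m.+1 j = lift ord0 (rshift m j)); last exact: val_inj.
by rewrite liftK /= row_mxEr.
Qed.

(** Phase space is a product, but the constant [Theta] for r = 0 involves the volume of
    the ball of R^(2d). *)
Lemma leb_add m n (A : set 'rV[R]_(m + n)) : measurable A ->
  leb R (m + n) A = (leb R m \x leb R n) [set z | A (row_mx z.1 z.2)].
Proof.
elim: m A => [|m IH] A mA.
  rewrite prod_leb_row_mx// integral_dirac//; last exact: measurable_leb_row_mx.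
  rewrite diracT mul1e; congr (leb R n _); apply/seteqP; split => y /=;
    by rewrite row_thin_mx.
rewrite prod_leb_row_mx// ge0_integral_lebS//; last exact: measurable_leb_row_mx.
rewrite [LHS]lebS; apply: eq_integral => x _.
rewrite IH; last exact: measurable_leb_vcons.
rewrite prod_leb_row_mx; last exact: measurable_leb_vcons.
apply: eq_integral => a _; congr (leb R n _); apply/seteqP; split => y /=;
  by rewrite vcons_row_mx.
Qed.

Definition cube n (c : 'rV[R]_n) (r : R) : set 'rV[R]_n :=
  [set y | forall i, (`|y ord0 i - c ord0 i| < r)%R].

Lemma measurable_cube n (c : 'rV[R]_n) (r : R) : measurable (cube c r).
Proof.
rewrite (_ : cube c r = \bigcap_(k in [set: nat]) (if insub k is Some i then
   (@rV_coor _ R n i) @^-1` [set x : R | `|x - c ord0 i| < r]%R else setT)).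
  apply: bigcapT_measurable => k; case: insub => [i|//]; apply: measurable_preimage.
    exact: measurable_rV_coor.
  rewrite (_ : [set x | _] = [set` `]c ord0 i - r, c ord0 i + r[]%R)//.
  by apply/seteqP; split => x /=; rewrite in_itv/= ltr_distl.
apply/seteqP; split => y h; first by move=> k _; case: insubP => // i _ _; exact: h.
by move=> i; have := h i I; rewrite valK.
Qed.

Lemma leb_cube n (c : 'rV[R]_n) (r : R) : (0 < r)%R ->
  leb R n (cube c r) = ((r + r) ^+ n)%:E.
Proof.
move=> r0; elim: n c => [|n IH] c.
  by rewrite expr0 /= diracE mem_set// => -[].
rewrite lebS.
transitivity (\int[lam]_x (((r + r) ^+ n)%:E * (\1_([set` `](vuncons c).1 - r, (vuncons c).1 + r[]%R) x)%:E)).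
  apply: eq_integral => x _; rewrite indicE mem_setE in_itv/= -ltr_distl.
  have E (y : 'rV[R]_n) : vcons (x, y) ord0 ord0 = x by rewrite mxE unlift_none.
  have E' (x' : R) (y : 'rV[R]_n) i : vcons (x', y) ord0 (lift ord0 i) = y ord0 i.
    by rewrite mxE liftK.
  have [h|h] := ltrP (`|x - c ord0 ord0|)%R r.
    rewrite mule1 -(IH (vuncons c).2); congr (leb R n _); apply/seteqP; split => y /=.
      by move=> H i; have := H (lift ord0 i); rewrite E' mxE.
    move=> H i.
    by case: (unliftP ord0 i) => [j ->|->]; rewrite ?E' ?E//; have := H j; rewrite mxE.
  rewrite mule0 (_ : [set y | _] = set0) ?measure0//.
  apply/seteqP; split => y //= /(_ ord0).
  by rewrite E ltNge h.
rewrite ge0_integralZl//; last first.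
- by rewrite lee_fin exprn_ge0// addr_ge0// ltW.
- by apply/measurable_EFinP; exact: measurable_indic.
rewrite (_ : \int[_]_x _ = lam [set` `](vuncons c).1 - r, (vuncons c).1 + r[%R]); last first.
  by rewrite integral_indic// setIT.
rewrite lebesgue_measure_itv/= lte_fin ltrD2l gtrN//.
rewrite -EFinB -EFinM exprSr; congr (_ * _)%:E.
by ring.
Qed.

Lemma eball_sub_cube n (r : R) : @eball R n r `<=` cube 0 (r + 1)%R.
Proof.
move=> y; rewrite /eball/= => yr i; rewrite mxE subr0.
by rewrite (le_lt_trans (le_trans (ler_coord_enorm _ _) yr))// ltrDl.
Qed.

Lemma ball_cube n (c : 'rV[R]_n) (r : R) : (0 < r)%R -> ball c r = cube c r.
Proof.
move=> r0; rewrite -ball_normE /ball_; apply/seteqP; split => y /= h.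
  by move=> i; rewrite distrC; apply: le_lt_trans h; have := ler_coord_norm (c - y)%R i; rewrite !mxE.
rewrite [ltLHS]/Num.norm/= mx_normrE; apply/bigmax_ltP; split => // -[i j] _ /=.
by rewrite (ord1 i) !mxE distrC.
Qed.

(** The sigma-algebra is generated by the coordinates; an open set is the union of the
    cubes with rational data that it contains. *)
Lemma open_measurable_rV n (O : set 'rV[R]_n) : open O -> measurable O.
Proof.
move=> oO.
pose F (k : nat) : set 'rV[R]_n := if unpickle k is Some (q, e) then
  (let c := cube (map_mx ratr (q : 'rV[rat]_n)) (ratr (e : rat)) in
   if `[< c `<=` O >] then c else set0) else set0.
rewrite (_ : O = \bigcup_k F k).
  apply: bigcup_measurable => k _; rewrite /F; case: unpickle => [[q e]|] //.
  by case: ifP => // _; exact: measurable_cube.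
apply/seteqP; split => x; last first.
  move=> [k _]; rewrite /F; case: unpickle => [[q e]|] //.
  by case: ifPn => // /asboolP; apply.
move=> Ox; have := oO; rewrite openE => /(_ x Ox) /nbhs_ballP[r /= r0 hr].
have [e] := rat_in_itvoo (divr_gt0 r0 (ltr0Sn R 1)).
rewrite in_itv/= => /andP[e0 er].
have Hq i : exists q : rat, (`|ratr q - x ord0 i| < ratr e)%R.
  have /rat_in_itvoo[q] : (x ord0 i - ratr e < x ord0 i + ratr e)%R.
    by rewrite ltrD2l gtrN.
  by rewrite in_itv/= -ltr_distl; exists q.
pose q : 'rV[rat]_n := \row_i sval (cid (Hq i)).
exists (pickle (q, e)) => //; rewrite /F pickleK.
have xc : cube (map_mx ratr q) (ratr e) x.
  by move=> i; rewrite !mxE distrC; exact: svalP (cid (Hq i)).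
rewrite ifT; first exact: xc.
apply/asboolP => y yc; apply: hr; rewrite ball_cube// => i.
  have := yc i; have := xc i; rewrite distrC => h1 h2.
  rewrite (le_lt_trans (ler_distD (map_mx ratr q ord0 i) _ _))//.
  by rewrite (lt_trans (ltrD h2 h1))// [ltRHS]splitr ltrD.
Qed.

Lemma continuous_measurable_rV n (f : 'rV[R]_n -> R) : continuous f ->
  measurable_fun setT f.
Proof.
move=> cf; apply: (measurability _ (RGenOInfty.measurableE R)) => //.
move=> /= _ [_ [a ->] <-]; rewrite setTI; apply: open_measurable_rV.
apply: open_comp => [x _|]; first exact: cf.
exact: interval_open.
Qed.

Lemma leb_open_gt0 n (O : set 'rV[R]_n) x : open O -> O x -> 0 < leb R n O.
Proof.
move=> oO Ox; have := oO; rewrite openE => /(_ x Ox) /nbhs_ballP[r /= r0 hr].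
apply: (@lt_le_trans _ _ (leb R n (cube x r))).
  by rewrite leb_cube// lte_fin exprn_gt0// addr_gt0.
apply: le_measure; rewrite ?inE.
- exact: measurable_cube.
- exact: open_measurable_rV.
- by rewrite -ball_cube.
Qed.

Lemma measurable_eball n (r : R) : measurable (@eball R n r).
Proof.
apply: (@measurable_preimage _ _ _ _ _ (continuous_measurable_rV (@continuous_enorm R n)) [set x : R | x <= r]%R).
rewrite (_ : [set x : R | _] = [set` `]-oo, r]%R]); first exact: measurable_itv.
by apply/seteqP; split => x /=; rewrite in_itv.
Qed.

Lemma leb_eball_lty n (r : R) : leb R n (eball r) < +oo.
Proof.
have [r0|r0] := leP 0%R r; last first.
  rewrite (_ : eball r = set0) ?measure0//; apply/seteqP; split => x //.
  by rewrite /eball/= leNgt (lt_le_trans r0)// enorm_ge0.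
apply: (@le_lt_trans _ _ (leb R n (cube 0 (r + 1)%R))).
  apply: le_measure; rewrite ?inE.
  - exact: measurable_eball.
  - exact: measurable_cube.
  - exact: eball_sub_cube.
by rewrite leb_cube ?ltry// ltr_wpDl.
Qed.

Lemma ae_le_everywhere n (f : 'rV[R]_n -> R) (m : R) : continuous f ->
  {ae leb R n, forall x, (f x <= m)%R} -> forall x, (f x <= m)%R.
Proof.
move=> cf [N [mN N0 sN]] x; rewrite leNgt; apply/negP => fx.
pose O := f @^-1` [set y | (m < y)%R].
have oO : open O by apply: open_comp => // y _; exact: cf.
have := leb_open_gt0 oO (fx : O x).
rewrite ltNge => /negP; apply; rewrite -N0; apply: le_measure; rewrite ?inE//.
  exact: open_measurable_rV.
by move=> y Oy; apply: sN => /=; rewrite leNgt => /negP; apply.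
Qed.
End lebn.

(** * Smooth bumps *)

Section bump1.
Context {R : realType}.

Lemma is_derive1_compo (f g : R -> R) (x df dg : R) :
  is_derive x 1 f df -> is_derive (f x) 1 g dg ->
  is_derive x 1 (g \o f) (dg * df).
Proof.
move=> [hf <-] [hg <-]; split.
  apply: diff_derivable; apply: differentiable_comp; exact/derivable1_diffP.
by rewrite -derive1E (derive1_comp hf hg) !derive1E.
Qed.

(** The family is stable under derivation up to linear combinations, so that smoothness
    of the bumps is a closure property and needs no formula for the iterated
    derivatives. *)
Definition flat (k : nat) (x : R) : R :=
  if 0 < x then (x^-1) ^+ k * expR (- x^-1) else 0.

Lemma flat_ge0 k x : 0 <= flat k x.
Proof.
by rewrite /flat; case: ifP => // x0; rewrite mulr_ge0 ?expR_ge0// exprn_ge0// invr_ge0 ltW.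
Qed.

Lemma flat_eq0 k x : x <= 0 -> flat k x = 0.
Proof. by move=> x0; rewrite /flat ltNge x0. Qed.

Lemma flat_gt0 k x : 0 < x -> 0 < flat k x.
Proof. by move=> x0; rewrite /flat x0 mulr_gt0 ?expR_gt0// exprn_gt0// invr_gt0. Qed.

Lemma flat_le k x : 0 < x -> flat k x <= (k.+2)`!%:R * x ^+ 2.
Proof.
move=> x0; rewrite /flat x0.
have u0 : 0 < x^-1 by rewrite invr_gt0.
rewrite expRN ler_pdivrMr ?expR_gt0//.
have := expR_ge1Dxn k.+1 (ltW u0) => h.
have h1 : x^-1 ^+ k.+2 / (k.+2)`!%:R <= expR x^-1 by rewrite (le_trans _ h)// lerDr.
have F0 : 0 < (k.+2)`!%:R :> R by rewrite ltr0n fact_gt0.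
rewrite -mulrA -ler_pdivrMl// (le_trans _ (ler_wpM2l (sqr_ge0 x) h1))//.
rewrite mulrA mulrC ler_pM2r ?invr_gt0//.
rewrite (_ : x^-1 ^+ k.+2 = x^-1 ^+ 2 * x^-1 ^+ k); last by rewrite -exprD.
by rewrite mulrA -exprMn mulfV ?gt_eqF// expr1n mul1r.
Qed.

(** At 0 the difference quotient tends to 0 because exp(-1/x) is smaller than any power
    of x. *)
Lemma is_derive_flat (k : nat) (x : R) :
  is_derive x 1 (flat k) (flat k.+2 x - k%:R * flat k.+1 x).
Proof.
have [x0|x0|->] := ltgtP x 0.
- apply: (@near_eq_is_derive _ _ _ (cst 0)).
    near=> y; rewrite flat_eq0//; apply: ltW; near: y; exact: lt_nbhsl.
  rewrite !flat_eq0 ?ltW// mulr0 subr0; exact: is_derive_cst.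
- pose G (u : R) := u ^+ k * expR (- u).
  apply: (@near_eq_is_derive _ _ _ (G \o (fun y => y^-1))).
    near=> y; rewrite /flat ifT//; near: y; exact: lt_nbhsr.
  have dinv : is_derive x 1 (fun y : R => y^-1) (- x ^- 2).
    split; first by apply: derivableV => //; rewrite gt_eqF.
    by rewrite deriveV ?gt_eqF// derive_id [_%:A]mulr1.
  have dN : is_derive x^-1 1 (fun u : R => expR (- u)) (expR (- x^-1) * - 1).
    by apply: (@is_derive1_compo (fun u => - u) expR).
  have dX : is_derive x^-1 1 (fun u : R => u ^+ k) (k%:R * x^-1 ^+ k.-1).
    rewrite (_ : (fun u : R => u ^+ k) = id ^+ k); last by apply/funext => u; rewrite exprfctE.
    by have := @is_deriveX R R id k x^-1 1 1 (is_derive_id _ _); rewrite [_ *: 1]mulr1.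
  have dG : is_derive x^-1 1 G (x^-1 ^+ k * (expR (- x^-1) * - 1) + expR (- x^-1) * (k%:R * x^-1 ^+ k.-1)).
    exact: is_deriveM.
  apply: (is_derive_eq (is_derive1_compo dinv dG)).
  rewrite /flat x0; case: k {G dX dG} => [|k] /=.
    by rewrite !mul0r mulr0 !expr0 addr0 subr0 -exprVn; ring.
  by rewrite -exprVn !exprS; ring.
- rewrite !flat_eq0// mulr0 subr0; apply/is_derive_dist => e e0.
  have F0 : 0 < (k.+2)`!%:R :> R by rewrite ltr0n fact_gt0.
  exists (e / (k.+2)`!%:R); first by rewrite divr_gt0.
  move=> h h0 hh; rewrite add0r (flat_eq0 _ (lexx 0)) !subr0.
  have [h1|h1] := leP h 0; first by rewrite flat_eq0// mulr0 normr0 ltW.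
  rewrite ger0_norm; last by rewrite mulr_ge0 ?flat_ge0// invr_ge0 ltW.
  rewrite ler_pdivrMl// (le_trans (flat_le _ h1))// expr2 mulrA [leRHS]mulrC.
  rewrite ler_pM2r// -ler_pdivlMl// mulrC.
  by move: hh; rewrite gtr0_norm// => /ltW.
Unshelve. all: by end_near. Qed.

Lemma continuous_flat k : continuous (flat k).
Proof. by move=> x; exact: is_derive_cont (is_derive_flat k x). Qed.
End bump1.

Section bumpn.
Context {R : realType} {d : nat}.
Implicit Types (x y c : 'rV[R]_d) (f : 'rV[R]_d -> R).

Lemma is_derive_axis f x (i : 'I_d) (D : R) :
  is_derive (0 : R) 1 (fun s : R => f (x + s *: delta_mx ord0 i)) D ->
  is_derive x (delta_mx ord0 i) f D.
Proof.
set e := delta_mx ord0 i.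
have E : (fun h : R => h^-1 *: (((fun s => f (x + s *: e)) \o shift 0) (h *: 1)
            - f (x + 0 *: e))) =
   (fun h : R => h^-1 *: ((f \o shift x) (h *: e) - f x)).
  apply/funext => h /=; rewrite scale0r; congr (_ *: (f _ - f _)).
    by rewrite addr0 [h%:A]mulr1 addrC.
  by rewrite addr0.
by move=> [h1 h2]; split; move: h1 h2; rewrite /derivable /derive E.
Qed.

Variable r : R.

Definition bump0 c (j l : 'I_d -> nat) x : R :=
  \prod_k (flat (j k) (r + (x ord0 k - c ord0 k)) * flat (l k) (r - (x ord0 k - c ord0 k))).

(** The class contains a nonnegative bump, its members vanish outside the cube of center
    [c] and radius [r], and it is stable by partial derivatives. *)
Inductive bumpfun c : ('rV[R]_d -> R) -> Prop :=
| bump_gen j l : bumpfun c (bump0 c j l)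
| bumpD f g : bumpfun c f -> bumpfun c g -> bumpfun c (f \+ g)
| bumpZ a f : bumpfun c f -> bumpfun c (a \*: f).

Definition upd (j : 'I_d -> nat) i m : 'I_d -> nat := fun k => if k == i then m else j k.

Lemma bump0_axis c j l x (i : 'I_d) (s : R) :
  bump0 c j l (x + s *: delta_mx ord0 i) =
  flat (j i) (r + (x ord0 i + s - c ord0 i)) * flat (l i) (r - (x ord0 i + s - c ord0 i)) *
  \prod_(k | k != i) (flat (j k) (r + (x ord0 k - c ord0 k)) * flat (l k) (r - (x ord0 k - c ord0 k))).
Proof.
rewrite /bump0 (bigD1 i)//= !mxE !eqxx mulr1; congr (_ * _).
by apply: eq_bigr => k ki; rewrite !mxE eqxx (negbTE ki) mulr0 addr0.
Qed.

Lemma bump0_upd c j l x (i : 'I_d) (m n : nat) :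
  bump0 c (upd j i m) (upd l i n) x =
  flat m (r + (x ord0 i - c ord0 i)) * flat n (r - (x ord0 i - c ord0 i)) *
  \prod_(k | k != i) (flat (j k) (r + (x ord0 k - c ord0 k)) * flat (l k) (r - (x ord0 k - c ord0 k))).
Proof.
rewrite /bump0 (bigD1 i)//= /upd eqxx; congr (_ * _).
by apply: eq_bigr => k ki; rewrite (negbTE ki).
Qed.

Lemma bump_derive c f (i : 'I_d) : bumpfun c f ->
  exists2 g, bumpfun c g & forall x, is_derive x (delta_mx ord0 i) f (g x).
Proof.
elim=> [j l|f1 f2 _ [g1 b1 h1] _ [g2 b2 h2]|a f1 _ [g1 b1 h1]].
- pose B m n := bump0 c (upd j i m) (upd l i n).
  exists ((B (j i).+2 (l i) \+ ((- (j i)%:R) \*: B (j i).+1 (l i))) \+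
          (((-1) \*: B (j i) (l i).+2) \+ ((l i)%:R \*: B (j i) (l i).+1))).
    by do 4?[apply: bumpD|apply: bumpZ|exact: bump_gen].
  move=> x; apply: is_derive_axis.
  rewrite (_ : (fun s => _) = fun s : R =>
     (flat (j i) (r + (x ord0 i + s - c ord0 i)) * flat (l i) (r - (x ord0 i + s - c ord0 i))) *:
  \prod_(k | k != i) (flat (j k) (r + (x ord0 k - c ord0 k)) * flat (l k) (r - (x ord0 k - c ord0 k)))); last first.
    by apply/funext => s; rewrite bump0_axis.
  set P := \prod_(k | _) _.
  have d1 : is_derive (0 : R) 1 (fun s : R => r + (x ord0 i + s - c ord0 i)) 1.
    apply/is_derive_dist => e e0; exists 1 => // h h0 _.
    rewrite (_ : r + _ - _ = h); last by rewrite add0r addr0; ring.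
    by rewrite mulVf// subrr normr0 ltW.
  have d2 : is_derive (0 : R) 1 (fun s : R => r - (x ord0 i + s - c ord0 i)) (- 1).
    apply/is_derive_dist => e e0; exists 1 => // h h0 _.
    rewrite (_ : r - _ - _ = - h); last by rewrite add0r addr0; ring.
    by rewrite mulrN mulVf// subrr normr0 ltW.
  have D1 := is_derive1_compo d1 (is_derive_flat (j i) _).
  have D2 := is_derive1_compo d2 (is_derive_flat (l i) _).
  have D3 := is_deriveM D1 D2.
  have := @is_deriveZ R R _ (fun=> P) _ _ _ _; move=> _.
  have D4 := is_deriveM D3 (is_derive_cst P (0 : R) 1).
  apply: (@is_derive_eq _ _ _ _ _ _ _ _ D4).
  rewrite /B /= !bump0_upd -/P /= addr0 /GRing.scale/=; ring.
- exists (g1 \+ g2); first exact: bumpD.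
  by move=> x; apply: is_deriveD.
- exists (a \*: g1); first exact: bumpZ.
  by move=> x; apply: is_deriveZ.
Qed.

Lemma bump_continuous c f : bumpfun c f -> continuous f.
Proof.
elim=> [j l|f1 f2 _ h1 _ h2|a f1 _ h1] x; have FF : Filter (nbhs x) := nbhs_filter x.
- rewrite /bump0; apply: cvg_big => //.
    by move=> z; apply: mul_continuous.
  move=> k _; have cx : x0 ord0 k @[x0 --> x] --> x ord0 k by exact: coord_continuous.
  apply: cvgM; apply: continuous_cvg; try exact: continuous_flat.
    by apply: cvgD; [exact: cvg_cst|apply: cvgB => //; exact: cvg_cst].
  by apply: cvgB; [exact: cvg_cst|apply: cvgB => //; exact: cvg_cst].
- by apply: continuousD; [exact: h1|exact: h2].
- by apply: continuousZr; exact: h1.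
Qed.

Lemma bump_partial c f i : bumpfun c f -> bumpfun c (partial i f).
Proof.
move=> /bump_derive-/(_ i)[g bg hg]; suff -> : partial i f = g by [].
by apply/funext => x; case: (hg x).
Qed.

Lemma bump_C1 c f : bumpfun c f -> C1 f.
Proof.
move=> bf i; split; last exact: bump_continuous (bump_partial i bf).
by move=> x; have [g bg hg] := bump_derive i bf; case: (hg x).
Qed.

Lemma bump_smooth c f : bumpfun c f -> smooth f.
Proof.
move=> bf s; have bs : bumpfun c (partials s f).
  by elim: s => //= i s IH; exact: bump_partial.
split; first exact: bump_continuous bs.
by move=> i x; have [h _] := bump_C1 bs i; exact: h.
Qed.

Lemma bump_supp0 c f x : bumpfun c f -> f x != 0 ->
  forall k, `|x ord0 k - c ord0 k| < r.
Proof.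
move=> bf; elim: bf => [j l|f1 f2 _ h1 _ h2|a f1 _ h1].
- rewrite /bump0 => /prodf_neq0 h k; have := h k isT.
  rewrite mulf_eq0 negb_or => /andP[h1 h2].
  rewrite ltr_norml; apply/andP; split.
    rewrite ltNge; apply: contra h1 => h1; rewrite flat_eq0//.
    by rewrite -lerBrDl sub0r.
  rewrite ltNge; apply: contra h2 => h2; rewrite flat_eq0//.
  by rewrite subr_le0.
- have [f10|/h1//] := eqVneq (f1 x) 0; have [f20|/h2//] := eqVneq (f2 x) 0.
  by rewrite /= f10 f20 addr0 eqxx.
- by have [f10|/h1//] := eqVneq (f1 x) 0; rewrite /= f10 scaler0 eqxx.
Qed.

Lemma closed_eball (M : R) : closed (@eball R d M).
Proof.
rewrite /eball (_ : [set x | _] = enorm @^-1` [set t | t <= M])//.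
by apply: closed_comp; [move=> x _; exact: continuous_enorm|exact: closed_le].
Qed.

Lemma compact_eball (M : R) : compact (@eball R d M).
Proof.
apply: bounded_closed_compact; last exact: closed_eball.
exists M; split; first exact: num_real.
by move=> t Mt x; rewrite /eball/= => xM; rewrite (le_trans (norm_le_enorm _))// (le_trans xM)// ltW.
Qed.

Lemma bump_zero c f x (M : R) : bumpfun c f -> enorm c + d%:R * r <= M ->
  M < enorm x -> f x = 0.
Proof.
move=> bf cM Mx; apply/eqP; apply: contraT => fx.
have := bump_supp0 bf fx => h.
have : enorm (x - c) <= d%:R * r.
  rewrite (le_trans (enorm_le_sum _))// mulr_natl.
  rewrite (@le_trans _ _ (\sum_(k < d) r))//; last by rewrite sumr_const card_ord.
  by apply: ler_sum => k _; rewrite !mxE ltW.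
rewrite leNgt => /negP[]; rewrite -(ltrD2l (enorm c)) (le_lt_trans cM)//.
by rewrite (lt_le_trans Mx)// (le_trans _ (enormD _ _))// subrKC.
Qed.

Lemma bump_supp c f (M : R) : bumpfun c f -> enorm c + d%:R * r <= M -> supp f `<=` eball M.
Proof.
move=> bf cM; rewrite /supp; have -> : eball M = closure (@eball R d M).
  exact/closure_id/closed_eball.
apply: closureS => x /= fx; rewrite /eball/= leNgt; apply: contra fx => Mx.
exact/eqP/(bump_zero bf cM).
Qed.

Lemma bump_test c f : bumpfun c f -> test_function f.
Proof.
move=> bf; split; first exact: bump_smooth bf.
by exists (enorm c + d%:R * r); apply: bump_supp bf _.
Qed.

(** Not normalised: only ratios of integrals against it will matter. *)
Definition rho c := bump0 c (fun=> 0%N) (fun=> 0%N).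

Lemma rho_bump c : bumpfun c (rho c). Proof. exact: bump_gen. Qed.

Lemma rho_ge0 c x : 0 <= rho c x.
Proof. by apply: prodr_ge0 => k _; rewrite mulr_ge0 ?flat_ge0. Qed.

Lemma rho_gt0 c : 0 < r -> 0 < rho c c.
Proof.
move=> r0; apply: prodr_gt0 => k _.
by rewrite subrr addr0 subr0 mulr_gt0// flat_gt0.
Qed.

Lemma rho_shift c z x : rho (c + z) x = rho c (x - z).
Proof.
by apply: eq_bigr => k _; rewrite !mxE; congr (flat _ (_ + _) * flat _ (_ - _)); ring.
Qed.
End bumpn.

(** * Integrals over R^n and translations *)

Section real_integrals.
Context d (T : measurableType d) (R : realType) (mu : {measure set T -> \bar R}).

Definition intg (f : T -> R) : Prop := mu.-integrable setT (EFin \o f).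

Lemma intgD f g : intg f -> intg g -> intg (fun x => f x + g x).
Proof. by move=> hf hg; exact: (integrableD measurableT hf hg). Qed.

Lemma intgZ a f : intg f -> intg (fun x => a * f x).
Proof. by move=> hf; exact: (integrableZl measurableT a hf). Qed.

Lemma intgN f : intg f -> intg (fun x => - f x).
Proof.
move=> hf; have := intgZ (-1) hf.
by rewrite (_ : (fun x => _ * f x) = (fun x => - f x))//; apply/funext => x; rewrite mulN1r.
Qed.

Lemma intgB f g : intg f -> intg g -> intg (fun x => f x - g x).
Proof. by move=> hf hg; apply: intgD => //; exact: intgN. Qed.

Lemma intg_sum (I : finType) (F : I -> T -> R) : (forall i, intg (F i)) ->
  intg (fun x => \sum_i F i x).
Proof.
move=> h; have := @integrable_sum _ T R mu setT measurableT I (index_enum I) xpredT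
  (fun i x => (F i x)%:E) (fun i _ => h i).
by apply: eq_integrable => // x _ /=; rewrite sumEFin.
Qed.

Lemma Rint_seqsum (I : finType) (F : I -> T -> R) (s : seq I) : (forall i, intg (F i)) ->
  intg (fun x => \sum_(i <- s) F i x) /\
  \int[mu]_x (\sum_(i <- s) F i x) = \sum_(i <- s) \int[mu]_x F i x.
Proof.
move=> h; elim: s => [|i s [IH1 IH2]].
  split.
    rewrite (_ : (fun x => _) = fun=> 0); last by apply/funext => x; rewrite big_nil.
    exact: integrable0.
  rewrite big_nil; transitivity (\int[mu]_x (0 : R)).
    by apply: eq_Rintegral => x _; rewrite big_nil.
  by rewrite Rintegral_cst// mul0r.
have E : (fun x => \sum_(j <- i :: s) F j x) = (fun x => F i x + \sum_(j <- s) F j x).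
  by apply/funext => x; rewrite big_cons.
split; first by rewrite E; exact: intgD.
rewrite big_cons -IH2 -RintegralD//; last exact: h.
by apply: eq_Rintegral => x _; rewrite big_cons.
Qed.

Lemma Rint_sum (I : finType) (F : I -> T -> R) : (forall i, intg (F i)) ->
  \int[mu]_x (\sum_i F i x) = \sum_i \int[mu]_x F i x.
Proof. by move=> h; case: (Rint_seqsum (index_enum I) h). Qed.

Lemma intg_measurable f : intg f -> measurable_fun setT f.
Proof. by move=> /integrableP[/measurable_EFinP]. Qed.

Lemma le_intg (f g : T -> R) : measurable_fun setT f -> (forall x, `|f x| <= g x) ->
  intg g -> intg f.
Proof.
move=> mf fg hg; apply: (le_integrable measurableT _ _ hg).
  exact/measurable_EFinP.
by move=> x _ /=; rewrite lee_fin (le_trans (fg x))// ler_norm.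
Qed.

Lemma intg_norm f : intg f -> intg (fun x => `|f x|).
Proof.
move=> hf; have mf := intg_measurable hf.
apply: (le_integrable measurableT _ _ hf).
  by apply/measurable_EFinP; exact: measurableT_comp.
by move=> x _ /=; rewrite normr_id.
Qed.

Lemma ae_le_Rint f g : intg f -> intg g -> {ae mu, forall x, f x <= g x} ->
  \int[mu]_x f x <= \int[mu]_x g x.
Proof.
move=> hf hg fg.
have mf := intg_measurable hf; have mg := intg_measurable hg.
pose h x := Num.min (f x) (g x).
have mh : measurable_fun setT h by exact: measurable_minr.
have hh : intg h.
  apply: (@le_intg h (fun x => `|f x| + `|g x|)) => //.
    by move=> x; rewrite /h /Num.min; case: ifP => _; rewrite ?lerDl ?lerDr.
  by apply: intgD; exact: intg_norm.
rewrite (_ : \int[mu]_x f x = \int[mu]_x h x).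
  by apply: le_Rintegral => // x _; rewrite ge_min lexx orbT.
congr fine; apply: ae_eq_integral => //; [exact/measurable_EFinP|exact/measurable_EFinP|].
by apply: filterS fg => x fgx _; rewrite /h min_l.
Qed.
End real_integrals.

Section rint_shift.
Context {R : realType} {d : nat}.
Implicit Types (x y u b c : 'rV[R]_d) (f : 'rV[R]_d -> R).
Local Notation leb := (leb R d).

Lemma ge0_integral_leb_shift c (h : 'rV[R]_d -> \bar R) : measurable_fun setT h ->
  (forall x, 0 <= h x)%E ->
  (\int[leb]_x h (x + c)%R = \int[leb]_x h x)%E.
Proof.
move=> mh h0; rewrite -(ge0_integral_pushm leb (measurable_rV_add c))//.
by apply: eq_measure_integral => A mA _; exact: (leb_shift c mA).
Qed.

Lemma Rint_leb_shift c f : measurable_fun setT f ->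
  \int[leb]_x f (x + c) = \int[leb]_x f x.
Proof.
move=> mf; have mf' : measurable_fun setT (EFin \o f) by exact/measurable_EFinP.
rewrite /Rintegral; congr fine; rewrite integralE [RHS]integralE; congr (_ - _)%E.
  rewrite -[RHS](ge0_integral_leb_shift c (measurable_funepos mf') (funepos_ge0 (EFin \o f))).
  by apply: eq_integral => x _; rewrite !funeposE.
rewrite -[RHS](ge0_integral_leb_shift c (measurable_funeneg mf') (funeneg_ge0 (EFin \o f))).
  by apply: eq_integral => x _; rewrite !funenegE.
Qed.

Lemma cont_bdd_eball f (M : R) : continuous f ->
  exists2 K, 0 <= K & forall x, enorm x <= M -> `|f x| <= K.
Proof.
move=> cf.
have [B [_ HB]] := compact_bounded (continuous_compact (continuous_subspaceT cf) (compact_eball (M := M))).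
exists (`|B| + 1) => [|x xM]; first by rewrite addr_ge0.
apply: HB; first by rewrite (le_lt_trans (ler_norm B))// ltrDl.
by exists x.
Qed.

Lemma intg_supp f (K M : R) : measurable_fun setT f ->
  (forall x, enorm x <= M -> `|f x| <= K) -> (forall x, M < enorm x -> f x = 0) ->
  intg leb f.
Proof.
move=> mf fK f0; apply: (@le_intg _ _ _ _ f (fun x => K * \1_(eball M) x)) => //.
  move=> x; rewrite indicE; case: (boolP (x \in eball M)); rewrite ?inE ?notin_setE => h.
    by rewrite mulr1 fK.
  by rewrite f0 ?normr0 ?mulr0//= ltNge; exact/negP.
apply: intgZ; apply/integrableP; split.
  by apply/measurable_EFinP/measurable_indic; exact: measurable_eball.
rewrite (eq_integral (fun x => (\1_(eball M) x)%:E)); last first.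
  by move=> x _ /=; rewrite ger0_norm.
rewrite integral_indic//; last exact: measurable_eball.
by rewrite setIT; exact: leb_eball_lty.
Qed.

Lemma C1_continuous f : C1 f -> continuous f.
Proof.
move=> hf x; apply/(@cvgrPdist_le _ _ _ (nbhs x)) => e e0.
have [r r0 hr] := C1_expand x hf ltr01.
pose K := (enorm (grad f x) + 1) * d%:R + 1.
have K0 : 0 < K by rewrite /K ltr_wpDl// mulr_ge0// addr_ge0 ?enorm_ge0.
near=> y.
have yr : `|y - x| < Num.min r (e / K).
  near: y; apply/(nbhs_ballP x); exists (Num.min r (e / K)).
    by rewrite /= lt_min r0 divr_gt0.
  by move=> y; rewrite -ball_normE /= distrC.
move: yr; rewrite lt_min => /andP[yr ye].
have := hr (y - x) yr; rewrite subrKC => h.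
rewrite distrC -(subrK (dot (grad f x) (y - x)) (f y - f x)).
rewrite (le_trans (ler_normD _ _))//.
rewrite (@le_trans _ _ ((enorm (grad f x) + 1) * enorm (y - x)))//.
  by rewrite mulrDl addrC lerD// normr_dot_le.
rewrite (@le_trans _ _ (K * `|y - x|))//; last by rewrite -ler_pdivlMl// mulrC ltW.
rewrite (@le_trans _ _ ((enorm (grad f x) + 1) * (d%:R * `|y - x|)))//.
  by rewrite ler_wpM2l ?addr_ge0 ?enorm_ge0// enorm_le_norm.
by rewrite /K [leRHS]mulrDl mulrA lerDl mul1r.
Unshelve. all: by end_near. Qed.

Lemma grad_zero f x (M : R) : (forall y, M < enorm y -> f y = 0) ->
  M < enorm x -> grad f x = 0.
Proof.
move=> f0 Mx; apply/rowP => i; rewrite !mxE /partial.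
have -> : 'D_(delta_mx ord0 i) f x = 'D_(delta_mx ord0 i) (cst 0 : 'rV[R]_d -> R) x.
  have FF : Filter (nbhs x) := nbhs_filter x.
  have nx : nbhs x (@enorm R d @^-1` [set t : R | M < t]).
    apply: open_nbhs_nbhs; split => //.
    by apply: open_comp; [move=> y _; exact: continuous_enorm|exact: open_gt].
  by apply: near_eq_derive; apply: filterS nx => y; exact: f0.
exact: derive_cst.
Qed.

Lemma continuous_dot_grad f b : C1 f -> continuous (fun y => dot (grad f y) b).
Proof.
move=> hf x; have FF : Filter (nbhs x) := nbhs_filter x.
rewrite /dot; apply: cvg_big => //; first by move=> z; apply: add_continuous.
move=> i _; apply: cvgM; last exact: cvg_cst.
under eq_fun do rewrite mxE; rewrite mxE.
by case: (hf i) => _; exact.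
Qed.

Lemma continuous_transl f c : continuous f -> continuous (fun y => f (y + c)).
Proof.
move=> cf x; apply: (@continuous_comp _ _ _ (fun y => y + c) f); last exact: cf.
have FF : Filter (nbhs x) := nbhs_filter x.
apply: (@cvgD _ 'rV[R]_d _ (nbhs x) FF); [exact: cvg_id|exact: cvg_cst].
Qed.

(** The derivative is placed on phi, whose translates stay, for t near t0, in one ball;
    there the continuous factors are bounded, which gives the domination. *)
Lemma is_derive_conv f phi u b (M t0 : R) : continuous f -> C1 phi ->
  (forall x, M < enorm x -> phi x = 0) ->
  is_derive t0 1 (fun t : R => \int[leb]_y (f y * phi (y - u - t *: b)))
    (- \int[leb]_y (f y * dot (grad phi (y - u - t0 *: b)) b)).
Proof.
move=> cf hphi phi0; have cphi := C1_continuous hphi.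
pose F (t : R) y := f y * phi (y - u - t *: b).
have dF (t : R) y : is_derive t 1 (fun t => F t y) (- (f y * dot (grad phi (y - u - t *: b)) b)).
  have H := is_derive_line (y - u) (- b) t hphi.
  have H1 : is_derive t 1 (fun t : R => f y *: phi (y - u + t *: - b))
     (f y *: dot (grad phi (y - u + t *: - b)) (- b)) by exact: is_deriveZ.
  rewrite (_ : (fun t => F t y) = (fun t : R => f y *: phi (y - u + t *: - b))); last first.
    by apply/funext => s; rewrite /F scalerN.
  apply: (is_derive_eq H1).
  by rewrite scalerN dotNr /GRing.scale/= mulrN.
pose M' := M + enorm u + (`|t0| + 1) * enorm b.
have supp t y : t0 - 1 < t < t0 + 1 -> M' < enorm y -> M < enorm (y - u - t *: b).
  move=> /andP[t1 t2]; rewrite /M' => My.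
  have tb : `|t| <= `|t0| + 1.
    rewrite -(subrK t0 t) (le_trans (ler_normD _ _))// addrC lerD2l ler_norml.
    by apply/andP; split; lra.
  have : enorm y <= enorm (y - u - t *: b) + enorm u + `|t| * enorm b.
    rewrite -enormZ -{1}(subrK u y) -{1}(subrK (t *: b) (y - u)).
    by rewrite (le_trans (enormD _ _))// [leRHS]addrAC lerD2r enormD.
  have : `|t| * enorm b <= (`|t0| + 1) * enorm b by rewrite ler_wpM2r ?enorm_ge0.
  by move: My; lra.
have [K1 K10 hK1] := cont_bdd_eball M' cf.
have cg := continuous_dot_grad (b := b) hphi.
have [K2 K20 hK2] := cont_bdd_eball M cg.
have [K3 K30 hK3] := cont_bdd_eball M cphi.
have hK2' y : `|dot (grad phi y) b| <= K2.
  have [yM|yM] := leP (enorm y) M; first exact: hK2.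
  by rewrite (grad_zero phi0 yM) dot0l normr0.
have hK3' y : `|phi y| <= K3.
  have [yM|yM] := leP (enorm y) M; first exact: hK3.
  by rewrite phi0// normr0.
have mF t : measurable_fun setT (F t).
  apply: measurable_funM; first exact: continuous_measurable_rV.
  apply: continuous_measurable_rV.
  rewrite (_ : (fun y => _) = (fun y => phi (y + (- u - t *: b)))).
    exact: continuous_transl.
  by apply/funext => y; rewrite addrA.
pose G y := K1 * K2 * \1_(eball M') y.
have It0 : `]t0 - 1, t0 + 1[%classic t0.
  by rewrite /= in_itv/= gtrBl ltrDl ltr01.
have HI : forall t : R, `]t0 - 1, t0 + 1[%classic t -> leb.-integrable setT (EFin \o F t).
  move=> t; rewrite /= in_itv/= => tt.
  apply: (@intg_supp _ (K1 * K3) M') => // y yM.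
    by rewrite normrM ler_pM// hK1.
  by rewrite /F phi0 ?mulr0//; exact: supp.
have HG0 : forall y, 0 <= G y by move=> y; rewrite /G !mulr_ge0.
have HG : leb.-integrable setT (EFin \o G).
  apply: (@intg_supp _ (K1 * K2) M').
  - apply: measurable_funM => //; apply: measurable_indic; exact: measurable_eball.
  - move=> y yM; rewrite ger0_norm// /G ler_piMr ?mulr_ge0//.
  - move=> y My; rewrite /G indicE memNset ?mulr0// /eball/=.
    by apply/negP; rewrite -ltNge.
have HD : forall t y, `]t0 - 1, t0 + 1[%classic t -> setT y -> derivable (F ^~ y) t 1.
  by move=> t y _ _; case: (dF t y).
have HdG : forall t y, `]t0 - 1, t0 + 1[%classic t -> setT y -> `|partial1of2 F t y| <= G y.
  move=> t y; rewrite /= in_itv/= => tt _; rewrite partial1of2E.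
  have [_ ->] := dF t y; rewrite normrN normrM /G indicE.
  have [yM|yM] := leP (enorm y) M'.
    by rewrite mem_set// mulr1 ler_pM// hK1.
  rewrite memNset; last by rewrite /eball/=; apply/negP; rewrite -ltNge.
  by rewrite mulr0 (grad_zero phi0) ?dot0l ?normr0 ?mulr0//; exact: supp.
have Hc := @cvg_differentiation_under_integral R _ _ leb F setT measurableT
  t0 (t0 - 1) (t0 + 1) It0 HI HD G HG0 HG HdG.
have HE : - (\int[leb]_y (f y * dot (grad phi (y - u - t0 *: b)) b)) =
   Rintegral leb setT (partial1of2 F t0).
  rewrite -[LHS]mulN1r -RintegralZl//; last first.
    apply: (@intg_supp _ (K1 * K2) M').
    - apply: measurable_funM; first exact: continuous_measurable_rV.
      apply: continuous_measurable_rV.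
      rewrite (_ : (fun y => _) = (fun y => dot (grad phi (y + (- u - t0 *: b))) b)).
        exact: (continuous_transl (c := - u - t0 *: b) cg).
      by apply/funext => y; rewrite addrA.
    - by move=> y yM; rewrite normrM ler_pM// hK1.
    - move=> y yM; rewrite (grad_zero phi0) ?dot0l ?mulr0//; exact: supp.
  congr (Rintegral _ _ _); apply/funext => y; rewrite mulN1r -[RHS]/(partial1of2 F t0 y).
  by rewrite partial1of2E; have [_ ->] := dF t0 y.
rewrite HE; split.
  apply/cvg_ex; exists (Rintegral leb setT (partial1of2 F t0)).
  by under eq_fun do rewrite [_%:A]mulr1; exact: Hc.
rewrite /derive; under eq_fun do rewrite [_%:A]mulr1.
by apply: cvg_lim => //; exact: Hc.
Qed.
End rint_shift.

(** * Second differences and weak Hessians *)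

Section lipschitz_gradient.
Context {R : realType} {d : nat}.
Implicit Types (x y a b c : 'rV[R]_d) (f : 'rV[R]_d -> R).
Local Notation leb := (leb R d).

(** Both derivatives are moved at once onto the test function, so that first weak
    derivatives never appear. *)
Definition weak_second (f : 'rV[R]_d -> R) (g : 'I_d -> 'I_d -> 'rV[R]_d -> R) : Prop :=
  forall i j,
    [/\ measurable_fun [set: 'rV[R]_d] (g i j),
        forall M : R, leb.-integrable (eball M) (EFin \o g i j) &
        forall phi, test_function phi ->
          \int[leb]_x (f x * partial j (partial i phi) x) = \int[leb]_x (g i j x * phi x)].

Lemma test_function_partial i (phi : 'rV[R]_d -> R) :
  test_function phi -> test_function (partial i phi).
Proof.
move=> [sphi [M hM]]; split.
  move=> s; have := sphi (s ++ [:: i]); rewrite /partials foldr_cat /=.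
  exact.
exists M => x; rewrite /supp => hx; rewrite /eball/= leNgt; apply/negP => Mx.
have phi0 y : M < enorm y -> phi y = 0.
  move=> My; apply/eqP; apply: contraT => /(@subset_closure _ [set x | phi x != 0] y) /hM.
  by rewrite /eball/= leNgt My.
have oM : nbhs x (@enorm R d @^-1` [set t : R | M < t]).
  apply: open_nbhs_nbhs; split => //.
  by apply: open_comp; [move=> y _; exact: continuous_enorm|exact: open_gt].
have [y [/= yx My]] := hx _ oM.
by move: yx; have := grad_zero phi0 My => /rowP/(_ i); rewrite !mxE => ->; rewrite eqxx.
Qed.

Lemma weak_second_weak_hess f :
  (forall i, has_weak_partial i f) ->
  (forall i j, has_weak_partial i (weak_partial j f)) ->
  weak_second f (fun i j => weak_partial i (weak_partial j f)).
Proof.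
move=> h1 h2 i j.
have Hj : is_weak_partial j f (weak_partial j f).
  by rewrite /weak_partial; case: xgetP => [g _ //|]; case: (h1 j) => g hg /(_ g).
have Hij : is_weak_partial i (weak_partial j f) (weak_partial i (weak_partial j f)).
  by rewrite {2}/weak_partial; case: xgetP => [g _ //|]; case: (h2 i j) => g hg /(_ g).
case: Hij => m I E; split => // phi tphi.
apply: oppr_inj; rewrite -E//.
by case: Hj => _ _ ->; [rewrite opprK|exact: test_function_partial].
Qed.

Lemma partial_shift i f c y : partial i (fun x => f (x - c)) y = partial i f (y - c).
Proof.
rewrite /partial /derive; congr (lim _); apply/funext => A; apply/propext.
rewrite (_ : (fun h : R => h^-1 *: _) = (fun h : R =>
   h^-1 *: ((f \o shift (y - c)) (h *: delta_mx ord0 i) - f (y - c))))//.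
by apply/funext => h /=; rewrite addrA.
Qed.

Lemma grad_shift f c y : grad (fun x => f (x - c)) y = grad f (y - c).
Proof. by apply/rowP => i; rewrite !mxE partial_shift. Qed.

Lemma intg_mul_supp f (g : 'rV[R]_d -> R) (M : R) :
  measurable_fun [set: 'rV[R]_d] g ->
  leb.-integrable (eball M) (EFin \o g) -> continuous f ->
  (forall x, M < enorm x -> f x = 0) -> intg leb (fun x => g x * f x).
Proof.
move=> mg ig cf f0; have [K K0 hK] := cont_bdd_eball M cf.
have mf := continuous_measurable_rV cf.
apply: (@le_intg _ _ _ _ _ (fun x => K * `|(g \_ (eball M)) x|)).
- exact: measurable_funM.
- move=> x; rewrite normrM mulrC patchE.
  case: (boolP (x \in eball M)); rewrite ?inE ?notin_setE => h.
    by rewrite ler_wpM2r// hK.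
  by rewrite f0 ?normr0 ?mul0r ?mulr_ge0// ltNge; exact/negP.
apply/intgZ/intg_norm.
have := (integrable_mkcond (EFin \o g) (measurable_eball (n := d) M)).1 ig.
by apply: eq_integrable => // x _; rewrite /= !patchE; case: ifP.
Qed.

Variables (f : 'rV[R]_d -> R) (g : 'I_d -> 'I_d -> 'rV[R]_d -> R) (L M : R).
Hypothesis cf : continuous f.
Hypothesis fg : weak_second f g.
Hypothesis gL : {ae leb, forall x, enorm x <= M -> opnorm (\matrix_(i, j) g i j x) <= L}.

(** Two translations of the bump are differentiated in turn; the second derivatives that
    fall on the bump are exchanged for the weak Hessian of f, evaluated at an
    intermediate translation. *)
Lemma second_diff_rho (r : R) x a b : 0 < r ->
  enorm x + enorm a + enorm b + d%:R * r <= M ->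
  \int[leb]_y (f y * rho r x (y - b - a)) - \int[leb]_y (f y * rho r x (y - a)) -
  (\int[leb]_y (f y * rho r x (y - b)) - \int[leb]_y (f y * rho r x y))
  <= L * enorm a * enorm b * \int[leb]_y rho r x y.
Proof.
move=> r0 xM.
have brho := @rho_bump R d r x.
pose M1 := enorm x + d%:R * r.
have rho0 y : M1 < enorm y -> rho r x y = 0 by exact: (bump_zero brho (lexx _)).
pose psi y := dot (grad (rho r x) y) a.
have bpsi : bumpfun r x psi.
  rewrite /psi /dot (_ : (fun y => _) = \sum_i (a ord0 i \*: partial i (rho r x))); last first.
    apply/funext => y; rewrite fct_sumE; apply: eq_bigr => i _.
    by rewrite !mxE mulrC.
  elim/big_ind: _ => [|u v|i _]; last by apply: bumpZ; exact: bump_partial.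
    rewrite (_ : 0 = 0 \*: rho r x); first exact: bumpZ.
    by apply/funext => y /=; rewrite scale0r.
  exact: bumpD.
have psi0 y : M1 < enorm y -> psi y = 0 by exact: (bump_zero bpsi (lexx _)).
pose k (s : R) := \int[leb]_y (f y * rho r x (y - b - s *: a)) -
   \int[leb]_y (f y * rho r x (y - 0 - s *: a)).
pose k' (s : R) := (- \int[leb]_y (f y * psi (y - b - s *: a))) -
   (- \int[leb]_y (f y * psi (y - 0 - s *: a))).
have dk (s : R) : is_derive s 1 k (k' s).
  apply: is_deriveB; exact: (is_derive_conv _ _ _ cf (bump_C1 brho) rho0).
have Iext (q q' : 'rV[R]_d -> 'rV[R]_d) : (forall y, q y = q' y) ->
    \int[leb]_y (f y * rho r x (q y)) = \int[leb]_y (f y * rho r x (q' y)).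
  by move=> E; apply: eq_Rintegral => y _; rewrite E.
have k1E : k 1 = \int[leb]_y (f y * rho r x (y - b - a)) - \int[leb]_y (f y * rho r x (y - a)).
  rewrite /k (Iext _ (fun y => y - b - a)); last by move=> y; rewrite scale1r.
  rewrite (Iext (fun y => y - 0 - 1 *: a) (fun y => y - a)); first exact: erefl.
  by move=> y; rewrite scale1r subr0.
have k0E : k 0 = \int[leb]_y (f y * rho r x (y - b)) - \int[leb]_y (f y * rho r x y).
  rewrite /k (Iext _ (fun y => y - b)); last by move=> y; rewrite scale0r subr0.
  rewrite (Iext (fun y => y - 0 - 0 *: a) (fun y => y)); first exact: erefl.
  by move=> y; rewrite scale0r subr0 subr0.
clearbody k.
suff : k 1 - k 0 <= L * enorm a * enorm b * \int[leb]_y rho r x y by rewrite k1E k0E.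
clear k1E k0E Iext.
have [s s1] := mvt_signed 1 dk.
rewrite mulr1 => ->.
pose J (t : R) := \int[leb]_y (f y * psi (y - s *: a - t *: b)).
pose J' (t : R) := - \int[leb]_y (f y * dot (grad psi (y - s *: a - t *: b)) b).
have dJ (t : R) : is_derive t 1 J (J' t).
  exact: (is_derive_conv _ _ _ cf (bump_C1 bpsi) psi0).
have [t t1] := mvt_signed 1 dJ.
rewrite mulr1 => EJ.
have J1E : \int[leb]_y (f y * psi (y - b - s *: a)) = J 1.
  by rewrite /J; apply: eq_Rintegral => y _; rewrite scale1r addrAC.
have J0E : \int[leb]_y (f y * psi (y - 0 - s *: a)) = J 0.
  by rewrite /J; apply: eq_Rintegral => y _; rewrite subr0 scale0r subr0.
have k'E : k' s = - J 1 - - J 0.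
  exact: (congr2 (fun A B : R => - A - - B) J1E J0E).
have J'E : J' t = - (\int[leb]_y (f y * dot (grad psi (y - s *: a - t *: b)) b)) by exact: erefl.
clear dk J1E J0E dJ; clearbody k' J J'.
have -> : k' s = - J' t by rewrite k'E -EJ; ring.
rewrite J'E; clear J'E EJ k'E J J' k k'.
rewrite opprK.
pose z := s *: a + t *: b.
pose rz := rho r (x + z).
have rzE y : rz y = rho r x (y - z) by exact: rho_shift.
have brz : bumpfun r (x + z) rz by exact: rho_bump.
have rzf : (fun y => rho r x (y - z)) = rz by apply/funext => y; rewrite rzE.
have rz_ge0 y : 0 <= rz y by exact: rho_ge0.
clearbody rz.
have zM : enorm z <= enorm a + enorm b.
  rewrite (le_trans (enormD _ _))// !enormZ lerD// ler_piMl ?enorm_ge0//; by rewrite ?normr1 in s1 t1 *.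
have rz0 y : M < enorm y -> rz y = 0.
  apply: (bump_zero brz); rewrite (le_trans _ xM)// lerD2r -addrA.
  by rewrite (le_trans (enormD _ _))// lerD2l.
have dpart i j y : is_derive y (delta_mx ord0 j) (partial i rz) (partial j (partial i rz) y).
  by have [q bq hq] := bump_derive j (bump_partial i brz); have := hq y => -[h1 h2]; split.
have E1 y : f y * dot (grad psi (y - s *: a - t *: b)) b =
    \sum_(ij : 'I_d * 'I_d) (a ord0 ij.1 * b ord0 ij.2) * (f y * partial ij.2 (partial ij.1 rz) y).
  rewrite -addrA -opprD -/z -grad_shift.
  have -> : (fun y => psi (y - z)) = \sum_i (a ord0 i \*: partial i rz).
    apply/funext => q; rewrite fct_sumE /psi -grad_shift rzf /dot; apply: eq_bigr => i _.
    by rewrite mxE mulrC.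
  rewrite /dot mulr_sumr -(pair_bigA _ (fun i j => a ord0 i * b ord0 j * (f y * partial j (partial i rz) y)))/=.
  rewrite exchange_big/=; apply: eq_bigr => j _.
  have -> : grad (\sum_i (a ord0 i \*: partial i rz)) y ord0 j =
      \sum_i a ord0 i * partial j (partial i rz) y.
    rewrite mxE.
    have H : is_derive y (delta_mx ord0 j) (\sum_i (a ord0 i \*: partial i rz))
       (\sum_i (a ord0 i *: partial j (partial i rz) y)).
      by apply: is_derive_sum => i; apply: is_deriveZ.
    by case: H.
  rewrite mulr_suml mulr_sumr; apply: eq_bigr => i _; ring.
have trz : test_function rz by exact: bump_test brz.
have bpp i j : bumpfun r (x + z) (partial j (partial i rz)).
  by do 2?apply: bump_partial.
have intf i j : intg leb (fun y => f y * partial j (partial i rz) y).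
  rewrite (_ : (fun y => _) = (fun y => partial j (partial i rz) y * f y)); last first.
    by apply/funext => y; rewrite mulrC.
  have [K K0 hK] := cont_bdd_eball M cf.
  have [K' K0' hK'] := cont_bdd_eball M (bump_continuous (bpp i j)).
  have pp0 y : M < enorm y -> partial j (partial i rz) y = 0.
    apply: (bump_zero (bpp i j)); rewrite (le_trans _ xM)// lerD2r -addrA.
    by rewrite (le_trans (enormD _ _))// lerD2l.
  apply: (@intg_supp _ _ _ (K' * K) M).
  - apply: measurable_funM; apply: continuous_measurable_rV => //.
    exact: bump_continuous (bpp i j).
  - by move=> y yM; rewrite normrM ler_pM// ?hK ?hK'.
  - by move=> y yM; rewrite pp0// mul0r.
have intgr i j : intg leb (fun y => g i j y * rz y).
  have [mg ig _] := fg i j.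
  exact: (intg_mul_supp mg (ig M) (bump_continuous brz) rz0).
under eq_Rintegral do rewrite E1.
rewrite (@Rint_sum _ _ _ leb _ (fun (ij : 'I_d * 'I_d) y => (a ord0 ij.1 * b ord0 ij.2) * (f y * partial ij.2 (partial ij.1 rz) y))); last first.
  by move=> ij; exact: intgZ.
under eq_bigr => ij _.
  rewrite RintegralZl//; last exact: intf.
  have [_ _ ->//] := fg ij.1 ij.2.
  rewrite -RintegralZl//; last exact: intgr.
  over.
rewrite -(@Rint_sum _ _ _ leb _ (fun (ij : 'I_d * 'I_d) y => (a ord0 ij.1 * b ord0 ij.2) * (g ij.1 ij.2 y * rz y))); last first.
  by move=> ij; exact: intgZ.
have -> : \int[leb]_y rho r x y = \int[leb]_y rz y.
  rewrite -[LHS](Rint_leb_shift (- z)); first by apply: eq_Rintegral => y _; rewrite rzE.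
  exact: continuous_measurable_rV (bump_continuous brho).
have irz : intg leb rz.
  have [K K0 hK] := cont_bdd_eball M (bump_continuous brz).
  apply: (@intg_supp _ _ _ K M) => //.
  exact: continuous_measurable_rV (bump_continuous brz).
rewrite -RintegralZl//.
apply: ae_le_Rint.
- by apply: intg_sum => ij; exact: intgZ.
- exact: intgZ.
- apply: filterS gL => y gLy.
  have [yM|yM] := leP (enorm y) M; last first.
    by rewrite rz0// mulr0 big1// => ij _; rewrite !mulr0.
  have -> : \sum_(ij : 'I_d * 'I_d) (a ord0 ij.1 * b ord0 ij.2) * (g ij.1 ij.2 y * rz y) =
     dot (a *m (\matrix_(i, j) g i j y)) b * rz y.
    rewrite -(pair_bigA _ (fun i j => a ord0 i * b ord0 j * (g i j y * rz y)))/=.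
    rewrite exchange_big/= /dot mulr_suml; apply: eq_bigr => j _.
    rewrite mxE !mulr_suml; apply: eq_bigr => i _; rewrite mxE; ring.
  rewrite ler_wpM2r// (le_trans (dot_le _ _))// ler_wpM2r ?enorm_ge0//.
  by rewrite (le_trans (enorm_mul_le _ _))// ler_wpM2r ?enorm_ge0// gLy.
Qed.

Lemma rho_int_gt0 (r : R) x : 0 < r -> 0 < \int[leb]_y rho r x y.
Proof.
move=> r0; have brho := @rho_bump R d r x.
pose M1 := enorm x + d%:R * r.
have rho0 y : M1 < enorm y -> rho r x y = 0 by exact: (bump_zero brho (lexx _)).
have mrho := continuous_measurable_rV (bump_continuous brho).
have irho : intg leb (rho r x).
  have [K K0 hK] := cont_bdd_eball M1 (bump_continuous brho).
  exact: (@intg_supp _ _ _ K M1).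
rewrite lt_neqAle Rintegral_ge0 ?andbT; last by move=> y _; exact: rho_ge0.
apply/eqP => /esym I0.
have I1 : (\int[leb]_y `|(rho r x y)%:E| = 0)%E.
  have -> : (\int[leb]_y `|(rho r x y)%:E| = \int[leb]_y (rho r x y)%:E)%E.
    by apply: eq_integral => y _; rewrite gee0_abs// lee_fin rho_ge0.
  move: I0; rewrite /Rintegral => /eqP; rewrite fine_eq0; first by move/eqP.
  exact: integrable_fin_num irho.
have mE : measurable_fun setT (fun y => (rho r x y)%:E) by exact/measurable_EFinP.
have := (ae_eq_integral_abs leb measurableT mE).1 I1 => H.
have H' : {ae leb, forall y, rho r x y <= 0}.
  by apply: filterS H => y /(_ I) /= [->].
have := ae_le_everywhere (bump_continuous brho) H' x.
by rewrite leNgt rho_gt0.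
Qed.

(** If the inequality failed at x, it would fail by a margin near x, contradicting its
    average against a bump concentrated there. *)
Lemma second_diff_le x a b : enorm x + enorm a + enorm b < M ->
  f (x + b + a) - f (x + a) - (f (x + b) - f x) <= L * enorm a * enorm b.
Proof.
move=> xM; rewrite leNgt; apply/negP => H.
pose D y := f (y + b + a) - f (y + a) - (f (y + b) - f y).
have cD : continuous D.
  have FF (y : 'rV[R]_d) : Filter (nbhs y) := nbhs_filter y.
  move=> y; apply: cvgB; apply: cvgB;
    [|exact: (continuous_transl cf)|exact: (continuous_transl cf)|exact: cf].
  have := continuous_transl (c := b + a) cf (x := y).
  by under eq_fun do rewrite addrA; exact.
pose e := (D x - L * enorm a * enorm b) / 2.
have e0 : 0 < e by rewrite divr_gt0// subr_gt0.
have /(@cvgrPdist_le _ _ _ (nbhs x)) /(_ _ e0) /nbhs_ballP[r0 /= r00 hr0] := cD x.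
pose r1 := (M - (enorm x + enorm a + enorm b)) / (d%:R + 1).
have r10 : 0 < r1 by rewrite divr_gt0// ?subr_gt0// ltr_wpDl.
pose r := Num.min r0 r1.
have rp : 0 < r by rewrite lt_min r00.
have rM : enorm x + enorm a + enorm b + d%:R * r <= M.
  rewrite -lerBrDl (@le_trans _ _ ((d%:R + 1) * r1))//.
    rewrite ler_pM// ?(ltW rp) ?lerDl//.
    by rewrite ge_min lexx orbT.
  by rewrite /r1 mulrC divfK// gt_eqF// ltr_wpDl.
have brho := @rho_bump R d r x.
have mrho := continuous_measurable_rV (bump_continuous brho).
have mf := continuous_measurable_rV cf.
have rho0 y : enorm x + d%:R * r < enorm y -> rho r x y = 0 by exact: (bump_zero brho (lexx _)).
have irho : intg leb (rho r x).
  have [K K0 hK] := cont_bdd_eball (enorm x + d%:R * r) (bump_continuous brho).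
  exact: (@intg_supp _ _ _ K (enorm x + d%:R * r)).
have intc (h : 'rV[R]_d -> R) : continuous h -> intg leb (fun y => h y * rho r x y).
  move=> ch; have [K K0 hK] := cont_bdd_eball (enorm x + d%:R * r) (bump_continuous brho).
  have [K' K0' hK'] := cont_bdd_eball (enorm x + d%:R * r) ch.
  apply: (@intg_supp _ _ _ (K' * K) (enorm x + d%:R * r)).
  - by apply: measurable_funM => //; exact: continuous_measurable_rV.
  - by move=> y yM; rewrite normrM ler_pM// ?hK ?hK'.
  - by move=> y yM; rewrite rho0// mulr0.
have shift c : \int[leb]_y (f y * rho r x (y - c)) = \int[leb]_y (f (y + c) * rho r x y).
  rewrite -(Rint_leb_shift c); first by apply: eq_Rintegral => y _; rewrite addrK.
  apply: measurable_funM => //; apply: continuous_measurable_rV.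
  exact: (continuous_transl (c := - c) (bump_continuous brho)).
have := second_diff_rho rp rM.
under [X in X - _ - _]eq_Rintegral do rewrite -addrA -opprD.
rewrite !shift.
have cs c : continuous (fun y => f (y + c)) by exact: continuous_transl.
rewrite -!RintegralB//; try by apply: intc.
rewrite leNgt => /negP; apply.
rewrite (_ : L * enorm a * enorm b = D x - e - e); last first.
  by rewrite /e; field.
rewrite -RintegralZl//.
apply: (@lt_le_trans _ _ (\int[leb]_y ((D x - e) * rho r x y))).
  by rewrite !RintegralZl// ltr_pM2r ?rho_int_gt0// gtrBl.
apply: le_Rintegral => //; first exact: intgZ.
- apply: intgB; apply: intgB; exact: intc.
- move=> y _; rewrite -!mulrBl addrA -/(D y).
  have [r0'|] := eqVneq (rho r x y) 0; first by rewrite r0' !mulr0.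
  move=> /(bump_supp0 brho) yr; rewrite ler_wpM2r ?rho_ge0//.
  have := hr0 y; rewrite ball_cube// => /(_ _)/wrap[].
    by move=> i; rewrite (lt_le_trans (yr i))// ge_min lexx.
  by rewrite ler_norml => /andP[_]; lra.
- exact: (intgB (intc _ (cs _)) (intc _ (cs _))).
- exact: (intgB (intc _ (cs _)) (intc _ cf)).
Qed.
End lipschitz_gradient.

(** * Gradients of functions with bounded weak Hessian *)

Section Loo_norm.
Context {R : realType} {d : nat}.
Implicit Types (x y a b : 'rV[R]_d) (f : 'rV[R]_d -> R).
Local Notation leb := (leb R d).

Lemma leb_setT_gt0 : (0 < leb [set: 'rV[R]_d])%E.
Proof. exact: (@leb_open_gt0 _ _ _ 0 openT). Qed.

Lemma normLooE f : normLoo f = ess_sup leb (abse \o (EFin \o f)).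
Proof. by rewrite /normLoo unlock /= leb_setT_gt0. Qed.

Lemma normLoo_ge0 f : (0 <= normLoo f)%E.
Proof. exact: Lnorm_ge0. Qed.

Lemma normLoo_fineK f : (normLoo f < +oo)%E -> (fine (normLoo f))%:E = normLoo f.
Proof. by move=> h; rewrite fineK// ge0_fin_numE// normLoo_ge0. Qed.

Lemma normLoo_ae f (m : R) : (normLoo f <= m%:E)%E -> {ae leb, forall x, `|f x| <= m}.
Proof. by rewrite normLooE => /ess_supP; apply: filterS => x /=; rewrite lee_fin. Qed.

Lemma normLoo_le f (m : R) : {ae leb, forall x, `|f x| <= m} -> (normLoo f <= m%:E)%E.
Proof. by rewrite normLooE => h; apply/ess_supP; apply: filterS h => x /=; rewrite lee_fin. Qed.

(** An essential bound on a continuous function holds everywhere, as nonempty open sets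
    have positive measure. *)
Lemma normLoo_cont f (m : R) : continuous f -> (normLoo f <= m%:E)%E -> forall x, `|f x| <= m.
Proof.
move=> cf /normLoo_ae h x; rewrite ler_norml; apply/andP; split; last first.
  by apply: (ae_le_everywhere cf); apply: filterS h => y; exact: le_trans (ler_norm _).
rewrite lerNl; apply: (@ae_le_everywhere _ _ (fun y => - f y)).
  by move=> y; have FF : Filter (nbhs y) := nbhs_filter y; apply: cvgN; exact: cf.
by apply: filterS h => y; rewrite -normrN; exact: le_trans (ler_norm _).
Qed.

Variables (f : 'rV[R]_d -> R) (g : 'I_d -> 'I_d -> 'rV[R]_d -> R) (L M : R).

(** The second difference in the directions a and s b, divided by s, tends to the
    increment of the gradient tested against b. *)
Lemma grad_lip_weak : C1 f -> weak_second f g -> 0 <= L ->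
  {ae leb, forall x, enorm x <= M -> opnorm (\matrix_(i, j) g i j x) <= L} ->
  forall x a, enorm x + enorm a < M ->
  enorm (grad f (x + a) - grad f x) <= L * enorm a.
Proof.
move=> hf fg L0 gL x a xM; apply: enorm_le_dual => [|b]; first by rewrite mulr_ge0 ?enorm_ge0.
have cf := C1_continuous hf.
have SD := second_diff_le cf fg gL.
pose h (s : R) := f (x + a + s *: b) - f (x + s *: b).
have dh : is_derive (0 : R) 1 h (dot (grad f (x + a + 0 *: b)) b - dot (grad f (x + 0 *: b)) b).
  by apply: is_deriveB; exact: is_derive_line.
have -> : dot (grad f (x + a) - grad f x) b =
   dot (grad f (x + a + 0 *: b)) b - dot (grad f (x + 0 *: b)) b.
  by rewrite scale0r !addr0 dotDl dotNl.
apply/ler_addgt0Pr => e e0.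
have [r r0 hr] := (is_derive_dist _ _ _).1 dh e e0.
pose s := Num.min (r / 2) ((M - (enorm x + enorm a)) / (enorm b + 1)).
have b0 : 0 < enorm b + 1 by rewrite ltr_wpDl ?enorm_ge0.
have s0 : 0 < s by rewrite lt_min !divr_gt0// subr_gt0.
have sr : `|s| < r.
  rewrite gtr0_norm// (@le_lt_trans _ _ (r / 2))//; first by rewrite ge_min lexx.
  by rewrite ltr_pdivrMr// ltr_pMr// ltr1n.
have := hr s (negbT (gt_eqF s0)) sr; rewrite add0r ler_norml => /andP[h1 _].
have sM : enorm x + enorm a + enorm (s *: b) < M.
  rewrite -ltrBrDl enormZ gtr0_norm//.
  rewrite (@lt_le_trans _ _ (s * (enorm b + 1)))//; first by rewrite ltr_pM2l// ltrDl.
  by rewrite -ler_pdivlMr// ge_min lexx orbT.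
have := SD x a (s *: b) sM.
rewrite enormZ gtr0_norm// => h2.
have h3 : h s - h 0 <= L * enorm a * (s * enorm b).
  apply: le_trans h2; rewrite /h scale0r !addr0 [x + a + _]addrAC.
  lra.
have h4 : s^-1 * (h s - h 0) <= L * enorm a * enorm b.
  by rewrite ler_pdivrMl// (le_trans h3)// mulrCA.
by move: h1 h4; lra.
Qed.
End Loo_norm.

Section local_regularity.
Context {R : realType} {d : nat}.
Implicit Types (x y a b : 'rV[R]_d) (f : 'rV[R]_d -> R).
Local Notation leb := (leb R d).

Lemma test_function_supp (phi : 'rV[R]_d -> R) : test_function phi ->
  continuous phi /\ exists M, forall x, M < enorm x -> phi x = 0.
Proof.
move=> [sphi [M hM]]; split; first by case: (sphi [::]).
exists M => y My; apply/eqP; apply: contraT => /(@subset_closure _ [set x | phi x != 0] y) /hM.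
by rewrite /eball/= leNgt My.
Qed.

Definition lint f := measurable_fun [set: 'rV[R]_d] f /\
  forall M : R, leb.-integrable (eball M) (EFin \o f).

Lemma lint_cont f : continuous f -> lint f.
Proof.
move=> cf; have mf := continuous_measurable_rV cf; split=> // M.
apply/(integrable_mkcond _ (measurable_eball (n := d) M)).
have [K K0 hK] := cont_bdd_eball M cf.
have H : intg leb (f \_ (eball M)).
  apply: (@intg_supp _ _ _ K M).
  - by apply/(measurable_restrictT _ (measurable_eball M)); apply: measurable_funS mf.
  - by move=> x xM; rewrite patchE mem_set// hK.
  - by move=> x xM; rewrite patchE memNset// /eball/=; apply/negP; rewrite -ltNge.
by apply: eq_integrable H => // x _; rewrite /= !patchE; case: ifP.
Qed.

Lemma is_weak_partialB i f1 f2 (g1 g2 : 'rV[R]_d -> R) : lint f1 -> lint f2 ->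
  is_weak_partial i f1 g1 -> is_weak_partial i f2 g2 ->
  is_weak_partial i (f1 \- f2) (g1 \- g2).
Proof.
move=> [n1 J1] [n2 J2] [m1 I1 E1] [m2 I2 E2]; split.
- exact: measurable_funB.
- by move=> M; exact: (integrableB (measurable_eball M) (I1 M) (I2 M)).
- move=> phi tphi; have [cphi [M M0]] := test_function_supp tphi.
  have [cp [M' M'0]] := test_function_supp (test_function_partial i tphi).
  under eq_Rintegral do rewrite mulrBl.
  under [in RHS]eq_Rintegral do rewrite mulrBl.
  rewrite RintegralB//; [|exact: (intg_mul_supp n1 (J1 M') cp M'0)|exact: (intg_mul_supp n2 (J2 M') cp M'0)].
  rewrite RintegralB//; [|exact: (intg_mul_supp m1 (I1 M) cphi M0)|exact: (intg_mul_supp m2 (I2 M) cphi M0)].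
  by rewrite E1// E2// opprB opprK addrC.
Qed.

(** A weak derivative enters only through its integrals against test functions, so the
    representative that is differentiated a second time is immaterial. *)
Lemma is_weak_partial_congr i j f G G' (h : 'rV[R]_d -> R) :
  is_weak_partial j f G -> is_weak_partial j f G' ->
  is_weak_partial i G' h -> is_weak_partial i G h.
Proof.
move=> [_ _ E] [_ _ E'] [m I E'']; split=> // phi tphi.
rewrite -E''//; apply: oppr_inj.
by rewrite -E ?E'//; exact: test_function_partial.
Qed.

Lemma weak_partialP i f : has_weak_partial i f -> is_weak_partial i f (weak_partial i f).
Proof. by move=> [g hg]; rewrite /weak_partial; case: xgetP => [//|/(_ g)]. Qed.

(** The weak partial derivative of a difference is a chosen representative, in general
    not the difference of the chosen ones; [is_weak_partial_congr] bridges the two. *)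
Lemma has_weak_hessB f1 f2 : continuous f1 -> continuous f2 ->
  (forall i, has_weak_partial i f1) -> (forall i j, has_weak_partial i (weak_partial j f1)) ->
  (forall i, has_weak_partial i f2) -> (forall i j, has_weak_partial i (weak_partial j f2)) ->
  (forall i, has_weak_partial i (f1 \- f2)) /\
  (forall i j, has_weak_partial i (weak_partial j (f1 \- f2))).
Proof.
move=> /lint_cont c1 /lint_cont c2 h1 h11 h2 h22.
have H i : is_weak_partial i (f1 \- f2) (weak_partial i f1 \- weak_partial i f2).
  exact: (is_weak_partialB c1 c2 (weak_partialP (h1 i)) (weak_partialP (h2 i))).
have H' i : has_weak_partial i (f1 \- f2) by eexists; exact: H.
split; first exact: H'.
move=> i j; have Hj := weak_partialP (H' j).
have [m1 I1 _] := weak_partialP (h1 j); have [m2 I2 _] := weak_partialP (h2 j).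
have K := is_weak_partialB (conj m1 I1) (conj m2 I2) (weak_partialP (h11 i j)) (weak_partialP (h22 i j)).
by eexists; exact: (is_weak_partial_congr Hj (H j) K).
Qed.

Lemma weak_hess_grad_lip f (L : R) : C1 f ->
  (forall i, has_weak_partial i f) -> (forall i j, has_weak_partial i (weak_partial j f)) ->
  (normLoo (opnorm \o weak_hess f) <= L%:E)%E ->
  forall x y, enorm (grad f x - grad f y) <= L * enorm (x - y).
Proof.
move=> hf h1 h2 hL x y.
have L0 : 0 <= L by have := le_trans (normLoo_ge0 _) hL; rewrite lee_fin.
have := @grad_lip_weak _ _ f _ L (enorm y + enorm (x - y) + 1) hf (weak_second_weak_hess h1 h2) L0 _ y (x - y).
rewrite subrKC; apply; last by rewrite ltrDl.
apply: filterS (normLoo_ae hL) => z /= + _; rewrite ger0_norm ?opnorm_ge0//.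
Qed.

Lemma gradB f1 f2 : C1 f1 -> C1 f2 -> forall x, grad (f1 \- f2) x = grad f1 x - grad f2 x.
Proof.
move=> h1 h2 x; apply/rowP => i; rewrite !mxE /partial.
have [d1 _] := h1 i; have [d2 _] := h2 i.
by have := deriveB (d1 x) (d2 x).
Qed.

Lemma gradD f1 f2 : C1 f1 -> C1 f2 -> forall x, grad (f1 \+ f2) x = grad f1 x + grad f2 x.
Proof.
move=> h1 h2 x; apply/rowP => i; rewrite !mxE /partial.
have [d1 _] := h1 i; have [d2 _] := h2 i.
by have := deriveD (d1 x) (d2 x).
Qed.

Lemma C1B f1 f2 : C1 f1 -> C1 f2 -> C1 (f1 \- f2).
Proof.
move=> h1 h2 i; have [d1 e1] := h1 i; have [d2 e2] := h2 i; split.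
  by move=> x; exact: derivableB.
have -> : partial i (f1 \- f2) = partial i f1 \- partial i f2.
  by apply/funext => x; have := gradB h1 h2 x => /rowP/(_ i); rewrite !mxE.
move=> x; have FF : Filter (nbhs x) := nbhs_filter x.
by apply: cvgB; [exact: e1|exact: e2].
Qed.

Lemma sum_normLoo_opnorm (h : 'rV[R]_d -> 'M[R]_d) (K : 'I_d -> 'I_d -> R) (P : 'rV[R]_d -> Prop) :
  (forall i j, {ae leb, forall x, P x -> `|h x i j| <= K i j}) ->
  {ae leb, forall x, P x -> opnorm (h x) <= \sum_i \sum_j K i j}.
Proof.
move=> H; have {}H : {ae leb, forall x, forall ij : 'I_d * 'I_d, P x -> `|h x ij.1 ij.2| <= K ij.1 ij.2}.
  by apply: filter_forall => -[i j]; exact: H.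
apply: filterS H => x H Px; rewrite (le_trans (opnorm_le_sum _))//.
by apply: ler_sum => i _; apply: ler_sum => j _; exact: (H (i, j)).
Qed.

Lemma W2oo_hess_lty f : W2oo f -> (normLoo (opnorm \o weak_hess f) < +oo)%E.
Proof.
move=> [_ _ h2].
apply: (@le_lt_trans _ _ (\sum_i \sum_j fine (normLoo (weak_partial i (weak_partial j f))))%:E); last exact: ltry.
apply: normLoo_le.
have : {ae leb, forall x, True -> opnorm (weak_hess f x) <= \sum_i \sum_j fine (normLoo (weak_partial i (weak_partial j f)))}.
  apply: sum_normLoo_opnorm => i j; have [_ [_ h]] := h2 i j.
  have := @normLoo_ae _ _ (weak_partial i (weak_partial j f)) (fine (normLoo (weak_partial i (weak_partial j f)))).
  by rewrite normLoo_fineK// => /(_ (lexx _)); apply: filterS => x; rewrite mxE.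
by apply: filterS => x /(_ I) /=; rewrite ger0_norm// opnorm_ge0.
Qed.

(** The Hessian is bounded on a larger ball, of radius M, which leaves room for the
    segment from y to x and for the bumps. *)
Lemma W2oo_loc_grad_lip f : C1 f -> W2oo_loc f -> forall m : R,
  exists2 L, 0 <= L & forall x y, enorm x <= m -> enorm y <= m ->
    enorm (grad f x - grad f y) <= L * enorm (x - y).
Proof.
move=> hf [_ h1 h2] m; pose M := `|m| + (`|m| + `|m|) + 1.
pose K i j := fine (normLoo (weak_partial i (weak_partial j f) \* \1_(eball M))).
have K0 i j : 0 <= K i j by rewrite fine_ge0// normLoo_ge0.
exists (\sum_i \sum_j K i j); first by do 2!apply: sumr_ge0 => ? _.
move=> x y xm ym.
have := @grad_lip_weak _ _ f _ (\sum_i \sum_j K i j) M hf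
   (weak_second_weak_hess (fun i => (h1 i).1) (fun i j => (h2 i j).1)) _ _ y (x - y).
rewrite subrKC; apply.
- by do 2!apply: sumr_ge0 => ? _.
- apply: (@sum_normLoo_opnorm (weak_hess f)) => i j; have [_ [_ /(_ M) h]] := h2 i j.
  have := @normLoo_ae _ _ (weak_partial i (weak_partial j f) \* \1_(eball M)) (K i j).
  rewrite normLoo_fineK// => /(_ (lexx _)); apply: filterS => z + zM; rewrite mxE /=.
  by rewrite indicE mem_set// mulr1.
- rewrite /M ltr_pwDr// lerD// ?(le_trans ym) ?ler_norm//.
  by rewrite (le_trans (enormD _ _))// enormN lerD// ?(le_trans ym) ?(le_trans xm) ?ler_norm.
Qed.
End local_regularity.

(** * Bounds on the forces *)

Section forces.
Context {R : realType} {d : nat}.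
Implicit Types (x y a b : 'rV[R]_d) (f : 'rV[R]_d -> R).
Local Notation leb := (leb R d).

(** By compactness of [0, T]; monotonicity in B merges finitely many local bounds into
    one. *)
Lemma segment_bound (T : R) (Q : R -> R -> Prop) :
  (forall s B B', B <= B' -> Q s B -> Q s B') ->
  (forall t, 0 <= t <= T -> exists2 r, 0 < r & exists B, forall s, 0 <= s <= T ->
     `|s - t| < r -> Q s B) ->
  exists2 B, 0 <= B & forall s, 0 <= s <= T -> Q s B.
Proof.
move=> Qm Qloc.
have /compact_near_coveringP/(_ R (pinfty_nbhs R) (fun B s => 0 <= s <= T -> Q s B)) := @segment_compact R 0 T.
case.
  move=> t; rewrite /= in_itv/= => tT.
  have [r r0 [B HB]] := Qloc t tT.
  exists (ball t r, [set B' | B < B']); first by split; [exact: nbhsx_ballx|exists B; split=> //; exact: num_real].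
  move=> [s B'] /= [st BB'] sT; apply: Qm (ltW BB') _; apply: HB => //.
  by rewrite distrC.
move=> B [_ HB]; exists (`|B| + 1); first by rewrite addr_ge0.
move=> s sT; apply: (HB (`|B| + 1)); rewrite ?in_itv//.
by rewrite (le_lt_trans (ler_norm B))// ltrDl.
Qed.

Section Phi.
Variable Phi : R -> 'rV[R]_d -> R.
Hypothesis hPhi : forall t, 0 <= t -> W2oo (Phi t) /\ C1 (Phi t).
Hypothesis cPhi : forall t, 0 <= t ->
  normW2oo (Phi s \- Phi t) @[s --> within [set s | 0 <= s] (nbhs t)] --> 0%E.

Let phi_near (t e : R) : 0 <= t -> 0 < e -> exists2 r, 0 < r & forall s, 0 <= s ->
  `|s - t| < r -> (forall x, `|Phi s x - Phi t x| <= e) /\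
  (forall x y, enorm ((grad (Phi s) x - grad (Phi t) x) - (grad (Phi s) y - grad (Phi t) y))
     <= e * enorm (x - y)).
Proof.
move=> t0 e0.
have N0 : nbhs (0%E : \bar R) [set u | (u < e%:E)%E].
  rewrite /nbhs/=; apply/nbhs_ballP; exists e => //= u; rewrite /ball/= sub0r normrN => ue.
  by rewrite lte_fin (le_lt_trans (ler_norm u)).
have := cPhi t0 N0; rewrite /= => /nbhs_ballP[r /= r0 hr].
exists r => // s s0 sr.
have : (normW2oo (Phi s \- Phi t)%R < e%:E)%E.
  by apply: (hr s) => //; rewrite /ball/= distrC.
rewrite /normW2oo => H.
have [[Ls p1s p2s] hs] := hPhi s0; have [[Lt p1t p2t] ht] := hPhi t0.
have [w1 w2] := has_weak_hessB (C1_continuous hs) (C1_continuous ht)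
  (fun i => (p1s i).1) (fun i j => (p2s i j).1) (fun i => (p1t i).1) (fun i j => (p2t i j).1).
have hst := C1B hs ht.
have He : (normLoo (opnorm \o weak_hess (Phi s \- Phi t)%R) <= e%:E)%E.
  apply: le_trans (ltW H); rewrite -[leLHS]add0e leeD2r//.
  by rewrite adde_ge0 ?normLoo_ge0.
have Hf : (normLoo (Phi s \- Phi t)%R <= e%:E)%E.
  apply: le_trans (ltW H); rewrite -addeA -[leLHS]adde0 leeD2l//.
  by rewrite adde_ge0 ?normLoo_ge0.
split; first exact: (normLoo_cont (C1_continuous hst) Hf).
have K := weak_hess_grad_lip hst w1 w2 He.
by move=> x y; have := K x y; rewrite (gradB hs ht x) (gradB hs ht y).
Qed.

Let phi_near' (t e : R) : 0 <= t -> 0 < e -> exists2 r, 0 < r & forall s, 0 <= s ->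
  `|s - t| < r -> forall x, enorm (grad (Phi s) x - grad (Phi t) x) <= e.
Proof.
move=> t0 e0; have e3 : 0 < e / 3 by rewrite divr_gt0.
have [r r0 hr] := phi_near t0 e3; exists r => // s s0 sr x.
have [h1 h2] := hr s s0 sr.
have [_ hs] := hPhi s0; have [_ ht] := hPhi t0.
have := @grad_interp _ _ (Phi s \- Phi t) (e / 3) (e / 3) 1 (C1B hs ht) ltr01 h1.
have H : forall x y, enorm (grad (Phi s \- Phi t) x - grad (Phi s \- Phi t) y) <= e / 3 * enorm (x - y).
  by move=> y z; rewrite (gradB hs ht y) (gradB hs ht z); exact: h2.
move=> /(_ H x); rewrite (gradB hs ht x) gtr0_norm//; lra.
Qed.

(** Smallness of Phi s - Phi t together with boundedness of its Hessian gives smallness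
    of its gradient, by interpolation. *)
Lemma grad_Phi_cont (t e : R) : 0 <= t -> 0 < e -> exists2 r, 0 < r & forall s, 0 <= s ->
  `|s - t| < r -> forall x, enorm (grad (Phi s) x - grad (Phi t) x) <= e.
Proof. exact: phi_near'. Qed.

Lemma grad_Phi_lip_at (t : R) : 0 <= t -> forall x y,
  enorm (grad (Phi t) x - grad (Phi t) y) <=
  fine (normLoo (opnorm \o weak_hess (Phi t))) * enorm (x - y).
Proof.
move=> t0; have [h ht] := hPhi t0; have [_ p1 p2] := h.
apply: weak_hess_grad_lip => //; [by move=> i; case: (p1 i)|by move=> i j; case: (p2 i j)|].
by rewrite normLoo_fineK//; exact: W2oo_hess_lty.
Qed.

Lemma grad_Phi_lip (T : R) : exists2 L, 0 <= L & forall s, 0 <= s <= T ->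
  forall x y, enorm (grad (Phi s) x - grad (Phi s) y) <= L * enorm (x - y).
Proof.
apply: segment_bound => [s B B' BB' h x y|t /andP[t0 _]].
  by rewrite (le_trans (h x y))// ler_wpM2r ?enorm_ge0.
have [r r0 hr] := phi_near t0 ltr01.
exists r => //; exists (fine (normLoo (opnorm \o weak_hess (Phi t))) + 1).
move=> s /andP[s0 _] sr x y; have [_ h] := hr s s0 sr.
have := h x y; have := grad_Phi_lip_at t0 x y => h1 h2.
rewrite (_ : grad (Phi s) x - grad (Phi s) y = (grad (Phi t) x - grad (Phi t) y) +
  ((grad (Phi s) x - grad (Phi t) x) - (grad (Phi s) y - grad (Phi t) y))); last first.
  by apply/rowP => i; rewrite !mxE; ring.
by rewrite (le_trans (enormD _ _))// mulrDl lerD.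
Qed.

Lemma grad_Phi_bdd (T : R) : exists2 B, 0 <= B & forall s, 0 <= s <= T ->
  forall x, enorm (grad (Phi s) x) <= B.
Proof.
apply: segment_bound => [s B B' BB' h x|t /andP[t0 _]]; first exact: le_trans (h x) BB'.
have [r r0 hr] := phi_near' t0 ltr01.
have [h ht] := hPhi t0; have [[mt lt] _ _] := h.
pose m := fine (normLoo (Phi t)); pose L := fine (normLoo (opnorm \o weak_hess (Phi t))).
have Hm : forall x, `|Phi t x| <= m.
  by apply: normLoo_cont; [exact: C1_continuous|rewrite normLoo_fineK].
have HB := grad_interp ht ltr01 Hm (grad_Phi_lip_at t0).
exists r => //; exists (1 + (m + m + `|L|)) => s /andP[s0 _] sr x.
rewrite -(subrK (grad (Phi t) x) (grad (Phi s) x)) (le_trans (enormD _ _))// lerD ?hr//.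
by have := HB x; rewrite mulr1 expr1n mulr1.
Qed.

(** The rate that [r2] uses is a supremum over [0, s]: monotone in s, but an extended
    real. Truncation at a global Lipschitz constant makes it finite without breaking the
    comparison with [r2], which is what discretising the constant [Cst] requires. *)
Lemma grad_Phi_lip_mono (T : R) : exists l : R -> R,
  [/\ forall s, 0 <= l s, forall s s', s <= s' -> l s <= l s',
      forall s, ((l s)%:E <= normLoo_hess_Phi0 Phi s)%E \/ s < 0,
      exists L, forall s, l s <= L &
      forall s, 0 <= s <= T -> forall x y,
        enorm (grad (Phi s) x - grad (Phi s) y) <= l s * enorm (x - y)].
Proof.
have [L L0 HL] := grad_Phi_lip T.
pose X (s : R) : \bar R := Order.min (Order.max 0%E (normLoo_hess_Phi0 Phi s)) L%:E.
have X0 s : (0 <= X s)%E by rewrite /X le_min le_max lexx lee_fin.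
have XL s : (X s <= L%:E)%E by rewrite /X ge_min lexx orbT.
have Xf s : (X s) \is a fin_num by rewrite ge0_fin_numE// (le_lt_trans (XL s))// ltry.
have Hge0 s : 0 <= s -> (0 <= normLoo_hess_Phi0 Phi s)%E.
  move=> s0; apply: (@le_trans _ _ (normLoo (opnorm \o weak_hess (Phi s)))); first exact: normLoo_ge0.
  by apply: ereal_sup_ubound; exists s => //; rewrite /= in_itv/= s0 lexx.
exists (fine \o X); split => /=.
- by move=> s; rewrite fine_ge0.
- move=> s s' ss'; rewrite fine_le//.
  rewrite /X le_min !ge_min lexx orbT andbT; apply/orP; left.
  rewrite ge_max !le_max lexx/=; apply/orP; right.
  apply: le_ereal_sup => _ [u uT <-]; exists u => //.
  by move: uT; rewrite /= !in_itv/= => /andP[-> /le_trans]; exact.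
- move=> s; have [s0|s0] := leP 0 s; [left|by right].
  by rewrite fineK// /X ge_min ge_max lexx Hge0.
- by exists L => s; rewrite -lee_fin fineK.
- move=> s sT x y; have /andP[s0 _] := sT.
  have [E|E] := leP (Order.max 0 (normLoo_hess_Phi0 Phi s))%E L%:E.
    apply: le_trans (grad_Phi_lip_at s0 x y) _; rewrite ler_wpM2r ?enorm_ge0//.
    rewrite fine_le//; first by rewrite ge0_fin_numE ?normLoo_ge0// W2oo_hess_lty//; case: (hPhi s0).
    rewrite /X min_l// le_max; apply/orP; right.
    by apply: ereal_sup_ubound; exists s => //; rewrite /= in_itv/= s0 lexx.
  by rewrite /X min_r ?(ltW E)//=; exact: HL.
Qed.
End Phi.

Section Sig.
Variable S : 'rV[R]_d -> R.
Hypothesis hS : C20 S.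

Lemma C20_C1 : C1 S.
Proof.
move=> i; have [_ _ h] := hS (isT : (size (Nil 'I_d) <= 2)%N).
split; first by move=> x; exact: h.
by have [h1 _ _] := hS (isT : (size [:: i] <= 2)%N).
Qed.

Lemma C20_partial_C1 j : C1 (partial j S).
Proof.
move=> i; have [_ _ h] := hS (isT : (size [:: j] <= 2)%N).
split; first by move=> x; exact: h.
by have [h1 _ _] := hS (isT : (size [:: i; j] <= 2)%N).
Qed.

Let bdd (s : seq 'I_d) : (size s <= 2)%N -> exists2 K, 0 <= K & forall x, `|partials s S x| <= K.
Proof.
move=> s2; have [cs vs _] := hS s2.
have [M hM] := vs 1 ltr01.
have [K K0 hK] := cont_bdd_eball M cs.
exists (Num.max K 1) => [|x]; first by rewrite le_max K0.
have [xM|xM] := leP (enorm x) M; first by rewrite le_max hK.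
by rewrite le_max (ltW (hM x xM)) orbT.
Qed.

Lemma C20_grad_lty : (normLoo (enorm \o grad S) < +oo)%E.
Proof.
have H i : exists2 K, 0 <= K & forall x, `|partial i S x| <= K := @bdd [:: i] isT.
pose K i := sval (cid2 (H i)).
have HK i x : `|partial i S x| <= K i by rewrite /K; case: cid2.
apply: (@le_lt_trans _ _ (\sum_i K i)%:E); last exact: ltry.
apply: normLoo_le; apply: aeW => x /=; rewrite ger0_norm ?enorm_ge0//.
by rewrite (le_trans (enorm_le_sum _))//; apply: ler_sum => i _; rewrite mxE.
Qed.

Lemma C20_hess_lty : (normLoo (opnorm \o hess S) < +oo)%E.
Proof.
have H (ij : 'I_d * 'I_d) : exists2 K, 0 <= K & forall x, `|partial ij.1 (partial ij.2 S) x| <= K := @bdd [:: ij.1; ij.2] isT.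
pose K ij := sval (cid2 (H ij)).
have HK ij x : `|partial ij.1 (partial ij.2 S) x| <= K ij by rewrite /K; case: cid2.
apply: (@le_lt_trans _ _ (\sum_i \sum_j K (i, j))%:E); last exact: ltry.
apply: normLoo_le; apply: aeW => x /=; rewrite ger0_norm ?opnorm_ge0//.
rewrite (le_trans (opnorm_le_sum _))//; apply: ler_sum => i _; apply: ler_sum => j _.
by rewrite mxE; exact: (HK (i, j)).
Qed.

Lemma C20_grad_le x : enorm (grad S x) <= fine (normLoo (enorm \o grad S)).
Proof.
set m := fine _; have m0 : 0 <= m by rewrite fine_ge0// normLoo_ge0.
apply: enorm_le_dual => // b.
apply: (@ae_le_everywhere _ _ (fun x => dot (grad S x) b)).
  exact: continuous_dot_grad C20_C1.
have := @normLoo_ae _ _ (enorm \o grad S) m.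
rewrite normLoo_fineK; last exact: C20_grad_lty.
move=> /(_ (lexx _)); apply: filterS => y /=; rewrite ger0_norm ?enorm_ge0// => h.
by rewrite (le_trans (dot_le _ _))// ler_wpM2r ?enorm_ge0.
Qed.

Lemma C20_grad_lip x y : enorm (grad S x - grad S y) <=
  fine (normLoo (opnorm \o hess S)) * enorm (x - y).
Proof.
set m := fine _; have m0 : 0 <= m by rewrite fine_ge0// normLoo_ge0.
apply: grad_lip_of_hess; first exact: C20_partial_C1.
move=> z; apply: ge_sup; first by case: (opnorm_has_sup (hess S z)).
move=> _ [a a1 <-]; apply: enorm_le_dual => // b.
have E w : dot (a *m hess S w) b = \sum_(j < d) dot (grad (partial j S) w) a * b ord0 j.
  rewrite /dot; apply: eq_bigr => j _; congr (_ * _); rewrite mxE.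
  by apply: eq_bigr => i _; rewrite !mxE mulrC.
apply: (@ae_le_everywhere _ _ (fun w => dot (a *m hess S w) b)).
  rewrite (_ : (fun w => _) = (fun w => \sum_(j < d) dot (grad (partial j S) w) a * b ord0 j)); last first.
    by apply/funext => w; exact: E.
  move=> w; have FF : Filter (nbhs w) := nbhs_filter w.
  apply: cvg_big => //; first by move=> u; apply: add_continuous.
  move=> j _; apply: cvgM; last exact: cvg_cst.
  exact: (continuous_dot_grad (C20_partial_C1 j)).
have := @normLoo_ae _ _ (opnorm \o hess S) m.
rewrite normLoo_fineK; last exact: C20_hess_lty.
move=> /(_ (lexx _)); apply: filterS => w /=; rewrite ger0_norm ?opnorm_ge0// => h.
rewrite (le_trans (dot_le _ _))// ler_wpM2r ?enorm_ge0//.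
rewrite (le_trans (enorm_mul_le _ _))// (le_trans _ h)// ler_piMr ?opnorm_ge0//.
Qed.
End Sig.
End forces.

(** * Distances in phase space and the constant Theta *)

Section phase_geometry.
Context {R : realType} {d : nat}.
Implicit Types (z y : @phase R d) (a b s r : R).

Definition hypot a b : R := Num.sqrt (a ^+ 2 + b ^+ 2).

Lemma hypot_ge0 a b : 0 <= hypot a b.
Proof. exact: sqrtr_ge0. Qed.

Lemma hypot2 a b : hypot a b ^+ 2 = a ^+ 2 + b ^+ 2.
Proof. by rewrite sqr_sqrtr// addr_ge0// sqr_ge0. Qed.

Lemma hypot0 : hypot 0 0 = 0.
Proof. by rewrite /hypot expr0n addr0 sqrtr0. Qed.

Lemma ler_hypot a b a' b' : 0 <= a -> 0 <= b -> a <= a' -> b <= b' ->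
  hypot a b <= hypot a' b'.
Proof.
move=> a0 b0 aa bb; rewrite /hypot ler_wsqrtr// lerD//.
  by rewrite ler_pXn2r// nnegrE// (le_trans a0).
by rewrite ler_pXn2r// nnegrE// (le_trans b0).
Qed.

(** Minkowski's inequality, in the plane. *)
Lemma hypotD a b a' b' : 0 <= a -> 0 <= b -> 0 <= a' -> 0 <= b' ->
  hypot (a + a') (b + b') <= hypot a b + hypot a' b'.
Proof.
move=> a0 b0 a0' b0'.
have s0 := hypot_ge0 a b; have t0 := hypot_ge0 a' b'.
have s2 := hypot2 a b; have t2 := hypot2 a' b'.
have H : a * a' + b * b' <= hypot a b * hypot a' b'.
  rewrite -(@ler_pXn2r _ 2)// ?nnegrE ?addr_ge0 ?mulr_ge0// exprMn s2 t2.
  have := sqr_ge0 (a * b' - b * a'); nra.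
rewrite -(@ler_pXn2r _ 2)// ?nnegrE ?hypot_ge0 ?addr_ge0// hypot2 !sqrrD s2 t2.
rewrite !mulr2n; lra.
Qed.

Lemma hypot_lel a b : 0 <= a -> a <= hypot a b.
Proof.
move=> a0; rewrite -(@ler_pXn2r _ 2)// ?nnegrE ?hypot_ge0// hypot2 lerDl sqr_ge0//.
Qed.

Lemma hypot_ler a b : 0 <= b -> b <= hypot a b.
Proof. by move=> b0; rewrite /hypot addrC; exact: hypot_lel. Qed.

Lemma hypot_leD a b : 0 <= a -> 0 <= b -> hypot a b <= a + b.
Proof.
move=> a0 b0; rewrite -(@ler_pXn2r _ 2)// ?nnegrE ?hypot_ge0 ?addr_ge0// hypot2.
by rewrite sqrrD mulr2n; have := mulr_ge0 a0 b0; lra.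
Qed.

Definition pdist z y : R := hypot (enorm (z.1 - y.1)) (enorm (z.2 - y.2)).

Lemma pdist_ge0 z y : 0 <= pdist z y.
Proof. exact: hypot_ge0. Qed.

Lemma pdistzz z : pdist z z = 0.
Proof. by rewrite /pdist !subrr !enorm0 hypot0. Qed.

Lemma pdistC z y : pdist z y = pdist y z.
Proof. by rewrite /pdist enormB (enormB z.2). Qed.

Lemma pdist_triangle x z y : pdist x y <= pdist x z + pdist z y.
Proof.
apply: le_trans (hypotD _ _ _ _); rewrite ?enorm_ge0//.
apply: ler_hypot; rewrite ?enorm_ge0//.
  by rewrite -(subrKA z.1) enormD.
by rewrite -(subrKA z.2) enormD.
Qed.

(** Distance to the rest set {|x| <= r, v = 0}, which contains all equilibria. *)
Definition rest_dist r z : R := hypot (Num.max (enorm z.1 - r) 0) (enorm z.2).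

Lemma rest_dist_ge0 r z : 0 <= rest_dist r z.
Proof. exact: hypot_ge0. Qed.

Lemma rest_dist_lip r z y : rest_dist r z <= pdist z y + rest_dist r y.
Proof.
have h1 := enormD (z.1 - y.1) y.1; have h2 := enormD (z.2 - y.2) y.2.
rewrite !subrK in h1 h2.
have m0 x : 0 <= Num.max (enorm x - r) 0 by rewrite le_max lexx orbT.
apply: le_trans (hypotD _ _ _ _); rewrite ?enorm_ge0//.
apply: ler_hypot; rewrite ?enorm_ge0//.
rewrite ge_max addr_ge0 ?enorm_ge0// andbT.
have : enorm y.1 - r <= Num.max (enorm y.1 - r) 0 by rewrite le_max lexx.
lra.
Qed.

Definition cutdist r z : R := Num.min (rest_dist r z) 1.

Lemma cutdist_ge0 r z : 0 <= cutdist r z.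
Proof. by rewrite /cutdist le_min rest_dist_ge0 ler01. Qed.

Lemma cutdist_le1 r z : cutdist r z <= 1.
Proof. by rewrite /cutdist ge_min lexx orbT. Qed.

Lemma cutdist_lip r z y : `|cutdist r z - cutdist r y| <= pdist z y.
Proof.
have h1 := rest_dist_lip r z y; have h2 := rest_dist_lip r y z.
rewrite pdistC in h2; have p0 := pdist_ge0 z y.
rewrite /cutdist ler_norml; move: h1 h2; set a := rest_dist r z; set b := rest_dist r y.
by move=> h1 h2; case: (leP a 1) => ?; case: (leP b 1) => ?; apply/andP; split; lra.
Qed.

Lemma cutdist_le_dist r z y : enorm y.1 <= r -> y.2 = 0 ->
  cutdist r z <= Num.min (pdist z y) 1.
Proof.
move=> y1 y2; have := rest_dist_lip r z y.
have -> : rest_dist r y = 0.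
  by rewrite /rest_dist y2 enorm0 max_r ?hypot0// subr_le0.
rewrite addr0 /cutdist => h; case: (leP (rest_dist r z) 1) => h1.
  by rewrite le_min h h1.
by rewrite le_min lexx andbT (le_trans (ltW h1)).
Qed.

Lemma DNE N (z1 z2 : 'I_N -> @phase R d) :
  DN z1 z2 = N%:R^-1 * \sum_k Num.min (pdist (z1 k) (z2 k)) 1.
Proof. by []. Qed.

(** Each particle is at least as far from any equilibrium as from the rest set. *)
Lemma DNEq_ge (V S : 'rV[R]_d -> R) (P : R -> R) N r (z : 'I_N -> @phase R d) :
  (forall y : 'I_N -> @phase R d, EqN V S P y ->
     forall k, enorm (y k).1 <= r /\ (y k).2 = 0) ->
  ((N%:R^-1 * \sum_k cutdist r (z k))%:E <= DNEq V S P z)%E.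
Proof.
move=> H; apply: le_ereal_inf_tmp => _ [y Ey <-]; rewrite lee_fin DNE.
rewrite ler_wpM2l ?invr_ge0//; apply: ler_sum => k _.
by have [h1 h2] := H y Ey k; exact: cutdist_le_dist.
Qed.

Lemma DN_triangle N (x y z : 'I_N -> @phase R d) : DN x z <= DN x y + DN y z.
Proof.
rewrite !DNE -mulrDr ler_wpM2l ?invr_ge0// -big_split/=; apply: ler_sum => k _.
have := pdist_triangle (x k) (y k) (z k).
have := pdist_ge0 (x k) (y k); have := pdist_ge0 (y k) (z k).
set a := pdist _ _; set b := pdist (x k) _; set c := pdist _ _.
by move=> *; case: (leP c 1) => ?; case: (leP b 1) => ?; case: (leP a 1) => ?; lra.
Qed.

Lemma DNC N (x y : 'I_N -> @phase R d) : DN x y = DN y x.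
Proof. by rewrite !DNE; congr (_ * _); apply: eq_bigr => k _; rewrite pdistC. Qed.

Section measurability.
Context dT (T : measurableType dT).
Implicit Types (f g : T -> R).

Lemma measurable_enorm_comp n (f : T -> 'rV[R]_n) : measurable_fun setT f ->
  measurable_fun setT (fun x => enorm (f x)).
Proof.
move=> mf; apply: (@measurableT_comp _ _ _ _ _ _ (@enorm R n)) mf.
exact: (continuous_measurable_rV (@continuous_enorm R n)).
Qed.

Lemma measurable_hypot f g : measurable_fun setT f -> measurable_fun setT g ->
  measurable_fun setT (fun x => hypot (f x) (g x)).
Proof.
move=> mf mg; apply: (@measurableT_comp _ _ _ _ _ _ (@Num.sqrt R)).
  exact: (continuous_measurable_fun (@sqrt_continuous R)).
by apply: measurable_funD; exact: measurable_funX.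
Qed.

Lemma measurable_min1 f : measurable_fun setT f ->
  measurable_fun setT (fun x => Num.min (f x) 1).
Proof.
move=> mf; rewrite (_ : (fun x => _) = (fun x => f x + 1 - Num.max (f x) 1)); last first.
  by apply/funext => x; case: (leP (f x) 1) => _; ring.
apply: measurable_funB; first exact: measurable_funD.
exact: measurable_maxr.
Qed.

Lemma measurable_pdist (F G : T -> @phase R d) :
  measurable_fun setT F -> measurable_fun setT G ->
  measurable_fun setT (fun x => pdist (F x) (G x)).
Proof.
have H n (u w : T -> 'rV[R]_n) : measurable_fun setT u -> measurable_fun setT w ->
    measurable_fun setT (fun x => u x - w x).
  move=> mu mw; apply: measurable_fun_rV => i.
  rewrite (_ : _ \o _ = (fun x => (rV_coor i \o u) x - (rV_coor i \o w) x)); last first.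
    by apply/funext => x; rewrite /rV_coor/= !mxE.
  by apply: measurable_funB; apply: measurableT_comp => //; exact: measurable_rV_coor.
move=> mF mG; apply: measurable_hypot; apply: measurable_enorm_comp; apply: H;
  by apply: measurableT_comp.
Qed.
End measurability.

Lemma measurable_rest_dist r : measurable_fun [set: @phase R d] (rest_dist r).
Proof.
apply: measurable_hypot.
  apply: measurable_maxr => //; apply: measurable_funB => //.
  exact: (@measurable_enorm_comp _ (@phase R d) d fst).
exact: (@measurable_enorm_comp _ (@phase R d) d snd).
Qed.

Lemma measurable_cutdist r : measurable_fun [set: @phase R d] (cutdist r).
Proof. by apply: measurable_min1; exact: measurable_rest_dist. Qed.

Definition slab r s : set (@phase R d) := [set z | rest_dist r z < s].

Lemma measurable_slab r s : measurable (slab r s).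
Proof.
rewrite (_ : slab r s = rest_dist r @^-1` [set` `]-oo, s[]).
  by apply: measurable_preimage => //; exact: measurable_rest_dist.
by apply/seteqP; split => z /=; rewrite in_itv.
Qed.
End phase_geometry.

Section theta.
Context {R : realType}.

Lemma leb_eball n (s : R) : 0 <= s -> (0 < n)%N ->
  (leb R n [set x | (enorm x < s)%R] <= (omega R n * s ^+ n)%:E)%E.
Proof.
rewrite le_eqVlt => /predU1P[<- n0|s0 _].
  rewrite (_ : [set x | _] = set0).
    by rewrite measure0 expr0n gtn_eqF// mulr0.
  by apply/seteqP; split => x //=; rewrite ltNge enorm_ge0.
have E : @eball R n 1 = [set y | eball s (s *: y)].
  apply/seteqP; split => y; rewrite /eball/= enormZ gtr0_norm//; first by move=> h; rewrite -[leRHS]mulr1 ler_wpM2l// ltW.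
  by rewrite -[leRHS]mulr1 ler_pM2l.
have := @leb_scale R n s (eball s) s0 (@measurable_eball R n s).
rewrite -E => H.
have lf t : leb R n (eball t) \is a fin_num.
  by rewrite ge0_fin_numE ?measure_ge0// leb_eball_lty.
have F : leb R n (eball s) = (omega R n * s ^+ n)%:E.
  have -> : omega R n = (s ^+ n)^-1 * fine (leb R n (eball s)) by rewrite /omega H fineM.
  by rewrite mulrAC mulVf ?mul1r ?expf_neq0 ?gt_eqF// fineK.
rewrite -F; apply: le_measure; rewrite ?inE; last by move=> x /ltW.
  rewrite (_ : [set x | _] = enorm @^-1` [set` `]-oo, s[]).
    apply: measurable_preimage => //; apply: continuous_measurable_rV.
    exact: continuous_enorm.
  by apply/seteqP; split => z /=; rewrite in_itv.
exact: measurable_eball.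
Qed.

Context (d : nat).
Hypothesis d0 : (0 < d)%N.

(** The position of a point of the slab lies within s <= 1 of the ball of radius r, and
    its velocity in a ball of radius s. *)
Lemma slab_vol_pos (r s : R) : 0 <= r -> 0 <= s <= 1 ->
  (@leb_phase R d (slab r s) <= (omega R d ^+ 2 * (r + 1) ^+ d * s ^+ d)%:E)%E.
Proof.
move=> r0 /andP[s0 s1].
pose A := [set x : 'rV[R]_d | enorm x < r + s]; pose B := [set x : 'rV[R]_d | enorm x < s].
have mB (t : R) : measurable [set x : 'rV[R]_d | enorm x < t].
  rewrite (_ : [set x | _] = enorm @^-1` [set` `]-oo, t[]).
    apply: measurable_preimage => //; apply: continuous_measurable_rV.
    exact: continuous_enorm.
  by apply/seteqP; split => z /=; rewrite in_itv.
have o0 : 0 <= omega R d by rewrite fine_ge0.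
apply: (@le_trans _ _ (@leb_phase R d (A `*` B))).
  apply: le_measure; rewrite ?inE.
  - exact: measurable_slab.
  - by apply: measurableX; exact: mB.
  - move=> z; rewrite /slab/A/B /= => h; split => /=.
      rewrite -ltrBlDl; apply: le_lt_trans h.
      apply: (@le_trans _ _ (Num.max (enorm z.1 - r) 0)); first by rewrite le_max lexx.
      by apply: hypot_lel; rewrite le_max lexx orbT.
    by apply: le_lt_trans h; apply: hypot_ler; exact: enorm_ge0.
have -> : @leb_phase R d (A `*` B) = (leb R d A * leb R d B)%E.
  by apply: product_measure1E; exact: mB.
apply: (@le_trans _ _ ((omega R d * (r + s) ^+ d)%:E * (omega R d * s ^+ d)%:E)%E).
  by apply: lee_pmul => //; apply: leb_eball => //; rewrite addr_ge0.
rewrite -EFinM lee_fin.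
rewrite (_ : omega R d ^+ 2 * (r + 1) ^+ d * s ^+ d = omega R d * (r + 1) ^+ d * (omega R d * s ^+ d)); last by ring.
rewrite ler_wpM2r ?mulr_ge0 ?exprn_ge0// ler_wpM2l// lerXn2r ?nnegrE ?addr_ge0//.
by rewrite lerD2l.
Qed.

(** For r = 0 the rest set is a point and the slab a ball of R^(2d): hence the better
    exponent. *)
Lemma slab_vol_0 (s : R) : 0 <= s ->
  (@leb_phase R d (slab 0 s) <= (omega R (2 * d) * s ^+ (2 * d))%:E)%E.
Proof.
move=> s0; rewrite mul2n -addnn.
have := @leb_add R d d [set x | (enorm x < s)%R].
have -> : [set z : 'rV[R]_d * 'rV[R]_d | [set x | (enorm x < s)%R] (row_mx z.1 z.2)] = slab 0 s.
  have E (z : @phase R d) : rest_dist 0 z = enorm (row_mx z.1 z.2).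
    rewrite /rest_dist/hypot subr0 max_l ?enorm_ge0// !enorm2 /enorm; congr Num.sqrt.
    rewrite /dot big_split_ord/=; congr (_ + _); apply: eq_bigr => i _.
      by rewrite row_mxEl.
    by rewrite row_mxEr.
  by apply/seteqP; split => z; rewrite /slab/= E.
move=> E; have -> : @leb_phase R d (slab 0 s) = leb R (d + d) [set x | (enorm x < s)%R].
  apply/esym/E; rewrite (_ : [set x | _] = enorm @^-1` [set` `]-oo, s[]).
    apply: measurable_preimage => //.
    exact: (continuous_measurable_rV (@continuous_enorm R _)).
  by apply/seteqP; split => z /=; rewrite in_itv.
by apply: leb_eball; rewrite ?addn_gt0 ?d0.
Qed.

(** [Theta r f0] is the best value of s (1 - c) in Markov's inequality: for volume
    bounds of the form a s^D the optimum is reached at a s^D = 1/(D+1), or at s = 1 if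
    that is beyond 1. *)
Lemma Theta_split (r : R) (f0 : @phase R d -> R) : 0 <= r ->
  exists s c, [/\ 0 <= s <= 1, 0 <= c <= 1, Theta r f0 = s * (1 - c) &
    ((fine (normLoo_phase f0))%:E * @leb_phase R d (slab r s) <= c%:E)%E].
Proof.
move=> r0; rewrite /Theta; set M := fine _.
have M0 : 0 <= M by rewrite fine_ge0// Lnorm_ge0.
have o0 n : 0 <= omega R n by rewrite fine_ge0.
have key (D : nat) (a : R) : (0 < D)%N -> 0 <= a ->
    let s := Num.min (a `^ (- D%:R^-1)) 1 in
    [/\ 0 <= s <= 1, a * s ^+ D <= 1, 0 <= (D.+1%:R^-1 : R) <= 1 & D%:R / D.+1%:R = 1 - D.+1%:R^-1 :> R].
  move=> D0 a0 /=; set s := Num.min _ _.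
  have s0 : 0 <= s by rewrite le_min powR_ge0 ler01.
  split.
  - by rewrite s0 ge_min lexx orbT.
  - move: a0; rewrite le_eqVlt => /predU1P[<-|a0]; first by rewrite mul0r ler01.
    apply: (@le_trans _ _ (a * (a `^ (- D%:R^-1)) ^+ D)).
      rewrite ler_wpM2l ?(ltW a0)// lerXn2r ?nnegrE ?powR_ge0//.
      by rewrite ge_min lexx.
    rewrite -powR_mulrn ?powR_ge0// -powRrM mulNr mulVf ?pnatr_eq0 ?gtn_eqF//.
    by rewrite powRN powRr1 ?(ltW a0)// divff// gt_eqF.
  - by rewrite invr_ge0 ler0n/= invf_le1 ?ltr0n// ler1n.
  - by rewrite -[X in X / _](addrK 1) -natr1 mulrBl divff ?mul1r// natr1 pnatr_eq0.
have [rp|rp] := ltP 0 r.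
  set a := (_ * M); have a0 : 0 <= a.
    by rewrite !mulr_ge0// ?exprn_ge0// addr_ge0.
  have [h1 h2 h3 h4] := key d a d0 a0.
  set s := Num.min _ _ in h1 h2 *; exists s, d.+1%:R^-1; split => //.
    by rewrite h4 mulrC.
  apply: (@le_trans _ _ (M%:E * (omega R d ^+ 2 * (r + 1) ^+ d * s ^+ d)%:E)%E).
    by rewrite lee_wpmul2l ?lee_fin//; exact: slab_vol_pos.
  rewrite -EFinM lee_fin -[leRHS]mul1r ler_pdivlMr ?ltr0n//.
  by apply: le_trans h2; rewrite le_eqVlt; apply/orP; left; apply/eqP; rewrite /a; ring.
have -> : r = 0 by apply/eqP; rewrite eq_le r0 rp.
set a := (_ * M); have a0 : 0 <= a by rewrite !mulr_ge0.
have [h1 h2 h3 h4] := key (2 * d)%N a (ltac:(by rewrite muln_gt0)) a0.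
set s := Num.min _ _ in h1 h2 *; exists s, (2 * d).+1%:R^-1; split => //.
  by rewrite h4 mulrC.
apply: (@le_trans _ _ (M%:E * (omega R (2 * d) * s ^+ (2 * d))%:E)%E).
  by rewrite lee_wpmul2l ?lee_fin//; apply: slab_vol_0; case/andP: h1.
rewrite -EFinM lee_fin -[leRHS]mul1r ler_pdivlMr ?ltr0n//.
by apply: le_trans h2; rewrite le_eqVlt; apply/orP; left; apply/eqP; rewrite /a; ring.
Qed.
End theta.

(** * Equilibria lie in the rest set *)

Section memory_sign.
Context {R : realType}.
Local Notation mu := (@lebesgue_measure R).
Local Notation RM := (measurableTypeR R).

Lemma der_mul (f g : R -> R) (x df dg : R) : is_derive x 1 f df -> is_derive x 1 g dg ->
  is_derive x 1 (fun y => f y * g y) (df * g x + f x * dg).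
Proof.
move=> hf hg; have H := is_deriveM hf hg.
by apply: (is_derive_eq H); rewrite /GRing.scale/= addrC; congr (_ + _); exact: mulrC.
Qed.

Lemma der_sub (f g : R -> R) (x df dg : R) : is_derive x 1 f df -> is_derive x 1 g dg ->
  is_derive x 1 (fun y => f y - g y) (df - dg).
Proof. by move=> hf hg; exact: is_deriveB. Qed.

Lemma der_cst (a x : R) : is_derive x 1 (fun=> a) 0.
Proof. exact: is_derive_cst. Qed.

Lemma der_id (x : R) : is_derive x 1 (fun y => y) 1.
Proof. exact: is_derive_id. Qed.

Lemma der_eq (f : R -> R) (x a b : R) : is_derive x 1 f a -> a = b -> is_derive x 1 f b.
Proof. by move=> h <-. Qed.

Lemma ftc (f F : R -> R) (a b : R) : a < b -> continuous f ->
  (forall x : R, is_derive x 1 F (f x)) ->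
  \int[mu]_(x in `[a, b]) f x = F b - F a.
Proof.
move=> ab cf dF; rewrite /Rintegral.
have -> : (\int[mu]_(x in `[a, b]) (f x)%:E)%E = ((F b)%:E - (F a)%:E)%E.
  apply: continuous_FTC2 => //.
  - by apply: continuous_subspaceT.
  - split => /=.
    + by move=> x _; have [] := dF x.
    + by apply: cvg_at_right_filter; apply: is_derive_cont (dF a).
    + by apply: cvg_at_left_filter; apply: is_derive_cont (dF b).
  - by move=> x _; rewrite derive1E; have [_ ->] := dF x.
by [].
Qed.

(** Truncating the cosine transform at A against a triangle rather than an indicator
    gives a nonnegative kernel. *)
Definition fejer (A t : R) : R := \int[mu]_(w in `[0, A]) ((A - w) * cos (t * w)).

Lemma continuous_fejer_integrand (A t : R) : continuous (fun w : R => (A - w) * cos (t * w)).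
Proof.
move=> w; apply: cvgM; first by apply: cvgB; [exact: cvg_cst|exact: cvg_id].
apply: (@continuous_comp _ _ _ (fun w => t * w) cos); last exact: continuous_cos.
by apply: cvgM; [exact: cvg_cst|exact: cvg_id].
Qed.

Lemma integrable_itv_cont (f : R -> R) (a b : R) : continuous f ->
  mu.-integrable `[a, b] (EFin \o f).
Proof.
move=> cf; apply: continuous_compact_integrable; first exact: segment_compact.
exact: continuous_subspaceT.
Qed.

Lemma fejerE (A t : R) : 0 < A -> t != 0 ->
  fejer A t = (1 - cos (A * t)) / t ^+ 2.
Proof.
move=> A0 t0; pose F (w : R) := (A - w) * (sin (t * w) / t) - cos (t * w) / t ^+ 2.
have dF (x : R) : is_derive x 1 F ((A - x) * cos (t * x)).
  have dt : is_derive x 1 (fun w => t * w) t.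
    by apply: der_eq (der_mul (der_cst t x) (der_id x)) _; rewrite mul0r add0r mulr1.
  have ds : is_derive x 1 (fun w => sin (t * w)) (cos (t * x) * t).
    by apply: (@is_derive1_compo _ (fun w => t * w) sin) => //; exact: is_derive_sin.
  have dc : is_derive x 1 (fun w => cos (t * w)) (- sin (t * x) * t).
    by apply: (@is_derive1_compo _ (fun w => t * w) cos) => //; exact: is_derive_cos.
  have dA := der_sub (der_cst A x) (der_id x).
  apply: der_eq (der_sub (der_mul dA (der_mul ds (der_cst t^-1 x))) (der_mul dc (der_cst (t ^+ 2)^-1 x))) _.
  by field.
rewrite /fejer (ftc A0 (@continuous_fejer_integrand A t) dF).
by rewrite /F subrr mul0r mulr0 cos0 sin0 (mulrC t A); field.
Qed.

Lemma fejer_small (A t c : R) : 0 < A -> (forall x, `|x| <= c -> 2^-1 <= cos x) ->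
  `|t| * A <= c -> A ^+ 2 / 4 <= fejer A t.
Proof.
move=> A0 hc tA.
have -> : A ^+ 2 / 4 = \int[mu]_(w in `[0, A]) ((A - w) / 2).
  have dF (x : R) : is_derive x 1 (fun w => (A * w - w * w / 2) / 2) ((A - x) / 2).
    have d1 := der_mul (der_cst A x) (der_id x).
    have d2 := der_mul (der_mul (der_id x) (der_id x)) (der_cst 2^-1 x).
    by apply: der_eq (der_mul (der_sub d1 d2) (der_cst 2^-1 x)) _; field.
  rewrite (ftc A0 _ dF); first by field.
  by move=> w; apply: cvgM; [apply: cvgB; [exact: cvg_cst|exact: cvg_id]|exact: cvg_cst].
apply: le_Rintegral.
- exact: measurable_itv.
- by apply: integrable_itv_cont => w; apply: cvgM; [apply: cvgB; [exact: cvg_cst|exact: cvg_id]|exact: cvg_cst].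
- apply: integrable_itv_cont; exact: continuous_fejer_integrand.
- move=> w; rewrite /= in_itv/= => /andP[w0 wA]; rewrite ler_wpM2l ?subr_ge0//.
  by apply: hc; rewrite normrM (le_trans _ tA)// ler_wpM2l// ger0_norm.
Qed.

Variable P : R -> R.
Hypothesis cP : continuous P.
Hypothesis iP : mu.-integrable setT (EFin \o P).
Hypothesis hP : forall w, fourier1 P w <= 0.

Lemma cos_transform_le0 (w : R) : \int[mu]_t (P t * cos (t * w)) <= 0.
Proof.
have := hP w; rewrite /fourier1 /Cintegral lecE/= => /andP[_ h].
apply: le_trans h; rewrite le_eqVlt; apply/orP; left; apply/eqP.
by congr Rintegral; apply/funext => t /=; rewrite /expi/= mul0r subr0 cosN.
Qed.

Let tri (A w : R) : R := (A - w) * \1_(`[0, A]%classic : set R) w.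
Let G (A : R) (z : RM * RM) : R := P z.1 * (tri A z.2 * cos (z.1 * z.2)).

Let mtri A : measurable_fun [set: RM] (tri A).
Proof.
by apply: measurable_funM; [apply: measurable_funB => //; exact: measurable_id|exact: measurable_indic].
Qed.

Let mP : measurable_fun [set: RM] P.
Proof. exact: continuous_measurable_fun. Qed.

Let mG A : measurable_fun setT (G A).
Proof.
apply: measurable_funM; first by apply: measurableT_comp; [exact: mP|exact: measurable_fst].
apply: measurable_funM; first by apply: measurableT_comp; [exact: mtri|exact: measurable_snd].
apply: (@measurableT_comp _ _ _ _ _ _ (@cos R)); first exact: continuous_measurable_fun (@continuous_cos R).
by apply: measurable_funM; [exact: measurable_fst|exact: measurable_snd].
Qed.

Let iG A : 0 < A -> (mu \x mu)%E.-integrable setT (EFin \o G A).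
Proof.
move=> A0.
have bd (t : R) : (\int[mu]_w `|(EFin \o G A) (t, w)| <= (A ^+ 2 * `|P t|)%:E)%E.
  have Hi : (\int[mu]_(w in `[0%R, A]) (A * `|P t|)%:E = (A ^+ 2 * `|P t|)%:E)%E.
    rewrite integral_cst; last exact: measurable_itv.
    have H : mu `[0, A]%classic = A%:E by rewrite lebesgue_measure_itv/= lte_fin A0 -EFinB subr0.
    apply: etrans (congr1 (fun x => ((A * `|P t|)%:E * x)%E) H) _.
    by rewrite -EFinM expr2 mulrAC.
  rewrite -Hi.
    rewrite [leRHS]integral_mkcond; apply: ge0_le_integral => //.
    - apply/measurable_EFinP; apply: measurableT_comp => //.
      apply: (@measurableT_comp _ _ _ _ _ _ (G A)); first exact: mG.
      by apply/measurable_fun_pairP; split; [exact: measurable_cst|exact: measurable_id].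
    - by apply/(measurable_restrictT (fun=> (A * `|P t|)%:E) (measurable_itv _)); exact: measurable_cst.
    move=> w _; rewrite patchE /G/tri/= indicE.
    case: ifPn => [|_]; last by rewrite mulr0 mul0r mulr0 normr0.
    rewrite inE/= in_itv/= => /andP[w0 wA].
    rewrite lee_fin mulr1 !normrM mulrC ler_wpM2r//.
    rewrite -[leRHS]mulr1; apply: ler_pM => //; first by rewrite ger0_norm ?subr_ge0// gerBl.
    by rewrite ler_norml cos_geN1 cos_le1.
apply/integrable12ltyP; first exact/measurable_EFinP.
apply: (@le_lt_trans _ _ (\int[mu]_t (A ^+ 2 * `|P t|)%:E)%E).
  apply: ge0_le_integral => //.
  - by move=> t _; apply: integral_ge0.
  - apply: (@measurable_fun_fubini_tonelli_F _ _ _ _ _ mu (fun z => `|(EFin \o G A) z|%E)).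
      by apply: measurableT_comp => //; apply/measurable_EFinP.
    by [].
  - apply/measurable_EFinP; apply: measurable_funM => //.
    by apply: measurableT_comp => //; exact: mP.
under eq_integral => t _ do rewrite EFinM.
rewrite ge0_integralZl//=; last 2 first.
- by apply/measurable_EFinP; apply: measurableT_comp => //; exact: mP.
- by rewrite lee_fin sqr_ge0.
rewrite lte_mul_pinfty ?lee_fin ?sqr_ge0//.
by move/integrableP : iP => [].
Qed.

Let fejer_mkcond A t : fejer A t = \int[mu]_w (tri A w * cos (t * w)).
Proof.
rewrite /fejer Rintegral_mkcond; congr Rintegral; apply/funext => w.
rewrite patchE /tri indicE; case: ifPn => _; last by rewrite mulr0 mul0r.
by rewrite mulr1.
Qed.

Let fejer_P A : 0 < A -> mu.-integrable setT (EFin \o (fun t => P t * fejer A t)) /\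
  \int[mu]_t (P t * fejer A t) <= 0.
Proof.
move=> A0.
have itc t : mu.-integrable setT (EFin \o (fun w => tri A w * cos (t * w))).
  have H := @integrable_itv_cont _ 0 A (@continuous_fejer_integrand A t).
  have mI : measurable (`[0, A]%classic : set RM) by exact: measurable_itv.
  have := (integrable_mkcond _ mI).1 H; apply: eq_integrable => // w _.
  rewrite restrict_EFin /= patchE /tri indicE; case: ifPn => _; last by rewrite mulr0 mul0r.
  by rewrite mulr1.
have E1 t : (\int[mu]_w (EFin \o G A) (t, w) = (P t * fejer A t)%:E)%E.
  rewrite fejer_mkcond.
  rewrite /= (_ : (fun w : R => _) = (fun w => (P t)%:E * (tri A w * cos (t * w))%:E)%E); last by apply/funext => w; rewrite /G/= -EFinM.
  rewrite integralZl//; last exact: itc.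
  rewrite EFinM; congr (_ * _)%E; rewrite /Rintegral fineK//.
  by apply: integrable_fin_num => //; exact: itc.
have E2 w : (\int[mu]_t (EFin \o G A) (t, w) = (tri A w * \int[mu]_t (P t * cos (t * w)))%:E)%E.
  rewrite /= (_ : (fun t : R => _) = (fun t => (tri A w)%:E * (P t * cos (t * w))%:E)%E); last first.
    by apply/funext => t; rewrite /G/= -EFinM; congr (_%:E); ring.
  have ipc : intg mu (fun t : RM => P t * cos (t * w)).
    apply: (@le_intg _ _ _ mu _ (fun t : RM => `|P t|)).
    - apply: measurable_funM; first exact: mP.
      apply: (@measurableT_comp _ _ _ _ _ _ (@cos R)); first exact: continuous_measurable_fun (@continuous_cos R).
      by apply: measurable_funM; [exact: measurable_id|exact: measurable_cst].
    - move=> t; rewrite normrM ler_piMr// ler_norml cos_geN1 cos_le1//.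
    - exact: intg_norm.
  rewrite integralZl// (EFinM (tri A w)).
  apply: (congr1 (fun x => ((tri A w)%:E * x)%E)); rewrite /Rintegral fineK//.
  exact: integrable_fin_num.
have FF := Fubini (iG A0).
have i1 := integrable_fubini_F (iG A0).
split.
  apply: eq_integrable i1 => // t _; rewrite -[RHS]E1//.
rewrite /Rintegral.
rewrite (_ : (\int[mu]_t (P t * fejer A t)%:E = \int[mu]_t \int[mu]_w (EFin \o G A) (t, w))%E); last first.
  by apply: eq_integral => t _; rewrite -E1.
rewrite FF (_ : (fun w => _) = (fun w => (tri A w * \int[mu]_t (P t * cos (t * w)))%:E)); last first.
  by apply/funext => w; rewrite E2.
have neg w : tri A w * \int[mu]_t (P t * cos (t * w)) <= 0.
  rewrite mulr_ge0_le0 ?cos_transform_le0// /tri indicE.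
  case: (w \in _) / idP => [|_]; last by rewrite mulr0.
  by rewrite inE/= in_itv/= => /andP[_ wA]; rewrite mulr1 subr_ge0.
rewrite integralE (eq_integral (cst 0%E)); last first.
  by move=> w _; rewrite funeposE/= max_r// lee_fin neg.
by rewrite integral0 sub0e fineN oppr_le0 fine_ge0// integral_ge0.
Qed.

(** The averages of the nonpositive cosine transform of P against triangles are
    integrals of P against the Fejer kernel, which is nonnegative and concentrates at 0:
    a positive P 0 would make them positive for large A. *)
Lemma memory_nonpos : P 0 <= 0.
Proof.
rewrite leNgt; apply/negP => P0.
pose m := P 0 / 2; have m0 : 0 < m by rewrite divr_gt0.
have [dl dl0 Pd] : exists2 dl, 0 < dl & forall t, `|t| < dl -> m <= P t.
  have /cvgrPdist_lt/(_ _ m0) := @cP 0.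
  move=> /nbhs_ballP[e /= e0 he]; exists e => // t te.
  have : `|P 0 - P t| < m by apply: he; rewrite /ball/= sub0r normrN.
  by rewrite ltr_norml => /andP[_ h]; rewrite /m in h *; lra.
have [c c0 hc] : exists2 c, 0 < c & forall x : R, `|x| <= c -> 2^-1 <= cos x.
  have : cos x @[x --> (0 : R)] --> cos (0 : R) := @continuous_cos R 0.
  rewrite cos0 => /cvgrPdist_lt/(_ (2^-1) (ltac:(lra))).
  move=> /nbhs_ballP[e /= e0 he]; exists (e / 2); first by rewrite divr_gt0.
  move=> x xe; have : `|1 - cos x| < 2^-1.
    by apply: he; rewrite /ball/= sub0r normrN; lra.
  by rewrite ltr_norml => /andP[_ h]; lra.
pose I := \int[mu]_t `|P t|; have I0 : 0 <= I by apply: Rintegral_ge0.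
(* the integral near 0 grows linearly in A, the tail stays bounded *)
pose A := 1 + c / dl + (2 / dl ^+ 2 * I + 1) / (m * c / 2).
have mc0 : 0 < m * c / 2 by rewrite !mulr_gt0.
have dl2 : 0 < dl ^+ 2 by rewrite exprn_gt0.
have T0 : 0 <= (2 / dl ^+ 2 * I + 1) / (m * c / 2).
  by rewrite divr_ge0 ?(ltW mc0)// addr_ge0// mulr_ge0// divr_ge0// ltW.
have cdl0 : 0 <= c / dl by rewrite divr_ge0 ?ltW.
have A0 : 0 < A by rewrite /A; lra.
have cA : c / A < dl.
  rewrite ltr_pdivrMr// mulrC -ltr_pdivrMr// /A; lra.
have [iK K0] := fejer_P A0.
pose J : set R := `[- (c / A), c / A]%classic.
have mJ : measurable (J : set RM) by exact: measurable_itv.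
have cA0 : 0 < c / A by rewrite divr_gt0.
have JE : (\int[mu]_t (\1_J t)%:E = (2 * (c / A))%:E)%E.
  rewrite integral_indic// setIT.
  have H : mu J = ((c / A)%:E - (- (c / A))%:E)%E.
    rewrite /J lebesgue_measure_itv/= lte_fin.
    by have -> : - (c / A) < c / A by lra.
  apply: etrans H _; rewrite -EFinB; congr (_%:E); ring.
have ij : mu.-integrable setT (EFin \o (\1_J : R -> R)).
  apply/integrableP; split; first by apply/measurable_EFinP.
  under eq_integral => t _ do rewrite /= ger0_norm//.
  by rewrite JE ltry.
have low : \int[mu]_t (m * (A ^+ 2 / 4) * \1_J t - 2 / dl ^+ 2 * `|P t|) <= 0.
  apply: le_trans K0; apply: le_Rintegral => //.
    by apply: intgB; apply: intgZ => //; exact: intg_norm.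
  have cn (t : R) : 0 <= 1 - cos t <= 2.
    by rewrite subr_ge0 cos_le1/=; have := cos_geN1 t; lra.
  have fj (t : R) : t != 0 -> 0 <= fejer A t <= 2 / t ^+ 2.
    move=> t0; rewrite fejerE//; have /andP[h1 h2] := cn (A * t).
    by rewrite divr_ge0 ?sqr_ge0//= ler_wpM2r// invr_ge0 sqr_ge0.
  have tail (t : R) : 0 <= 2 / dl ^+ 2 * `|P t| by rewrite mulr_ge0// divr_ge0// ltW.
  move=> t _; rewrite indicE; have [tJ|tJ] := boolP (t \in J).
    have : t \in J by []; rewrite inE /J/= in_itv/= -ler_norml => tc.
    have td : m <= P t by apply: Pd; exact: le_lt_trans tc cA.
    have := @fejer_small A t c A0 hc; rewrite -ler_pdivlMr// => /(_ tc) h.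
    have : m * (A ^+ 2 / 4) <= P t * fejer A t.
      by rewrite ler_pM// ?(ltW m0)// divr_ge0// sqr_ge0.
    by rewrite mulr1; have := tail t; lra.
  rewrite mulr0 sub0r.
  have t0 : t != 0.
    apply: contraNneq tJ => ->; rewrite inE /J/= in_itv/= -ler_norml normr0.
    by rewrite divr_ge0 ?ltW.
  have /andP[h1 h2] := fj t t0.
  have [td|td] := ltP `|t| dl.
    apply: (@le_trans _ _ 0); first by rewrite oppr_le0.
    by rewrite mulr_ge0// (le_trans (ltW m0))// Pd.
  rewrite lerNl -mulrN (le_trans (ler_norm _))// normrM mulrC normrN ler_wpM2r//.
  rewrite ger0_norm// (le_trans h2)// ler_wpM2l// lef_pV2 ?posrE//.
    by rewrite -[leRHS]real_normK ?num_real// lerXn2r ?nnegrE// ltW.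
  by rewrite exprn_even_gt0.
have i1 : intg mu (fun t => m * (A ^+ 2 / 4) * \1_J t) by exact: intgZ.
have i2 : intg mu (fun t => 2 / dl ^+ 2 * `|P t|) by apply: intgZ; exact: intg_norm.
move: low; rewrite (RintegralB measurableT i1 i2) !RintegralZl//; last exact: intg_norm.
have -> : \int[mu]_t (\1_J t : R) = 2 * (c / A).
  by rewrite /Rintegral JE.
rewrite -/I (_ : m * (A ^+ 2 / 4) * (2 * (c / A)) = m * c / 2 * A); last by field; rewrite gt_eqF.
have : m * c / 2 * A >= m * c / 2 * ((2 / dl ^+ 2 * I + 1) / (m * c / 2)).
  by rewrite ler_wpM2l ?(ltW mc0)// /A; lra.
rewrite mulrCA divff ?gt_eqF// mulr1; lra.
Qed.
End memory_sign.

Section equilibria.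
Context {R : realType} {d : nat}.
Implicit Types (x y w : 'rV[R]_d).

(** A radial function is even along the line through y that is orthogonal to y. *)
Lemma radial_grad_orth (S : 'rV[R]_d -> R) y w : C1 S -> radial S -> dot y w = 0 ->
  dot (grad S y) w = 0.
Proof.
move=> cS rS yw; have H := @is_derive_line _ _ S y w 0 cS.
rewrite scale0r addr0 in H.
have H' := @is_derive1_compo _ (fun t : R => 0 - t) (fun s => S (y + s *: w)) 0 _ _
  (der_sub (der_cst 0 0) (der_id 0)).
rewrite subr0 in H'; have {}H' := H' _ H.
rewrite (_ : _ \o _ = (fun s => S (y + s *: w))) in H'; last first.
  apply/funext => s /=; apply: rS; rewrite /enorm; congr Num.sqrt.
  rewrite !dotDl !dotDr !dotZl !dotZr (dotC w y) yw; ring.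
have [_ e1] := H; have [_ e2] := H'; move: e2; rewrite e1; lra.
Qed.

Lemma radial_grad (S : 'rV[R]_d -> R) y : C1 S -> radial S ->
  exists l, grad S y = l *: y.
Proof.
move=> cS rS; set g := grad S y.
have [y0|y0] := eqVneq (dot y y) 0.
  exists 0; rewrite scale0r; apply: dot_eq0; apply: radial_grad_orth => //.
  by rewrite (dot_eq0 y0) dot0l.
exists (dot g y / dot y y); apply/eqP; rewrite -subr_eq0; apply/eqP; apply: dot_eq0.
set w := g - _.
have yw : dot y w = 0 by rewrite /w dotDr dotNr dotZr (dotC y g) divfK ?subrr.
by rewrite {1}/w dotDl dotNl dotZl yw mulr0 subr0; exact: radial_grad_orth.
Qed.

(** Along the position x of an outermost particle the confining force and each
    interaction term have opposite signs, so all of them vanish along x; the interaction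
    being radial, each term then vanishes as a vector, and so does the confining force. *)
Lemma equilibrium_in_ball (V S : 'rV[R]_d -> R) (P : R -> R) r N (y : 'I_N -> @phase R d) :
  C1 S -> radial S -> P 0 <= 0 -> (forall x, 0 <= dot x (grad V x)) ->
  (forall x, dot x (grad S x) <= 0) -> [set x | grad V x = 0] `<=` eball r ->
  EqN V S P y -> forall k, enorm (y k).1 <= r /\ (y k).2 = 0.
Proof.
move=> cS rS P0 hV hS hr Ey k0; split; last by case: (Ey k0).
case: (@arg_maxP _ _ _ k0 predT (fun k => enorm (y k).1) isT) => k _ kmax.
have {}kmax j : enorm (y j).1 <= enorm (y k).1 := kmax j isT.
apply: le_trans (kmax k0) _; apply: hr => /=.
have [Ek _] := Ey k; have kap : 0 <= kappa P by rewrite /kappa oppr_ge0.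
set x := (y k).1 in Ek kmax *; set kN := kappa P / N%:R in Ek.
have kN0 : 0 <= kN by rewrite divr_ge0.
have term j : kN * dot x (grad S (x - (y j).1)) <= 0 /\
   (kN * dot x (grad S (x - (y j).1)) = 0 -> kN *: grad S (x - (y j).1) = 0).
  set u := x - _; have [l El] := radial_grad u cS rS.
  have xu : 0 <= dot x u.
    rewrite /u dotDr dotNr subr_ge0 -enorm2 (le_trans (dot_le _ _))//.
    by rewrite expr2 ler_wpM2l ?enorm_ge0// kmax.
  have [u0|u0] := eqVneq (dot u u) 0.
    by rewrite El (dot_eq0 u0) scaler0 dot0r mulr0 scaler0 lexx.
  have uu : 0 < dot u u by rewrite lt_neqAle eq_sym u0 dot_ge0.
  have l0 : l <= 0 by have := hS u; rewrite El dotZr pmulr_lle0.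
  rewrite El dotZr; split.
    by rewrite mulr_ge0_le0// mulr_le0_ge0.
  move=> /eqP; rewrite mulf_eq0 => /orP[/eqP->|]; first by rewrite scale0r.
  rewrite mulf_eq0 => /orP[/eqP->|/eqP xu0]; first by rewrite scale0r scaler0.
  exfalso; move: uu; rewrite ltNge => /negP; apply.
  have : dot (y j).1 (y j).1 <= dot x x.
    by rewrite -!enorm2 lerXn2r ?nnegrE ?enorm_ge0// kmax.
  have -> : dot u u = dot x u - dot (y j).1 u by rewrite {1}/u dotDl dotNl.
  have -> : dot (y j).1 u = dot x x - dot x u - dot (y j).1 (y j).1.
    by rewrite /u !dotDr !dotNr (dotC (y j).1 x); ring.
  rewrite xu0; lra.
have EV : grad V x = \sum_j kN *: grad S (x - (y j).1).
  by rewrite -scaler_sumr; apply/eqP; rewrite -subr_eq0 Ek.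
have D : dot x (grad V x) = \sum_j kN * dot x (grad S (x - (y j).1)).
  by rewrite EV dotC dot_suml; apply: eq_bigr => j _; rewrite dotZl dotC.
have D0 : \sum_j - (kN * dot x (grad S (x - (y j).1))) = 0.
  apply/eqP; rewrite eq_le sumr_ge0 ?andbT; last by move=> j _; rewrite oppr_ge0; case: (term j).
  by rewrite sumrN oppr_le0 -D.
rewrite EV big1// => j _; apply: (term j).2.
move/eqP: D0; rewrite psumr_eq0; last by move=> i _; rewrite oppr_ge0; case: (term i).
by move=> /allP/(_ j (mem_index_enum _)); rewrite /= oppr_eq0 => /eqP.
Qed.
End equilibria.

(** * The kick-drift scheme: stability and volume *)

Section stability.
Context {R : realType} {d : nat}.
Variables (I : Type) (n : nat) (h e r0 : R) (a g : nat -> R).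
Hypotheses (h0 : 0 <= h) (e0 : 0 <= e) (r00 : 0 <= r0).
Hypotheses (a0 : forall m, 0 <= a m) (g0 : forall m, 0 <= g m).

(** The velocity error explained by the force perturbations alone; it is kept
    apart from the phase error because only its time integral is amplified. *)
Definition drift_err (m : nat) : R := \sum_(l < m) h * g l.

Fixpoint phase_err (m : nat) : R :=
  if m is k.+1 then (1 + h) * (1 + h * a k) * phase_err k + h * (drift_err k.+1 + e)
  else r0.

Lemma drift_err_ge0 m : 0 <= drift_err m.
Proof. by apply: sumr_ge0 => l _; rewrite mulr_ge0. Qed.

Lemma phase_err_ge0 m : 0 <= phase_err m.
Proof.
elim: m => //= m IH; rewrite addr_ge0 ?mulr_ge0 ?addr_ge0 ?mulr_ge0//.
exact: drift_err_ge0.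
Qed.

Lemma phase_err_mono m k : (m <= k)%N -> phase_err m <= phase_err k.
Proof.
elim: k => [|k IH]; first by rewrite leqn0 => /eqP ->.
rewrite leq_eqVlt => /predU1P[->//|mk]; apply: le_trans (IH mk) _ => /=.
apply: ler_wpDr; first by rewrite mulr_ge0// addr_ge0// drift_err_ge0.
rewrite ler_peMl ?phase_err_ge0//.
have b0 := mulr_ge0 h0 (a0 k).
by rewrite -[leLHS]mulr1 ler_pM// lerDl.
Qed.

Variables (x v y u f f' e1 e2 : nat -> I -> 'rV[R]_d).
Hypothesis Hx : forall m i, (m < n)%N ->
  v m.+1 i = v m i + h *: f m i /\ x m.+1 i = x m i + h *: v m.+1 i.
Hypothesis Hy : forall m i, (m < n)%N ->
  u m.+1 i = u m i + h *: (f' m i + e1 m i) /\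
  y m.+1 i = y m i + h *: (u m.+1 i + e2 m i).
Hypothesis He1 : forall m i, (m < n)%N -> enorm (e1 m i) <= g m.
Hypothesis He2 : forall m i, (m < n)%N -> enorm (e2 m i) <= e.
Hypothesis Hf : forall m rho, (m < n)%N -> 0 <= rho ->
  (forall l i, (l <= m)%N -> enorm (x l i - y l i) <= rho) ->
  forall i, enorm (f m i - f' m i) <= a m * rho.
Hypothesis Hinit : forall i, pdist (x 0%N i, v 0%N i) (y 0%N i, u 0%N i) <= r0.

(** The run y, u is perturbed by e1 in its forces and e2 in its drifts. The velocity
    difference is split into the sum of the e1, bounded by [drift_err], and a rest that
    reacts to the force difference only: thus e1 acts on the positions through its time
    integral, as in the constant [Cst]. *)
Lemma kick_drift_stability m i : (m <= n)%N ->
  pdist (x m i, v m i) (y m i, u m i) <= phase_err m + drift_err m.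
Proof.
pose ga m i := \sum_(l < m) h *: e1 l i.
pose dw m i := v m i - u m i + ga m i.
have ga_le k j : (k <= n)%N -> enorm (ga k j) <= drift_err k.
  move=> kn; apply: le_trans (enorm_sum _ _ _) _; apply: ler_sum => l _.
  by rewrite enormZ ger0_norm// ler_wpM2l// He1// (leq_trans (ltn_ord l)).
have main k : (k <= n)%N -> forall j, hypot (enorm (x k j - y k j)) (enorm (dw k j)) <= phase_err k.
  elim/ltn_ind: k => -[|k] IH kn j.
    by rewrite /dw /ga big_ord0 addr0; exact: Hinit.
  have [Ev Ex] := Hx j kn; have [Eu Ey] := Hy j kn.
  have kn' := ltnW kn.
  have IHk := IH k (ltnSn _) kn' j.
  have Hfk := Hf kn (phase_err_ge0 k).
  have {}Hfk : forall j, enorm (f k j - f' k j) <= a k * phase_err k.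
    apply: Hfk => l i' lk; apply: le_trans (phase_err_mono lk).
    apply: le_trans (hypot_lel _ (enorm_ge0 _)) (IH l _ _ i'); first by rewrite ltnS.
    exact: leq_trans lk kn'.
  have Edw : dw k.+1 j = dw k j + h *: (f k j - f' k j).
    rewrite /dw /ga big_ord_recr/= Ev Eu scalerDr scalerBr.
    by apply/rowP => q; rewrite !mxE; ring.
  have Edx : x k.+1 j - y k.+1 j = (x k j - y k j) + h *: (dw k.+1 j - ga k.+1 j - e2 k j).
    rewrite Ex Ey /dw addrK.
    by apply/rowP => q; rewrite !mxE; ring.
  pose B := (1 + h * a k) * phase_err k.
  have hB : hypot (enorm (x k j - y k j)) (enorm (dw k.+1 j)) <= B.
    apply: (@le_trans _ _ (hypot (enorm (x k j - y k j)) (enorm (dw k j)) + hypot 0 (h * (a k * phase_err k)))).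
      apply: le_trans (hypotD _ _ _ _); rewrite ?enorm_ge0 ?mulr_ge0 ?phase_err_ge0//.
      apply: ler_hypot; rewrite ?enorm_ge0 ?addr0// Edw.
      apply: le_trans (enormD _ _) _; rewrite lerD2l enormZ ger0_norm// ler_wpM2l//.
    have s0 (t : R) : 0 <= t -> hypot 0 t <= t.
      by move=> t0; have := hypot_leD (lexx 0) t0; rewrite add0r.
    have := s0 (h * (a k * phase_err k)); rewrite !mulr_ge0 ?phase_err_ge0// => /(_ isT).
    rewrite /B mulrDl mul1r mulrA => hh.
    by apply: lerD => //.
  have dwB := le_trans (hypot_ler (enorm (x k j - y k j)) (enorm_ge0 (dw k.+1 j))) hB.
  have B0 : 0 <= B by apply: le_trans (enorm_ge0 _) dwB.
  rewrite [phase_err k.+1]/= -mulrA -/B; clearbody B.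
  have dd := drift_err_ge0 k.+1.
  apply: (@le_trans _ _ (hypot (enorm (x k j - y k j)) (enorm (dw k.+1 j)) +
      hypot (h * B + h * (drift_err k.+1 + e)) 0)).
    apply: le_trans (hypotD _ _ _ _); rewrite ?enorm_ge0 ?addr_ge0 ?mulr_ge0 ?addr_ge0//.
    apply: ler_hypot; rewrite ?enorm_ge0 ?addr0// Edx.
    apply: le_trans (enormD _ _) _; rewrite lerD2l enormZ ger0_norm// -mulrDr ler_wpM2l//.
    apply: le_trans (enormD _ _) _; rewrite enormN addrA lerD ?He2//.
    apply: le_trans (enormD _ _) _; rewrite enormN lerD// ga_le//.
  have t0 : 0 <= h * B + h * (drift_err k.+1 + e) by rewrite addr_ge0// mulr_ge0// addr_ge0.
  have := hypot_leD t0 (lexx 0); rewrite addr0 => hh.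
  have := lerD hB hh; lra.
move=> mn; rewrite /pdist /=.
have -> : v m i - u m i = dw m i + - ga m i by rewrite /dw addrK.
apply: (@le_trans _ _ (hypot (enorm (x m i - y m i)) (enorm (dw m i)) + hypot 0 (enorm (ga m i)))).
  apply: le_trans (hypotD _ _ _ _); rewrite ?enorm_ge0//.
  apply: ler_hypot; rewrite ?enorm_ge0 ?addr0//.
  by apply: le_trans (enormD _ _) _; rewrite enormN.
apply: lerD; first exact: main.
apply: le_trans (hypot_leD (lexx 0) (enorm_ge0 _)) _; rewrite add0r; exact: ga_le.
Qed.

Definition growth (m : nat) : R := \sum_(i < m) h * (1 + a i).

(** The discrete Gronwall inequality, in Duhamel's form. *)
Lemma phase_err_gronwall m : phase_err m <=
  expR (growth m) * r0 + \sum_(l < m) h * (drift_err l.+1 + e) * expR (growth m - growth l.+1).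
Proof.
elim: m => [|m IH] /=; first by rewrite /growth !big_ord0 expR0 mul1r addr0.
rewrite big_ord_recr/= subrr expR0 mulr1 [leRHS]addrA lerD2r.
have step : (1 + h) * (1 + h * a m) <= expR (h * (1 + a m)).
  rewrite (_ : h * (1 + a m) = h + h * a m); last by ring.
  rewrite expRD; apply: ler_pM; rewrite ?expR_ge1Dx//.
    by rewrite addr_ge0.
  by rewrite addr_ge0// mulr_ge0.
apply: (@le_trans _ _ (expR (h * (1 + a m)) * phase_err m)).
  by rewrite ler_wpM2r// phase_err_ge0.
apply: (@le_trans _ _ (expR (h * (1 + a m)) * (expR (growth m) * r0 +
  \sum_(l < m) h * (drift_err l.+1 + e) * expR (growth m - growth l.+1)))).
  by rewrite ler_wpM2l ?expR_ge0.
have gS : growth m.+1 = h * (1 + a m) + growth m by rewrite /growth big_ord_recr/= addrC.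
rewrite mulrDr mulrA -expRD -gS lerD2l mulr_sumr; apply: ler_sum => l _.
have -> : growth m.+1 - growth l.+1 = h * (1 + a m) + (growth m - growth l.+1).
  by rewrite gS addrA.
by rewrite (expRD (h * (1 + a m))) mulrCA.
Qed.

Lemma phase_err_crude m (A D : R) : (forall k, (k < m)%N -> a k <= A) ->
  (forall k, (k <= m)%N -> drift_err k <= D) ->
  phase_err m <= expR (m%:R * h * (1 + A)) * (r0 + m%:R * h * (D + e)).
Proof.
move=> hA hD; apply: le_trans (phase_err_gronwall m) _.
have gA : growth m <= m%:R * h * (1 + A).
  rewrite /growth; apply: (@le_trans _ _ (\sum_(i < m) h * (1 + A))).
    by apply: ler_sum => i _; rewrite ler_wpM2l// lerD2l hA.
  by rewrite sumr_const card_ord -mulrA mulr_natl.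
rewrite mulrDr; apply: lerD; first by rewrite ler_wpM2r// ler_expR.
apply: (@le_trans _ _ (\sum_(l < m) h * (D + e) * expR (m%:R * h * (1 + A)))).
  apply: ler_sum => l _; apply: ler_pM; rewrite ?expR_ge0//.
  - by rewrite mulr_ge0// addr_ge0// drift_err_ge0.
  - by rewrite ler_wpM2l// lerD2r hD.
  - rewrite ler_expR; apply: le_trans gA; rewrite gerBl.
    by apply: sumr_ge0 => i _; rewrite mulr_ge0// addr_ge0.
rewrite sumr_const card_ord -mulr_natl le_eqVlt; apply/orP; left; apply/eqP; ring.
Qed.
End stability.

Section scheme.
Context {R : realType} {d : nat}.
Local Notation phase := (@phase R d).
Variables (h : R) (F : nat -> 'rV[R]_d -> 'rV[R]_d) (G : 'rV[R]_d -> 'rV[R]_d)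
  (w : nat -> R).

(** One particle under a prescribed force: kick, then drift. Each half step is a
    shear, hence preserves the phase volume. *)
Fixpoint kick_drift (E : nat -> 'rV[R]_d -> 'rV[R]_d) (m : nat) (z : phase) : phase :=
  if m is k.+1 then
    let y := kick_drift E k z in let u := y.2 + h *: E k y.1 in (y.1 + h *: u, u)
  else z.

Variable N : nat.
Variable c : 'I_N -> 'I_N -> R.
Local Notation state := ('I_N -> phase).

(** The force at step [m] felt at [x] by particle [k], given the whole history
    [X]; [w l] is the mass of the memory kernel on the [l]-th time cell. *)
Definition delayed_force (X : nat -> state) (m : nat) (k : 'I_N) (x : 'rV[R]_d) : 'rV[R]_d :=
  F m x + \sum_(l < m) w l *: \sum_j c k j *: G (x - (X (m - l)%N j).1).

Definition sstep (X : nat -> state) (m : nat) : state := fun k =>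
  let u := (X m k).2 + h *: delayed_force X m k (X m k).1 in
  ((X m k).1 + h *: u, u).

(** The memory requires the whole past: [history z m] lists the states up to step m, and
    repeats the last one afterwards. *)
Fixpoint history (z : state) (m : nat) : nat -> state :=
  if m is k.+1 then
    fun l => if (l <= k)%N then history z k l else sstep (history z k) k
  else fun=> z.

Definition scheme (z : state) (m : nat) : state := history z m m.

Lemma history_scheme z m l : (l <= m)%N -> history z m l = scheme z l.
Proof.
elim: m => [|m IH]; first by rewrite leqn0 => /eqP ->.
rewrite leq_eqVlt => /predU1P[->//|lm] /=.
by rewrite -ltnS lm IH.
Qed.

Lemma delayed_force_eq (X X' : nat -> state) m k x : (forall l, (l <= m)%N -> X l = X' l) ->
  delayed_force X m k x = delayed_force X' m k x.
Proof.
move=> XX; rewrite /delayed_force; congr (_ + _); apply: eq_bigr => l _.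
by congr (_ *: _); apply: eq_bigr => j _; rewrite XX// leq_subr.
Qed.

Lemma scheme0 z : scheme z 0 = z.
Proof. by []. Qed.

Lemma schemeS z m : scheme z m.+1 = sstep (scheme z) m.
Proof.
rewrite /scheme /= ltnn; apply/funext => k; rewrite /sstep -/(scheme z).
rewrite (delayed_force_eq _ _ (@history_scheme z m)).
by rewrite history_scheme.
Qed.

(** Along a run, each particle follows the kick-drift map of the force field that the
    run produces. *)
Lemma scheme_kick_drift z m k :
  scheme z m k = kick_drift (fun l => delayed_force (scheme z) l k) m (z k).
Proof. by elim: m => [|m IH]; rewrite ?scheme0// schemeS /sstep IH. Qed.
End scheme.

Section decoupled.
Context {R : realType} {d : nat}.
Local Notation phase := (@phase R d).
Variables (h : R) (F : nat -> 'rV[R]_d -> 'rV[R]_d) (G : 'rV[R]_d -> 'rV[R]_d)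
  (w : nat -> R) (N : nat) (c : 'I_N -> 'I_N -> R) (k0 : 'I_N).
Hypothesis ck0 : forall k, c k k0 = 0.

Lemma delayed_force_decoupled (X X' : nat -> 'I_N -> phase) m k x :
  (forall l j, (l <= m)%N -> j != k0 -> X l j = X' l j) ->
  delayed_force F G w c X m k x = delayed_force F G w c X' m k x.
Proof.
move=> XX; rewrite /delayed_force; congr (_ + _); apply: eq_bigr => l _.
congr (_ *: _); apply: eq_bigr => j _; have [->|jk] := eqVneq j k0.
  by rewrite ck0 !scale0r.
by rewrite XX// leq_subr.
Qed.

(** If particle k0 acts on nobody, the motion of the others ignores its datum, and so
    does the field that k0 feels. *)
Lemma scheme_decoupled (z z' : 'I_N -> phase) m k : (forall j, j != k0 -> z j = z' j) ->
  k != k0 -> scheme h F G w c z m k = scheme h F G w c z' m k.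
Proof.
move=> zz; elim/ltn_ind: m k => -[|m] IH k kk; first by rewrite !scheme0 zz.
rewrite !schemeS /sstep (IH m (ltnSn m) k kk).
rewrite (@delayed_force_decoupled _ (scheme h F G w c z'))// => l j lm jk.
exact: IH.
Qed.

Lemma force_decoupled (z z' : 'I_N -> phase) m k : (forall j, j != k0 -> z j = z' j) ->
  delayed_force F G w c (scheme h F G w c z) m k =
  delayed_force F G w c (scheme h F G w c z') m k.
Proof.
move=> zz; apply/funext => x; apply: delayed_force_decoupled => l j _ jk.
exact: scheme_decoupled.
Qed.
End decoupled.

Section volume.
Context {R : realType} {d : nat}.
Local Notation phase := (@phase R d).
Local Open Scope ereal_scope.

Lemma measurable_pairf dT (T : measurableType dT) d1 (T1 : measurableType d1)
    d2 (T2 : measurableType d2) (f : T -> T1) (g : T -> T2) :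
  measurable_fun setT f -> measurable_fun setT g ->
  measurable_fun setT (fun x => (f x, g x)).
Proof. by move=> mf mg; apply/measurable_fun_pairP; split. Qed.

Lemma measurable_rV_D dT (T : measurableType dT) n (f g : T -> 'rV[R]_n) :
  measurable_fun setT f -> measurable_fun setT g ->
  measurable_fun setT (fun x => (f x + g x)%R).
Proof.
move=> mf mg; apply: measurable_fun_rV => i.
rewrite (_ : _ \o _ = (fun x => ((rV_coor i \o f) x + (rV_coor i \o g) x)%R)); last first.
  by apply/funext => x; rewrite /rV_coor/= !mxE.
by apply: measurable_funD; apply: measurableT_comp => //; exact: measurable_rV_coor.
Qed.

Lemma measurable_rV_Z dT (T : measurableType dT) n (a : R) (f : T -> 'rV[R]_n) :
  measurable_fun setT f -> measurable_fun setT (fun x => (a *: f x)%R).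
Proof.
move=> mf; apply: (measurableT_comp (measurable_rV_scale a)) mf.
Qed.

Lemma measurable_rV_sum dT (T : measurableType dT) n (I : Type) (s : seq I)
    (f : I -> T -> 'rV[R]_n) : (forall i, measurable_fun setT (f i)) ->
  measurable_fun setT (fun x => (\sum_(i <- s) f i x)%R).
Proof.
move=> mf; elim: s => [|i s IH].
  by under eq_fun do rewrite big_nil; exact: measurable_cst.
by under eq_fun do rewrite big_cons; exact: measurable_rV_D.
Qed.

(** Translating the velocity by a function of the position, or the position by a
    function of the velocity, translates every slice. *)
Lemma kick_volume (E : 'rV[R]_d -> 'rV[R]_d) (A : set phase) :
  measurable_fun setT E -> measurable A ->
  @leb_phase R d [set z | A (z.1, (z.2 + E z.1)%R)] = @leb_phase R d A.
Proof.
move=> mE mA.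
have mf : measurable_fun setT (fun z : phase => (\1_A z : R)%:E).
  by apply/measurable_EFinP; exact: measurable_indic.
have mK : measurable_fun setT (fun z : phase => (z.1, (z.2 + E z.1)%R)).
  apply: measurable_pairf; first exact: measurable_fst.
  apply: measurable_rV_D; first exact: measurable_snd.
  exact: (measurableT_comp mE measurable_fst).
have mB : measurable [set z : phase | A (z.1, (z.2 + E z.1)%R)].
  exact: (measurable_preimage mK mA).
have E1 (B : set phase) : measurable B ->
    @leb_phase R d B = \int[leb R d]_x \int[leb R d]_v (\1_B (x, v) : R)%:E.
  move=> mb; have := integral_indic (@leb_phase R d) measurableT mb; rewrite setIT => <-.
  apply: (@fubini_tonelli1 _ _ _ _ _ (leb R d) (leb R d) (fun z : phase => (\1_B z)%:E)) => //.
  by apply/measurable_EFinP; exact: measurable_indic.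
rewrite (E1 _ mB) (E1 _ mA); apply: eq_integral => x _.
rewrite -(@ge0_integral_leb_shift R d (E x) (fun v => (\1_A (x, v) : R)%:E))//.
apply: (measurableT_comp mf); apply: measurable_pairf; [exact: measurable_cst|exact: measurable_id].
Qed.

Lemma drift_volume (h : R) (A : set phase) : measurable A ->
  @leb_phase R d [set z | A ((z.1 + h *: z.2)%R, z.2)] = @leb_phase R d A.
Proof.
move=> mA.
have mf : measurable_fun setT (fun z : phase => (\1_A z : R)%:E).
  by apply/measurable_EFinP; exact: measurable_indic.
have mK : measurable_fun setT (fun z : phase => ((z.1 + h *: z.2)%R, z.2)).
  apply: measurable_pairf; last exact: measurable_snd.
  apply: measurable_rV_D; first exact: measurable_fst.
  by apply: measurable_rV_Z; exact: measurable_snd.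
have mB : measurable [set z : phase | A ((z.1 + h *: z.2)%R, z.2)].
  exact: (measurable_preimage mK mA).
have E1 (B : set phase) : measurable B ->
    @leb_phase R d B = \int[leb R d]_v \int[leb R d]_x (\1_B (x, v) : R)%:E.
  move=> mb; have := integral_indic (@leb_phase R d) measurableT mb; rewrite setIT => <-.
  apply: (@fubini_tonelli2 _ _ _ _ _ (leb R d) (leb R d) (fun z : phase => (\1_B z)%:E)) => //.
  by apply/measurable_EFinP; exact: measurable_indic.
rewrite (E1 _ mB) (E1 _ mA); apply: eq_integral => v _.
rewrite -(@ge0_integral_leb_shift R d (h *: v)%R (fun x => (\1_A (x, v) : R)%:E))//.
apply: (measurableT_comp mf); apply: measurable_pairf; [exact: measurable_id|exact: measurable_cst].
Qed.

Variables (h : R) (E : nat -> 'rV[R]_d -> 'rV[R]_d).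
Hypothesis mE : forall m, measurable_fun setT (E m).

Lemma measurable_kick_drift m : measurable_fun [set: phase] (kick_drift h E m).
Proof.
elim: m => [|m IH]; first exact: measurable_id.
have m1 : measurable_fun [set: phase] (fun z => (kick_drift h E m z).1) by exact: measurableT_comp.
have m2 : measurable_fun [set: phase] (fun z => (kick_drift h E m z).2) by exact: measurableT_comp.
have mu : measurable_fun [set: phase] (fun z => ((kick_drift h E m z).2 + h *: E m (kick_drift h E m z).1)%R).
  by apply: measurable_rV_D => //; apply: measurable_rV_Z; apply: measurableT_comp.
apply: measurable_pairf => //=.
by apply: measurable_rV_D => //; exact: measurable_rV_Z.
Qed.

Lemma kick_drift_volume m (A : set phase) : measurable A ->
  @leb_phase R d (kick_drift h E m @^-1` A) = @leb_phase R d A.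
Proof.
elim: m A => [//|m IH] A mA.
pose B := [set z : phase | A ((z.1 + h *: z.2)%R, z.2)].
pose C := [set z : phase | B (z.1, (z.2 + h *: E m z.1)%R)].
have mB : measurable B.
  have mK : measurable_fun setT (fun z : phase => ((z.1 + h *: z.2)%R, z.2)).
    apply: measurable_pairf; last exact: measurable_snd.
    apply: measurable_rV_D; first exact: measurable_fst.
    by apply: measurable_rV_Z; exact: measurable_snd.
  exact: (measurable_preimage mK mA).
have mhE : measurable_fun setT (fun x => h *: E m x)%R by exact: measurable_rV_Z.
have mC : measurable C.
  have mK : measurable_fun setT (fun z : phase => (z.1, (z.2 + h *: E m z.1)%R)).
    apply: measurable_pairf; first exact: measurable_fst.
    apply: measurable_rV_D; first exact: measurable_snd.
    exact: (measurableT_comp mhE measurable_fst).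
  exact: (measurable_preimage mK mB).
rewrite -(drift_volume h mA) -(kick_volume mhE mB) -/C -(IH C mC).
by [].
Qed.
End volume.

(** * Memory kernels, and curves on a half-line *)

Section kernel.
Context {R : realType} {d : nat}.
Local Notation mu := (@lebesgue_measure R).
Local Notation RM := (measurableTypeR R).
Variable p : R -> R.
Hypothesis hp : locally_integrable setT p.

(** The kernel cut to ]a, b]: with the cut-off inside the integrand, splitting an
    interval is an identity between functions. *)
Definition pcut (a b s : R) : R := p s * \1_(`]a, b]%classic : set R) s.

Definition pmass (a b : R) : R := \int[mu]_s `|pcut a b s|.

Definition pweight (h : R) (l : nat) : R := \int[mu]_s pcut (l%:R * h) (l.+1%:R * h) s.

Lemma pcut_intg a b : intg mu (pcut a b).
Proof.
have [mp _ ip] := hp.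
have mI : measurable (`]a, b]%classic : set RM) by exact: measurable_itv.
have H : mu.-integrable (`]a, b]%classic : set RM) (EFin \o p).
  have mJ : measurable (`[a, b]%classic : set RM) by exact: measurable_itv.
  have : mu.-integrable (`[a, b]%classic : set RM) (EFin \o p).
    apply/integrableP; split.
      by apply/measurable_EFinP; apply: measurable_funS mp => //.
    exact: (ip _ (@subsetT _ _) (@segment_compact _ a b)).
  apply: integrableS => //; exact: subset_itv_oc_cc.
have := (integrable_mkcond _ mI).1 H; rewrite /intg; apply: eq_integrable => // s _.
rewrite restrict_EFin /= patchE /pcut indicE; case: ifPn => _; last by rewrite mulr0.
by rewrite mulr1.
Qed.

Lemma indic_ioc (a b s : R) : (\1_(`]a, b]%classic : set R) s : R) = (a < s <= b)%R%:R.
Proof.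
rewrite indicE; congr (_%:R); congr nat_of_bool; apply/idP/idP.
  by rewrite inE/= in_itv.
by move=> h; rewrite inE/= in_itv.
Qed.

Lemma pcutD a b c s : a <= b <= c -> pcut a c s = pcut a b s + pcut b c s.
Proof.
move=> /andP[ab bc]; rewrite /pcut -mulrDr; congr (_ * _); rewrite !indic_ioc -natrD; congr (_%:R).
case: (leP s a) => h1 /=; case: (leP s b) => h2 /=; case: (leP s c) => h3 //=; exfalso; lra.
Qed.

Lemma normr_pcutD a b c s : a <= b <= c -> `|pcut a c s| = `|pcut a b s| + `|pcut b c s|.
Proof.
move=> /andP[ab bc]; rewrite /pcut !normrM -mulrDr; congr (_ * _); rewrite !indic_ioc !normr_nat -natrD; congr (_%:R).
case: (leP s a) => h1 /=; case: (leP s b) => h2 /=; case: (leP s c) => h3 //=; exfalso; lra.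
Qed.

Lemma pmass_ge0 a b : 0 <= pmass a b.
Proof. by apply: Rintegral_ge0. Qed.

Lemma pmassD a b c : a <= b <= c -> pmass a c = pmass a b + pmass b c.
Proof.
move=> abc; rewrite /pmass -RintegralD//; try by apply: intg_norm; exact: pcut_intg.
by congr Rintegral; apply/funext => s; exact: normr_pcutD.
Qed.

Lemma pmass_mono a b c : a <= b <= c -> pmass a b <= pmass a c.
Proof. by move=> abc; rewrite (pmassD abc) lerDl pmass_ge0. Qed.

Lemma pweight_sum h m : 0 <= h -> \sum_(l < m) `|pweight h l| <= pmass 0 (m%:R * h).
Proof.
move=> h0; elim: m => [|m IH]; first by rewrite big_ord0 pmass_ge0.
rewrite big_ord_recr/= (@pmassD 0 (m%:R * h)); last first.
  by rewrite mulr_ge0//= ler_wpM2r// ler_nat.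
apply: lerD => //; apply: le_normr_Rintegral => //; exact: pcut_intg.
Qed.

(** Absolute continuity of the integral, uniformly over short intervals of [0, T]. *)
Lemma pmass_small (T e : R) : 0 < e -> exists2 dl, 0 < dl & forall a b, 0 <= a -> a <= b ->
  b <= T -> b - a < dl -> pmass a b <= e.
Proof.
move=> e0; have [dl [dl0 H]] := integral_normr_continuous (pcut_intg (- 1) T) e0.
exists dl => // a b a0 ab bT bad.
have mI : measurable (`]a, b]%classic : set RM) by exact: measurable_itv.
have Em : mu (`]a, b]%classic : set RM) = (b - a)%:E.
  rewrite lebesgue_measure_itv/= lte_fin; move: ab; rewrite le_eqVlt => /predU1P[->|->]//.
  by rewrite ltxx subrr.
have mb : (mu (`]a, b]%classic : set RM) < dl%:E)%E by rewrite Em lte_fin.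
have /ltW := H _ mI mb.
apply: le_trans; rewrite Rintegral_mkcond le_eqVlt; apply/orP; left; apply/eqP.
rewrite /pmass; congr Rintegral; apply/funext => s; rewrite patchE /pcut.
case: ifPn => sI.
  rewrite !indic_ioc; move: sI; rewrite inE/= in_itv/= => /andP[as_ sb].
  by rewrite as_ sb (le_trans sb bT) (lt_trans _ as_)//; lra.
by rewrite indicE (negbTE sI) mulr0 normr0.
Qed.

Implicit Types K : R -> 'rV[R]_d.

Definition bdd_meas K : Prop :=
  (forall i, measurable_fun [set: RM] (fun s : RM => K s ord0 i)) /\
  exists B, forall s, enorm (K s) <= B.

Definition pint a b K : 'rV[R]_d := \row_i \int[mu]_s (pcut a b s * K s ord0 i).

Lemma pint_intg a b K i : bdd_meas K -> intg mu (fun s : RM => pcut a b s * K s ord0 i).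
Proof.
move=> [mK [B hB]]; apply: (@le_intg _ _ _ mu _ (fun s : RM => B * `|pcut a b s|)).
- by apply: measurable_funM => //; exact: intg_measurable (pcut_intg a b).
- move=> s; rewrite normrM mulrC ler_wpM2r// (le_trans _ (hB s))//.
  exact: ler_coord_enorm.
- by apply: intgZ; apply: intg_norm; exact: pcut_intg.
Qed.

Lemma dot_pint a b K y : bdd_meas K ->
  intg mu (fun s : RM => pcut a b s * dot (K s) y) /\
  dot (pint a b K) y = \int[mu]_s (pcut a b s * dot (K s) y).
Proof.
move=> hK.
have E s : pcut a b s * dot (K s) y = \sum_i (y ord0 i * (pcut a b s * K s ord0 i)).
  by rewrite /dot mulr_sumr; apply: eq_bigr => i _; ring.
have I i : intg mu (fun s : RM => y ord0 i * (pcut a b s * K s ord0 i)).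
  by apply: intgZ; exact: pint_intg.
split.
  by rewrite (_ : (fun s : RM => _) = (fun s => \sum_i (y ord0 i * (pcut a b s * K s ord0 i))));
    [exact: intg_sum|apply/funext => s; exact: E].
rewrite (_ : (fun s => pcut a b s * dot (K s) y) = (fun s => \sum_i (y ord0 i * (pcut a b s * K s ord0 i)))); last first.
  by apply/funext => s; exact: E.
rewrite Rint_sum// /dot; apply: eq_bigr => i _; rewrite mxE mulrC.
by rewrite RintegralZl//; exact: pint_intg.
Qed.

(** By duality with constant vectors, as the integral is taken coordinatewise. *)
Lemma pint_le a b K B : 0 <= B -> bdd_meas K -> (forall s, a < s <= b -> enorm (K s) <= B) ->
  enorm (pint a b K) <= B * pmass a b.
Proof.
move=> B0 hK hB; apply: enorm_le_dual; first by rewrite mulr_ge0// pmass_ge0.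
move=> y; have [i1 ->] := dot_pint a b y hK.
apply: le_trans (ler_norm _) _; apply: le_trans (le_normr_Rintegral _ i1) _ => //.
rewrite mulrAC /pmass -RintegralZl//; last by apply: intg_norm; exact: pcut_intg.
apply: le_Rintegral => //.
- exact: intg_norm.
- by apply: intgZ; apply: intg_norm; exact: pcut_intg.
move=> s _; rewrite normrM mulrC /pcut indic_ioc.
case: (boolP (a < s <= b)) => [h|_]; last by rewrite mulr0 normr0 !mulr0.
by rewrite ler_wpM2r// (le_trans (normr_dot_le _ _))// ler_wpM2r ?enorm_ge0// hB.
Qed.

Lemma bdd_measB K K' : bdd_meas K -> bdd_meas K' -> bdd_meas (fun s => K s - K' s).
Proof.
move=> [m1 [B1 h1]] [m2 [B2 h2]]; split.
  move=> i; rewrite (_ : (fun s : RM => _) = (fun s : RM => K s ord0 i - K' s ord0 i)).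
    exact: measurable_funB.
  by apply/funext => s; rewrite !mxE.
exists (B1 + B2) => s; rewrite (le_trans (enormD _ _))// enormN lerD//.
Qed.

Lemma bdd_meas_cst k : bdd_meas (fun=> k).
Proof. by split; [move=> i; exact: measurable_cst|exists (enorm k)]. Qed.

Lemma pintB a b K K' : bdd_meas K -> bdd_meas K' ->
  pint a b (fun s => K s - K' s) = pint a b K - pint a b K'.
Proof.
move=> h1 h2; apply/rowP => i; rewrite !mxE -RintegralB//; try exact: pint_intg.
by congr Rintegral; apply/funext => s; rewrite !mxE mulrBr.
Qed.

Lemma pintD a b c K : a <= b <= c -> bdd_meas K -> pint a c K = pint a b K + pint b c K.
Proof.
move=> abc hK; apply/rowP => i; rewrite !mxE -RintegralD//; try exact: pint_intg.
by congr Rintegral; apply/funext => s; rewrite (pcutD _ abc) mulrDl.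
Qed.

Lemma pint_cst a b k : pint a b (fun=> k) = (\int[mu]_s pcut a b s) *: k.
Proof.
apply/rowP => i; rewrite !mxE mulrC -RintegralZl//; last exact: pcut_intg.
by congr Rintegral; apply/funext => s; rewrite mulrC.
Qed.

Lemma pint_aa a K : pint a a K = 0.
Proof.
apply/rowP => i; rewrite !mxE (_ : (fun s => _) = (fun=> 0)).
  by rewrite /Rintegral integral0.
apply/funext => s; rewrite /pcut indic_ioc.
by case: (ltP a s) => h /=; rewrite ?mulr0 ?mul0r// leNgt h mulr0 mul0r.
Qed.

(** Left-endpoint quadrature, with the exact masses of the kernel as weights. *)
Lemma pint_quadrature (h B : R) (m : nat) K (k : nat -> 'rV[R]_d) :
  0 <= h -> 0 <= B -> bdd_meas K ->
  (forall l s, (l < m)%N -> l%:R * h < s <= l.+1%:R * h -> enorm (K s - k l) <= B) ->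
  enorm (pint 0 (m%:R * h) K - \sum_(l < m) pweight h l *: k l) <= B * pmass 0 (m%:R * h).
Proof.
move=> h0 B0 hK; elim: m => [|m IH] hB.
  by rewrite mul0r pint_aa big_ord0 subr0 enorm0 mulr_ge0// pmass_ge0.
have abc : 0 <= m%:R * h <= m.+1%:R * h.
  by rewrite mulr_ge0//= ler_wpM2r// ler_nat.
rewrite (pintD abc hK) big_ord_recr/= (pmassD abc) mulrDr.
rewrite opprD addrACA (le_trans (enormD _ _))// lerD//.
  by apply: IH => l s lm; apply: hB; exact: ltnW.
rewrite /pweight -pint_cst -pintB//; last exact: bdd_meas_cst.
apply: pint_le => //; first by apply: bdd_measB => //; exact: bdd_meas_cst.
by move=> s; apply: hB.
Qed.

End kernel.

Section halfline.
Context {R : realType} {d : nat}.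
Implicit Types (f : R -> 'rV[R]_d) (c l : 'rV[R]_d).

Definition cont_ge0 f : Prop := forall t e, 0 <= t -> 0 < e ->
  exists2 r, 0 < r & forall s, 0 <= s -> `|s - t| < r -> enorm (f s - f t) <= e.

Lemma derive_ge0_dist f (t : R) l (e : R) : is_derive_ge0 f t l -> 0 < e ->
  exists2 r, 0 < r & forall h, h != 0 -> `|h| < r -> 0 <= t + h ->
    enorm (h^-1 *: (f (t + h) - f t) - l) <= e.
Proof.
rewrite /is_derive_ge0 => H e0; have e1 : 0 < e / (d%:R + 1) by rewrite divr_gt0// ltr_wpDl.
have /cvgrPdist_lt/(_ _ e1) := H.
rewrite /= => -[r /= r0 hr]; exists r => // h h0 hh th.
have : `|l - h^-1 *: (f (t + h) - f t)| < e / (d%:R + 1).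
  by apply: hr => //=; rewrite sub0r normrN.
rewrite ltr_pdivlMr; last by rewrite ltr_wpDl.
move=> K; rewrite enormB (le_trans (enorm_le_norm _))// (le_trans _ (ltW K))// mulrC ler_wpM2l//.
by rewrite lerDl.
Qed.

Lemma derive_ge0_cont f f' : (forall t, 0 <= t -> is_derive_ge0 f t (f' t)) -> cont_ge0 f.
Proof.
move=> H t e t0 e0; have [r r0 hr] := derive_ge0_dist (H t t0) ltr01.
pose M := enorm (f' t) + 1; have M0 : 0 < M by rewrite ltr_wpDl// enorm_ge0.
exists (Num.min r (e / M)); first by rewrite lt_min r0 divr_gt0.
move=> s s0; rewrite lt_min => /andP[sr se].
have [->|st] := eqVneq s t; first by rewrite subrr enorm0 ltW.
have h0 : s - t != 0 by rewrite subr_eq0.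
have := hr (s - t) h0 sr; rewrite addrC subrK => /(_ s0) K.
have E : f s - f t = (s - t) *: ((s - t)^-1 *: (f s - f t)) by rewrite scalerA mulfV// scale1r.
rewrite E enormZ; have : enorm ((s - t)^-1 *: (f s - f t)) <= M.
  rewrite -[X in enorm X](subrK (f' t)) (le_trans (enormD _ _))// /M addrC lerD2l//.
move=> K2; apply: (@le_trans _ _ (e / M * M)); last by rewrite divfK// gt_eqF.
by rewrite ler_pM ?enorm_ge0// ltW.
Qed.

(** Compactness enters through [segment_bound], with the reciprocal of the radius as the
    monotone bound. *)
Lemma heine_ge0 f (T e : R) : cont_ge0 f -> 0 < e -> exists2 r, 0 < r &
  forall s t, 0 <= s <= T -> 0 <= t <= T -> `|s - t| < r -> enorm (f s - f t) <= e.
Proof.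
move=> cf e0.
pose Q s B := forall s', 0 <= s' <= T -> `|s' - s| * B < 1 -> enorm (f s' - f s) <= e.
have [||B B0 hB] := @segment_bound R T Q.
- move=> s B B' BB h s' s'T hs; apply: h => //.
  by apply: le_lt_trans hs; rewrite ler_wpM2l.
- move=> t /andP[t0 tT]; have e2 : 0 < e / 2 by rewrite divr_gt0.
  have [r r0 hr] := cf t _ t0 e2; exists (r / 2); first by rewrite divr_gt0.
  exists (2 / r) => s /andP[s0 sT] sr s' /andP[s0' sT'].
  rewrite mulrA ltr_pdivrMr// mul1r => ss.
  rewrite (_ : f s' - f s = (f s' - f t) - (f s - f t)); last by rewrite opprB addrA subrK.
  rewrite (le_trans (enormD _ _))// enormN [leRHS]splitr lerD//; apply: hr => //.
    by rewrite -(subrKA s); apply: le_lt_trans (ler_normD _ _) _; lra.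
  by apply: lt_le_trans sr _; lra.
exists (B + 1)^-1; first by rewrite invr_gt0 ltr_wpDl.
move=> s t sT tT st; apply: hB => //.
apply: (@le_lt_trans _ _ (`|s - t| * (B + 1))); first by rewrite ler_wpM2l// lerDl.
by rewrite -ltr_pdivlMr ?ltr_wpDl// mul1r.
Qed.

Lemma derive_ge0_coord f (t : R) l i : 0 < t -> is_derive_ge0 f t l ->
  is_derive t 1 (fun s => f s ord0 i) (l ord0 i).
Proof.
move=> t0 H; apply/is_derive_dist => e e0; have [r r0 hr] := derive_ge0_dist H e0.
exists (Num.min r t); first by rewrite lt_min r0.
move=> h h0; rewrite lt_min => /andP[hr1 ht]; have th : 0 <= t + h.
  by move: ht; rewrite ltr_norml => /andP[? _]; lra.
apply: le_trans (hr h h0 hr1 th).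
by have := ler_coord_enorm (h^-1 *: (f (t + h) - f t) - l) i; rewrite !mxE.
Qed.

Lemma is_derive_dot (f : R -> 'rV[R]_d) (t : R) l y :
  (forall i, is_derive t 1 (fun s => f s ord0 i) (l ord0 i)) ->
  is_derive t 1 (fun s => dot (f s) y) (dot l y).
Proof.
move=> H; apply/is_derive_dist => e e0.
have e1 : 0 < e / (enorm y + 1) by rewrite divr_gt0// ltr_wpDl// enorm_ge0.
have [r r0 hr] := is_derive_coord_norm H e1; exists r => // h h0 hh.
rewrite (_ : _ - _ = dot (h^-1 *: (f (t + h) - f t) - l) y); last first.
  by rewrite dotDl dotNl dotZl dotDl dotNl.
rewrite (le_trans (normr_dot_le _ _))//.
apply: (@le_trans _ _ (e / (enorm y + 1) * (enorm y + 1))).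
  by rewrite ler_pM ?enorm_ge0// ?hr// lerDl.
by rewrite divfK// gt_eqF// ltr_wpDl// enorm_ge0.
Qed.

Lemma within_cont (g : R -> R) (a b : R) : 0 <= a ->
  (forall t e, 0 <= t -> 0 < e -> exists2 r, 0 < r & forall s, 0 <= s -> `|s - t| < r -> `|g s - g t| <= e) ->
  {within `[a, b], continuous g}.
Proof.
move=> a0 H; apply/subspace_continuousP => t; rewrite /= in_itv/= => /andP[at_ tb].
apply/cvgrPdist_le => e e0; have [r r0 hr] := H t e (le_trans a0 at_) e0.
exists r => //= s; rewrite /= => st; rewrite in_itv/= => /andP[as_ _].
by rewrite distrC; apply: hr; [exact: le_trans as_|rewrite distrC].
Qed.

(** By duality and the mean value theorem, which asks at the endpoint 0 only for
    continuity; the derivative there is one-sided. *)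
Lemma increment_le f f' c (a b e : R) : (forall t, 0 <= t -> is_derive_ge0 f t (f' t)) ->
  0 <= a -> a <= b -> 0 <= e -> (forall s, a < s < b -> enorm (f' s - c) <= e) ->
  enorm (f b - f a - (b - a) *: c) <= (b - a) * e.
Proof.
move=> H a0; rewrite le_eqVlt => /predU1P[->|ab] e0 hc.
  by rewrite !subrr scale0r subr0 enorm0 mul0r.
apply: enorm_le_dual; first by rewrite mulr_ge0// subr_ge0 ltW.
move=> y; have cf := derive_ge0_cont H.
have [s sab E] := @MVT R (fun s => dot (f s) y) (fun s => dot (f' s) y) a b ab
  (ltac:(move=> s; rewrite in_itv/= => /andP[as_ _]; apply: is_derive_dot => i;
         apply: derive_ge0_coord; [exact: le_lt_trans as_|apply: H; apply: ltW; exact: le_lt_trans as_]))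
  (ltac:(apply: within_cont => // t e' t0 e0';
    have e1 : 0 < e' / (enorm y + 1) by [rewrite divr_gt0// ltr_wpDl// enorm_ge0];
    have [r r0 hr] := cf t _ t0 e1; exists r => // s s0 st;
    rewrite -dotNl -dotDl (le_trans (normr_dot_le _ _))//;
    apply: (@le_trans _ _ (e' / (enorm y + 1) * (enorm y + 1)));
    [by rewrite ler_pM ?enorm_ge0// ?hr// lerDl|by rewrite divfK// gt_eqF// ltr_wpDl// enorm_ge0])).
move: sab; rewrite in_itv/= => sab.
rewrite !dotDl !dotNl dotZl E mulrC -mulrBr -mulrA ler_wpM2l ?subr_ge0 ?(ltW ab)//.
rewrite -dotNl -dotDl (le_trans (dot_le _ _))// ler_wpM2r ?enorm_ge0// hc//.
Qed.

End halfline.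

(** * Solutions of the particle system as perturbed runs of the scheme *)

Section reflection.
Context {R : realType}.
Local Notation mu := (@lebesgue_measure R).
Local Notation RM := (measurableTypeR R).

Lemma Rint_reflect (c : R) (f : RM -> R) : measurable_fun setT f ->
  \int[mu]_x f (c - x) = \int[mu]_x f x.
Proof.
move=> mf; have mf' : measurable_fun setT (EFin \o f) by exact/measurable_EFinP.
rewrite /Rintegral; congr fine; rewrite integralE [RHS]integralE; congr (_ - _)%E.
  rewrite -[RHS](ge0_integral_reflect c (measurable_funepos mf') (funepos_ge0 (EFin \o f))).
  by apply: eq_integral => x _; rewrite !funeposE.
rewrite -[RHS](ge0_integral_reflect c (measurable_funeneg mf') (funeneg_ge0 (EFin \o f))).
  by apply: eq_integral => x _; rewrite !funenegE.
Qed.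

Lemma fin_min_pos (n : nat) (Q : 'I_n -> R -> Prop) :
  (forall i r r', r' <= r -> Q i r -> Q i r') -> (forall i, exists2 r, 0 < r & Q i r) ->
  exists2 r, 0 < r & forall i, Q i r.
Proof.
move=> Qm Qe; pose r i := sval (cid2 (Qe i)).
have r0 i : 0 < r i by rewrite /r; case: cid2.
have rQ i : Q i (r i) by rewrite /r; case: cid2.
exists (\big[Num.min/1]_i r i).
  by elim/big_ind: _ => // x y x0 y0; rewrite lt_min x0.
move=> i; apply: Qm (rQ i); exact: bigmin_le_cond.
Qed.
End reflection.

Section coupling.
Context {R : realType} {d : nat}.
Local Notation phase := (@phase R d).
Variables (S : 'rV[R]_d -> R).
Hypothesis hS : C20 S.

Definition Sig1 : R := fine (normLoo (enorm \o grad S)).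
Definition Sig2 : R := fine (normLoo (opnorm \o hess S)).

Lemma Sig1_ge0 : 0 <= Sig1.
Proof. by rewrite fine_ge0// normLoo_ge0. Qed.

Lemma Sig2_ge0 : 0 <= Sig2.
Proof. by rewrite fine_ge0// normLoo_ge0. Qed.

Lemma measurable_grad f : C1 f -> measurable_fun [set: 'rV[R]_d] (grad f).
Proof.
move=> cf; apply: measurable_fun_rV => i.
rewrite (_ : _ \o _ = partial i f); last by apply/funext => x; rewrite /rV_coor/= mxE.
by apply: continuous_measurable_rV; case: (cf i).
Qed.

Variables (N : nat) (c : 'I_N -> 'I_N -> R).
Hypothesis c0 : forall k j, 0 <= c k j.
Hypothesis c1 : forall k, \sum_j c k j <= 1.

(** The factor 2 comes from the two positions in the interaction: that of the particle
    and that of its partner in the past. *)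
Lemma delayed_force_lip (F : nat -> 'rV[R]_d -> 'rV[R]_d) (w : nat -> R) (L : R)
    (X Y : nat -> 'I_N -> phase) m (rho : R) : 0 <= rho ->
  (forall x y, enorm (F m x - F m y) <= L * enorm (x - y)) -> 0 <= L ->
  (forall l j, (l <= m)%N -> enorm ((X l j).1 - (Y l j).1) <= rho) -> forall k,
  enorm (delayed_force F (grad S) w c X m k (X m k).1 -
         delayed_force F (grad S) w c Y m k (Y m k).1)
   <= (L + 2 * Sig2 * \sum_(l < m) `|w l|) * rho.
Proof.
move=> rho0 hL L0 hXY k; rewrite /delayed_force opprD addrACA mulrDl.
apply: le_trans (enormD _ _) _; apply: lerD.
  by apply: le_trans (hL _ _) _; rewrite ler_wpM2l// hXY.
rewrite -sumrB mulr_sumr mulr_suml; apply: le_trans (enorm_sum _ _ _) _.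
apply: ler_sum => l _; rewrite -scalerBr enormZ -sumrB.
rewrite (_ : 2 * Sig2 * `|w l| * rho = `|w l| * (2 * Sig2 * rho)); last by ring.
rewrite ler_wpM2l//; apply: le_trans (enorm_sum _ _ _) _.
apply: (@le_trans _ _ (\sum_j c k j * (2 * Sig2 * rho))).
  apply: ler_sum => j _; rewrite -scalerBr enormZ ger0_norm// ler_wpM2l//.
  apply: le_trans (C20_grad_lip hS _ _) _; rewrite -/Sig2 (_ : 2 * Sig2 * rho = Sig2 * (2 * rho)); last by ring.
  rewrite ler_wpM2l ?Sig2_ge0//.
  set x := (X m k).1; set y := (Y m k).1.
  rewrite (_ : _ - _ = (x - y) - ((X (m - l)%N j).1 - (Y (m - l)%N j).1)); last first.
    by apply/rowP => i; rewrite !mxE; ring.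
  by rewrite mulr_natl mulr2n (le_trans (enormD _ _))// enormN lerD// hXY// leq_subr.
by rewrite -mulr_suml ler_piMl// mulr_ge0// mulr_ge0// Sig2_ge0.
Qed.

Lemma measurable_delayed_force (F : nat -> 'rV[R]_d -> 'rV[R]_d) (w : nat -> R)
    (X : nat -> 'I_N -> phase) m k : measurable_fun setT (F m) ->
  measurable_fun setT (delayed_force F (grad S) w c X m k).
Proof.
move=> mF; apply: measurable_rV_D => //; apply: measurable_rV_sum => l.
apply: measurable_rV_Z; apply: measurable_rV_sum => j; apply: measurable_rV_Z.
apply: (measurableT_comp (measurable_grad (C20_C1 hS))).
by apply: measurable_rV_D => //; exact: measurable_cst.
Qed.

Lemma measurable_scheme dT (T : measurableType dT) (z : T -> 'I_N -> phase)
    (h : R) (F : nat -> 'rV[R]_d -> 'rV[R]_d) (w : nat -> R) :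
  (forall m, measurable_fun setT (F m)) ->
  (forall k, measurable_fun setT (fun x => z x k)) -> forall m k,
  measurable_fun setT (fun x => scheme h F (grad S) w c (z x) m k).
Proof.
move=> mF mz; elim/ltn_ind => -[|m] IH k; first exact: mz.
under eq_fun => x do rewrite schemeS /sstep.
have m1 l j : (l <= m)%N -> measurable_fun setT (fun x => (scheme h F (grad S) w c (z x) l j).1).
  move=> lm; apply: (measurableT_comp measurable_fst); exact: IH.
have mu : measurable_fun setT (fun x => (scheme h F (grad S) w c (z x) m k).2 +
     h *: delayed_force F (grad S) w c (scheme h F (grad S) w c (z x)) m k (scheme h F (grad S) w c (z x) m k).1).
  apply: measurable_rV_D.
    by apply: (measurableT_comp measurable_snd); exact: IH.
  apply: measurable_rV_Z; apply: measurable_rV_D.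
    by apply: (measurableT_comp (mF m)); exact: m1.
  apply: measurable_rV_sum => l; apply: measurable_rV_Z; apply: measurable_rV_sum => j.
  apply: measurable_rV_Z; apply: (measurableT_comp (measurable_grad (C20_C1 hS))).
  apply: measurable_rV_D; first exact: m1.
  rewrite (_ : (fun x => _) = (fun x => -1 *: (scheme h F (grad S) w c (z x) (m - l)%N j).1)); last first.
    by apply/funext => x; rewrite scaleN1r.
  by apply: measurable_rV_Z; apply: m1; exact: leq_subr.
apply: measurable_pairf => //.
by apply: measurable_rV_D; [exact: m1|exact: measurable_rV_Z].
Qed.
End coupling.

Section solution.
Context {R : realType} {d : nat}.
Local Notation phase := (@phase R d).
Local Notation mu := (@lebesgue_measure R).
Local Notation RM := (measurableTypeR R).
Variables (V S : 'rV[R]_d -> R) (Phi : R -> 'rV[R]_d -> R) (p : R -> R).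
Hypotheses (cV : C1 V) (hS : C20 S) (hp : locally_integrable setT p).
Hypothesis hPhi : forall t, 0 <= t -> W2oo (Phi t) /\ C1 (Phi t).
Hypothesis cPhi : forall t, 0 <= t ->
  normW2oo (Phi s \- Phi t) @[s --> within [set s | 0 <= s] (nbhs t)] --> 0%E.
Variables (N : nat) (z0 : 'I_N -> phase) (q v : 'I_N -> R -> 'rV[R]_d).
Hypothesis N0 : (0 < N)%N.
Hypothesis sol : is_solution V S Phi p z0 q v.

Let Q (j : 'I_N) (s : R) : 'rV[R]_d := q j (Num.max s 0).

(** The memory force felt at [x]; the past is extended to negative times by
    the initial position, where the kernel has been cut anyway. *)
Definition mem_integrand (t : R) (x : 'rV[R]_d) (s : R) : 'rV[R]_d :=
  N%:R^-1 *: \sum_j grad S (x - Q j (t - s)).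

Definition mem_field (t : R) (x : 'rV[R]_d) : 'rV[R]_d := pint p 0 t (mem_integrand t x).

Definition accel (k : 'I_N) (t : R) : 'rV[R]_d :=
  - grad (V \+ Phi t) (q k t) + memory_force S p q k t.

Let dq k : forall t, 0 <= t -> is_derive_ge0 (q k) t (v k t).
Proof. by move=> t t0; have [_ /(_ t t0 k)[]] := sol. Qed.

Let dv k : forall t, 0 <= t -> is_derive_ge0 (v k) t (accel k t).
Proof. by move=> t t0; have [_ /(_ t t0 k)[]] := sol. Qed.

Let cq k : cont_ge0 (q k). Proof. exact: derive_ge0_cont (@dq k). Qed.
Let cv k : cont_ge0 (v k). Proof. exact: derive_ge0_cont (@dv k). Qed.

Let contQ j i : continuous (fun s : R => Q j s ord0 i).
Proof.
move=> s; apply/cvgrPdist_le => e e0.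
have m0 (t : R) : 0 <= Num.max t 0 by rewrite le_max lexx orbT.
have [r r0 hr] := @cq j _ _ (m0 s) e0.
apply/nbhs_ballP; exists r => //= t; rewrite /ball/= distrC => st.
have := ler_coord_enorm (Q j t - Q j s) i; rewrite !mxE distrC => /le_trans; apply.
apply: hr => //; apply: le_lt_trans st.
by case: (leP t 0) => ?; case: (leP s 0) => ?; rewrite ?subrr ?normr0// ler_norml;
   apply/andP; split; have := ler_norm (t - s); have := ler_norm (- (t - s)); rewrite normrN; lra.
Qed.

Let S1 := Sig1 S.
Let S2 := Sig2 S.
Let gS x : enorm (grad S x) <= S1 := C20_grad_le hS x.
Let lS x y : enorm (grad S x - grad S y) <= S2 * enorm (x - y) := C20_grad_lip hS x y.

Let mean_le (u : 'I_N -> 'rV[R]_d) (B : R) : (forall j, enorm (u j) <= B) ->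
  enorm (N%:R^-1 *: \sum_j u j) <= B.
Proof.
move=> hu; rewrite enormZ ger0_norm ?invr_ge0// ler_pdivrMl ?ltr0n//.
apply: le_trans (enorm_sum _ _ _) _; apply: (@le_trans _ _ (\sum_(j < N) B)).
  exact: ler_sum.
by rewrite sumr_const card_ord mulr_natl.
Qed.

Lemma mem_integrand_meas t x : bdd_meas (mem_integrand t x).
Proof.
split; last by exists S1 => s; apply: mean_le => j.
move=> i; rewrite (_ : (fun s : RM => _) = (fun s : RM => (N%:R^-1 *: \sum_j (grad S \o (fun s => x - Q j (t - s))) s) ord0 i)) //.
apply: (@measurableT_comp _ _ _ _ _ _ (rV_coor i)); first exact: measurable_rV_coor.
apply: measurable_rV_Z; apply: measurable_rV_sum => j.
apply: (measurableT_comp (measurable_grad (C20_C1 hS))).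
apply: measurable_fun_rV => i'.
rewrite (_ : _ \o _ = (fun s : RM => x ord0 i' - Q j (t - s) ord0 i')); last first.
  by apply/funext => s; rewrite /rV_coor/= !mxE.
apply: measurable_funB => //.
apply: (@measurableT_comp _ _ _ _ _ _ (fun s : RM => Q j s ord0 i') _ (fun s : RM => t - s)).
  exact: continuous_measurable_fun (@contQ j i').
exact: measurable_funB.
Qed.

(** The change of variable s -> t - s puts the kernel at a fixed place and the past of
    the solution in the second factor. *)
Lemma memory_forceE k t : 0 <= t -> memory_force S p q k t = mem_field t (q k t).
Proof.
move=> t0; apply/rowP => i; rewrite !mxE.
pose g (s : RM) : R := p s * \1_(`[0, t]%classic : set R) s * mem_integrand t (q k t) s ord0 i.
have mp : measurable_fun [set: RM] p by case: hp.
have mK := mem_integrand_meas t (q k t).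
have mg : measurable_fun [set: RM] g.
  apply: measurable_funM; last by case: mK => mK _; exact: mK.
  by apply: measurable_funM => //; apply: measurable_indic; exact: measurable_itv.
rewrite [LHS]Rintegral_mkcond.
transitivity (\int[mu]_s g (t - s)).
  congr Rintegral; apply/funext => s; rewrite patchE /g/= indicE.
  have -> : (t - s \in `[0, t]%classic) = (s \in `[0, t]%classic).
    have H (u : R) : (t - u \in `[0, t]%classic) = (u \in `[0, t]%classic).
      by apply/idP/idP; rewrite inE/= in_itv/= => /andP[h1 h2]; rewrite inE/= in_itv/=; apply/andP; split; lra.
    exact: H.
  case: ifPn => sI; last by rewrite mulr0 mul0r.
  rewrite mulr1; congr (_ * _); rewrite /mem_integrand mxE summxE; congr (_ * _).
  apply: eq_bigr => j _; rewrite subKr /Q max_l//.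
  by move: sI; rewrite inE/= in_itv/= => /andP[].
rewrite Rint_reflect//.
have Z : {ae mu, forall s : RM, g s = pcut p 0 t s * mem_integrand t (q k t) s ord0 i}.
  exists [set 0]; split; [exact: measurable_set1|exact: lebesgue_measure_set1|].
  move=> s /= h; apply: contrapT => s0; apply: h; rewrite /g /pcut; congr (_ * _ * _).
  rewrite !indicE; congr (_%:R); congr nat_of_bool; apply/idP/idP; rewrite !inE/= !in_itv/= => /andP[h1 ->];
    rewrite andbT; last exact: ltW.
  by rewrite lt_neqAle h1 andbT eq_sym; apply/eqP.
have ip := @pint_intg _ _ p hp 0 t (mem_integrand t (q k t)) i mK.
rewrite /Rintegral; congr fine; apply: ae_eq_integral => //.
- exact/measurable_EFinP.
- by apply/measurable_EFinP; exact: intg_measurable ip.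
- by apply: filterS Z => s h _ /=; rewrite h.
Qed.

Lemma mem_field_le t x : enorm (mem_field t x) <= S1 * pmass p 0 t.
Proof.
apply: pint_le => //; [exact: Sig1_ge0|exact: mem_integrand_meas|].
by move=> s _; apply: mean_le => j.
Qed.

Lemma mem_field_lip t x y : enorm (mem_field t x - mem_field t y) <=
  S2 * pmass p 0 t * enorm (x - y).
Proof.
rewrite /mem_field -pintB//; try exact: mem_integrand_meas.
rewrite mulrAC; apply: pint_le => //; first by rewrite mulr_ge0 ?enorm_ge0// Sig2_ge0.
  by apply: bdd_measB; exact: mem_integrand_meas.
move=> s _; rewrite /mem_integrand -scalerBr -sumrB; apply: mean_le => j.
by apply: le_trans (lS _ _) _; rewrite opprB addrA subrK.
Qed.

Lemma measurable_mem_field t : measurable_fun [set: 'rV[R]_d] (mem_field t).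
Proof.
apply: measurable_fun_rV => i; apply: continuous_measurable_rV.
apply: (@lipschitz_continuous _ _ _ (S2 * pmass p 0 t)) => x y.
apply: le_trans (mem_field_lip t x y).
have -> : (rV_coor i \o mem_field t) x - (rV_coor i \o mem_field t) y = (mem_field t x - mem_field t y) ord0 i.
  by rewrite /rV_coor/= [RHS]mxE; congr (_ + _); rewrite [RHS]mxE.
exact: ler_coord_enorm.
Qed.

Let heine_q T e : 0 < e -> exists2 r, 0 < r & forall k s t, 0 <= s <= T -> 0 <= t <= T ->
  `|s - t| < r -> enorm (q k s - q k t) <= e.
Proof.
move=> e0; apply: (@fin_min_pos _ _ (fun k r => forall s t, 0 <= s <= T -> 0 <= t <= T ->
  `|s - t| < r -> enorm (q k s - q k t) <= e)).
  by move=> k r r' rr h s t sT tT st; apply: h => //; exact: lt_le_trans rr.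
by move=> k; apply: heine_ge0 => //; exact: cq.
Qed.

Let heine_v T e : 0 < e -> exists2 r, 0 < r & forall k s t, 0 <= s <= T -> 0 <= t <= T ->
  `|s - t| < r -> enorm (v k s - v k t) <= e.
Proof.
move=> e0; apply: (@fin_min_pos _ _ (fun k r => forall s t, 0 <= s <= T -> 0 <= t <= T ->
  `|s - t| < r -> enorm (v k s - v k t) <= e)).
  by move=> k r r' rr h s t sT tT st; apply: h => //; exact: lt_le_trans rr.
by move=> k; apply: heine_ge0 => //; exact: cv.
Qed.

Let grad_cont (f : 'rV[R]_d -> R) x e : C1 f -> 0 < e -> exists2 r, 0 < r & forall y, enorm (y - x) < r ->
  enorm (grad f y - grad f x) <= e.
Proof.
move=> cf e0; have [r r0 hr] := @partial_near_uniform _ _ f x (e / (d%:R + 1)) cf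
  (ltac:(by rewrite divr_gt0// ltr_wpDl)).
exists r => // y yx; apply: le_trans (enorm_le_sum _) _.
apply: (@le_trans _ _ (\sum_(i < d) e / (d%:R + 1))).
  by apply: ler_sum => i _; rewrite !mxE; apply: hr; apply: le_lt_trans (norm_le_enorm _) yx.
rewrite sumr_const card_ord -[leLHS]mulr_natr mulrAC ler_pdivrMr ?ltr_wpDl// ler_wpM2l ?ltW//.
by rewrite ?lerDl ?ltrDl.
Qed.

Let cont_ext k : cont_ge0 (fun t => grad (V \+ Phi t) (q k t)).
Proof.
move=> t e t0 e0; have e4 : 0 < e / 4 by rewrite divr_gt0.
have e34 : e / 4 + (e / 4 + e / 4) <= e by lra.
have [_ ht] := hPhi t0.
have [r1 r10 h1] := grad_cont (q k t) cV e4.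
have [r2 r20 h2] := grad_Phi_cont hPhi cPhi t0 e4.
have [r3 r30 h3] := grad_cont (q k t) ht e4.
have [r4 r40 h4] := @cq k _ _ t0 (ltac:(by rewrite divr_gt0// lt_min r10) : 0 < Num.min r1 r3 / 2).
exists (Num.min r2 r4); first by rewrite lt_min r20.
move=> s s0; rewrite lt_min => /andP[sr2 sr4]; have [_ hs] := hPhi s0.
have := h4 s s0 sr4 => qq.
have qlt : enorm (q k s - q k t) < Num.min r1 r3.
  by apply: le_lt_trans qq _; rewrite ltr_pdivrMr// ltr_pMr ?ltr1n// lt_min r10.
move: qlt; rewrite lt_min => /andP[q1 q3].
rewrite (gradD cV hs) (gradD cV ht).
have := h1 _ q1; have := h2 s s0 sr2 (q k s); have := h3 _ q3.
set A := grad (Phi t) (q k s); set B := grad V _; set C := grad (Phi s) _.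
set B' := grad V _; set C' := grad (Phi t) _ => i1 i2 i3.
rewrite (_ : _ - _ = (B - B') + ((C - A) + (A - C'))); last first.
  by apply/rowP => i; rewrite !mxE; ring.
exact: le_trans (enormD _ _) (le_trans (lerD i3 (le_trans (enormD _ _) (lerD i2 i1))) e34).
Qed.

Let heine_mem T e : 0 < e -> exists2 r, 0 < r & forall k s t, 0 <= s <= T -> 0 <= t <= T ->
  `|s - t| < r -> enorm (mem_field s (q k s) - mem_field t (q k t)) <= e.
Proof.
move=> e0.
pose A := 2 * S2 * pmass p 0 T + S1 + 1.
have S10 : 0 <= S1 := Sig1_ge0 S. have S20 : 0 <= S2 := Sig2_ge0 S.
have PT : 0 <= pmass p 0 T by exact: pmass_ge0.
have A0 : 0 < A by rewrite /A ltr_wpDl// addr_ge0// !mulr_ge0.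
have eA : 0 < e / A by rewrite divr_gt0.
have [r1 r10 h1] := heine_q T eA.
have [r2 r20 h2] := pmass_small hp T eA.
exists (Num.min r1 r2); first by rewrite lt_min r10.
suff main k s t : 0 <= s <= T -> 0 <= t <= T -> s <= t -> `|s - t| < Num.min r1 r2 ->
    enorm (mem_field t (q k t) - mem_field s (q k s)) <= e.
  move=> k s t sT tT st; have [le|lt] := leP s t.
    by rewrite enormB; apply: main.
  by apply: main => //; [exact: ltW|rewrite distrC].
move=> /andP[s0 sT] /andP[t0 tT] le; rewrite lt_min => /andP[st1 st2].
have abc : 0 <= s <= t by rewrite s0.
rewrite /mem_field (pintD hp abc (mem_integrand_meas _ _)) addrAC.
rewrite -pintB//; try exact: mem_integrand_meas.
apply: le_trans (enormD _ _) _.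
have i1 : enorm (pint p s t (mem_integrand t (q k t))) <= S1 * (e / A).
  apply: (@le_trans _ _ (S1 * pmass p s t)).
    by apply: pint_le => //; [exact: mem_integrand_meas|move=> u _; apply: mean_le => j].
  by rewrite ler_wpM2l// h2//; move: st2; rewrite distrC ger0_norm ?subr_ge0.
have i2 : enorm (pint p 0 s (fun u => mem_integrand t (q k t) u - mem_integrand s (q k s) u)) <=
   (S2 * (2 * (e / A))) * pmass p 0 s.
  apply: pint_le => //; first by rewrite mulr_ge0// mulr_ge0// ltW.
    by apply: bdd_measB; exact: mem_integrand_meas.
  move=> u /andP[u0 us]; rewrite /mem_integrand -scalerBr -sumrB; apply: mean_le => j.
  apply: le_trans (lS _ _) _; rewrite ler_wpM2l//.
  rewrite (_ : _ - _ = (q k t - q k s) - (Q j (t - u) - Q j (s - u))); last first.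
    by apply/rowP => i; rewrite !mxE; ring.
  rewrite (le_trans (enormD _ _))// enormN mulr2n mulrDl mul1r lerD//.
    by apply: h1; rewrite ?s0 ?t0// distrC.
  rewrite /Q !max_l; [|lra..]; apply: h1; [lra..|].
  by rewrite opprB addrA subrK distrC.
have i3 : pmass p 0 s <= pmass p 0 T by apply: (pmass_mono hp); rewrite s0.
apply: le_trans (lerD i2 i1) _.
apply: (@le_trans _ _ (S2 * (2 * (e / A)) * pmass p 0 T + S1 * (e / A))).
  by rewrite lerD2r ler_wpM2l// mulr_ge0// mulr_ge0// ltW.
rewrite (_ : _ + _ = (A - 1) * (e / A)); last by rewrite /A; ring.
by rewrite mulrBl mulrC divfK ?gt_eqF// gerBl mul1r ltW.
Qed.

Lemma heine_accel T e : 0 < e -> exists2 r, 0 < r & forall k s t, 0 <= s <= T -> 0 <= t <= T ->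
  `|s - t| < r -> enorm (accel k s - accel k t) <= e.
Proof.
move=> e0; have e2 : 0 < e / 2 by rewrite divr_gt0.
have [r1 r10 h1] := heine_mem T e2.
have [r2 r20 h2] : exists2 r, 0 < r & forall k s t, 0 <= s <= T -> 0 <= t <= T ->
    `|s - t| < r -> enorm (grad (V \+ Phi s) (q k s) - grad (V \+ Phi t) (q k t)) <= e / 2.
  apply: (@fin_min_pos _ _ (fun k r => forall s t, 0 <= s <= T -> 0 <= t <= T ->
  `|s - t| < r -> enorm (grad (V \+ Phi s) (q k s) - grad (V \+ Phi t) (q k t)) <= e / 2)).
    by move=> k r r' rr h s t sT tT st; apply: h => //; exact: lt_le_trans rr.
  by move=> k; exact: heine_ge0 (@cont_ext k) e2.
exists (Num.min r1 r2); first by rewrite lt_min r10.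
move=> k s t sT tT; rewrite lt_min => /andP[st1 st2].
have /andP[s0 _] := sT; have /andP[t0 _] := tT.
rewrite /accel !memory_forceE// opprD opprK addrACA (le_trans (enormD _ _))//.
rewrite [leRHS]splitr lerD//; last exact: h1.
by rewrite addrC enormB; exact: h2.
Qed.

(** Velocities and accelerations are uniformly continuous on [0, T]. *)
Lemma sampled_solution T e : 0 < e -> exists2 r, 0 < r & forall h m k, 0 < h -> h < r ->
  m.+1%:R * h <= T ->
  enorm (v k (m.+1%:R * h) - v k (m%:R * h) - h *: accel k (m%:R * h)) <= h * e /\
  enorm (q k (m.+1%:R * h) - q k (m%:R * h) - h *: v k (m.+1%:R * h)) <= h * e.
Proof.
move=> e0; have [r1 r10 h1] := heine_accel T e0; have [r2 r20 h2] := heine_v T e0.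
exists (Num.min r1 r2); first by rewrite lt_min r10.
move=> h m k h0; rewrite lt_min => /andP[hr1 hr2] mT.
have E : m.+1%:R * h - m%:R * h = h by rewrite -mulrBl -natrB// subSnn mul1r.
have mh0 : 0 <= m%:R * h by rewrite mulr_ge0// ltW.
split.
- have := @increment_le _ _ (v k) (accel k) (accel k (m%:R * h)) (m%:R * h) (m.+1%:R * h) e (@dv k) mh0.
  rewrite E; apply; [lra|exact: ltW|] => s /andP[s1 s2]; apply: h1; [lra|lra|].
  rewrite ger0_norm; lra.
- have := @increment_le _ _ (q k) (v k) (v k (m.+1%:R * h)) (m%:R * h) (m.+1%:R * h) e (@dq k) mh0.
  rewrite E; apply; [lra|exact: ltW|] => s /andP[s1 s2]; apply: h2; [lra|lra|].
  rewrite distrC ger0_norm; lra.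
Qed.

(** Positions vary little over a cell, while the kernel, which may be unbounded, is
    integrated exactly. *)
Lemma memory_quadrature T e : 0 < e -> exists2 r, 0 < r & forall h m k, 0 < h -> h < r ->
  m%:R * h <= T ->
  enorm (mem_field (m%:R * h) (q k (m%:R * h)) -
    \sum_(l < m) pweight p h l *: \sum_j N%:R^-1 *: grad S (q k (m%:R * h) - q j ((m - l)%N%:R * h))) <= e.
Proof.
move=> e0.
pose A := S2 * pmass p 0 T + 1.
have S20 : 0 <= S2 := Sig2_ge0 S.
have PT : 0 <= pmass p 0 T by exact: pmass_ge0.
have A0 : 0 < A by rewrite /A ltr_wpDl// mulr_ge0.
have eA : 0 < e / A by rewrite divr_gt0.
have [r r0 hr] := heine_q T eA; exists r => // h m k h0 hh mT.
have mh0 : 0 <= m%:R * h by rewrite mulr_ge0// ltW.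
apply: (@le_trans _ _ (S2 * (e / A) * pmass p 0 (m%:R * h))).
  apply: (@pint_quadrature _ _ p hp h (S2 * (e / A)) m (mem_integrand (m%:R * h) (q k (m%:R * h)))
    (fun l => \sum_j N%:R^-1 *: grad S (q k (m%:R * h) - q j ((m - l)%N%:R * h)))).
  - exact: ltW.
  - by rewrite mulr_ge0// ltW.
  - exact: mem_integrand_meas.
  move=> l s lm /andP[s1 s2]; rewrite -scaler_sumr /mem_integrand -scalerBr -sumrB.
  apply: mean_le => j; apply: le_trans (lS _ _) _; rewrite ler_wpM2l//.
  rewrite (_ : _ - _ = q j ((m - l)%N%:R * h) - Q j (m%:R * h - s)); last first.
    by apply/rowP => i; rewrite !mxE; ring.
  have E : (m - l)%N%:R * h = m%:R * h - l%:R * h :> R by rewrite natrB ?mulrBl// ltnW.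
  have lm' : l.+1%:R * h <= m%:R * h by rewrite ler_wpM2r ?(ltW h0)// ler_nat.
  have l0 : 0 <= l%:R * h by rewrite mulr_ge0// ltW.
  have lS' : l.+1%:R * h = l%:R * h + h by rewrite -natr1 mulrDl mul1r.
  rewrite /Q max_l; last lra.
  rewrite E; apply: hr; [lra|lra|]; rewrite ger0_norm; lra.
apply: (@le_trans _ _ (S2 * (e / A) * pmass p 0 T)).
  rewrite ler_wpM2l//; first by rewrite mulr_ge0// ltW.
  by apply: (pmass_mono hp); rewrite mh0.
rewrite (_ : _ * _ = (A - 1) * (e / A)); last by rewrite /A; ring.
by rewrite mulrBl mulrC divfK ?gt_eqF// gerBl mul1r ltW.
Qed.
End solution.

(** * The constant C as a bound for discrete sums *)

Section lower_sums.
Context {R : realType}.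
Local Notation mu := (@lebesgue_measure R).
Local Notation RM := (measurableTypeR R).
Local Open Scope ereal_scope.

(** The integral of a nonnegative function is a supremum over simple minorants,
    so it is monotone without any measurability. *)
Lemma ge0_le_integralT (f g : RM -> \bar R) : (forall x, 0 <= f x) -> (forall x, f x <= g x) ->
  \int[mu]_x f x <= \int[mu]_x g x.
Proof.
move=> f0 fg; rewrite !ge0_integralTE//; last by move=> x; exact: le_trans (f0 x) (fg x).
apply: le_ereal_sup => _ [h hf <-]; exists h => // x; exact: le_trans (hf x) (fg x).
Qed.

Definition step_fun (h : R) (k n : nat) (c : nat -> R) (t : RM) : \bar R :=
  \sum_(k <= i < n) (c i * \1_(`[i%:R * h, i.+1%:R * h[%classic : set R) t)%:E.

Lemma integral_step_fun h k n c : (0 <= h)%R -> (forall i, (0 <= c i)%R) ->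
  \int[mu]_t step_fun h k n c t = (\sum_(k <= i < n) h * c i)%R%:E.
Proof.
move=> h0 c0; rewrite /step_fun ge0_integral_sum//.
- rewrite -sumEFin; apply: eq_bigr => i _.
  have mI : measurable (`[i%:R * h, i.+1%:R * h[%classic : set RM)%R by exact: measurable_itv.
  under eq_integral => t _ do rewrite EFinM.
  rewrite ge0_integralZl//; last by rewrite lee_fin.
    rewrite integral_indic// setIT [in RHS]mulrC EFinM; congr (_ * _).
    have H : mu (`[i%:R * h, i.+1%:R * h[%classic : set RM)%R = h%:E.
      rewrite lebesgue_measure_itv/= lte_fin.
      have E : (i.+1%:R * h - i%:R * h = h :> R)%R by rewrite -mulrBl -natrB// subSnn mul1r.
      case: ifPn => [_|]; first by rewrite -EFinB E.
      by rewrite -leNgt -subr_le0 E => hle; congr EFin; apply/eqP; rewrite eq_le h0 hle.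
    exact: H.
  by apply/measurable_EFinP; exact: measurable_indic.
- move=> i; apply/measurable_EFinP; apply: measurable_funM => //.
- by move=> i t _; rewrite lee_fin mulr_ge0.
Qed.

Lemma step_fun_out h k n c t : (0 <= h)%R -> (t < k%:R * h)%R \/ (n%:R * h <= t)%R ->
  step_fun h k n c t = 0.
Proof.
move=> h0 H; rewrite /step_fun big_nat big1// => i /andP[ki iN].
have -> : (\1_(`[i%:R * h, i.+1%:R * h[%classic : set R) t = 0 :> R)%R.
  rewrite indicE; case: (boolP (t \in _)) => //; rewrite inE/= in_itv/= => /andP[h1 h2].
  exfalso; case: H => H.
    have : (k%:R * h <= i%:R * h)%R by rewrite ler_wpM2r// ler_nat.
    by move=> h3; have := le_lt_trans (le_trans h3 h1) H; rewrite ltxx.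
  have : (i.+1%:R * h <= n%:R * h)%R by rewrite ler_wpM2r// ler_nat.
  by move=> h3; have := lt_le_trans h2 (le_trans h3 H); rewrite ltxx.
by rewrite mulr0.
Qed.

Lemma step_fun_in h k n c i t : (0 <= h)%R -> (k <= i < n)%N ->
  (i%:R * h <= t < i.+1%:R * h)%R -> step_fun h k n c t = (c i)%:E.
Proof.
move=> h0 /andP[ki iN] tI; have h1 : (0 < h)%R.
  rewrite lt_neqAle h0 andbT eq_sym; apply/eqP => hz; move: tI; rewrite hz !mulr0.
  by move=> /andP[/le_lt_trans H /H]; rewrite ltxx.
rewrite /step_fun (big_cat_nat _ (n := i))//=; last exact: ltnW.
rewrite [X in _ + X]big_ltn//.
rewrite big_nat big1 => [|j /andP[kj ji]]; last first.
  rewrite indicE memNset ?mulr0//= in_itv/= => /andP[_ H].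
  have : (j.+1%:R * h <= i%:R * h)%R by rewrite ler_wpM2r// ler_nat.
  move=> H2; have /andP[H3 _] := tI.
  by have := lt_le_trans H (le_trans H2 H3); rewrite ltxx.
rewrite big_nat big1 => [|j /andP[kj ji]]; last first.
  rewrite indicE memNset ?mulr0//= in_itv/= => /andP[H _].
  have : (i.+1%:R * h <= j%:R * h)%R by rewrite ler_wpM2r// ler_nat.
  move=> H2; have /andP[_ H3] := tI.
  by have := lt_le_trans H3 (le_trans H2 H); rewrite ltxx.
by rewrite add0e adde0 indicE mem_set ?mulr1.
Qed.

(** Lower Riemann sums on the cells of a grid; the integrand need not be measurable,
    which spares the measurability of [r2] and of the inner integrals of [Cst]. *)
Lemma lower_sum (h : R) (k n : nat) (c : nat -> R) (D : set RM) (f : RM -> \bar R) :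
  (0 < h)%R -> (forall i, (0 <= c i)%R) -> (forall t, D t -> 0 <= f t) ->
  (forall i (t : R), (k <= i < n)%N -> (i%:R * h <= t < i.+1%:R * h)%R ->
     D t /\ (c i)%:E <= f t) ->
  ((\sum_(k <= i < n) h * c i)%R)%:E <= \int[mu]_(t in D) f t.
Proof.
move=> h0 c0 f0 cf; rewrite -(integral_step_fun _ _ (ltW h0) c0).
rewrite [leRHS]integral_mkcond; apply: ge0_le_integralT => t.
  rewrite /step_fun big_nat sume_ge0// => i _.
  by rewrite lee_fin mulr_ge0.
have F0 : 0 <= (f \_ D) t.
  by rewrite patchE; case: ifPn => //; rewrite inE => /f0.
have [tk|tk] := ltP t (k%:R * h)%R; first by rewrite step_fun_out//; [exact: ltW|left].
have [tn|tn] := leP (n%:R * h)%R t; first by rewrite step_fun_out//; [exact: ltW|right].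
have t0 : (0 <= t / h)%R.
  by rewrite divr_ge0 ?(ltW h0)// (le_trans _ tk)// mulr_ge0// ltW.
pose i := Num.truncn (t / h).
have tI : (i%:R * h <= t < i.+1%:R * h)%R.
  by rewrite -ler_pdivlMr// -ltr_pdivrMr// truncn_itv.
have iI : (k <= i < n)%N.
  have /andP[h1 h2] := tI; clear -h0 h1 h2 tk tn; clearbody i; apply/andP; split.
    rewrite -ltnS -(ltr_nat R) -(ltr_pM2r h0); exact: le_lt_trans tk h2.
  rewrite -(ltr_nat R) -(ltr_pM2r h0); exact: le_lt_trans h1 tn.
rewrite (step_fun_in _ (ltW h0) iI tI); have [Dt ct] := cf i t iI tI.
by rewrite patchE mem_set.
Qed.
End lower_sums.

Section constant.
Context {R : realType} {d : nat}.
Local Notation mu := (@lebesgue_measure R).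
Local Notation RM := (measurableTypeR R).
Variables (V S : 'rV[R]_d -> R) (Phi : R -> 'rV[R]_d -> R) (p : R -> R).
Hypotheses (hS : C20 S) (hp : locally_integrable setT p).
Hypothesis (hV : (normLoo (opnorm \o weak_hess V) < +oo)%E).

Lemma normL1E (t : R) : 0 <= t -> normL1 p t = (pmass p 0 t)%:E.
Proof.
move=> t0; have ip := intg_norm (pcut_intg hp 0 t).
rewrite /pmass /Rintegral fineK; last exact: integrable_fin_num.
have mp : measurable_fun setT (fun s : RM => `|p s|%:E).
  by apply/measurable_EFinP; apply: measurableT_comp => //; case: hp.
rewrite /normL1 integral_itv_bndo_bndc; last exact: measurable_funTS.
rewrite [LHS]integral_mkcond; apply: eq_integral => s _.
rewrite patchE /pcut indicE; case: ifPn => _; first by rewrite mulr1.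
by rewrite mulr0 normr0.
Qed.

Variables (T h : R) (n : nat) (l : R -> R).
Hypotheses (h0 : 0 < h) (nh : n%:R * h = T).
Hypothesis l0 : forall s, 0 <= l s.
Hypothesis lm : forall s s', s <= s' -> l s <= l s'.
Hypothesis lPhi : forall s, ((l s)%:E <= normLoo_hess_Phi0 Phi s)%E \/ s < 0.

Definition LV : R := fine (normLoo (opnorm \o weak_hess V)).

(** A lower bound of [r2] on the [m]-th time cell, without its leading 1: that term is
    the drift's share of the growth. *)
Definition cell_rate (m : nat) : R :=
  LV + l (m%:R * h) + 2 * Sig2 S * pmass p 0 (m%:R * h).

Lemma LV_ge0 : 0 <= LV.
Proof. by rewrite fine_ge0// normLoo_ge0. Qed.

Lemma cell_rate_ge0 m : 0 <= cell_rate m.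
Proof. by rewrite !addr_ge0 ?LV_ge0// !mulr_ge0 ?Sig2_ge0// pmass_ge0. Qed.

Let mh0 (m : nat) : 0 <= m%:R * h.
Proof. by rewrite mulr_ge0// ltW. Qed.

Let hessPhi_ge0 t : 0 <= t -> (0 <= normLoo_hess_Phi0 Phi t)%E.
Proof.
move=> t0; apply: (@le_trans _ _ (normLoo (opnorm \o weak_hess (Phi t)))); first exact: normLoo_ge0.
by apply: ereal_sup_ubound; exists t => //; rewrite /= in_itv/= t0 lexx.
Qed.

Lemma normL1_ge0 t : (0 <= normL1 p t)%E.
Proof. exact: integral_ge0. Qed.

Lemma r2_ge0 t : 0 <= t -> (0 <= r2 V S Phi p t)%E.
Proof.
move=> t0; rewrite /r2 !adde_ge0 ?normLoo_ge0 ?hessPhi_ge0//.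
by rewrite !mule_ge0 ?normLoo_ge0 ?normL1_ge0.
Qed.

Lemma cell_rate_le m t : m%:R * h <= t -> ((1 + cell_rate m)%:E <= r2 V S Phi p t)%E.
Proof.
move=> mt; have t0 := le_trans (mh0 m) mt.
rewrite /cell_rate /r2 !addrA !EFinD; apply: leeD.
  apply: leeD.
    by rewrite /LV normLoo_fineK.
  case: (lPhi t) => [h1|]; last by rewrite ltNge t0.
  by apply: le_trans h1; rewrite lee_fin lm.
rewrite !EFinM normL1E// /Sig2 normLoo_fineK; last exact: C20_hess_lty.
rewrite lee_wpmul2l//; first by rewrite mule_ge0 ?normLoo_ge0.
by rewrite lee_fin; apply: (pmass_mono hp); rewrite mh0.
Qed.

Let E (m : nat) : R := expR (growth h cell_rate n - growth h cell_rate m).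

Let exp_le m s : (m < n)%N -> m%:R * h <= s < m.+1%:R * h ->
  ((E m.+1)%:E <= expeR (\int[mu]_(tau in `[s, T]) r2 V S Phi p tau))%E.
Proof.
move=> mn /andP[ms sm]; rewrite -[(E m.+1)%:E]/(expeR _%:E) lee_expeR.
have -> : growth h cell_rate n - growth h cell_rate m.+1 = \sum_(m.+1 <= i < n) h * (1 + cell_rate i).
  rewrite /growth -!(big_mkord xpredT (fun i => h * (1 + cell_rate i))).
  by rewrite (big_cat_nat _ (n := m.+1))//= addrAC subrr add0r.
apply: lower_sum => //.
- by move=> i; rewrite addr_ge0// cell_rate_ge0.
- move=> t; rewrite /= in_itv/= => /andP[st _]; apply: r2_ge0.
  exact: le_trans (le_trans (mh0 m) ms) st.
- move=> i t /andP[mi iN] /andP[it ti].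
  have mi' : m.+1%:R * h <= i%:R * h by rewrite ler_wpM2r ?(ltW h0)// ler_nat.
  have iN' : i.+1%:R * h <= n%:R * h by rewrite ler_wpM2r ?(ltW h0)// ler_nat.
  split; last exact: cell_rate_le.
  rewrite /= in_itv/=; apply/andP; split.
    exact: le_trans (ltW sm) (le_trans mi' it).
  rewrite -nh; exact: le_trans (ltW ti) iN'.
Qed.

(** The double sum on the left is what the stability estimate produces for a force
    perturbation of size [Sig1 S * pmass p 0 t]; monotonicity of the integrands turns it
    into a lower sum of [Cst]. *)
Lemma Cst_lower : ((3 * (\sum_(i < n) h * (Sig1 S * pmass p 0 (i%:R * h) *
    (1 + \sum_(i.+1 <= m < n) h * E m.+1))))%:E <= Cst V S Phi p T)%E.
Proof.
have E0 m : 0 <= E m by exact: expR_ge0.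
have inner0 t : (0 <= \int[mu]_(s in `[t, T]) expeR (\int[mu]_(tau in `[s, T]) r2 V S Phi p tau))%E.
  by apply: integral_ge0 => s _; exact: expeR_ge0.
have main : ((\sum_(0 <= i < n) h * (pmass p 0 (i%:R * h) *
    (1 + \sum_(i.+1 <= m < n) h * E m.+1)))%:E <=
  \int[mu]_(t in `[0%R, T]) (normL1 p t * (1 + \int[mu]_(s in `[t, T])
       expeR (\int[mu]_(tau in `[s, T]) r2 V S Phi p tau))))%E.
  apply: lower_sum => //.
  - move=> i; rewrite mulr_ge0 ?pmass_ge0// addr_ge0// sumr_ge0// => m _.
    by rewrite mulr_ge0// ltW.
  - by move=> t _; rewrite mule_ge0 ?normL1_ge0// adde_ge0.
  move=> i t /andP[_ iN] /andP[it ti].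
  have iN' : i.+1%:R * h <= n%:R * h by rewrite ler_wpM2r ?(ltW h0)// ler_nat.
  have t0 := le_trans (mh0 i) it.
  split; first by rewrite /= in_itv/= t0 -nh; exact: le_trans (ltW ti) iN'.
  rewrite EFinM; apply: lee_pmul.
  - by rewrite lee_fin pmass_ge0.
  - rewrite lee_fin addr_ge0// sumr_ge0// => m _; by rewrite mulr_ge0// ltW.
  - by rewrite normL1E// lee_fin; apply: (pmass_mono hp); rewrite mh0.
  rewrite EFinD leeD2l//; apply: lower_sum => //.
  - by move=> s _; exact: expeR_ge0.
  move=> m s /andP[im mn] sI; split; last exact: exp_le.
  have /andP[ms sm] := sI.
  have mn' : m.+1%:R * h <= n%:R * h by rewrite ler_wpM2r ?(ltW h0)// ler_nat.
  have im' : i.+1%:R * h <= m%:R * h by rewrite ler_wpM2r ?(ltW h0)// ler_nat.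
  rewrite /= in_itv/=; apply/andP; split; first exact: le_trans (ltW ti) (le_trans im' ms).
  by rewrite -nh; exact: le_trans (ltW sm) mn'.
rewrite /Cst.
have -> : (3%:E * normLoo (enorm \o grad S) = (3 * Sig1 S)%:E)%E.
  by rewrite EFinM /Sig1 normLoo_fineK//; exact: C20_grad_lty.
apply: le_trans (lee_wpmul2l _ main); last by rewrite lee_fin mulr_ge0// Sig1_ge0.
rewrite -EFinM lee_fin -mulrA ler_wpM2l// big_mkord mulr_sumr le_eqVlt; apply/orP; left; apply/eqP.
by apply: eq_bigr => i _; ring.
Qed.
End constant.

Section discrete_constant.
Context {R : realType}.
Variables (n : nat) (h : R) (a g : nat -> R).
Hypotheses (h0 : 0 <= h) (a0 : forall m, 0 <= a m) (g0 : forall m, 0 <= g m).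

(** Discrete counterpart of exchanging the two integrals in [Cst]; the last term
    comes from evaluating the drift error at the right end of each cell. *)
Lemma stability_bound :
  phase_err h 0 0 a g n + drift_err h g n <=
  \sum_(i < n) h * (g i * (1 + \sum_(i.+1 <= m < n) h * expR (growth h a n - growth h a m.+1))) +
  h * (\sum_(m < n) h * g m) * expR (growth h a n).
Proof.
pose E m := expR (growth h a n - growth h a m).
have P := phase_err_gronwall h0 (lexx 0) (lexx 0) a0 g0 n.
apply: le_trans (lerD P (lexx _)) _; rewrite mulr0 add0r.
have EE m : (m < n)%N -> E m.+1 <= expR (growth h a n).
  move=> mn; rewrite ler_expR gerBl; apply: sumr_ge0 => i _.
  by rewrite mulr_ge0// addr_ge0.
have R1 : \sum_(i < n) h * (g i * (1 + \sum_(i.+1 <= m < n) h * E m.+1)) =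
    drift_err h g n + \sum_(m < n) h * drift_err h g m * E m.+1.
  under eq_bigr => i _ do rewrite mulrDr mulr1 mulrDr.
  rewrite big_split/=; congr (_ + _).
  have -> : \sum_(m < n) h * drift_err h g m * E m.+1 =
      \sum_(m < n) \sum_(i < n | (i < m)%N) h * (h * g i) * E m.+1.
    apply: eq_bigr => m _; rewrite /drift_err mulr_sumr mulr_suml.
    rewrite (big_ord_widen n (fun i => h * (h * g i) * E m.+1))//; exact: ltnW.
  rewrite (exchange_big_dep xpredT)//=; apply: eq_bigr => i _.
  rewrite mulrA mulr_sumr.
  rewrite (big_geq_mkord i.+1 n xpredT (fun m => h * g i * (h * E m.+1))).
  by apply: eq_big => [m|m _]; [rewrite ?andbT|ring].
rewrite [in leRHS]R1 addrC -addrA lerD2l.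
apply: (@le_trans _ _ (\sum_(m < n) (h * drift_err h g m * E m.+1 + h * (h * g m) * expR (growth h a n)))).
  apply: ler_sum => m _; rewrite addr0 /drift_err big_ord_recr/= mulrDr mulrDl lerD2l.
  by rewrite ler_wpM2l ?EE// mulr_ge0// mulr_ge0.
rewrite big_split/= lerD2l -mulr_suml -mulr_sumr//.
Qed.
End discrete_constant.

(** * Convergence of the scheme, and removal of one particle *)

Section global_dynamics.
Context {R : realType} {d : nat}.
Local Notation phase := (@phase R d).
Variables (V S : 'rV[R]_d -> R) (Phi : R -> 'rV[R]_d -> R) (p : R -> R).
Hypotheses (cV : C1 V) (hS : C20 S) (hp : locally_integrable setT p).
Hypothesis hPhi : forall t, 0 <= t -> W2oo (Phi t) /\ C1 (Phi t).
Hypothesis cPhi : forall t, 0 <= t ->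
  normW2oo (Phi s \- Phi t) @[s --> within [set s | 0 <= s] (nbhs t)] --> 0%E.
Hypothesis hV : (normLoo (opnorm \o weak_hess V) < +oo)%E.
Hypothesis lV : forall x y, enorm (grad V x - grad V y) <= LV V * enorm (x - y).

Definition ext_force (h : R) (m : nat) (x : 'rV[R]_d) : 'rV[R]_d :=
  - grad (V \+ Phi (m%:R * h)) x.

Definition full_coupling (N : nat) (k j : 'I_N) : R := N%:R^-1.

(** Particle k0 still feels the others, itself excepted, but acts on nobody. *)
Definition out_coupling (N : nat) (k0 k j : 'I_N) : R := if j == k0 then 0 else N%:R^-1.

Definition scheme_at (N : nat) (c : 'I_N -> 'I_N -> R) (T : R) (n : nat) (z : 'I_N -> phase) : 'I_N -> phase :=
  scheme (T / n%:R) (ext_force (T / n%:R)) (grad S) (pweight p (T / n%:R)) c z n.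

Lemma full_coupling_ge0 N (k j : 'I_N) : 0 <= full_coupling k j.
Proof. by rewrite invr_ge0. Qed.

Lemma full_coupling_le1 N (k : 'I_N) : \sum_j full_coupling k j <= 1.
Proof.
rewrite /full_coupling sumr_const card_ord -[leLHS]mulr_natr mulVf// pnatr_eq0.
by rewrite -lt0n (leq_trans _ (ltn_ord k)).
Qed.

Lemma scheme_no_time N c F w (z : 'I_N -> phase) m k :
  scheme 0 F (grad S) w c z m k = z k.
Proof.
elim/ltn_ind: m => -[|m] IH //; rewrite schemeS /sstep !scale0r !addr0 IH//.
by case: (z k).
Qed.

Lemma grad_VPhi t : 0 <= t -> forall x, grad (V \+ Phi t) x = grad V x + grad (Phi t) x.
Proof. by move=> t0 x; rewrite gradD//; case: (hPhi t0). Qed.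

Lemma ext_force_lip (h L : R) m : 0 <= m%:R * h ->
  (forall x y, enorm (grad (Phi (m%:R * h)) x - grad (Phi (m%:R * h)) y) <= L * enorm (x - y)) ->
  forall x y, enorm (ext_force h m x - ext_force h m y) <= (LV V + L) * enorm (x - y).
Proof.
move=> t0 hL x y; rewrite /ext_force !grad_VPhi// -opprD enormN.
rewrite (_ : _ - _ = (grad V x - grad V y) + (grad (Phi (m%:R * h)) x - grad (Phi (m%:R * h)) y)); last first.
  by apply/rowP => i; rewrite !mxE; ring.
by rewrite mulrDl (le_trans (enormD _ _))// lerD.
Qed.

Lemma measurable_ext_force h m : 0 <= m%:R * h -> measurable_fun setT (ext_force h m).
Proof.
move=> t0; have [_ ht] := hPhi t0.
rewrite (_ : ext_force h m = (fun x => -1 *: (grad V x + grad (Phi (m%:R * h)) x))); last first.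
  by apply/funext => x; rewrite /ext_force grad_VPhi// scaleN1r.
by apply: measurable_rV_Z; apply: measurable_rV_D; exact: measurable_grad.
Qed.

(** A solution, sampled on the grid, is a run of the scheme perturbed by consistency
    errors, so stability gives convergence. *)
Lemma scheme_at_cvg N (N0 : (0 < N)%N) (z0 : 'I_N -> phase) (q v : 'I_N -> R -> 'rV[R]_d) (T e : R) :
  is_solution V S Phi p z0 q v -> 0 <= T -> 0 < e ->
  exists n0, forall n, (n0 <= n)%N -> (0 < n)%N -> forall k,
    pdist (scheme_at (@full_coupling N) T n z0 k) (q k T, v k T) <= e.
Proof.
move=> sol; rewrite le_eqVlt => /predU1P[<- e0|T0 e0].
  exists 0%N => n _ n0 k; rewrite /scheme_at mul0r scheme_no_time.
  by have [-> _] := sol; rewrite pdistzz ltW.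
have [l [l0 lm lPhi [L hL] lLip]] := grad_Phi_lip_mono hPhi cPhi T.
have S20 := Sig2_ge0 S; have PT := pmass_ge0 p 0 T; have LV0 := LV_ge0 V.
have L0 : 0 <= L := le_trans (l0 0) (hL 0).
pose A := LV V + L + 2 * Sig2 S * pmass p 0 T.
have A0 : 0 <= A by rewrite !addr_ge0// !mulr_ge0.
pose K := expR (T * (1 + A)) * (T * (T + 1)) + T.
have K0 : 0 <= K.
  by rewrite addr_ge0 ?(ltW T0)// mulr_ge0 ?expR_ge0// mulr_ge0 ?addr_ge0 ?(ltW T0).
pose ep := e / (K + 1); have K1 : 0 < K + 1 by rewrite ltr_wpDl.
have ep0 : 0 < ep by rewrite divr_gt0.
have ep2 : 0 < ep / 2 by rewrite divr_gt0.
have [r1 r10 h1] := sampled_solution cV hS hp hPhi cPhi N0 sol T ep2.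
have [r2 r20 h2] := memory_quadrature hS hp N0 sol T ep2.
have [n0 hn0] : exists n0 : nat, forall n, (n0 <= n)%N -> (0 < n)%N -> T / n%:R < Num.min r1 r2.
  have m0 : 0 < Num.min r1 r2 by rewrite lt_min r10.
  exists (Num.truncn (T / Num.min r1 r2)).+1 => n nn n1.
  rewrite ltr_pdivrMr ?ltr0n// mulrC -ltr_pdivrMr//.
  apply: lt_le_trans (truncnS_gt _) _; by rewrite ler_nat.
exists n0 => n nn n1 k; set h := T / n%:R.
have nh : n%:R * h = T by rewrite /h mulrC divfK// pnatr_eq0 -lt0n.
have h0 : 0 < h by rewrite divr_gt0// ltr0n.
have := hn0 n nn n1; rewrite -/h lt_min => /andP[hr1 hr2].
have tm m : (m <= n)%N -> 0 <= m%:R * h <= T.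
  by move=> mn; rewrite mulr_ge0 ?(ltW h0)//= -nh ler_wpM2r ?(ltW h0)// ler_nat.
pose c := @full_coupling N.
pose X := scheme h (ext_force h) (grad S) (pweight p h) c z0.
pose Y (m : nat) (k : 'I_N) : phase := (q k (m%:R * h), v k (m%:R * h)).
pose f m k := delayed_force (ext_force h) (grad S) (pweight p h) c X m k (X m k).1.
pose f' m k := delayed_force (ext_force h) (grad S) (pweight p h) c Y m k (Y m k).1.
pose e1 m k := h^-1 *: (v k (m.+1%:R * h) - v k (m%:R * h)) - f' m k.
pose e2 m k := h^-1 *: (q k (m.+1%:R * h) - q k (m%:R * h)) - v k (m.+1%:R * h).
have hn : h != 0 by rewrite gt_eqF.
have upd (b b' b2 : 'rV[R]_d) : b2 = b + h *: (b' + (h^-1 *: (b2 - b) - b')).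
  by rewrite [b' + _]addrC subrK scalerA mulfV// scale1r addrC subrK.
have stab := @kick_drift_stability R d 'I_N n h ep 0 (fun=> A) (fun=> ep) (ltW h0) (ltW ep0)
  (lexx 0) (fun=> A0) (fun=> ltW ep0) (fun m k => (X m k).1) (fun m k => (X m k).2)
  (fun m k => (Y m k).1) (fun m k => (Y m k).2) f f' e1 e2.
apply: (@le_trans _ _ (phase_err h ep 0 (fun=> A) (fun=> ep) n + drift_err h (fun=> ep) n)).
  rewrite /scheme_at -/h -/X.
  have -> : X n k = ((X n k).1, (X n k).2) by case: (X n k).
  have -> : (q k T, v k T) = ((Y n k).1, (Y n k).2) by rewrite /Y nh.
  apply: stab => //.
  - by move=> m i mn; rewrite /X schemeS.
  - move=> m i mn; have [ha _] := h1 h m i h0 hr1 (ltac:(by case/andP: (tm _ mn))).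
    have /andP[t0 tT] := tm m (ltnW mn).
    have hq := h2 h m i h0 hr2 tT.
    have -> : e1 m i = h^-1 *: (v i (m.+1%:R * h) - v i (m%:R * h) - h *: accel V S Phi p q i (m%:R * h)) +
       (mem_field S p q (m%:R * h) (q i (m%:R * h)) - \sum_(l < m) pweight p h l *:
          \sum_j N%:R^-1 *: grad S (q i (m%:R * h) - q j ((m - l)%N%:R * h))).
      rewrite /e1 /f' /delayed_force /Y /c /full_coupling/= [in RHS]scalerBr scalerA mulVf// scale1r.
      rewrite /accel (memory_forceE hS hp N0 sol)// /ext_force.
      set a1 := h^-1 *: _; set a2 := grad _ _; set a3 := mem_field _ _ _ _ _; set a4 := \sum_(l < m) _.
      by rewrite !opprD !opprK -!addrA; congr (_ + (_ + _)); rewrite addrA addNr add0r.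
    rewrite (le_trans (enormD _ _))// (splitr ep) lerD//.
    by rewrite enormZ ger0_norm ?invr_ge0 ?(ltW h0)// ler_pdivrMl.
  - move=> m i mn; have [_ hb] := h1 h m i h0 hr1 (ltac:(by case/andP: (tm _ mn))).
    have -> : e2 m i = h^-1 *: (q i (m.+1%:R * h) - q i (m%:R * h) - h *: v i (m.+1%:R * h)).
      by rewrite /e2 [in RHS]scalerBr scalerA mulVf// scale1r.
    rewrite enormZ ger0_norm ?invr_ge0 ?(ltW h0)// ler_pdivrMl// (le_trans hb)//.
    by rewrite ler_wpM2l ?(ltW h0)// ler_pdivrMr// ler_pMr// ler1n.
  - move=> m rho mn rho0 hXY i; have /andP[t0 tT] := tm m (ltnW mn).
    apply: le_trans (@delayed_force_lip R d S hS N c (@full_coupling_ge0 N) (@full_coupling_le1 N)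
      (ext_force h) (pweight p h) (LV V + L) X Y m rho rho0 _ _ hXY i) _.
    + apply: ext_force_lip => // x y; apply: le_trans (lLip _ _ x y) _; first by rewrite t0.
      by rewrite ler_wpM2r ?enorm_ge0.
    + by rewrite addr_ge0.
    + rewrite ler_wpM2r// /A lerD2l ler_wpM2l ?mulr_ge0//.
      by apply: le_trans (pweight_sum hp m (ltW h0)) _; apply: (pmass_mono hp); rewrite t0.
  - move=> i; rewrite /X scheme0 /Y mul0r -!surjective_pairing.
    by have [-> _] := sol; rewrite pdistzz.
have dk m : (m <= n)%N -> drift_err h (fun=> ep) m <= T * ep.
  move=> mn; rewrite /drift_err sumr_const card_ord -[leLHS]mulr_natl mulrA ler_wpM2r ?(ltW ep0)//.
  by case/andP: (tm m mn).
have pc := phase_err_crude (ltW h0) (ltW ep0) (lexx 0) (fun=> A0) (fun=> ltW ep0)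
   (m := n) (A := A) (D := T * ep) (fun _ _ => lexx _) dk.
apply: le_trans (lerD pc (dk n (leqnn n))) _; rewrite nh add0r.
have rg (E t u : R) : E * (t * (t * u + u)) + t * u = (E * (t * (t + 1)) + t) * u by ring.
rewrite rg -/K.
by rewrite /ep mulrCA ler_piMr ?(ltW e0)// ler_pdivrMr// mul1r lerDl.
Qed.

Variables (T : R) (C : R).
Hypotheses (T0 : 0 <= T) (hC : (Cst V S Phi p T <= C%:E)%E).

Lemma Cst_real_ge0 : 0 <= C.
Proof.
rewrite -lee_fin; apply: le_trans hC; rewrite /Cst mule_ge0 ?mule_ge0 ?normLoo_ge0//.
by apply: integral_ge0 => t _; rewrite mule_ge0 ?normL1_ge0// adde_ge0// integral_ge0// => s _; exact: expeR_ge0.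
Qed.

(** The forces of the two systems differ by the influence of k0 alone, at most [Sig1 S *
    pmass p 0 t / N]; the effect of this perturbation is at most a lower sum of [Cst]
    divided by 3N, up to one time step. *)
Lemma leave_one_out_bound : exists2 K, 0 <= K & forall N (z : 'I_N -> phase) (k0 k : 'I_N) n, (0 < n)%N ->
  pdist (scheme_at (@full_coupling N) T n z k) (scheme_at (out_coupling k0) T n z k) <=
    N%:R^-1 * (C / 3 + K / n%:R).
Proof.
have C0 := Cst_real_ge0.
move: T0; rewrite le_eqVlt => /predU1P[T0'|T0'].
  exists 0 => // N z k0 k n n0; rewrite /scheme_at -T0' mul0r !scheme_no_time pdistzz.
  by rewrite addr0 mulr_ge0 ?invr_ge0// divr_ge0.
have [l [l0 lm lPhi [L hL] lLip]] := grad_Phi_lip_mono hPhi cPhi T.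
have S10 := Sig1_ge0 S; have S20 := Sig2_ge0 S; have PT := pmass_ge0 p 0 T; have LV0 := LV_ge0 V.
have L0 : 0 <= L := le_trans (l0 0) (hL 0).
pose A := LV V + L + 2 * Sig2 S * pmass p 0 T.
exists (T * (T * (Sig1 S * pmass p 0 T)) * expR (T * (1 + A))).
  by rewrite !mulr_ge0 ?expR_ge0// ltW.
move=> N z k0 k n n1; set h := T / n%:R.
have nh : n%:R * h = T by rewrite /h mulrC divfK// pnatr_eq0 -lt0n.
have h0 : 0 < h by rewrite divr_gt0// ltr0n.
have tm m : (m <= n)%N -> 0 <= m%:R * h <= T.
  by move=> mn; rewrite mulr_ge0 ?(ltW h0)//= -nh ler_wpM2r ?(ltW h0)// ler_nat.
pose c := @full_coupling N; pose c' := out_coupling k0.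
pose X := scheme h (ext_force h) (grad S) (pweight p h) c z.
pose Y := scheme h (ext_force h) (grad S) (pweight p h) c' z.
pose f m k := delayed_force (ext_force h) (grad S) (pweight p h) c X m k (X m k).1.
pose f' m k := delayed_force (ext_force h) (grad S) (pweight p h) c Y m k (Y m k).1.
pose f'' m k := delayed_force (ext_force h) (grad S) (pweight p h) c' Y m k (Y m k).1.
pose a m := cell_rate V S p h l m.
have a0 m : 0 <= a m by exact: cell_rate_ge0.
pose g (m : nat) : R := N%:R^-1 * (Sig1 S * pmass p 0 (m%:R * h)).
have g0 m : 0 <= g m by rewrite mulr_ge0 ?invr_ge0// mulr_ge0// pmass_ge0.
have stab := @kick_drift_stability R d 'I_N n h 0 0 a g (ltW h0) (lexx 0)
  (lexx 0) a0 g0 (fun m k => (X m k).1) (fun m k => (X m k).2)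
  (fun m k => (Y m k).1) (fun m k => (Y m k).2) f f' (fun m k => f'' m k - f' m k) (fun _ _ => 0).
apply: (@le_trans _ _ (phase_err h 0 0 a g n + drift_err h g n)).
  rewrite /scheme_at -/h -/X -/Y.
  have -> : X n k = ((X n k).1, (X n k).2) by case: (X n k).
  have -> : Y n k = ((Y n k).1, (Y n k).2) by case: (Y n k).
  apply: stab => //.
  - by move=> m i mn; rewrite /X schemeS.
  - move=> m i mn; rewrite [f' _ _ + _]addrC subrK addr0 /Y schemeS; split => //.
  - move=> m i mn; rewrite /f'' /f' /delayed_force opprD addrACA subrr add0r -sumrB.
    apply: le_trans (enorm_sum _ _ _) _.
    apply: (@le_trans _ _ (\sum_(l < m) `|pweight p h l| * (N%:R^-1 * Sig1 S))).
      apply: ler_sum => i' _; rewrite -scalerBr enormZ ler_wpM2l// -sumrB.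
      rewrite (bigD1 k0)//= big1 => [|j jk]; last first.
        by rewrite /c' /c /out_coupling /full_coupling (negbTE jk) subrr.
      rewrite addr0 /c' /out_coupling eqxx scale0r sub0r enormN enormZ /c /full_coupling.
      by rewrite ger0_norm ?invr_ge0// ler_wpM2l ?invr_ge0//; exact: C20_grad_le.
    rewrite -mulr_suml /g mulrC -mulrA ler_wpM2l ?invr_ge0// ler_wpM2l//.
    exact: (pweight_sum hp m (ltW h0)).
  - by move=> m i mn; rewrite enorm0.
  - move=> m rho mn rho0 hXY i; have /andP[t0 tT] := tm m (ltnW mn).
    apply: le_trans (@delayed_force_lip R d S hS N c (@full_coupling_ge0 N) (@full_coupling_le1 N)
      (ext_force h) (pweight p h) (LV V + l (m%:R * h)) X Y m rho rho0 _ _ hXY i) _.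
    + by apply: ext_force_lip => // x y; apply: lLip; rewrite t0.
    + by rewrite addr_ge0.
    + by rewrite ler_wpM2r// /a /cell_rate lerD2l ler_wpM2l ?mulr_ge0// (pweight_sum hp m (ltW h0)).
  - by move=> i; rewrite /X /Y !scheme0 pdistzz.
apply: le_trans (stability_bound n (ltW h0) a0 g0) _.
have low := Cst_lower hS hp hV h0 nh l0 lm lPhi.
have {low} := le_trans low hC; rewrite lee_fin => low.
rewrite mulrDr; apply: lerD.
  rewrite (_ : \sum_(i < n) _ = N%:R^-1 * (\sum_(i < n) h * (Sig1 S * pmass p 0 (i%:R * h) *
    (1 + \sum_(i.+1 <= m < n) h * expR (growth h a n - growth h a m.+1))))); last first.
    by rewrite mulr_sumr; apply: eq_bigr => i _; rewrite /g; ring.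
  by rewrite ler_wpM2l ?invr_ge0// ler_pdivlMr// mulrC.
have gs : \sum_(m < n) h * g m <= N%:R^-1 * (T * (Sig1 S * pmass p 0 T)).
  apply: (@le_trans _ _ (\sum_(m < n) h * (N%:R^-1 * (Sig1 S * pmass p 0 T)))).
    apply: ler_sum => m _; rewrite ler_wpM2l ?(ltW h0)// ler_wpM2l ?invr_ge0// ler_wpM2l//.
    by apply: (pmass_mono hp); exact: tm (ltnW (ltn_ord m)).
  rewrite sumr_const card_ord -[leLHS]mulr_natl mulrA nh mulrCA//.
have gr : expR (growth h a n) <= expR (T * (1 + A)).
  rewrite ler_expR /growth; apply: (@le_trans _ _ (\sum_(i < n) h * (1 + A))).
    apply: ler_sum => i _; rewrite ler_wpM2l ?(ltW h0)// lerD2l /a /cell_rate /A.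
    rewrite lerD ?lerD2l ?hL// ler_wpM2l ?mulr_ge0//.
    by apply: (pmass_mono hp); exact: tm (ltnW (ltn_ord i)).
  by rewrite sumr_const card_ord -[leLHS]mulr_natl mulrA nh.
apply: (@le_trans _ _ (h * (N%:R^-1 * (T * (Sig1 S * pmass p 0 T))) * expR (T * (1 + A)))).
  apply: ler_pM => //; rewrite ?expR_ge0//.
    by rewrite mulr_ge0 ?(ltW h0)// sumr_ge0// => m _; rewrite mulr_ge0// ltW.
  by rewrite ler_wpM2l// ltW.
by rewrite le_eqVlt; apply/orP; left; apply/eqP; rewrite /h; ring.
Qed.
End global_dynamics.

(** * Product probabilities and the Efron-Stein inequality *)

Section bounded.
Context {R : realType} {dT} {T : measurableType dT}.
Variable P : probability T R.
Implicit Types f g : T -> R.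

(** Bounded measurable functions: all observables are of this kind, and integrability
    need never be discussed. *)
Definition bmf f : Prop := measurable_fun [set: T] f /\ exists B, forall x, `|f x| <= B.

Lemma bmf_intg f : bmf f -> intg P f.
Proof.
move=> [mf [B hB]]; apply: (@le_intg _ _ _ P f (fun=> B)) => //.
apply/integrableP; split; first exact/measurable_EFinP.
under eq_integral => x _ do rewrite /=.
by rewrite integral_cst//= probability_setT mule1 ltry.
Qed.

Lemma bmf_cst (c : R) : bmf (fun=> c).
Proof. by split => //; exists `|c|. Qed.

Lemma bmfD f g : bmf f -> bmf g -> bmf (fun x => f x + g x).
Proof.
move=> [mf [B hB]] [mg [C hC]]; split; first exact: measurable_funD.
by exists (B + C) => x; rewrite (le_trans (ler_normD _ _))// lerD.
Qed.

Lemma bmfM f g : bmf f -> bmf g -> bmf (fun x => f x * g x).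
Proof.
move=> [mf [B hB]] [mg [C hC]]; split; first exact: measurable_funM.
by exists (B * C) => x; rewrite normrM ler_pM.
Qed.

Lemma bmfN f : bmf f -> bmf (fun x => - f x).
Proof.
move=> [mf [B hB]]; split; first exact: measurableT_comp.
by exists B => x; rewrite normrN.
Qed.

Lemma bmfB f g : bmf f -> bmf g -> bmf (fun x => f x - g x).
Proof. by move=> hf hg; apply: bmfD => //; exact: bmfN. Qed.

Lemma bmf_norm f : bmf f -> bmf (fun x => `|f x|).
Proof.
move=> [mf [B hB]]; split; first exact: measurableT_comp.
by exists B => x; rewrite normr_id.
Qed.

Lemma Rint_prob_cst (c : R) : \int[P]_x c = c.
Proof. by rewrite /Rintegral integral_cst//= probability_setT mule1. Qed.

Lemma Rint_le f g : bmf f -> bmf g -> (forall x, f x <= g x) ->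
  \int[P]_x f x <= \int[P]_x g x.
Proof. by move=> hf hg fg; apply: le_Rintegral => //; exact: bmf_intg. Qed.

Lemma RintD f g : bmf f -> bmf g -> \int[P]_x (f x + g x) = \int[P]_x f x + \int[P]_x g x.
Proof. by move=> hf hg; rewrite RintegralD//; exact: bmf_intg. Qed.

Lemma RintB f g : bmf f -> bmf g -> \int[P]_x (f x - g x) = \int[P]_x f x - \int[P]_x g x.
Proof. by move=> hf hg; rewrite RintegralB//; exact: bmf_intg. Qed.

Lemma RintZ (c : R) f : bmf f -> \int[P]_x (c * f x) = c * \int[P]_x f x.
Proof. by move=> hf; rewrite RintegralZl//; exact: bmf_intg. Qed.

Lemma bmf_integralE f : bmf f -> (\int[P]_x (f x)%:E = (\int[P]_x f x)%:E)%E.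
Proof. by move=> hf; rewrite fineK//; apply: integrable_fin_num => //; exact: bmf_intg. Qed.

Lemma Rint_le_cst f (c : R) : bmf f -> (forall x, f x <= c) -> \int[P]_x f x <= c.
Proof. by move=> hf fc; rewrite -[leRHS]Rint_prob_cst; apply: Rint_le => //; exact: bmf_cst. Qed.

Lemma Rint_ge_cst f (c : R) : bmf f -> (forall x, c <= f x) -> c <= \int[P]_x f x.
Proof. by move=> hf fc; rewrite -[leLHS]Rint_prob_cst; apply: Rint_le => //; exact: bmf_cst. Qed.

Lemma Rint_norm_le f (c : R) : bmf f -> (forall x, `|f x| <= c) -> `|\int[P]_x f x| <= c.
Proof.
move=> hf fc; rewrite ler_norml Rint_ge_cst//=; last first.
  by move=> x; have := fc x; rewrite ler_norml => /andP[].
by apply: Rint_le_cst => // x; have := fc x; rewrite ler_norml => /andP[].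
Qed.

(** Integrate 2 s |f| <= f^2 + s^2. *)
Lemma Rint_abs_le_sqr f (s : R) : bmf f -> 0 <= s -> \int[P]_x (f x ^+ 2) <= s ^+ 2 ->
  \int[P]_x `|f x| <= s.
Proof.
move=> hf; have h2 : bmf (fun x => f x ^+ 2) by exact: bmfM.
have hn := bmf_norm hf.
have hb (u : R) : bmf (fun x => (2 * u)^-1 * f x ^+ 2) by apply: bmfM => //; exact: bmf_cst.
rewrite le_eqVlt => /predU1P[<-|s0] H; last first.
  have : \int[P]_x `|f x| <= \int[P]_x ((2 * s)^-1 * f x ^+ 2 + s / 2).
    apply: Rint_le => //; first by apply: bmfD; [apply: bmfM => //; exact: bmf_cst|exact: bmf_cst].
    move=> x; rewrite -(real_normK (num_real (f x))).
    rewrite -(ler_pM2l (_ : 0 < 2 * s)) ?mulr_gt0// mulrDr mulrA divff ?mul1r ?mulf_neq0 ?gt_eqF//.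
    rewrite (_ : 2 * s * (s / 2) = s ^+ 2); last by field.
    have := sqr_ge0 (`|f x| - s); rewrite sqrrB; lra.
  rewrite (RintD (hb s) (@bmf_cst (s / 2))) (RintZ _ h2) Rint_prob_cst.
  move=> /le_trans; apply.
  have : (2 * s)^-1 * \int[P]_x f x ^+ 2 <= (2 * s)^-1 * s ^+ 2.
    by rewrite ler_wpM2l// invr_ge0 mulr_ge0// ltW.
  rewrite (_ : (2 * s)^-1 * s ^+ 2 = s / 2); last by field; rewrite gt_eqF.
  lra.
rewrite expr0n /= in H; apply/ler_addgt0Pr => e e0; rewrite add0r.
have : \int[P]_x `|f x| <= \int[P]_x ((2 * e)^-1 * f x ^+ 2 + e / 2).
  apply: Rint_le => //; first by apply: bmfD; [apply: bmfM => //; exact: bmf_cst|exact: bmf_cst].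
  move=> x; rewrite -(real_normK (num_real (f x))).
  rewrite -(ler_pM2l (_ : 0 < 2 * e)) ?mulr_gt0// mulrDr mulrA divff ?mul1r ?mulf_neq0 ?gt_eqF//.
  rewrite (_ : 2 * e * (e / 2) = e ^+ 2); last by field.
  have := sqr_ge0 (`|f x| - e); rewrite sqrrB; lra.
rewrite (RintD (hb e) (@bmf_cst (e / 2))) (RintZ _ h2) Rint_prob_cst.
move=> /le_trans; apply.
have : (2 * e)^-1 * \int[P]_x f x ^+ 2 <= 0.
  by rewrite mulr_ge0_le0// invr_ge0 mulr_ge0// ltW.
lra.
Qed.
End bounded.

Section prob_fubini.
Context {R : realType} {d1 d2} {T1 : measurableType d1} {T2 : measurableType d2}.
Variables (P1 : probability T1 R) (P2 : probability T2 R).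

Lemma bmf_sect (f : T1 * T2 -> R) x : bmf f -> bmf (fun y => f (x, y)).
Proof.
move=> [mf [B hB]]; split; last by exists B.
by apply: (measurableT_comp mf); apply/measurable_fun_pairP; split; [exact: measurable_cst|exact: measurable_id].
Qed.

Lemma bmf_fubini (f : T1 * T2 -> R) : bmf f ->
  bmf (fun x => \int[P2]_y f (x, y)) /\
  \int[(P1 \x P2)%E]_z f z = \int[P1]_x \int[P2]_y f (x, y).
Proof.
move=> hf; have [mf [B hB]] := hf.
pose g z := f z + B; have hg : bmf g by apply: bmfD => //; exact: bmf_cst.
have g0 z : 0 <= g z by have := hB z; rewrite ler_norml /g => /andP[? _]; lra.
have mg : measurable_fun setT (EFin \o g) by apply/measurable_EFinP; case: hg.
have E x : \int[P2]_y f (x, y) = fine (\int[P2]_y (EFin \o g) (x, y))%E - B.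
  have h1 : bmf (fun y => f (x, y)) by exact: bmf_sect.
  have := RintD P2 h1 (@bmf_cst R _ T2 B); rewrite Rint_prob_cst /Rintegral => H.
  by apply/eqP; rewrite eq_sym subr_eq; apply/eqP; exact: H.
have bF : bmf (fun x => \int[P2]_y f (x, y)).
  split; last by exists B => x; apply: Rint_norm_le => //; exact: bmf_sect.
  rewrite (_ : (fun x => _) = (fun x => fine (\int[P2]_y (EFin \o g) (x, y))%E - B)); last first.
    by apply/funext => x.
  apply: measurable_funB => //; apply: measurableT_comp => //.
  exact: (@measurable_fun_fubini_tonelli_F _ _ _ _ _ P2 (EFin \o g)).
split => //.
have H := @fubini_tonelli1 _ _ _ _ _ P1 P2 (EFin \o g) mg (fun z => g0 z).
have hF : bmf (fun x => \int[P2]_y f (x, y) + B) by apply: bmfD => //; exact: bmf_cst.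
have L : \int[(P1 \x P2)%E]_z g z = \int[P1]_x (\int[P2]_y f (x, y) + B).
  rewrite /Rintegral H; congr fine; apply: eq_integral => x _; rewrite /fubini_F.
  have h1 : bmf (fun y => g (x, y)) by exact: bmf_sect.
  have Ex : \int[P2]_y f (x, y) + B = fine (\int[P2]_y (EFin \o g) (x, y))%E by rewrite E subrK.
  apply: etrans (congr1 EFin (esym Ex)).
  by rewrite fineK//; apply: integrable_fin_num => //; exact: (bmf_intg P2 h1).
have R1 : \int[(P1 \x P2)%E]_z g z = \int[(P1 \x P2)%E]_z f z + B.
  by rewrite (RintD _ hf (@bmf_cst R _ _ B)) Rint_prob_cst.
have R2 : \int[P1]_x (\int[P2]_y f (x, y) + B) = \int[P1]_x \int[P2]_y f (x, y) + B.
  by rewrite (RintD _ bF (@bmf_cst R _ _ B)) Rint_prob_cst.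
by apply: (addIr B); rewrite -R1 L R2.
Qed.
End prob_fubini.

Section prod_step.
Context {R : realType} {dT} {T : measurableType dT}.
Variables (mu : probability T R) (n : nat) (nu : probability 'rV[T]_n R).
Local Open Scope ereal_scope.

Definition prodm_step (A : set 'rV[T]_n.+1) : \bar R := (mu \x nu) (@vcons T n @^-1` A).

Let mvcons (A : set 'rV[T]_n.+1) : measurable A -> measurable (@vcons T n @^-1` A).
Proof. by move=> mA; apply: measurable_preimage => //; exact: measurable_vcons. Qed.

Let prodm_step0 : prodm_step set0 = 0.
Proof. by rewrite /prodm_step preimage_set0 measure0. Qed.

Let prodm_step_ge0 A : 0 <= prodm_step A.
Proof. exact: measure_ge0. Qed.

Let prodm_step_sigma_additive : semi_sigma_additive prodm_step.
Proof.
move=> F mF tF mUF; rewrite /prodm_step preimage_bigcup.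
apply: measure_semi_sigma_additive.
- by move=> k; exact: mvcons.
- apply/trivIsetP => /= i j _ _ ij; rewrite -preimage_setI.
  by move/trivIsetP : tF => /(_ _ _ _ _ ij) ->//; rewrite preimage_set0.
- by rewrite -preimage_bigcup; exact: mvcons.
Qed.

HB.instance Definition _ := isMeasure.Build _ _ _
  prodm_step prodm_step0 prodm_step_ge0 prodm_step_sigma_additive.

Let prodm_stepT : prodm_step setT = 1.
Proof. by rewrite /prodm_step preimage_setT probability_setT. Qed.

HB.instance Definition _ := Measure_isProbability.Build _ _ _ prodm_step prodm_stepT.

Lemma prodm_step_fubini (f : 'rV[T]_n.+1 -> R) : bmf f ->
  bmf (fun z => \int[nu]_x f (vcons (z, x)))%R /\
  (\int[prodm_step]_x f x = \int[mu]_z \int[nu]_x f (vcons (z, x)))%R.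
Proof.
move=> [mf [B hB]].
have hg : bmf (fun zx : T * 'rV[T]_n => f (vcons zx)).
  by split; [exact: (measurableT_comp mf (@measurable_vcons _ T n))|exists B].
have [h1 h2] := bmf_fubini mu nu hg; split => //.
rewrite -h2.
pose g x := (f x + B)%R; have g0 x : (0 <= g x)%R.
  by have := hB x; rewrite ler_norml /g => /andP[? _]; lra.
have bf : bmf f by split => //; exists B.
have mg : measurable_fun setT (EFin \o g).
  by apply/measurable_EFinP; apply: measurable_funD.
have R1 : (\int[prodm_step]_x g x = \int[prodm_step]_x f x + B)%R.
  by rewrite (RintD _ bf (@bmf_cst R _ _ B)) Rint_prob_cst.
have R2 : (\int[(mu \x nu)%E]_zx g (vcons zx) = \int[(mu \x nu)%E]_zx f (vcons zx) + B)%R.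
  by rewrite (RintD _ hg (@bmf_cst R _ _ B)) Rint_prob_cst.
apply: (addIr B); rewrite -R1 -R2 /Rintegral; congr fine.
have H := ge0_integral_pushm (mu \x nu) (@measurable_vcons _ T n) mg (fun x => g0 x).
rewrite -[RHS]H; apply: eq_measure_integral => A mA _; exact: erefl.
Qed.
End prod_step.

(** Built by adding one coordinate in front, like [leb], so that statements go by
    induction on the number of draws. *)
Fixpoint prodm (R : realType) dT (T : measurableType dT) (mu : probability T R) (n : nat) :
    probability 'rV[T]_n R :=
  match n with
  | 0 => (\d_ (const_mx point : 'rV[T]_0) : probability 'rV[T]_0 R)
  | m.+1 => prodm_step mu (prodm mu m)
  end.

Section concentration.
Context {R : realType} {dT} {T : measurableType dT}.
Variable mu : probability T R.

Definition bounded_diff n (f : 'rV[T]_n -> R) (D : R) : Prop :=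
  forall i (x y : 'rV[T]_n), (forall j, j != i -> x ord0 j = y ord0 j) -> `|f x - f y| <= D.

Lemma bmf_vcons n (f : 'rV[T]_n.+1 -> R) z : bmf f -> bmf (fun x => f (vcons (z, x))).
Proof.
move=> [mf [B hB]]; split; last by exists B.
apply: (measurableT_comp mf); apply: (measurableT_comp (@measurable_vcons _ T n)).
by apply/measurable_fun_pairP; split; [exact: measurable_cst|exact: measurable_id].
Qed.

(** Efron-Stein inequality: conditioning on the first draw splits the variance into
    the variance of the conditional mean and a mean of variances. *)
Lemma efron_stein n (f : 'rV[T]_n -> R) (D : R) : bmf f -> 0 <= D -> bounded_diff f D ->
  \int[prodm mu n]_x ((f x - \int[prodm mu n]_y f y) ^+ 2) <= n%:R * D ^+ 2.
Proof.
move=> bf D0; elim: n f bf => [|n IH] f bf hD.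
  have c x : f x = f (const_mx point) by congr f; apply/rowP => -[].
  have -> : \int[prodm mu 0]_y f y = f (const_mx point).
    by rewrite (_ : f = (fun=> f (const_mx point))) ?Rint_prob_cst//; apply/funext.
  rewrite mul0r (_ : (fun x => _) = (fun=> 0)); first by rewrite Rint_prob_cst.
  by apply/funext => x; rewrite c subrr expr0n.
set m := \int[prodm mu n.+1]_y f y.
pose a z := \int[prodm mu n]_x f (vcons (z, x)).
have [ba Em] := prodm_step_fubini mu (prodm mu n) bf.
have {}Em : m = \int[mu]_z a z by [].
have bs z := bmf_vcons z bf.
have da z z' : `|a z - a z'| <= D.
  rewrite /a -RintB//; apply: Rint_norm_le; first exact: bmfB.
  move=> x; apply: (hD ord0) => j j0; rewrite !mxE.
  by case: unliftP j0 => [//|->]; rewrite eqxx.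
have dm z : `|a z - m| <= D.
  have -> : a z - m = \int[mu]_z' (a z - a z').
    by rewrite (RintB _ (bmf_cst (a z)) ba) Rint_prob_cst Em.
  by apply: Rint_norm_le => //; apply: bmfB => //; exact: bmf_cst.
have b2 : bmf (fun x => (f x - m) ^+ 2) by apply: bmfM; apply: bmfB => //; exact: bmf_cst.
have [bo ->] := prodm_step_fubini mu (prodm mu n) b2.
apply: Rint_le_cst => // z.
have bz : bmf (fun x => f (vcons (z, x)) - a z) by apply: bmfB => //; exact: bmf_cst.
have E : (fun x => (f (vcons (z, x)) - m) ^+ 2) =
    (fun x => (f (vcons (z, x)) - a z) ^+ 2 + (2 * (a z - m) * (f (vcons (z, x)) - a z) + (a z - m) ^+ 2)).
  by apply/funext => x; ring.
rewrite E RintD; [|exact: bmfM|by apply: bmfD; [apply: bmfM => //; exact: bmf_cst|exact: bmf_cst]].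
rewrite RintD; [|by apply: bmfM => //; exact: bmf_cst|exact: bmf_cst].
rewrite RintZ// Rint_prob_cst RintB//; last exact: bmf_cst.
rewrite Rint_prob_cst -/(a z) subrr mulr0 add0r -natr1 mulrDl mul1r; apply: lerD.
  apply: IH => // i x y xy; apply: (hD (lift ord0 i)) => j ji; rewrite !mxE.
  case: unliftP ji => [k ->|//] ji; apply: xy; apply: contraNneq ji => ->; exact: eqxx.
by rewrite -(real_normK (num_real (a z - m))) lerXn2r ?nnegrE.
Qed.

Definition rV_box n (B : 'I_n -> set T) : set 'rV[T]_n := [set x | forall i, B i (x ord0 i)].

Lemma prodm_box n (B : 'I_n -> set T) : (forall i, measurable (B i)) ->
  (prodm mu n (rV_box B) = \prod_i mu (B i))%E.
Proof.
elim: n B => [|n IH] B mB.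
  rewrite big_ord0 /= diracE (_ : _ \in _ = true)//.
  by apply/mem_set => -[].
rewrite big_ord_recl /=.
have -> : prodm_step mu (prodm mu n) (rV_box B) =
    (mu \x prodm mu n)%E (B ord0 `*` rV_box (fun i => B (lift ord0 i))).
  rewrite /prodm_step; congr ((_ \x _)%E _); apply/seteqP; split => -[z x] /=.
    move=> h; split; first by have := h ord0; rewrite mxE unlift_none.
    by move=> i /=; have := h (lift ord0 i); rewrite mxE liftK.
  move=> [h0 h] i; rewrite mxE; case: unliftP => [j ->|->] //=; exact: h.
rewrite product_measure1E//; last first.
  rewrite (_ : rV_box _ = \bigcap_(i in [set: 'I_n]) (rV_coor i @^-1` B (lift ord0 i))).
    apply: fin_bigcap_measurable => [|i _]; first exact: finite_finset.
    by apply: measurable_preimage => //; exact: measurable_rV_coor.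
  apply/seteqP; split => x /= h i; first by move=> _; exact: h.
  exact: (h i).
by apply: (congr1 (fun u => (mu (B ord0) * u)%E)); apply: IH => i.
Qed.
End concentration.

(** * Independent draws *)

Section uniqueness.
Context {R : realType} {dT} {T : measurableType dT}.
Variable mu : probability T R.

Definition boxes n : set (set 'rV[T]_n) :=
  [set rV_box B | B in [set B : 'I_n -> set T | forall i, measurable (B i)]].
Arguments boxes : clear implicits.

Lemma measurable_boxes n : @measurable _ 'rV[T]_n = <<s boxes n >>.
Proof.
apply/seteqP; split => A.
  move=> mA; have : g_sigma_preimage (@rV_coor _ T n) `<=` <<s boxes n >>.
    apply: smallest_sub; first exact: smallest_sigma_algebra.
    move=> B; rewrite -bigcup_seq/= => -[i _ [C mC <-]].
    apply: sub_sigma_algebra; exists (fun j => if j == i then C else setT).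
      by move=> j; case: ifP.
    rewrite setTI; apply/seteqP; split => x /=.
      by move=> /(_ i); rewrite eqxx.
    by move=> h j; case: eqP => // ->.
  by apply.
have : <<s boxes n >> `<=` [set A : set 'rV[T]_n | measurable A].
  apply: smallest_sub; first exact: sigma_algebra_measurable.
  move=> _ [B mB <-] /=.
  rewrite (_ : rV_box _ = \bigcap_(i in [set: 'I_n]) (rV_coor i @^-1` B i)).
    apply: fin_bigcap_measurable => [|i _]; first exact: finite_finset.
    by apply: measurable_preimage => //; exact: measurable_rV_coor.
  by apply/seteqP; split => x /= h i; [move=> _; exact: h|exact: (h i)].
by apply.
Qed.

(** Boxes are stable under intersection and generate the sigma-algebra. *)
Lemma prodm_unique n (m : {measure set 'rV[T]_n -> \bar R}) :
  (forall B : 'I_n -> set T, (forall i, measurable (B i)) -> m (rV_box B) = (\prod_i mu (B i))%E) ->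
  forall A, measurable A -> m A = prodm mu n A.
Proof.
move=> H A mA; apply: (@measure_unique _ R _ (boxes n) (fun=> setT) (@measurable_boxes n)) => //.
- move=> _ _ [B mB <-] [C mC <-]; exists (fun i => B i `&` C i).
    by move=> i; exact: measurableI.
  by apply/seteqP; split => x /=; [move=> h; split => i; case: (h i)|move=> [h1 h2] i; split].
- by move=> _; exists (fun=> setT) => //; apply/seteqP; split.
- by rewrite bigcup_const.
- by move=> _ [B mB <-]; apply: etrans (H B mB) _; apply/esym; exact: prodm_box.
- move=> _; have -> : [set: 'rV[T]_n] = rV_box (fun=> setT) by apply/seteqP; split.
  rewrite H// big1; first exact: ltry.
  by move=> i _; exact: probability_setT.
Qed.

Lemma measurable_perm n (s : {perm 'I_n}) : measurable_fun setT (fun x : 'rV[T]_n => \row_i x ord0 (s i)).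
Proof.
apply: measurable_fun_rV => i; rewrite (_ : _ \o _ = rV_coor (s i)); first exact: measurable_rV_coor.
by apply/funext => x; rewrite /rV_coor/= mxE.
Qed.

Lemma prodm_perm n (s : {perm 'I_n}) (A : set 'rV[T]_n) : measurable A ->
  prodm mu n [set x | A (\row_i x ord0 (s i))] = prodm mu n A.
Proof.
move=> mA; have := @prodm_unique n (pushm (prodm mu n) (measurable_perm s)).
apply => // B mB.
transitivity (prodm mu n (rV_box (fun i => B (s^-1%g i)))).
  congr (prodm mu n _); apply/seteqP; split => x /= h i.
    by have := h (s^-1%g i); rewrite mxE permKV.
  by rewrite mxE; have := h (s i); rewrite permK.
rewrite prodm_box//.
rewrite (reindex_inj (@perm_inj _ s))/=; apply: eq_bigr => i _; by rewrite permK.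
Qed.

Lemma Rint_push dU (U : measurableType dU) (Q : probability U R) n (X : U -> 'rV[T]_n) (f : 'rV[T]_n -> R) :
  measurable_fun setT X -> (forall A, measurable A -> Q (X @^-1` A) = prodm mu n A) -> bmf f ->
  \int[Q]_w f (X w) = \int[prodm mu n]_x f x.
Proof.
move=> mX HX bf; have [mf [B hB]] := bf.
pose g x := f x + B; have g0 x : (0 <= (g x)%:E)%E.
  by rewrite lee_fin /g; have := hB x; rewrite ler_norml => /andP[? _]; lra.
have mg : measurable_fun setT (EFin \o g) by apply/measurable_EFinP; apply: measurable_funD.
have bX : bmf (fun w => f (X w)) by split; [exact: (measurableT_comp mf mX)|exists B].
apply: (addIr B).
have R1 := RintD Q bX (@bmf_cst R _ U B); rewrite Rint_prob_cst in R1; rewrite -R1.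
have R2 := RintD (prodm mu n) bf (@bmf_cst R _ _ B); rewrite Rint_prob_cst in R2; rewrite -R2.
rewrite /Rintegral; congr fine.
rewrite -(ge0_integral_pushm Q mX mg g0).
by apply: eq_measure_integral => A mA _; exact: HX.
Qed.

(** Allows any particle to be drawn first. *)
Lemma Rint_perm n (s : {perm 'I_n}) f : bmf f ->
  \int[prodm mu n]_x f (\row_i x ord0 (s i)) = \int[prodm mu n]_x f x.
Proof.
by move=> bf; apply: (Rint_push (measurable_perm s)) => // A mA; exact: prodm_perm.
Qed.
End uniqueness.

Section law.
Context {R : realType} {dT} {T : measurableType dT} {dO} {Omega : measurableType dO}.
Variables (Pr : probability Omega R) (X : nat -> {RV Pr >-> T}) (mu : probability T R).
Hypothesis indep : mutually_independent X.
Hypothesis lawX : forall k A, measurable A -> Pr (X k @^-1` A) = mu A.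

Definition sample n (w : Omega) : 'rV[T]_n := \row_(i < n) X i w.

Lemma measurable_sample n : measurable_fun setT (sample n).
Proof.
apply: measurable_fun_rV => i; rewrite (_ : _ \o _ = X i) //.
by apply/funext => w; rewrite /rV_coor/= mxE.
Qed.

Lemma sample_law n A : measurable A -> Pr (sample n @^-1` A) = prodm mu n A.
Proof.
move=> mA; have := @prodm_unique _ _ _ mu n (pushm Pr (@measurable_sample n)).
apply => // B mB.
pose C (k : nat) : set T := if insub k is Some i then B i else setT.
have mC k : measurable (C k) by rewrite /C; case: insub => [i|] //.
have CE (i : 'I_n) : C i = B i by rewrite /C valK.
have := @indep (iota 0 n) C (iota_uniq 0 n) mC.
have -> : \bigcap_(k in [set` iota 0 n]) (X k @^-1` C k) = sample n @^-1` rV_box B.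
  apply/seteqP; split => w /= h.
    by move=> i; rewrite mxE -CE; apply: (h i); rewrite /= mem_iota add0n ltn_ord.
  move=> k; rewrite /= mem_iota add0n => /= kn.
  by have := h (Ordinal kn); rewrite mxE -CE.
move=> E; apply: etrans E _.
rewrite (_ : iota 0 n = index_iota 0 n); last by rewrite /index_iota subn0.
rewrite big_mkord; apply: eq_bigr => i _.
by rewrite lawX// CE.
Qed.
End law.

Section swap.
Context {R : realType} {d1 d2} {T1 : measurableType d1} {T2 : measurableType d2}.
Variables (P1 : probability T1 R) (P2 : probability T2 R).

Lemma bmf_swap (f : T1 * T2 -> R) : bmf f ->
  \int[P1]_x \int[P2]_y f (x, y) = \int[P2]_y \int[P1]_x f (x, y).
Proof.
move=> hf; have [mf [B hB]] := hf.
pose g z := f z + B; have hg : bmf g by apply: bmfD => //; exact: bmf_cst.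
have g0 z : (0 <= (EFin \o g) z)%E.
  by rewrite lee_fin /g; have := hB z; rewrite ler_norml => /andP[? _]; lra.
have mg : measurable_fun setT (EFin \o g) by apply/measurable_EFinP; case: hg.
have [b1 e1] := bmf_fubini P1 P2 hf.
pose f' (z : T2 * T1) := f (z.2, z.1).
have hf' : bmf f'.
  split; last by exists B => z; exact: hB.
  apply: (measurableT_comp mf); apply/measurable_fun_pairP; split; [exact: measurable_snd|exact: measurable_fst].
have [b2 e2] := bmf_fubini P2 P1 hf'.
have s1 x : bmf (fun y => f (x, y)) by exact: bmf_sect.
have s2 y : bmf (fun x => f (x, y)) by exact: (bmf_sect y hf').
have FT := @fubini_tonelli _ _ _ _ _ P1 P2 (EFin \o g) mg g0.
have L : \int[P1]_x (\int[P2]_y f (x, y) + B) = fine (\int[P1]_x \int[P2]_y (EFin \o g) (x, y))%E.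
  rewrite /Rintegral; congr fine; apply: eq_integral => x _.
  have := RintD P2 (s1 x) (@bmf_cst R _ T2 B); rewrite Rint_prob_cst => <-.
  by rewrite -bmf_integralE//; apply: bmfD => //; exact: bmf_cst.
have L' : \int[P2]_y (\int[P1]_x f (x, y) + B) = fine (\int[P2]_y \int[P1]_x (EFin \o g) (x, y))%E.
  rewrite /Rintegral; congr fine; apply: eq_integral => y _.
  have := RintD P1 (s2 y) (@bmf_cst R _ T1 B); rewrite Rint_prob_cst => <-.
  by rewrite -bmf_integralE//; apply: bmfD => //; exact: bmf_cst.
apply: (addIr B).
have R1 := RintD P1 b1 (@bmf_cst R _ T1 B); rewrite Rint_prob_cst in R1; rewrite -R1 L FT -L'.
by have R2 := RintD P2 b2 (@bmf_cst R _ T2 B); rewrite Rint_prob_cst in R2; rewrite -R2.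
Qed.
End swap.

Section limits.
Context {R : realType} {dT} {T : measurableType dT}.
Variable P : probability T R.

(** Bounded convergence. *)
Lemma bmf_cvg (f : nat -> T -> R) (g : T -> R) (B : R) :
  (forall n, measurable_fun setT (f n)) -> (forall n x, `|f n x| <= B) ->
  (forall x, f n x @[n --> \oo] --> g x) ->
  bmf g /\ \int[P]_x f n x @[n --> \oo] --> \int[P]_x g x.
Proof.
move=> mf fB fg.
have mg : measurable_fun setT g by apply: (measurable_fun_cvg mf) => x _; exact: fg.
have gB x : `|g x| <= B.
  have H : `|f n x| @[n --> \oo] --> `|g x| by apply: cvg_norm; exact: fg.
  rewrite -(cvg_lim _ H)//; apply: limr_le; first by apply/cvg_ex; eexists; exact: H.
  by apply: nearW => n; exact: fB.
have bg : bmf g by split => //; exists B.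
split => //.
have bf n : bmf (f n) by split => //; exists B.
have := @dominated_cvg _ T R P setT measurableT (fun n => EFin \o f n) (EFin \o g) (fun=> B%:E).
move=> H; have {H} : (\int[P]_x (f n x)%:E @[n --> \oo] --> \int[P]_x (g x)%:E)%E.
  apply: H => //.
  - by move=> n; apply/measurable_EFinP.
  - by move=> x _; apply: cvg_EFin; [exact: nearW|exact: fg].
  - exact: (bmf_intg P (@bmf_cst R _ T B)).
  - by move=> n x _; rewrite /= lee_fin.
rewrite bmf_integralE// (_ : (fun n => _) = EFin \o (fun n => \int[P]_x f n x)); last first.
  by apply/funext => n; rewrite bmf_integralE.
by move=> /fine_cvg.
Qed.
End limits.

(** * Mean and fluctuations of the cut distance along the scheme *)

Section mean_bound.
Context {R : realType} {d : nat}.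
Local Notation phase := (@phase R d).
Variables (mu : probability phase R) (M s c r : R).
Hypothesis muM : forall A : set phase, measurable A -> (mu A <= M%:E * @leb_phase R d A)%E.
Hypotheses (hs : 0 <= s <= 1) (hc : (M%:E * @leb_phase R d (slab r s) <= c%:E)%E).

Lemma volume_preserving_slab (psi : phase -> phase) : measurable_fun setT psi ->
  (forall A : set phase, measurable A -> @leb_phase R d (psi @^-1` A) = @leb_phase R d A) ->
  (mu (psi @^-1` slab r s) <= c%:E)%E.
Proof.
move=> mpsi vol; have ms : measurable (slab r s : set phase) by exact: measurable_slab.
apply: le_trans (muM (measurable_preimage mpsi ms)) _; rewrite vol//.
Qed.

Lemma bmf_cutdist dT (T : measurableType dT) (psi : T -> phase) : measurable_fun setT psi ->
  bmf (fun z => cutdist r (psi z)).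
Proof.
move=> mpsi; split; first exact: (measurableT_comp (measurable_cutdist r) mpsi).
by exists 1 => z; rewrite ger0_norm ?cutdist_ge0// cutdist_le1.
Qed.

(** Markov's inequality: a volume-preserving motion cannot concentrate a bounded
    density in a thin slab around the rest set. *)
Lemma mean_cutdist (psi : phase -> phase) : measurable_fun setT psi ->
  (forall A : set phase, measurable A -> @leb_phase R d (psi @^-1` A) = @leb_phase R d A) ->
  s * (1 - c) <= \int[mu]_z cutdist r (psi z).
Proof.
move=> mpsi vol; have hA := volume_preserving_slab mpsi vol.
set A := psi @^-1` slab r s in hA *.
have mA : measurable A by apply: measurable_preimage => //; exact: measurable_slab.
have /andP[s0 s1] := hs.
have b1 : bmf (fun z : phase => \1_A z : R).
  split; first exact: measurable_indic.
  by exists 1 => z; rewrite indicE normr_nat; case: (_ \in _).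
have bc := @bmf_cst R _ phase 1.
have bi : bmf (fun z : phase => s * (1 - \1_A z)).
  by apply: bmfM; [exact: bmf_cst|exact: bmfB].
have IA : \int[mu]_z (\1_A z : R) <= c.
  rewrite -lee_fin -bmf_integralE// integral_indic// setIT//.
apply: (@le_trans _ _ (\int[mu]_z (s * (1 - \1_A z)))).
  rewrite RintZ; last exact: bmfB.
  by rewrite (RintB _ bc b1) Rint_prob_cst ler_wpM2l// lerD2l lerN2.
apply: Rint_le => //; first exact: bmf_cutdist.
move=> z; rewrite indicE; case: (boolP (z \in A)) => zA.
  by rewrite subrr mulr0 cutdist_ge0.
rewrite subr0 mulr1 /cutdist le_min s1 andbT leNgt; apply/negP => h.
by move/negP: zA; apply; rewrite inE.
Qed.
End mean_bound.

Section scheme_estimates.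
Context {R : realType} {d : nat}.
Local Notation phase := (@phase R d).
Variables (V S : 'rV[R]_d -> R) (Phi : R -> 'rV[R]_d -> R) (p : R -> R).
Hypotheses (cV : C1 V) (hS : C20 S).
Hypothesis hPhi : forall t, 0 <= t -> W2oo (Phi t) /\ C1 (Phi t).
Variables (mu : probability phase R) (M s c r : R).
Hypothesis muM : forall A : set phase, measurable A -> (mu A <= M%:E * @leb_phase R d A)%E.
Hypotheses (hs : 0 <= s <= 1) (hc : (M%:E * @leb_phase R d (slab r s) <= c%:E)%E).
Variables (T C : R).
Hypotheses (T0 : 0 <= T) (hC : (Cst V S Phi p T <= C%:E)%E).

Definition mean_cut (N : nat) (z : 'I_N -> phase) : R := N%:R^-1 * \sum_k cutdist r (z k).

Lemma mean_cut_ge0 N (z : 'I_N -> phase) : 0 <= mean_cut z.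
Proof. by rewrite mulr_ge0 ?invr_ge0// sumr_ge0// => k _; exact: cutdist_ge0. Qed.

Lemma mean_cut_le1 N (z : 'I_N -> phase) : mean_cut z <= 1.
Proof.
case: N z => [|N] z; first by rewrite /mean_cut invr0 mul0r.
rewrite /mean_cut ler_pdivrMl ?ltr0n// mulr1.
apply: (@le_trans _ _ (\sum_(k < N.+1) 1)); first by apply: ler_sum => k _; exact: cutdist_le1.
by rewrite sumr_const card_ord.
Qed.

Definition coords (N : nat) (x : 'rV[phase]_N) : 'I_N -> phase := fun k => x ord0 k.

Let th := s * (1 - c).

Lemma measurable_scheme_at dU (U : measurableType dU) N (cc : 'I_N -> 'I_N -> R) n (z : U -> 'I_N -> phase) k :
  (forall k, measurable_fun setT (fun x => z x k)) ->
  measurable_fun setT (fun x => scheme_at V S Phi p cc T n (z x) k).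
Proof.
move=> mz; apply: measurable_scheme => // m; apply: measurable_ext_force => //.
by rewrite mulr_ge0// divr_ge0.
Qed.

Let mcoord N k : measurable_fun setT (fun x : 'rV[phase]_N => coords x k).
Proof. exact: measurable_rV_coor. Qed.

(** The test particle is moved to the front by a transposition and integrated first; for
    fixed data of the others, its motion is a kick-drift map. *)
Let mean_out N' n (k : 'I_N'.+1) :
  th <= \int[prodm mu N'.+1]_x cutdist r (scheme_at V S Phi p (@out_coupling R _ k) T n (coords x) k).
Proof.
set N := N'.+1.
pose g (x : 'rV[phase]_N) := cutdist r (scheme_at V S Phi p (@out_coupling R _ k) T n (coords x) k).
have bg : bmf g by apply: bmf_cutdist; apply: measurable_scheme_at => k'; exact: mcoord.
pose sg := tperm ord0 k.
pose pm (x : 'rV[phase]_N) : 'rV[phase]_N := \row_i x ord0 (sg i).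
have -> : \int[prodm mu N]_x cutdist r (scheme_at V S Phi p (@out_coupling R _ k) T n (coords x) k) =
   \int[prodm mu N]_x g (pm x) by rewrite /pm Rint_perm.
have bgp : bmf (fun x => g (pm x)).
  have [mg [B hB]] := bg; split; last by exists B => x; exact: hB.
  exact: (measurableT_comp mg (measurable_perm sg)).
have [_ ->] := prodm_step_fubini mu (prodm mu N') bgp.
have bz : bmf (fun zx : phase * 'rV[phase]_N' => g (pm (vcons zx))).
  have [mg [B hB]] := bgp; split; last by exists B => x; exact: hB.
  exact: (measurableT_comp mg (@measurable_vcons _ phase N')).
rewrite (bmf_swap mu (prodm mu N') bz); apply: Rint_ge_cst.
  have bz' : bmf (fun yz : 'rV[phase]_N' * phase => g (pm (vcons (yz.2, yz.1)))).
    have [mg [B hB]] := bz; split; last by exists B => x; exact: hB.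
    apply: (measurableT_comp mg); apply: measurable_pairf; [exact: measurable_snd|exact: measurable_fst].
  by have [] := bmf_fubini (prodm mu N') mu bz'.
move=> y.
pose Z z := coords (pm (vcons (z, y))).
have Zk z : Z z k = z by rewrite /Z /coords /pm mxE tpermR mxE unlift_none.
have Zj z z' j : j != k -> Z z j = Z z' j.
  move=> jk; rewrite /Z /coords /pm !mxE; case: unliftP => [//|E].
  by move: jk; rewrite -(inj_eq (@perm_inj _ sg)) E tpermR eqxx.
pose h := T / n%:R.
pose E l := delayed_force (ext_force V Phi h) (grad S) (pweight p h) (@out_coupling R _ k)
  (scheme h (ext_force V Phi h) (grad S) (pweight p h) (@out_coupling R _ k) (Z point)) l k.
have gE z : g (pm (vcons (z, y))) = cutdist r (kick_drift h E n z).
  have H := scheme_kick_drift h (ext_force V Phi h) (grad S) (pweight p h) (@out_coupling R _ k) (Z z) n k.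
  rewrite Zk in H.
  have EE : (fun l => delayed_force (ext_force V Phi h) (grad S) (pweight p h) (@out_coupling R _ k)
      (scheme h (ext_force V Phi h) (grad S) (pweight p h) (@out_coupling R _ k) (Z z)) l k) = E.
    have ck k' : @out_coupling R N k k' k = 0 by rewrite /out_coupling eqxx.
    apply/funext => l; apply: (force_decoupled h (ext_force V Phi h) (grad S) (pweight p h) ck) => j jk.
    exact: Zj.
  rewrite EE in H; exact: (congr1 (cutdist r) H).
have mE l : measurable_fun setT (E l).
  apply: measurable_delayed_force => //; apply: measurable_ext_force => //.
  by rewrite mulr_ge0// divr_ge0.
rewrite (_ : (fun x => _) = (fun z => cutdist r (kick_drift h E n z))); last first.
  by apply/funext => z; exact: gE.
apply: (mean_cutdist muM hs hc); first exact: measurable_kick_drift.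
by move=> A mA; exact: kick_drift_volume.
Qed.

Section fixed_step.
Variable K : R.
Hypothesis K0 : 0 <= K.
Hypothesis HK : forall N (z : 'I_N -> phase) (k0 k : 'I_N) n, (0 < n)%N ->
  pdist (scheme_at V S Phi p (@full_coupling R N) T n z k) (scheme_at V S Phi p (@out_coupling R _ k0) T n z k) <=
    N%:R^-1 * (C / 3 + K / n%:R).
Variables (N' n : nat).
Hypothesis n0 : (0 < n)%N.
Let N := N'.+1.
Let Nr : R := N%:R.
Let e : R := C / 3 + K / n%:R.
Let A (x : 'rV[phase]_N) : R := mean_cut (scheme_at V S Phi p (@full_coupling R N) T n (coords x)).

Let e0 : 0 <= e.
Proof. by rewrite addr_ge0 ?divr_ge0// (Cst_real_ge0 hC). Qed.

Let Nr0 : 0 < Nr. Proof. by rewrite ltr0n. Qed.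

Let mA k : measurable_fun setT (fun x : 'rV[phase]_N => scheme_at V S Phi p (@full_coupling R N) T n (coords x) k).
Proof. by apply: measurable_scheme_at => k'; exact: mcoord. Qed.

Lemma bmf_mean_cut : bmf A.
Proof.
split; last by exists 1 => x; rewrite ger0_norm ?mean_cut_ge0// mean_cut_le1.
apply: measurable_funM => //; apply: measurable_sum => k.
by case: (bmf_cutdist r (mA k)).
Qed.

Lemma mean_lower_scheme : th - Nr^-1 * e <= \int[prodm mu N]_x A x.
Proof.
have bk k := bmf_cutdist r (mA k).
have bs : bmf (fun x : 'rV[phase]_N => \sum_k cutdist r (scheme_at V S Phi p (@full_coupling R N) T n (coords x) k)).
  split; first by apply: measurable_sum => k; case: (bk k).
  exists (\sum_(k < N) 1) => x; rewrite ger0_norm; last by apply: sumr_ge0 => k _; exact: cutdist_ge0.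
  by apply: ler_sum => k _; exact: cutdist_le1.
rewrite /A /mean_cut RintZ// Rint_sum; last by move=> k; exact: bmf_intg.
rewrite ler_pdivlMl//.
apply: (@le_trans _ _ (\sum_(k < N) (th - Nr^-1 * e))).
  by rewrite sumr_const card_ord mulr_natl.
apply: ler_sum => k _; rewrite lerBlDr.
have bo : bmf (fun x : 'rV[phase]_N => cutdist r (scheme_at V S Phi p (@out_coupling R _ k) T n (coords x) k)).
  by apply: bmf_cutdist; apply: measurable_scheme_at => k'; exact: mcoord.
apply: le_trans (mean_out n k) _.
apply: (@le_trans _ _ (\int[prodm mu N]_x (cutdist r (scheme_at V S Phi p (@full_coupling R N) T n (coords x) k) + Nr^-1 * e))).
  apply: (Rint_le _ bo (bmfD (bk k) (@bmf_cst R _ _ (Nr^-1 * e)))) => x.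
  rewrite addrC -lerBlDr; apply: le_trans (ler_norm _) _.
  by apply: le_trans (cutdist_lip r _ _) _; rewrite pdistC; exact: HK.
by rewrite (RintD _ (bk k) (@bmf_cst R _ _ _)) Rint_prob_cst.
Qed.

(** The modified particle itself contributes at most 1; each other one is compared with
    the run in which the modified particle has no influence. *)
Let bdA : bounded_diff A (Nr^-1 * (1 + 2 * e)).
Proof.
move=> i x y xy; rewrite /A /mean_cut -mulrBr normrM ger0_norm ?invr_ge0// ler_wpM2l ?invr_ge0//.
rewrite -sumrB; apply: le_trans (ler_norm_sum _ _ _) _.
rewrite (bigD1 i)//=; apply: lerD.
  set u := scheme_at _ _ _ _ _ _ _ _ i; set u' := scheme_at _ _ _ _ _ _ _ _ i.
  have h1 := cutdist_ge0 r u; have h2 := cutdist_le1 r u.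
  have h3 := cutdist_ge0 r u'; have h4 := cutdist_le1 r u'.
  by rewrite ler_norml; apply/andP; split; lra.
apply: (@le_trans _ _ (\sum_(k < N | k != i) Nr^-1 * (2 * e))).
  apply: ler_sum => k ki; apply: le_trans (cutdist_lip r _ _) _.
  have E : scheme_at V S Phi p (@out_coupling R _ i) T n (coords x) k = scheme_at V S Phi p (@out_coupling R _ i) T n (coords y) k.
    have ck k' : @out_coupling R N i k' i = 0 by rewrite /out_coupling eqxx.
    apply: (scheme_decoupled (T / n%:R) (ext_force V Phi (T / n%:R)) (grad S) (pweight p (T / n%:R)) ck _ _ ki) => j ji.
    exact: xy.
  apply: le_trans (pdist_triangle _ (scheme_at V S Phi p (@out_coupling R _ i) T n (coords x) k) _) _.
  rewrite (_ : Nr^-1 * (2 * e) = Nr^-1 * e + Nr^-1 * e); last by ring.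
  apply: lerD; first exact: HK.
  by rewrite E pdistC; exact: HK.
apply: (@le_trans _ _ (\sum_(k < N) Nr^-1 * (2 * e))).
  rewrite [leRHS](bigD1 i)//= lerDr mulr_ge0 ?invr_ge0// mulr_ge0//.
by rewrite sumr_const card_ord -[leLHS]mulr_natl mulrA mulfV ?mul1r// gt_eqF.
Qed.

(** A deficit below Theta is either a deficit of the mean or a deviation from the mean. *)
Lemma deviation_scheme :
  \int[prodm mu N]_x Num.max (th - A x) 0 <= Nr^-1 * e + Num.sqrt Nr^-1 * (1 + 2 * e).
Proof.
have bA := bmf_mean_cut; set m := \int[prodm mu N]_x A x.
have D0 : 0 <= Nr^-1 * (1 + 2 * e) by rewrite mulr_ge0 ?invr_ge0 ?addr_ge0 ?mulr_ge0// ltW.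
have es := efron_stein mu bA D0 bdA.
have bm : bmf (fun x => A x - m) by apply: bmfB => //; exact: bmf_cst.
have H : \int[prodm mu N]_x `|A x - m| <= Num.sqrt Nr^-1 * (1 + 2 * e).
  apply: Rint_abs_le_sqr => //; first by rewrite mulr_ge0 ?sqrtr_ge0// addr_ge0// mulr_ge0.
  apply: le_trans es _; rewrite [leRHS]exprMn sqr_sqrtr ?invr_ge0 ?(ltW Nr0)// exprMn mulrA.
  have -> : N%:R * Nr^-1 ^+ 2 = Nr^-1 by rewrite -/Nr expr2 mulrA mulfV ?mul1r// gt_eqF.
  exact: lexx.
apply: (@le_trans _ _ (\int[prodm mu N]_x (Nr^-1 * e + `|A x - m|))).
  apply: Rint_le.
  - split; first by apply: measurable_maxr => //; apply: measurable_funB => //; case: bA.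
    exists (`|th| + 1) => x; rewrite ger0_norm ?le_max ?lexx ?orbT//.
    rewrite ge_max addr_ge0// andbT; have := mean_cut_ge0 (scheme_at V S Phi p (@full_coupling R N) T n (coords x)).
    by have := ler_norm th; rewrite -/(A x); lra.
  - by apply: bmfD; [exact: bmf_cst|exact: bmf_norm].
  move=> x; rewrite ge_max; apply/andP; split; last first.
    by rewrite addr_ge0// mulr_ge0 ?invr_ge0// ltW.
  have := mean_lower_scheme; rewrite -/m; have := ler_norm (m - A x); rewrite distrC; lra.
by rewrite (RintD _ (@bmf_cst R _ _ _) (bmf_norm bm)) Rint_prob_cst lerD2l.
Qed.
End fixed_step.
End scheme_estimates.

(** * Bounded densities, and measurability of the distance to equilibria *)

Section density.
Context {R : realType} {d : nat}.
Local Notation phase := (@phase R d).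
Local Open Scope ereal_scope.

Lemma normLoo_phase_ae (f : phase -> R) (m : R) : 0 < @leb_phase R d setT ->
  normLoo_phase f <= m%:E -> {ae @leb_phase R d, forall z, (`|f z| <= m)%R}.
Proof.
move=> l0; rewrite /normLoo_phase unlock /= l0 => /ess_supP.
by apply: filterS => z /=; rewrite lee_fin.
Qed.

(** The density may be replaced by its truncation between 0 and its essential supremum. *)
Lemma density_le (f0 : phase -> R) (A : set phase) : prob_density f0 ->
  normLoo_phase f0 < +oo -> measurable A ->
  \int[@leb_phase R d]_(z in A) (f0 z)%:E <= (fine (normLoo_phase f0))%:E * @leb_phase R d A.
Proof.
move=> [mf f0ge f1] flt mA; set M := fine _.
have M0 : (0 <= M)%R by rewrite fine_ge0// Lnorm_ge0.
have ME : M%:E = normLoo_phase f0 by rewrite fineK// ge0_fin_numE ?Lnorm_ge0.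
have l0 : 0 < @leb_phase R d setT.
  rewrite lt_neqAle measure_ge0 andbT; apply/negP => /eqP l0.
  have E : \int[@leb_phase R d]_z (f0 z)%:E = 0.
    rewrite null_set_integral//; first exact/measurable_EFinP.
  by move: f1; rewrite E => /esym/eqP; rewrite onee_eq0.
have fM := normLoo_phase_ae l0 (eq_ind _ (fun u => u <= M%:E) (lexx _) _ ME).
pose g z : R := (Num.min (Num.max (f0 z) 0) M)%R.
have mg : measurable_fun setT g.
  rewrite (_ : g = (fun z => Num.max (f0 z) 0 + M - Num.max (Num.max (f0 z) 0) M)%R); last first.
    by apply/funext => z; rewrite /g; case: (leP (Num.max (f0 z) 0)%R M) => _; lra.
  apply: measurable_funB; first by apply: measurable_funD => //; exact: measurable_maxr.
  by apply: measurable_maxr => //; exact: measurable_maxr.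
rewrite (@ae_eq_integral _ _ _ (@leb_phase R d) A (EFin \o g))//; last 3 first.
- by apply: measurable_funTS; exact/measurable_EFinP.
- by apply: measurable_funTS; exact/measurable_EFinP.
- apply: filterS2 f0ge fM => z h1 h2 _; rewrite /g /= max_l// min_l//.
  by rewrite (le_trans (ler_norm _)).
rewrite -integral_cst//; apply: ge0_le_integral => //.
- by move=> z _; rewrite lee_fin /g le_min M0 le_max lexx orbT.
- by apply: measurable_funTS; exact/measurable_EFinP.
- by move=> z _; rewrite lee_fin /g ge_min lexx orbT.
Qed.
End density.

Section measurable_distance.
Context {R : realType} {d : nat}.
Local Notation phase := (@phase R d).
Variables (V S : 'rV[R]_d -> R) (P : R -> R) (N : nat).
Implicit Types (z y : 'I_N -> phase).

Lemma DNEq_lip z y : (DNEq V S P z <= DNEq V S P y + (DN z y)%:E)%E.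
Proof.
rewrite -leeBlDr//; apply: le_ereal_inf_tmp => _ [x Ex <-].
rewrite leeBlDr// -EFinD; apply: (@le_trans _ _ (DN z x)%:E).
  by apply: ereal_inf_lbound; exists x.
by rewrite lee_fin addrC DN_triangle.
Qed.

Local Notation code := {ffun 'I_N -> 'rV[rat]_d * 'rV[rat]_d}.

Definition rat_state (c : code) : 'I_N -> phase :=
  fun k => (\row_i ratr ((c k).1 ord0 i), \row_i ratr ((c k).2 ord0 i)).

Lemma rat_state_dense z (e : R) : 0 < e -> exists c, DN z (rat_state c) <= e.
Proof.
move=> e0; pose e' := e / (2 * d%:R + 1).
have D0 : 0 < 2 * d%:R + 1 :> R by rewrite ltr_wpDl// mulr_ge0.
have e'0 : 0 < e' by rewrite divr_gt0.
have ap (x : R) : exists a : rat, `|x - ratr a| <= e'.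
  have [a] := @rat_in_itvoo R (x - e') x (ltac:(lra)).
  rewrite in_itv/= => /andP[h1 h2]; exists a; rewrite ger0_norm; lra.
pose a x := sval (cid (ap x)).
have ha x : `|x - ratr (a x)| <= e' by rewrite /a; case: cid.
exists [ffun k => (\row_i a ((z k).1 ord0 i), \row_i a ((z k).2 ord0 i))].
have row_le (x : 'rV[R]_d) : enorm (x - \row_i ratr (a (x ord0 i))) <= d%:R * e'.
  apply: le_trans (enorm_le_sum _) _; apply: (@le_trans _ _ (\sum_(i < d) e')).
    by apply: ler_sum => i _; rewrite !mxE.
  by rewrite sumr_const card_ord mulr_natl.
have [N0|N0] := posnP N.
  by rewrite DNE (_ : (N%:R^-1 : R) = 0) ?mul0r ?ltW// N0 invr0.
rewrite DNE ler_pdivrMl ?ltr0n//.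
apply: (@le_trans _ _ (\sum_(k < N) e)); last by rewrite sumr_const card_ord mulr_natl.
apply: ler_sum => k _; rewrite ge_min; apply/orP; left.
rewrite /pdist /rat_state ffunE /=; apply: le_trans (hypot_leD _ _) _; rewrite ?enorm_ge0//.
have r1 := row_le (z k).1; have r2 := row_le (z k).2.
apply: (@le_trans _ _ (d%:R * e' + d%:R * e')).
  apply: lerD.
    by apply: le_trans r1; rewrite le_eqVlt; apply/orP; left; apply/eqP; congr (enorm (_ - _)); apply/rowP => i; rewrite !mxE.
  by apply: le_trans r2; rewrite le_eqVlt; apply/orP; left; apply/eqP; congr (enorm (_ - _)); apply/rowP => i; rewrite !mxE.
rewrite (_ : _ + _ = 2 * d%:R * e'); last by ring.
by rewrite /e' mulrCA ler_piMr ?(ltW e0)// ler_pdivrMr// mul1r lerDl.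
Qed.

Definition rat_seq (n : nat) : 'I_N -> phase := rat_state (odflt [ffun=> (0, 0)] (unpickle n)).

(** A Lipschitz function is the infimum of the cones over a countable dense set. *)
Lemma DNEq_countable z :
  DNEq V S P z = einfs (fun n => DNEq V S P (rat_seq n) + (DN z (rat_seq n))%:E)%E 0.
Proof.
apply/eqP; rewrite eq_le; apply/andP; split.
  by apply: le_ereal_inf_tmp => _ [n _ <-]; exact: DNEq_lip.
apply/lee_addgt0Pr => e e0; have e2 : 0 < e / 2 by rewrite divr_gt0.
have [c hc] := rat_state_dense z e2.
have E : rat_seq (pickle c) = rat_state c by rewrite /rat_seq pickleK.
apply: (@le_trans _ _ (DNEq V S P (rat_state c) + (DN z (rat_state c))%:E)%E).
  by apply: ereal_inf_lbound; exists (pickle c) => //; rewrite E.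
apply: (@le_trans _ _ ((DNEq V S P z + (DN (rat_state c) z)%:E) + (DN z (rat_state c))%:E)%E).
  by rewrite leeD2r// DNEq_lip.
rewrite -addeA leeD2l// -EFinD lee_fin DNC; lra.
Qed.

Lemma measurable_DNEq dU (U : measurableType dU) (z : U -> 'I_N -> phase) :
  (forall k, measurable_fun setT (fun x => z x k)) ->
  measurable_fun setT (fun x => DNEq V S P (z x)).
Proof.
move=> mz; under eq_fun => x do rewrite DNEq_countable.
apply: (@measurable_fun_einfs _ _ _ setT
  (fun n x => DNEq V S P (rat_seq n) + (DN (z x) (rat_seq n))%:E)%E) => n.
apply: emeasurable_funD => //; apply/measurable_EFinP.
under eq_fun => x do rewrite DNE.
apply: measurable_funM => //; apply: measurable_sum => k.
by apply: measurable_min1; apply: measurable_pdist.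
Qed.
End measurable_distance.

(** * Bounds on the mean and on deviations *)

Section finite_bounds.
Context {R : realType} {d : nat}.
Local Notation phase := (@phase R d).
Variables (V S : 'rV[R]_d -> R) (Phi : R -> 'rV[R]_d -> R) (p P : R -> R) (r : R) (f0 : phase -> R).
Context {dO : measure_display} {Omega : measurableType dO}.
Variables (Pr : probability Omega R) (Z0 : nat -> {RV Pr >-> phase}).
Variables (q v : forall N : nat, Omega -> 'I_N -> R -> 'rV[R]_d).
Arguments q : clear implicits.
Arguments v : clear implicits.
Hypotheses (d0 : (0 < d)%N) (hf0 : prob_density f0) (hf0_Loo : (normLoo_phase f0 < +oo)%E).
Hypotheses (cV : C1 V) (hS : C20 S) (hp : locally_integrable setT p).
Hypothesis hPhi : forall t, 0 <= t -> W2oo (Phi t) /\ C1 (Phi t).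
Hypothesis cPhi : forall t, 0 <= t ->
  normW2oo (Phi s \- Phi t) @[s --> within [set s | 0 <= s] (nbhs t)] --> 0%E.
Hypothesis weakV : (forall i, has_weak_partial i V) /\
  (forall i j, has_weak_partial i (weak_partial j V)).
Hypothesis hr : 0 <= r.
Hypothesis hEq : forall N (y : 'I_N -> phase), EqN V S P y ->
  forall k, enorm (y k).1 <= r /\ (y k).2 = 0.
Hypothesis indep : mutually_independent Z0.
Hypothesis law : forall k, has_density (Z0 k) f0.
Hypothesis hqv : forall N : nat, (0 < N)%N -> forall w : Omega,
  is_solution V S Phi p (fun k : 'I_N => Z0 k w) (q N w) (v N w).
Hypothesis hV : (normLoo (opnorm \o weak_hess V) < +oo)%E.

Let D N t w := DNEq V S P (fun k : 'I_N => (q N w k t, v N w k t)).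

Let mu : probability phase R := distribution Pr (Z0 0%N).

Lemma law_draw k (A : set phase) : measurable A -> Pr (Z0 k @^-1` A) = mu A.
Proof.
by move=> mA; apply: etrans (law k mA) _; apply/esym; exact: (law 0%N mA).
Qed.

Lemma draw_density (A : set phase) : measurable A ->
  (mu A <= (fine (normLoo_phase f0))%:E * @leb_phase R d A)%E.
Proof.
move=> mA; have -> : mu A = (\int[@leb_phase R d]_(z in A) (f0 z)%:E)%E by exact: (law 0%N mA).
exact: density_le.
Qed.

Let lV : forall x y, enorm (grad V x - grad V y) <= LV V * enorm (x - y).
Proof.
case: weakV => w1 w2; apply: weak_hess_grad_lip => //.
by rewrite /LV normLoo_fineK.
Qed.

Variables (N' : nat) (T : R).
Hypothesis T0 : 0 <= T.
Let N := N'.+1.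

Let state w : 'I_N -> phase := fun k => (q N w k T, v N w k T).

Let numeric n w : 'I_N -> phase :=
  scheme_at V S Phi p (@full_coupling R N) T n (coords (sample Z0 N w)).

Let coords_sample w : coords (sample Z0 N w) = (fun k : 'I_N => Z0 k w).
Proof. by apply/funext => k; rewrite /coords /sample mxE. Qed.

Let numeric_cvg w e : 0 < e -> exists n0, forall n, (n0 <= n)%N -> forall k,
  pdist (numeric n.+1 w k) (state w k) <= e.
Proof.
move=> e0; have [n0 hn0] := scheme_at_cvg cV hS hp hPhi cPhi lV (ltn0Sn N') (hqv (ltn0Sn N') w) T0 e0.
exists n0 => n nn k; rewrite /numeric coords_sample; apply: hn0 => //.
exact: leq_trans nn _.
Qed.

Let measurable_numeric n k : measurable_fun setT (fun w => numeric n w k).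
Proof.
apply: measurable_scheme_at => // k'.
rewrite (_ : (fun x => _) = Z0 k') //.
by apply/funext => w; rewrite coords_sample.
Qed.

(** Solutions are given for each outcome separately; their measurability comes from
    their being limits of explicit functions of the data. *)
Lemma measurable_state k : measurable_fun setT (fun w => state w k).
Proof.
have aux (pr : phase -> 'rV[R]_d) : measurable_fun setT pr ->
    (forall z y, enorm (pr z - pr y) <= pdist z y) ->
    measurable_fun setT (fun w => pr (state w k)).
  move=> mpr lpr; apply: measurable_fun_rV => i.
  apply: (@measurable_fun_cvg _ _ _ _ (fun n w => rV_coor i (pr (numeric n.+1 w k)))).
    move=> n; apply: (measurableT_comp (measurable_rV_coor i)).
    exact: (measurableT_comp mpr).
  move=> w _; apply/cvgrPdist_le => e e0; have [n0 hn0] := numeric_cvg w e0.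
  exists n0 => // n /= nn; rewrite distrC; apply: le_trans (hn0 n nn k).
  apply: le_trans (lpr _ _); rewrite /rV_coor.
  by have := ler_coord_enorm (pr (numeric n.+1 w k) - pr (state w k)) i; rewrite !mxE.
apply: measurable_pairf.
  by apply: (aux fst) => // z y; apply: hypot_lel; exact: enorm_ge0.
by apply: (aux snd) => // z y; apply: hypot_ler; exact: enorm_ge0.
Qed.

Let A w : R := mean_cut r (state w).

Let mean_cut_lip (z y : 'I_N -> phase) e : (forall k, pdist (z k) (y k) <= e) ->
  `|mean_cut r z - mean_cut r y| <= e.
Proof.
move=> h; rewrite /mean_cut -mulrBr -sumrB normrM ger0_norm ?invr_ge0// ler_pdivrMl ?ltr0n//.
apply: le_trans (ler_norm_sum _ _ _) _; apply: (@le_trans _ _ (\sum_(k < N) e)).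
  by apply: ler_sum => k _; apply: le_trans (cutdist_lip r _ _) _.
by rewrite sumr_const card_ord mulr_natl.
Qed.

Let A_cvg w : mean_cut r (numeric n.+1 w) @[n --> \oo] --> A w.
Proof.
apply/cvgrPdist_le => e e0; have [n0 hn0] := numeric_cvg w e0.
by exists n0 => // n /= nn; rewrite distrC; apply: mean_cut_lip; exact: hn0.
Qed.

Let max_cvg : forall (th : R) (u : nat -> R) (l : R), u n @[n --> \oo] --> l ->
  Num.max (th - u n) 0 @[n --> \oo] --> Num.max (th - l) 0.
Proof.
move=> th u l /cvgrPdist_le ul; apply/cvgrPdist_le => e e0.
apply: filterS (ul e e0) => n; rewrite ler_norml => /andP[h1 h2].
by rewrite ler_norml; case: (leP (th - l) 0) => ?; case: (leP (th - u n) 0) => ?; apply/andP; split; lra.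
Qed.

(** The bounds for the scheme pass to the limit of vanishing time steps, by bounded
    convergence. *)
Lemma mean_cut_bounds (C : R) : (Cst V S Phi p T <= C%:E)%E ->
  [/\ bmf A, Theta r f0 - (Num.sqrt N%:R)^-1 * C <= \int[Pr]_w A w &
      \int[Pr]_w Num.max (Theta r f0 - A w) 0 <= (1 + C) * (Num.sqrt N%:R)^-1].
Proof.
move=> hC; have C0 := Cst_real_ge0 hC.
have [s [c [hs hc1 -> hc]]] := Theta_split d0 f0 hr.
set th := s * (1 - c).
have [K K0 HK] := leave_one_out_bound cV hS hp hPhi cPhi hV lV T0 hC.
have mm n : measurable_fun setT (fun w => mean_cut r (numeric n.+1 w)).
  apply: measurable_funM => //; apply: measurable_sum => k.
  by case: (bmf_cutdist r (@measurable_numeric n.+1 k)).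
have b1 n w : `|mean_cut r (numeric n.+1 w)| <= 1 by rewrite ger0_norm ?mean_cut_ge0// mean_cut_le1.
have [bA cA] := bmf_cvg Pr mm b1 A_cvg.
have bB n : bmf (fun x : 'rV[phase]_N => mean_cut r (scheme_at V S Phi p (@full_coupling R N) T n.+1 (coords x))).
  exact: (bmf_mean_cut p cV hS hPhi r T0).
have push n : \int[Pr]_w mean_cut r (numeric n.+1 w) = \int[prodm mu N]_x
    mean_cut r (scheme_at V S Phi p (@full_coupling R N) T n.+1 (coords x)).
  exact: (Rint_push (measurable_sample (n:=N) Z0) (fun B mB => sample_law indep law_draw mB) (bB n)).
pose Nr : R := N%:R; have Nr0 : 0 < Nr by rewrite ltr0n.
(* the deficit C/3 of the mean and the deviation 1 + 2C/3 sum up to 1 + C *)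
have sN : Nr^-1 <= (Num.sqrt Nr)^-1.
  rewrite lef_pV2 ?posrE ?sqrtr_gt0// -[leRHS]sqr_sqrtr ?(ltW Nr0)// expr2 ler_peMr ?sqrtr_ge0//.
  by rewrite -sqrtr1 ler_wsqrtr// ler1n.
have sNe : Num.sqrt Nr^-1 = (Num.sqrt Nr)^-1 by rewrite sqrtrV// ltW.
have s0 : 0 <= (Num.sqrt Nr)^-1 by rewrite invr_ge0 sqrtr_ge0.
have lim_e (a b : R) : a + b * (K / n.+1%:R) @[n --> \oo] --> a.
  rewrite -[X in _ --> X]addr0 -[X in _ --> a + X](mulr0 b) -[X in _ --> a + b * X](mulr0 K).
  apply: cvgD; first exact: cvg_cst.
  by apply: cvgM; [exact: cvg_cst|apply: cvgM; [exact: cvg_cst|exact: cvg_harmonic]].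
split => //.
- apply: (@le_trans _ _ (th - Nr^-1 * (C / 3))).
    rewrite lerD2l lerN2; apply: ler_pM => //; first by rewrite invr_ge0 ltW.
      by rewrite divr_ge0.
    by rewrite ler_pdivrMr// ler_peMr// ler1n.
  have L := lim_e (th - Nr^-1 * (C / 3)) (- Nr^-1).
  rewrite -(cvg_lim _ L)// -(cvg_lim _ cA)//.
  apply: ler_lim; [by apply/cvg_ex; eexists; exact: L|by apply/cvg_ex; eexists; exact: cA|].
  apply: nearW => n; rewrite push.
  have := mean_lower_scheme cV hS hPhi draw_density hs hc T0 HK N' (ltn0Sn n).
  apply: le_trans; rewrite -/th -/Nr le_eqVlt; apply/orP; left; apply/eqP; ring.
- pose M w := Num.max (th - A w) 0.
  have mM n : measurable_fun setT (fun w => Num.max (th - mean_cut r (numeric n.+1 w)) 0).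
    by apply: measurable_maxr => //; apply: measurable_funB.
  have bM' n w : `|Num.max (th - mean_cut r (numeric n.+1 w)) 0| <= `|th| + 1.
    rewrite ger0_norm ?le_max ?lexx ?orbT// ge_max addr_ge0// andbT.
    by have := mean_cut_ge0 r (numeric n.+1 w); have := ler_norm th; lra.
  have [bM cM] := @bmf_cvg R _ _ Pr (fun n w => Num.max (th - mean_cut r (numeric n.+1 w)) 0) M (`|th| + 1) mM
    bM' (fun w => @max_cvg th _ _ (@A_cvg w)).
  pose X : R := (Num.sqrt Nr)^-1 * (1 + C).
  rewrite [leRHS]mulrC -/Nr -/X.
  have L := lim_e X (3 * (Num.sqrt Nr)^-1).
  rewrite -(cvg_lim _ L)// -(cvg_lim _ cM)//.
  apply: ler_lim; [by apply/cvg_ex; eexists; exact: cM|by apply/cvg_ex; eexists; exact: L|].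
  apply: nearW => n.
  have bMx : bmf (fun x : 'rV[phase]_N => Num.max (th - mean_cut r (scheme_at V S Phi p (@full_coupling R N) T n.+1 (coords x))) 0).
    split; first by apply: measurable_maxr => //; apply: measurable_funB => //; case: (bB n).
    exists (`|th| + 1) => x; rewrite ger0_norm ?le_max ?lexx ?orbT//.
    rewrite ge_max addr_ge0// andbT; have := mean_cut_ge0 r (scheme_at V S Phi p (@full_coupling R N) T n.+1 (coords x)).
    by have := ler_norm th; lra.
  have push' := Rint_push (measurable_sample (n:=N) Z0) (fun B mB => sample_law indep law_draw mB) bMx.
  apply: le_trans (le_trans (_ : _ <= _) (deviation_scheme cV hS hPhi draw_density hs hc T0 hC K0 HK N' (ltn0Sn n))) _.
    by rewrite le_eqVlt; apply/orP; left; apply/eqP; exact: push'.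
  rewrite -/Nr sNe.
  have e0 : 0 <= C / 3 + K / n.+1%:R by rewrite addr_ge0// divr_ge0.
  have : Nr^-1 * (C / 3 + K / n.+1%:R) <= (Num.sqrt Nr)^-1 * (C / 3 + K / n.+1%:R) by rewrite ler_wpM2r.
  rewrite /X; set a := (Num.sqrt Nr)^-1; set b := K / _; set a' := Nr^-1 => H.
  rewrite (_ : a * (1 + C) + 3 * a * b = a * (C / 3 + b) + a * (1 + 2 * (C / 3 + b))); last by field.
  by rewrite lerD2r.
Qed.

Lemma rest_distance_bounds (eps : R) : 0 < eps ->
  ((Theta r f0)%:E - Cst V S Phi p T * ((Num.sqrt N%:R)^-1)%:E <= \int[Pr]_w D N T w)%E /\
  (Pr [set w | D N T w <= (Theta r f0 - eps)%:E]
    <= (1 + Cst V S Phi p T) * ((eps * Num.sqrt N%:R)^-1)%:E)%E.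
Proof.
move=> e0; set th := Theta r f0.
have Nr0 : 0 < Num.sqrt N%:R :> R by rewrite sqrtr_gt0 ltr0n.
have Cge : (0 <= Cst V S Phi p T)%E.
  rewrite /Cst mule_ge0 ?mule_ge0 ?normLoo_ge0//.
  by apply: integral_ge0 => t _; rewrite mule_ge0 ?normL1_ge0// adde_ge0// integral_ge0// => s _; exact: expeR_ge0.
case E : (Cst V S Phi p T) Cge => [C| |] // Cge; last first.
  have ei : 0 < (eps * Num.sqrt N%:R)^-1 by rewrite invr_gt0 mulr_gt0.
  have i0 : 0 < (Num.sqrt N%:R)^-1 :> R by rewrite invr_gt0.
  split; first by rewrite gt0_mulye ?lte_fin//; exact: leNye.
  by rewrite (_ : (1 + +oo = +oo :> \bar R)%E)// gt0_mulye ?lte_fin// leey.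
have hC : (Cst V S Phi p T <= C%:E)%E by rewrite E.
have [bA h1 h2] := mean_cut_bounds hC.
have mD : measurable_fun setT (D N T) by apply: measurable_DNEq => k; exact: measurable_state.
have AD w : ((A w)%:E <= D N T w)%E by apply: DNEq_ge => y; exact: hEq.
split.
  apply: (@le_trans _ _ (\int[Pr]_w (A w)%:E)%E).
    by rewrite bmf_integralE// -EFinM -EFinB lee_fin mulrC.
  apply: ge0_le_integral => //.
  - by move=> w _; rewrite lee_fin mean_cut_ge0.
  - by apply/measurable_EFinP; case: bA.
pose B := [set w | A w <= th - eps].
have mB : measurable B.
  rewrite (_ : B = A @^-1` [set` `]-oo, th - eps]]).
    by apply: measurable_preimage => //; case: bA.
  by apply/seteqP; split => w /=; rewrite in_itv.
apply: (@le_trans _ _ (Pr B)).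
  apply: le_measure; rewrite ?inE//.
    by rewrite -[X in measurable X]setTI; apply: emeasurable_fun_infty_c => //; exact: mD.
  by move=> w /= h; rewrite /B/= -lee_fin (le_trans (AD w)).
have bM : bmf (fun w => Num.max (th - A w) 0).
  split; first by apply: measurable_maxr => //; apply: measurable_funB => //; case: bA.
  exists (`|th| + 1) => w; rewrite ger0_norm ?le_max ?lexx ?orbT//.
  rewrite ge_max addr_ge0// andbT; have := mean_cut_ge0 r (state w); rewrite -/(A w).
  by have := ler_norm th; lra.
have bI : bmf (fun w => eps * \1_B w : R).
  apply: bmfM; first exact: bmf_cst.
  split; first exact: measurable_indic.
  by exists 1 => z; rewrite indicE normr_nat; case: (_ \in _).
have M1 : \int[Pr]_w (eps * \1_B w) <= \int[Pr]_w Num.max (th - A w) 0.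
  apply: Rint_le => // w; rewrite indicE; case: (boolP (w \in B)) => wB; last first.
    by rewrite mulr0 le_max lexx orbT.
  by move: wB; rewrite inE /B/= mulr1 le_max => h; apply/orP; left; lra.
have {M1 h2} := le_trans M1 h2.
rewrite -lee_fin -bmf_integralE//.
under eq_integral => w _ do rewrite EFinM.
rewrite ge0_integralZl//; [|by apply/measurable_EFinP; exact: measurable_indic|by rewrite lee_fin ltW].
rewrite integral_indic// setIT => H.
rewrite -EFinD -EFinM invfM [X in (_ <= (_ * X)%:E)%E]mulrC mulrA.
rewrite EFinM -lee_pdivrMr// ?invr_gt0// invrK muleC//.
Qed.
End finite_bounds.

(** * Energy estimate and tracking of single particles *)

Section energy.
Context {R : realType} {d : nat}.
Local Notation phase := (@phase R d).
Variable V : 'rV[R]_d -> R.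

Definition energy (z : phase) : R := V z.1 + enorm z.2 ^+ 2 / 2.

Lemma within_cont_comp (g : 'rV[R]_d -> R) (f : R -> 'rV[R]_d) (t : R) : continuous g -> cont_ge0 f ->
  {within `[0, t], continuous (fun s => g (f s))}.
Proof.
move=> cg cf; apply: within_cont => // s e s0 e0.
have /(@cvgrPdist_le _ _ _ (nbhs (f s))) /(_ e e0) /nbhs_ballP[r /= r0 hr] := cg (f s).
have r2 : 0 < r / 2 by rewrite divr_gt0.
have [r' r'0 hr'] := cf s _ s0 r2; exists r' => // s' s'0 ss.
rewrite distrC; apply: hr; rewrite -ball_normE /= distrC.
by apply: le_lt_trans (norm_le_enorm _) _; apply: le_lt_trans (hr' s' s'0 ss) _; lra.
Qed.

Hypotheses (cV : C1 V) (V0 : forall x, 0 <= V x).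
Variables (q v F : R -> 'rV[R]_d) (B T : R).
Hypothesis dq : forall t, 0 <= t -> is_derive_ge0 q t (v t).
Hypothesis dv : forall t, 0 <= t -> is_derive_ge0 v t (- grad V (q t) + F t).
Hypothesis hF : forall t, 0 <= t <= T -> enorm (F t) <= B.

(** The confining force does no net work on the energy, and the remaining bounded
    force works at a rate at most B |v| <= B (1 + energy). *)
Lemma energy_growth t : 0 <= t <= T ->
  1 + energy (q t, v t) <= (1 + energy (q 0, v 0)) * expR (B * t).
Proof.
move=> /andP[]; rewrite le_eqVlt => /predU1P[<- _|t0 tT].
  by rewrite mulr0 expR0 mulr1.
pose H (s : R) := 1 + (V (q s) + dot (v s) (v s) / 2).
have HE s : 1 + energy (q s, v s) = H s by rewrite /H /energy enorm2.
rewrite !HE.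
pose G (s : R) := H s * expR (- B * s).
have H0 s : 0 <= H s by rewrite /H addr_ge0// addr_ge0// divr_ge0// dot_ge0.
have dH (s : R) : 0 < s -> is_derive s 1 H (dot (v s) (F s)).
  move=> s0; have s0' := ltW s0.
  have d1 : is_derive s 1 (V \o q) (dot (grad V (q s)) (v s)).
    by apply: is_derive_curve => // i; apply: derive_ge0_coord => //; exact: dq.
  have d2 i : is_derive s 1 (fun s' => v s' ord0 i) ((- grad V (q s) + F s) ord0 i).
    by apply: derive_ge0_coord => //; exact: dv.
  have d3 : is_derive s 1 (\sum_(i < d) ((fun s' => v s' ord0 i) * (fun s' => v s' ord0 i)))
      (\sum_(i < d) (v s ord0 i *: ((- grad V (q s) + F s) ord0 i) + v s ord0 i *: ((- grad V (q s) + F s) ord0 i))).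
    by apply: is_derive_sum => i; apply: is_deriveM.
  have d4 : is_derive s 1 (fun s' => dot (v s') (v s') / 2) (dot (v s) (- grad V (q s) + F s)).
    have := is_deriveZ 2^-1 d3.
    rewrite (_ : _ \*: _ = (fun s' => dot (v s') (v s') / 2)); last first.
      by apply/funext => s'; rewrite /= fct_sumE mulrC; congr (_ * _).
    move=> h; apply: (is_derive_eq h).
    rewrite scaler_sumr; apply: eq_bigr => i _.
    rewrite /GRing.scale/=; set a := v s _ _; set b := _ ord0 i.
    have half (x y : R) : 2^-1 * (x * y + x * y) = x * y by lra.
    exact: half.
  have d5 := is_deriveD d1 d4.
  have d6 := is_deriveD (is_derive_cst (1 : R) s 1) d5.
  apply: (is_derive_eq d6).
  by rewrite dotDr dotNr add0r [dot (grad V _) _]dotC addrA subrr add0r.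
have dG (s : R) : s \in `]0, t[ -> is_derive s 1 G (expR (- B * s) * (dot (v s) (F s) - B * H s)).
  rewrite in_itv/= => /andP[s0 _].
  have e1 : is_derive s 1 (fun s : R => expR (- B * s)) (- B * expR (- B * s)).
    have h : is_derive s 1 (fun s : R => - B * s) (- B).
      have := is_deriveZ (- B) (is_derive_id (s : R) 1).
      by move=> h; apply: (is_derive_eq h); rewrite /GRing.scale/= mulr1.
    have := @is_derive1_comp R expR (fun s : R => - B * s) s _ _ (is_derive_expR (- B * s)) h.
    by move=> h'; apply: (is_derive_eq h'); rewrite /GRing.scale/= mulrC.
  have := is_deriveM (dH _ s0) e1 => h; apply: (is_derive_eq h).
  by rewrite /GRing.scale/=; ring.
have cq := derive_ge0_cont dq; have cv := derive_ge0_cont dv.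
have cG : {within `[0, t], continuous G}.
  have c1 : {within `[0, t], continuous (fun s => V (q s))}.
    by apply: within_cont_comp => //; exact: C1_continuous.
  have c2 : {within `[0, t], continuous (fun s : R => expR (- B * s))}.
    apply: continuous_subspaceT => s; apply: continuous_comp; last exact: continuous_expR.
    by apply: cvgM; [exact: cvg_cst|exact: cvg_id].
  have c3 : {within `[0, t], continuous (fun s => dot (v s) (v s))}.
    rewrite (_ : (fun s => _) = (fun s => enorm (v s) ^+ 2)); last by apply/funext => s; rewrite enorm2.
    have ce : {within `[0, t], continuous (fun s => enorm (v s))}.
      by apply: within_cont_comp => //; exact: continuous_enorm.
    by move=> x; apply: cvgM; exact: ce.
  move=> x; apply: cvgM; last exact: c2.
  apply: cvgD; first exact: cvg_cst.
  apply: cvgD; first exact: c1.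
  by apply: cvgM; [exact: c3|exact: cvg_cst].
have [s st E] := MVT t0 dG cG.
have {}E : G t <= G 0.
  rewrite -subr_le0 E; move: st; rewrite in_itv/= => /andP[s0 st].
  rewrite pmulr_lle0 ?subr0// pmulr_rle0 ?expR_gt0// subr_le0.
  have hFs : enorm (F s) <= B by apply: hF; rewrite (ltW s0) (ltW (lt_le_trans st tT)).
  apply: (le_trans (dot_le _ _)); rewrite mulrC; apply: ler_pM; rewrite ?enorm_ge0//.
  rewrite /H -enorm2; have := V0 (q s); have := sqr_ge0 (enorm (v s) - 1).
  by rewrite sqrrB1; lra.
move: E; rewrite /G mulr0 expR0 mulr1 mulNr expRN ler_pdivrMr ?expR_gt0//.
Qed.
End energy.

Section tracking.
Context {R : realType} {d : nat}.
Local Notation phase := (@phase R d).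

(** A 1-Lipschitz map into a ball, equal to the identity on a smaller one; composing
    with it makes locally Lipschitz fields Lipschitz. *)
Definition clamp (a : R) (x : 'rV[R]_d) : 'rV[R]_d := \row_i Num.max (- a) (Num.min a (x ord0 i)).

Lemma clamp_lip a x y : enorm (clamp a x - clamp a y) <= enorm (x - y).
Proof.
rewrite /enorm ler_wsqrtr//; apply: ler_sum => i _; rewrite !mxE -!expr2.
rewrite -[leLHS]real_normK ?num_real// -[leRHS]real_normK ?num_real//.
rewrite lerXn2r ?nnegrE//.
have maxl (c s t : R) : `|Num.max c s - Num.max c t| <= `|s - t|.
  have h1 := ler_norm (s - t); have := ler_norm (- (s - t)); rewrite normrN => h2.
  by case: (leP c s) => ?; case: (leP c t) => ?; rewrite ler_norml; apply/andP; split; lra.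
have minl (c s t : R) : `|Num.min c s - Num.min c t| <= `|s - t|.
  have h1 := ler_norm (s - t); have := ler_norm (- (s - t)); rewrite normrN => h2.
  by case: (leP c s) => ?; case: (leP c t) => ?; rewrite ler_norml; apply/andP; split; lra.
exact: le_trans (maxl _ _ _) (minl _ _ _).
Qed.

Lemma clamp_id a x : enorm x <= a -> clamp a x = x.
Proof.
move=> xa; apply/rowP => i; rewrite mxE.
have := le_trans (ler_coord_enorm x i) xa; rewrite ler_norml => /andP[h1 h2].
by rewrite min_r// max_r.
Qed.

Lemma clamp_le a x : 0 <= a -> enorm (clamp a x) <= d%:R * a.
Proof.
move=> a0; apply: le_trans (enorm_le_sum _) _; apply: (@le_trans _ _ (\sum_(i < d) a)).
  apply: ler_sum => i _; rewrite mxE ler_norml le_max lexx/= ge_max ge_min lexx/=.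
  by rewrite andbT lerNl; lra.
by rewrite sumr_const card_ord mulr_natl.
Qed.

Variables (V S : 'rV[R]_d -> R) (Phi : R -> 'rV[R]_d -> R) (p : R -> R).
Hypotheses (cV : C1 V) (V0 : forall x, 0 <= V x).
Hypothesis locV : W2oo_loc V.
Hypothesis coercive : forall A : R, exists M : R, forall x, M < enorm x -> A < V x.
Hypotheses (hS : C20 S) (hp : locally_integrable setT p).
Hypothesis hPhi : forall t, 0 <= t -> W2oo (Phi t) /\ C1 (Phi t).
Hypothesis cPhi : forall t, 0 <= t ->
  normW2oo (Phi s \- Phi t) @[s --> within [set s | 0 <= s] (nbhs t)] --> 0%E.

(** Particles of bounded initial energy all move in one ball, whatever their number;
    there the confining force is Lipschitz, so each of them follows the flow of a
    Lipschitz, volume-preserving map, up to an arbitrarily small error. The Lipschitz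
    constant depends neither on the number of particles nor on the data. *)
Lemma tracking (T E0 : R) : 0 <= T -> exists2 K, 0 <= K &
  forall N (z0 : 'I_N -> phase) (q v : 'I_N -> R -> 'rV[R]_d) (e : R), (0 < N)%N ->
    is_solution V S Phi p z0 q v -> 0 < e ->
  exists psi : phase -> phase,
    [/\ measurable_fun setT psi,
        forall A, measurable A -> @leb_phase R d (psi @^-1` A) = @leb_phase R d A,
        forall z y, pdist (psi z) (psi y) <= K * pdist z y &
        forall k, energy V (z0 k) <= E0 -> pdist (psi (z0 k)) (q k T, v k T) <= e].
Proof.
rewrite le_eqVlt => /predU1P[<-|T0].
  exists 1 => // N z0 q v e N0 sol e0; exists id; split => //.
    by move=> z y; rewrite mul1r.
  by move=> k _; have [-> _] := sol; rewrite pdistzz ltW.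
have T0' := ltW T0.
have [B B0 hB] := grad_Phi_bdd hPhi cPhi T.
have [L L0 hL] := grad_Phi_lip hPhi cPhi T.
have S10 := Sig1_ge0 S; have S20 := Sig2_ge0 S; have PT := pmass_ge0 p 0 T.
pose Bt := B + Sig1 S * pmass p 0 T.
have Bt0 : 0 <= Bt by rewrite addr_ge0// mulr_ge0.
pose Emax := (1 + E0) * expR (Bt * T).
have [M hM] := coercive Emax.
pose rho := Num.max M 0; have rho0 : 0 <= rho by rewrite le_max lexx orbT.
have [LV LV0 hLV] := W2oo_loc_grad_lip cV locV (d%:R * rho).
pose gV x := grad V (clamp rho x).
have gVlip x y : enorm (gV x - gV y) <= LV * enorm (x - y).
  apply: le_trans (hLV _ _ (clamp_le _ rho0) (clamp_le _ rho0)) _.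
  by rewrite ler_wpM2l// clamp_lip.
have mgV : measurable_fun [set: 'rV[R]_d] gV.
  apply: measurable_fun_rV => i; apply: continuous_measurable_rV.
  apply: (@lipschitz_continuous _ _ _ LV) => x y; apply: le_trans (gVlip x y).
  have -> : (rV_coor i \o gV) x - (rV_coor i \o gV) y = (gV x - gV y) ord0 i.
    by rewrite /rV_coor/= [RHS]mxE; congr (_ + _); rewrite [RHS]mxE.
  exact: ler_coord_enorm.
pose A := LV + L + Sig2 S * pmass p 0 T.
have A0 : 0 <= A by rewrite !addr_ge0// mulr_ge0.
pose K := expR (T * (1 + A)).
exists K; first exact: expR_ge0.
move=> N z0 q v e N0 sol e0.
pose C := K * (T * (T + 1)) + T.
have C0 : 0 <= C by rewrite addr_ge0// mulr_ge0 ?expR_ge0// mulr_ge0// addr_ge0.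
have C1' : 0 < C + 1 by rewrite ltr_wpDl.
pose ep := e / (C + 1); have ep0 : 0 < ep by rewrite divr_gt0.
have [r1 r10 h1] := sampled_solution cV hS hp hPhi cPhi N0 sol T ep0.
pose n := (Num.truncn (T / r1)).+1.
pose h := T / n%:R.
have hr : h < r1.
  by rewrite /h ltr_pdivrMr ?ltr0n// mulrC -ltr_pdivrMr//; exact: truncnS_gt.
have nh : n%:R * h = T by rewrite /h mulrC divfK// pnatr_eq0.
have h0 : 0 < h by rewrite divr_gt0// ltr0n.
have tm m : (m <= n)%N -> 0 <= m%:R * h <= T.
  by move=> mn; rewrite mulr_ge0 ?(ltW h0)//= -nh ler_wpM2r ?(ltW h0)// ler_nat.
have tm0 m : 0 <= m%:R * h by rewrite mulr_ge0// ltW.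
pose E (m : nat) x : 'rV[R]_d := - (gV x + grad (Phi (m%:R * h)) x) + mem_field S p q (m%:R * h) x.
have mE m : measurable_fun setT (E m).
  have [_ cP] := hPhi (tm0 m).
  rewrite (_ : E m = (fun x => -1 *: (gV x + grad (Phi (m%:R * h)) x) + mem_field S p q (m%:R * h) x)); last first.
    by apply/funext => x; rewrite /E scaleN1r.
  apply: measurable_rV_D; last exact: (measurable_mem_field hS hp N0 sol).
  by apply: measurable_rV_Z; apply: measurable_rV_D => //; exact: measurable_grad.
have Elip m x y : (m <= n)%N -> enorm (E m x - E m y) <= A * enorm (x - y).
  move=> mn; have H3 := gVlip x y; have H2 := hL _ (tm m mn) x y.
  have H1 := mem_field_lip hS hp N0 sol (m%:R * h) x y.
  have pm : pmass p 0 (m%:R * h) <= pmass p 0 T by apply: (pmass_mono hp); exact: tm.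
  have H0 := ler_wpM2r (enorm_ge0 (x - y)) (ler_wpM2l S20 pm).
  have rg (a b c a' b' c' : 'rV[R]_d) : - (a + b) + c - (- (a' + b') + c') = - ((a - a') + (b - b')) + (c - c').
    by apply/rowP => i; rewrite !mxE; ring.
  rewrite rg; apply: le_trans (enormD _ _) _; rewrite enormN.
  have D := enormD (gV x - gV y) (grad (Phi (m%:R * h)) x - grad (Phi (m%:R * h)) y).
  by rewrite /A !mulrDl; apply: lerD; [apply: le_trans D _; exact: lerD|exact: le_trans H1 H0].
have step (b c : 'rV[R]_d) : b = c + h *: (h^-1 *: (b - c)).
  by rewrite scalerA mulfV ?gt_eqF// scale1r addrC subrK.
exists (kick_drift h E n); split.
- exact: measurable_kick_drift.
- by move=> B' mB'; exact: kick_drift_volume.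
- move=> z y.
  have Z m (i : unit) : (m < n)%N -> (kick_drift h E m.+1 z).2 = (kick_drift h E m z).2 + h *: E m (kick_drift h E m z).1 /\ (kick_drift h E m.+1 z).1 = (kick_drift h E m z).1 + h *: (kick_drift h E m.+1 z).2 by [].
  have Y m (i : unit) : (m < n)%N -> (kick_drift h E m.+1 y).2 = (kick_drift h E m y).2 + h *: (E m (kick_drift h E m y).1 + 0) /\ (kick_drift h E m.+1 y).1 = (kick_drift h E m y).1 + h *: ((kick_drift h E m.+1 y).2 + 0) by rewrite !addr0.
  have := @kick_drift_stability R d unit n h 0 (pdist z y) (fun=> A) (fun=> 0) (ltW h0) (lexx _) (pdist_ge0 _ _) (fun=> A0) (fun=> lexx _)
    (fun m _ => (kick_drift h E m z).1) (fun m _ => (kick_drift h E m z).2)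
    (fun m _ => (kick_drift h E m y).1) (fun m _ => (kick_drift h E m y).2)
    (fun m _ => E m (kick_drift h E m z).1) (fun m _ => E m (kick_drift h E m y).1) (fun _ _ => 0) (fun _ _ => 0)
    Z Y.
  move=> /(_ _ _ _ _ n tt (leqnn n)) st.
  apply: le_trans (st _ _ _ _) _.
  + by move=> *; rewrite enorm0.
  + by move=> *; rewrite enorm0.
  + move=> m x mn x0 H i; apply: le_trans (Elip m _ _ (ltnW mn)) _; rewrite ler_wpM2l//.
    exact: (H m tt).
  + by move=> i; rewrite -!surjective_pairing.
  have D0 k : drift_err h (fun=> 0) k = 0 by rewrite /drift_err big1// => *; rewrite mulr0.
  rewrite D0 addr0.
  apply: le_trans (@phase_err_crude R h 0 (pdist z y) (fun=> A) (fun=> 0) (ltW h0) (lexx _) (pdist_ge0 _ _) (fun=> A0) (fun=> lexx _) n A 0 _ _) _ => //.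
    by move=> k _; rewrite D0.
  by rewrite nh addr0 mulr0 addr0.
- move=> k Ek.
  have good t : 0 <= t <= T -> enorm (q k t) <= rho.
    move=> /andP[t0 tT].
    have dq s : 0 <= s -> is_derive_ge0 (q k) s (v k s) by move=> s0; have [_ /(_ s s0 k)[]] := sol.
    pose F s := - grad (Phi s) (q k s) + memory_force S p q k s.
    have dv s : 0 <= s -> is_derive_ge0 (v k) s (- grad V (q k s) + F s).
      move=> s0; have [_ /(_ s s0 k)[_]] := sol.
      by rewrite gradD ?opprD ?addrA//; have [] := hPhi s0.
    have hF s : 0 <= s <= T -> enorm (F s) <= Bt.
      move=> sT; have /andP[s0 sT'] := sT; apply: le_trans (enormD _ _) _; rewrite enormN lerD ?hB//.
      rewrite (memory_forceE hS hp N0 sol)//; apply: le_trans (mem_field_le hS hp N0 sol _ _) _.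
      by rewrite ler_wpM2l//; apply: (pmass_mono hp).
    have := energy_growth cV V0 dq dv hF (t := t); rewrite t0 tT => /(_ isT) G.
    have init : (q k 0, v k 0) = z0 k by have [] := sol.
    rewrite init in G.
    rewrite leNgt; apply/negP => qr.
    have := hM (q k t) (le_lt_trans _ qr); rewrite le_max lexx => /(_ isT).
    apply/negP; rewrite -leNgt /Emax.
    have e1 : 0 <= energy V (z0 k) by rewrite /energy addr_ge0// divr_ge0// sqr_ge0.
    have v0 : 0 <= enorm (v k t) ^+ 2 / 2 by rewrite divr_ge0// sqr_ge0.
    have : (1 + energy V (z0 k)) * expR (Bt * t) <= (1 + E0) * expR (Bt * T).
      apply: ler_pM; [by rewrite addr_ge0|exact: expR_ge0|by rewrite lerD2l|].
      by rewrite ler_expR ler_wpM2l.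
    by move: G; rewrite /energy /=; lra.
  pose Y (m : nat) := (q k (m%:R * h), v k (m%:R * h)).
  pose e1 (m : nat) := h^-1 *: (v k (m.+1%:R * h) - v k (m%:R * h)) - accel V S Phi p q k (m%:R * h).
  pose e2 (m : nat) := h^-1 *: (q k (m.+1%:R * h) - q k (m%:R * h)) - v k (m.+1%:R * h).
  have Z m (i : unit) : (m < n)%N -> (kick_drift h E m.+1 (z0 k)).2 = (kick_drift h E m (z0 k)).2 + h *: E m (kick_drift h E m (z0 k)).1 /\ (kick_drift h E m.+1 (z0 k)).1 = (kick_drift h E m (z0 k)).1 + h *: (kick_drift h E m.+1 (z0 k)).2 by [].
  have HY m (i : unit) : (m < n)%N -> v k (m.+1%:R * h) = v k (m%:R * h) + h *: (accel V S Phi p q k (m%:R * h) + e1 m) /\ q k (m.+1%:R * h) = q k (m%:R * h) + h *: (v k (m.+1%:R * h) + e2 m).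
    by move=> _; rewrite /e1 /e2 ![_ + (_ - _)]addrC !subrK; split; exact: step.
  have esm (b c a : 'rV[R]_d) : enorm (b - c - h *: a) <= h * ep -> enorm (h^-1 *: (b - c) - a) <= ep.
    move=> H; rewrite -(ler_pM2l h0) -[X in X * enorm _](gtr0_norm h0) -enormZ scalerBr scalerA mulfV ?gt_eqF// scale1r//.
  have mT m : (m < n)%N -> m.+1%:R * h <= T by move=> mn; have /andP[] := tm m.+1 mn.
  have := @kick_drift_stability R d unit n h ep 0 (fun=> A) (fun=> ep) (ltW h0) (ltW ep0) (lexx _) (fun=> A0) (fun=> ltW ep0)
    (fun m _ => (kick_drift h E m (z0 k)).1) (fun m _ => (kick_drift h E m (z0 k)).2)
    (fun m _ => q k (m%:R * h)) (fun m _ => v k (m%:R * h))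
    (fun m _ => E m (kick_drift h E m (z0 k)).1) (fun m _ => accel V S Phi p q k (m%:R * h)) (fun m _ => e1 m) (fun m _ => e2 m)
    Z HY.
  move=> /(_ _ _ _ _ n tt (leqnn n)) st.
  have -> : (q k T, v k T) = (q k (n%:R * h), v k (n%:R * h)) by rewrite nh.
  rewrite [kick_drift _ _ _ _]surjective_pairing.
  apply: le_trans (st _ _ _ _) _.
  + by move=> m i mn; apply: esm; case: (h1 h m k h0 hr (mT m mn)).
  + by move=> m i mn; apply: esm; case: (h1 h m k h0 hr (mT m mn)).
  + move=> m x mn x0 H i.
    have -> : accel V S Phi p q k (m%:R * h) = E m (q k (m%:R * h)).
      have [_ cP] := hPhi (tm0 m).
      rewrite /accel (gradD cV cP) (memory_forceE hS hp N0 sol k (tm0 m)) /E /gV clamp_id; first by [].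
      by apply: good; apply: tm; exact: ltnW.
    apply: le_trans (Elip m _ _ (ltnW mn)) _; rewrite ler_wpM2l//.
    exact: (H m tt).
  + move=> i /=; rewrite mul0r.
    have -> : (q k 0, v k 0) = z0 k by have [] := sol.
    by rewrite -surjective_pairing pdistzz.
  have D0 m : (m <= n)%N -> drift_err h (fun=> ep) m <= T * ep.
    move=> mn; rewrite /drift_err sumr_const card_ord -mulr_natl mulrA ler_wpM2r ?(ltW ep0)//.
    by have /andP[] := tm m mn.
  have := @phase_err_crude R h ep 0 (fun=> A) (fun=> ep) (ltW h0) (ltW ep0) (lexx _) (fun=> A0) (fun=> ltW ep0) n A (T * ep)
    (fun _ _ => lexx _) D0.
  rewrite nh add0r -/K => H; have := lerD H (D0 n (leqnn n)).
  move=> /le_trans; apply.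
  rewrite (_ : _ + _ = C * ep); last by rewrite /C; ring.
  apply: (@le_trans _ _ ((C + 1) * ep)); first by rewrite ler_wpM2r ?(ltW ep0)// lerDl.
  by rewrite /ep mulrC divfK// gt_eqF.
Qed.
End tracking.

(** * A law of large numbers for frequencies *)

Section lln.
Context {R : realType} {dT} {T : measurableType dT} {dO} {Omega : measurableType dO}.
Variables (Pr : probability Omega R) (X : nat -> {RV Pr >-> T}) (mu : probability T R).
Hypothesis indep : mutually_independent X.
Hypothesis lawX : forall k A, measurable A -> Pr (X k @^-1` A) = mu A.

Definition freq (A : set T) (N : nat) (w : Omega) : R := N%:R^-1 * \sum_(k < N) \1_A (X k w).

Lemma bmf_indic dU (U : measurableType dU) (A : set U) : measurable A -> bmf (fun x => \1_A x : R).
Proof.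
move=> mA; split; first exact: measurable_indic.
by exists 1 => z; rewrite indicE normr_nat; case: (_ \in _).
Qed.

Lemma bmf_comp dU (U : measurableType dU) dU' (U' : measurableType dU') (g : U -> U') (f : U' -> R) :
  measurable_fun setT g -> bmf f -> bmf (fun x => f (g x)).
Proof. by move=> mg [mf [B hB]]; split; [exact: measurableT_comp mf mg|exists B]. Qed.

Lemma bmf_sum dU (U : measurableType dU) (I : Type) (s : seq I) (f : I -> U -> R) :
  (forall i, bmf (f i)) -> bmf (fun x => \sum_(i <- s) f i x).
Proof.
move=> bf; elim: s => [|i s IH].
  by under eq_fun do rewrite big_nil; exact: bmf_cst.
by under eq_fun do rewrite big_cons; exact: bmfD.
Qed.

Variable A : set T.
Hypothesis mA : measurable A.
Let m : R := fine (mu A).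

Let muA : mu A = m%:E.
Proof. by rewrite /m fineK// fin_num_measure. Qed.

Let f N (x : 'rV[T]_N) : R := N%:R^-1 * \sum_(k < N) \1_A (x ord0 k).

Let bf N : bmf (@f N).
Proof.
apply: bmfM; first exact: bmf_cst.
apply: bmf_sum => k; apply: (bmf_comp (g := rV_coor k)); first exact: measurable_rV_coor.
exact: bmf_indic.
Qed.

Lemma bmf_freq N : bmf (freq A N).
Proof.
apply: bmfM; first exact: bmf_cst.
by apply: bmf_sum => k; apply: (bmf_comp (g := X k)) => //; exact: bmf_indic.
Qed.

Let freqE N w : freq A N w = f (sample X N w).
Proof. by rewrite /freq /f; congr (_ * _); apply: eq_bigr => k _; rewrite mxE. Qed.

Lemma freq_mean N : (0 < N)%N -> \int[Pr]_w freq A N w = m.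
Proof.
move=> N0; rewrite /freq RintZ; last first.
  by apply: bmf_sum => k; apply: (bmf_comp (g := X k)) => //; exact: bmf_indic.
rewrite Rint_sum; last first.
  by move=> k; apply: bmf_intg; apply: (bmf_comp (g := X k)) => //; exact: bmf_indic.
rewrite (eq_bigr (fun=> m)); last first.
  move=> k _; have mP : measurable (X k @^-1` A) by apply: measurable_preimage.
  apply: EFin_inj; rewrite -muA -(lawX k mA) -bmf_integralE; last first.
    by apply: (bmf_comp (g := X k)) => //; exact: bmf_indic.
  by have := integral_indic Pr measurableT mP; rewrite setIT => <-.
by rewrite sumr_const card_ord -[m *+ _]mulr_natl mulKf// pnatr_eq0 -lt0n.
Qed.

(** Replacing one draw changes the frequency by at most 1/N, so the Efron-Stein
    inequality applies. *)
Lemma freq_variance N : (0 < N)%N -> \int[Pr]_w ((freq A N w - m) ^+ 2) <= N%:R^-1.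
Proof.
move=> N0.
have H := Rint_push (measurable_sample (n := N) X) (fun B mB => sample_law indep lawX mB).
have E1 : \int[prodm mu N]_x f x = m.
  by rewrite -(freq_mean N0) -H//; apply: eq_Rintegral => w _; rewrite freqE.
have b2 : bmf (fun x : 'rV[T]_N => (f x - m) ^+ 2).
  have b1 : bmf (fun x : 'rV[T]_N => f x - m) by apply: bmfB => //; exact: bmf_cst.
  exact: bmfM.
have E2 : \int[Pr]_w ((freq A N w - m) ^+ 2) = \int[prodm mu N]_x ((f x - m) ^+ 2).
  by rewrite -(H _ b2); apply: eq_Rintegral => w _; rewrite freqE.
have N0' : 0 < N%:R :> R by rewrite ltr0n.
have bd : bounded_diff (@f N) N%:R^-1.
  move=> i x y xy; rewrite /f -mulrBr -sumrB normrM ger0_norm ?invr_ge0//.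
  rewrite ler_piMr ?invr_ge0// (bigD1 i)//= big1; last by move=> j ji; rewrite xy// subrr.
  rewrite addr0 !indicE; case: (_ \in A); case: (_ \in A) => /=;
    by rewrite ?subrr ?subr0 ?sub0r ?normrN ?normr1 ?normr0.
rewrite E2 -E1; apply: le_trans (efron_stein mu (@bf N) _ bd) _; first by rewrite invr_ge0.
by rewrite expr2 mulrA mulfV ?mul1r// gt_eqF.
Qed.

Lemma freq_deviation N (e : R) : (0 < N)%N -> 0 < e ->
  (Pr [set w | (m + e < freq A N w)%R] <= (N%:R^-1 / e ^+ 2)%:E)%E.
Proof.
move=> N0 e0; set B := [set w | _].
have [mf _] := bmf_freq N.
have mB : measurable B.
  rewrite (_ : B = freq A N @^-1` [set` `]m + e, +oo[]); first by apply: measurable_preimage.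
  by apply/seteqP; split => w; rewrite /B/= in_itv/= andbT.
have bI : bmf (fun w => e ^+ 2 * \1_B w : R) by apply: bmfM; [exact: bmf_cst|exact: bmf_indic].
have b2 : bmf (fun w => (freq A N w - m) ^+ 2).
  have b1 : bmf (fun w => freq A N w - m) by apply: bmfB; [exact: bmf_freq|exact: bmf_cst].
  exact: bmfM.
have : \int[Pr]_w (e ^+ 2 * \1_B w) <= N%:R^-1.
  apply: le_trans (Rint_le _ bI b2 _) (freq_variance N0) => w.
  rewrite indicE; case: (boolP (w \in B)) => wB; last by rewrite mulr0 sqr_ge0.
  by move: wB; rewrite inE /B/= mulr1 => h; rewrite lerXn2r ?nnegrE//; lra.
rewrite RintZ; last exact: bmf_indic.
rewrite mulrC -ler_pdivlMr ?exprn_gt0// => h.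
by have := integral_indic Pr measurableT mB; rewrite setIT => <-; rewrite bmf_integralE ?lee_fin//; exact: bmf_indic.
Qed.

Lemma sum_inv_sqr n : \sum_(i < n) (i.+1%:R ^+ 2)^-1 <= 2 - n%:R^-1 :> R.
Proof.
case: n => [|n]; first by rewrite big_ord0 invr0 subr0.
elim: n => [|n IH]; first by rewrite big_ord1 expr1n invr1; lra.
rewrite big_ord_recr/=; apply: le_trans (lerD IH (lexx _)) _.
set a : R := n.+1%:R; have a0 : 0 < a by rewrite ltr0n.
have -> : n.+2%:R = a + 1 :> R by rewrite natr1.
have a1 : 0 < a + 1 by lra.
rewrite -subr_ge0 (_ : _ - _ = (a * (a + 1) ^+ 2)^-1); first by rewrite invr_ge0 mulr_ge0 ?sqr_ge0// ltW.
by field; rewrite !gt_eqF.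
Qed.

(** Borel-Cantelli along the squares, where the deviation probabilities are summable. *)
Lemma freq_squares (e : R) : 0 < e -> {ae Pr, forall w,
  exists n0, forall n, (n0 <= n)%N -> freq A (n.+1 ^ 2) w <= m + e}.
Proof.
move=> e0; pose F n := [set w | (m + e < freq A (n.+1 ^ 2) w)%R].
have mF n : measurable (F n).
  have [mf _] := bmf_freq (n.+1 ^ 2).
  rewrite (_ : F n = freq A (n.+1 ^ 2) @^-1` [set` `]m + e, +oo[]); first by apply: measurable_preimage.
  by apply/seteqP; split => w; rewrite /F/= in_itv/= andbT.
have F0 : Pr (lim_sup_set F) = 0%E.
  apply: lim_sup_set_cvg0 => //.
  apply: (@le_lt_trans _ _ (2 / e ^+ 2)%:E); last exact: ltry.
  apply: lime_le; first by apply: is_cvg_nneseries.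
  apply: nearW => n; rewrite big_mkord.
  apply: (@le_trans _ _ (\sum_(i < n) ((i.+1%:R ^+ 2)^-1 / e ^+ 2)%:E)%E).
    apply: lee_sum => i _; rewrite -natrX; apply: freq_deviation => //.
  rewrite sumEFin lee_fin -mulr_suml ler_wpM2r ?invr_ge0 ?sqr_ge0//.
  by apply: le_trans (sum_inv_sqr n) _; rewrite gerBl invr_ge0.
exists (lim_sup_set F); split => //.
  by apply: bigcap_measurable => // n _; exact: bigcup_measurable.
move=> w /= H n _; apply: contrapT => H'; apply: H; exists n => k nk.
by rewrite leNgt; apply/negP => h; apply: H'; exists k.
Qed.

Lemma between_squares N : exists n, (n ^ 2 <= N < n.+1 ^ 2)%N.
Proof.
elim: N => [|N [n /andP[h1 h2]]]; first by exists 0%N.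
have [h|h] := ltnP N.+1 (n.+1 ^ 2); first by exists n; rewrite h andbT (leq_trans h1).
exists n.+1; rewrite h/= (leq_ltn_trans h2)// ltn_sqr//.
Qed.

(** Between consecutive squares the count of the event is monotone, and the ratio of the
    squares tends to 1. *)
Lemma freq_limsup : {ae Pr, forall w, forall e : R, 0 < e ->
  exists n0, forall n, (n0 <= n)%N -> freq A n w <= m + e}.
Proof.
have H j : {ae Pr, forall w, exists n0, forall n, (n0 <= n)%N -> freq A (n.+1 ^ 2) w <= m + j.+1%:R^-1}.
  by apply: freq_squares; rewrite invr_gt0.
have {}H := ae_foralln H.
apply: filterS H => w H e e0.
pose j := Num.truncn (2 / e).
have hj : j.+1%:R^-1 < e / 2 :> R.
  by rewrite -[e / 2]invrK ltf_pV2 ?posrE ?invr_gt0 ?divr_gt0// invf_div truncnS_gt.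
have [n0 hn0] := H j.
pose n1 := (maxn n0 (Num.truncn (12 / e))).+1.
exists (n1 ^ 2)%N => N hN.
have [n /andP[h1 h2]] := between_squares N.
have nn : (n1 <= n)%N by rewrite -ltnS -ltn_sqr (leq_ltn_trans hN).
have n_gt0 : (0 < n)%N by apply: leq_trans nn.
have N0 : (0 < N)%N by apply: leq_trans h1; rewrite expn_gt0 n_gt0.
have n00 : (n0 <= n)%N by apply: leq_trans nn; rewrite ltnW// ltnS leq_maxl.
have hE := hn0 n n00.
have n12 : 12 / e <= n%:R.
  apply: (@le_trans _ _ n1%:R); last by rewrite ler_nat.
  apply: le_trans (ltW (truncnS_gt _)) _; rewrite ler_nat ltnS leq_maxr//.
have sub : \sum_(k < N) \1_A (X k w) <= \sum_(k < (n.+1 ^ 2)%N) \1_A (X k w) :> R.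
  rewrite -(subnKC (ltnW h2)) big_split_ord/= lerDl; apply: sumr_ge0 => i _.
  by rewrite indicE ler0n.
have m0 : 0 <= m by rewrite fine_ge0.
have m1 : m <= 1 by rewrite -lee_fin -muA probability_le1.
set b : R := m + j.+1%:R^-1 in hE.
have b0 : 0 <= b by rewrite addr_ge0// invr_ge0.
have b2 : b <= 2 by rewrite /b; apply: lerD => //; rewrite invf_le1// ler1n.
have nR : 0 < n%:R :> R by rewrite ltr0n.
have NR : n%:R ^+ 2 <= N%:R :> R by rewrite -natrX ler_nat.
have N0' : 0 < N%:R :> R by rewrite ltr0n.
have s1 : \sum_(k < N) \1_A (X k w) <= (n%:R + 1) ^+ 2 * b.
  apply: le_trans sub _; move: hE; rewrite /freq ler_pdivrMl ?ltr0n ?expn_gt0//.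
  by rewrite natrX -natr1.
have s2 : (n%:R + 1) ^+ 2 * b <= n%:R ^+ 2 * (b + 6 / n%:R).
  rewrite (_ : n%:R ^+ 2 * (b + 6 / n%:R) = n%:R ^+ 2 * b + 6 * n%:R); last by field; rewrite gt_eqF.
  have n1' : 1 <= n%:R :> R by rewrite ler1n.
  have : (2 * n%:R + 1) * b <= (3 * n%:R) * 2 by apply: ler_pM => //; lra.
  rewrite sqrrD1; lra.
have b6 : 0 <= b + 6 / n%:R by rewrite addr_ge0// divr_ge0.
rewrite /freq ler_pdivrMl//; apply: le_trans s1 _; apply: le_trans s2 _.
apply: ler_pM => //.
have : 6 / n%:R <= e / 2.
  rewrite ler_pdivrMr//; have := ler_wpM2l (ltW e0) n12.
  rewrite mulrCA mulfV ?gt_eqF// mulr1; lra.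
by move=> h6; rewrite /b -addrA lerD2l [leRHS]splitr; exact: lerD (ltW hj) h6.
Qed.

End lln.

Lemma ae_forall_count {R : realType} {dO} {Omega : measurableType dO} (Pr : probability Omega R) (I : countType)
    (Q : I -> Omega -> Prop) : (forall i, {ae Pr, forall w, Q i w}) -> {ae Pr, forall w, forall i, Q i w}.
Proof.
move=> H; have : {ae Pr, forall w, forall n, if unpickle n is Some i then Q i w else True}.
  apply: ae_foralln => n; case: (unpickle n) => [i|]; first exact: H.
  exact: aeW.
by apply: filterS => w h i; have := h (pickle i); rewrite pickleK.
Qed.

(** * The almost sure lower bound *)

Section almost_sure.
Context {R : realType} {d : nat}.
Local Notation phase := (@phase R d).
Variables (V S : 'rV[R]_d -> R) (Phi : R -> 'rV[R]_d -> R) (p P : R -> R) (r : R) (f0 : phase -> R).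
Context {dO : measure_display} {Omega : measurableType dO}.
Variables (Pr : probability Omega R) (Z0 : nat -> {RV Pr >-> phase}).
Variables (q v : forall N : nat, Omega -> 'I_N -> R -> 'rV[R]_d).
Arguments q : clear implicits.
Arguments v : clear implicits.
Hypotheses (d0 : (0 < d)%N) (hf0 : prob_density f0) (hf0_Loo : (normLoo_phase f0 < +oo)%E).
Hypotheses (cV : C1 V) (V0 : forall x, 0 <= V x) (locV : W2oo_loc V).
Hypothesis coercive : forall A : R, exists M : R, forall x, M < enorm x -> A < V x.
Hypotheses (hS : C20 S) (hp : locally_integrable setT p).
Hypothesis hPhi : forall t, 0 <= t -> W2oo (Phi t) /\ C1 (Phi t).
Hypothesis cPhi : forall t, 0 <= t ->
  normW2oo (Phi s \- Phi t) @[s --> within [set s | 0 <= s] (nbhs t)] --> 0%E.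
Hypothesis hr : 0 <= r.
Hypothesis hEq : forall N (y : 'I_N -> phase), EqN V S P y ->
  forall k, enorm (y k).1 <= r /\ (y k).2 = 0.
Hypothesis indep : mutually_independent Z0.
Hypothesis law : forall k, has_density (Z0 k) f0.
Hypothesis hqv : forall N : nat, (0 < N)%N -> forall w : Omega,
  is_solution V S Phi p (fun k : 'I_N => Z0 k w) (q N w) (v N w).

Let mu : probability phase R := distribution Pr (Z0 0%N).

Let grid (i : nat) : phase := @rat_seq R d 1 i ord0.

Let eta (j : nat) : R := j.+1%:R^-1.

Let grid_dense j z : exists i, pdist z (grid i) < eta j.
Proof.
have e1 : 0 < (j.+2%:R)^-1 :> R by rewrite invr_gt0.
have [c hc] := rat_state_dense (fun _ : 'I_1 => z) e1.
exists (pickle c); have -> : grid (pickle c) = rat_state c ord0 by rewrite /grid /rat_seq pickleK.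
move: hc; rewrite DNE invr1 mul1r big_ord1 ge_min => /orP[h|].
  by apply: le_lt_trans h _; rewrite /eta ltf_pV2 ?posrE// ltr_nat.
by rewrite leNgt invf_lt1// ltr1n.
Qed.

Let cluster j m (J : {set 'I_m}) : set phase := [set z | exists2 i : 'I_m, i \in J & pdist z (grid i) < eta j].

Let uncovered j m : set phase := ~` cluster j [set: 'I_m].

Let fast (E0 : nat) : set phase := [set z | E0%:R < energy V z].

Let mcluster j m (J : {set 'I_m}) : measurable (cluster j J).
Proof.
rewrite (_ : cluster j J = \bigcup_(i in [set i : 'I_m | i \in J]) [set z | pdist z (grid i) < eta j]); last first.
  by apply/seteqP; split => z [l]; exists l.
apply: fin_bigcup_measurable => // i _.
rewrite (_ : [set z | _] = (fun z => pdist z (grid i)) @^-1` [set` `]-oo, eta j[]); last first.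
  by apply/seteqP; split => z /=; rewrite in_itv.
apply: measurable_preimage => //; apply: measurable_pdist; [exact: measurable_id|exact: measurable_cst].
Qed.

Let muncovered j m : measurable (uncovered j m).
Proof. by apply: measurableC; exact: mcluster. Qed.

Let menergy : measurable_fun [set: phase] (energy V).
Proof.
apply: measurable_funD.
  by apply: (measurableT_comp (continuous_measurable_rV (C1_continuous cV))); exact: measurable_fst.
apply: measurable_funM => //; apply: measurable_funX; exact: (measurable_enorm_comp measurable_snd).
Qed.

Let mfast E0 : measurable (fast E0).
Proof.
rewrite (_ : fast E0 = energy V @^-1` [set` `]E0%:R, +oo[]); first exact: measurable_preimage.
by apply/seteqP; split => z /=; rewrite in_itv/= andbT.
Qed.

Let law_mu k (A : set phase) : measurable A -> Pr (Z0 k @^-1` A) = mu A.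
Proof. exact: (law_draw law). Qed.

(** Continuity from above. *)
Let shrink (F : nat -> set phase) : (forall n, measurable (F n)) ->
  (forall n k, (n <= k)%N -> F k `<=` F n) -> (forall z, exists n, ~ F n z) ->
  forall e, 0 < e -> exists n, fine (mu (F n)) <= e.
Proof.
move=> mF dF eF e e0.
have F0 : \bigcap_n F n = set0.
  by apply/seteqP; split => // z h; have [n] := eF z; apply; exact: h.
have := @nonincreasing_cvg_mu _ _ _ mu F.
rewrite F0 measure0 => H.
have {}H : (mu \o F) n @[n --> \oo] --> 0%E.
  apply: H => //; first by apply: le_lt_trans (probability_le1 _ (mF 0%N)) _; exact: ltry.
  by move=> n k nk; apply/subsetPset; exact: dF.
have /fine_cvgP[_ /cvgrPdist_le /(_ e e0) [n _ hn]] := H.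
exists n; have := hn n (leqnn n); rewrite sub0r normrN /=.
by move=> h; apply: le_trans h; exact: ler_norm.
Qed.

(** Countably many events, fixed before the time T and the accuracy are chosen: the
    almost sure event depends on neither. *)
Let frequencies w : Prop := forall (A : set phase), 
  ((exists j m J, A = @cluster j m J) \/ (exists j m, A = uncovered j m) \/ (exists E0, A = fast E0)) ->
  forall e : R, 0 < e -> exists n0, forall n, (n0 <= n)%N -> freq Z0 A n w <= fine (mu A) + e.

Let frequencies_ae : {ae Pr, forall w, frequencies w}.
Proof.
have H (A : set phase) := @freq_limsup R _ _ _ _ Pr Z0 mu indep law_mu A.
have H1 : {ae Pr, forall w, forall j m (J : {set 'I_m}), forall e : R, 0 < e ->
    exists n0, forall n, (n0 <= n)%N -> freq Z0 (cluster j J) n w <= fine (mu (cluster j J)) + e}.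
  apply: ae_foralln => j; apply: ae_foralln => m; apply: ae_forall_count => J; exact: H.
have H2 : {ae Pr, forall w, forall j m, forall e : R, 0 < e ->
    exists n0, forall n, (n0 <= n)%N -> freq Z0 (uncovered j m) n w <= fine (mu (uncovered j m)) + e}.
  apply: ae_foralln => j; apply: ae_foralln => m; exact: H.
have H3 : {ae Pr, forall w, forall E0, forall e : R, 0 < e ->
    exists n0, forall n, (n0 <= n)%N -> freq Z0 (fast E0) n w <= fine (mu (fast E0)) + e}.
  apply: ae_foralln => E0; exact: H.
apply: filterS3 H1 H2 H3 => w h1 h2 h3 A [[j [m [J ->]]]|[[j [m ->]]|[E0 ->]]]; [exact: h1|exact: h2|exact: h3].
Qed.

Let state N w T : 'I_N -> phase := fun k => (q N w k T, v N w k T).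

(** Apart from rare data ([fast] or [uncovered]), the datum of a particle that ends
    close to rest lies in a union of small balls that a volume-preserving map sends into
    the slab. *)
Lemma mean_cut_liminf w T e : frequencies w -> 0 <= T -> 0 < e ->
  exists n0, forall N, (n0 <= N)%N -> (0 < N)%N -> Theta r f0 - e <= mean_cut r (@state N w T).
Proof.
move=> Fw T0 e0; have [s [c [hs hc1 -> hc]]] := Theta_split d0 f0 hr.
have /andP[s0 s1] := hs; have /andP[c0 c1] := hc1.
(* half of e goes to the width of the slab, and 5 dl to the frequencies *)
pose dl := e / 16; have dl0 : 0 < dl by rewrite divr_gt0.
pose s' := s - e / 2.
have [E0 hE0] : exists E0, fine (mu (fast E0)) <= dl.
  apply: shrink => //.
    by move=> n k nk z; apply: le_lt_trans; rewrite ler_nat.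
  move=> z; exists (Num.truncn (energy V z)).+1; apply/negP; rewrite -leNgt ltW//.
  exact: truncnS_gt.
have [K K0 hK] := tracking cV V0 locV coercive hS hp hPhi cPhi E0%:R T0.
pose j := Num.truncn (2 * K / (e / 8)).
have hj : K * (2 * eta j) < e / 8.
  rewrite /eta mulrA ltr_pdivrMr ?ltr0n// [K * 2]mulrC [ltRHS]mulrC -ltr_pdivrMr ?divr_gt0//; exact: truncnS_gt.
have [m hm] : exists m, fine (mu (uncovered j m)) <= dl.
  apply: shrink => //.
    move=> n k nk z hz [i _ hi]; apply: hz.
    by exists (widen_ord nk i); rewrite ?finset.in_setT.
  move=> z; have [i hi] := grid_dense j z; exists i.+1 => h; apply: h.
  by exists (ord_max : 'I_i.+1); rewrite ?finset.in_setT.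
have [n1 h1] := Fw (fast E0) (or_intror (or_intror (ex_intro _ E0 erefl))) dl dl0.
have [n2 h2] := Fw (uncovered j m) (or_intror (or_introl (ex_intro _ j (ex_intro _ m erefl)))) dl dl0.
have f3 J := Fw (cluster j J) (or_introl (ex_intro _ j (ex_intro _ m (ex_intro _ J erefl)))) dl dl0.
pose n3 (J : {set 'I_m}) := sval (cid (f3 J)).
have h3 J n : (n3 J <= n)%N -> freq Z0 (cluster j J) n w <= fine (mu (cluster j J)) + dl.
  by move: n; rewrite /n3; case: cid.
exists (maxn (maxn n1 n2) (\max_(J : {set 'I_m}) n3 J)) => N; rewrite !geq_max => /andP[/andP[N1 N2] N3] N0.
have {}h1 := le_trans (h1 N N1) (lerD hE0 (lexx dl)).
have {}h2 := le_trans (h2 N N2) (lerD hm (lexx dl)).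
have e8 : 0 < e / 8 by rewrite divr_gt0.
have [psi [mpsi vpsi lpsi tpsi]] := hK N _ _ _ _ N0 (hqv N0 w) e8.
pose slow (k : 'I_N) := [&& energy V (Z0 k w) <= E0%:R & rest_dist r (state w T k) < s'].
pose J : {set 'I_m} := [set i : 'I_m | [exists k : 'I_N, slow k && (pdist (Z0 k w) (grid i) < eta j)]]%SET.
have hJ : fine (mu (cluster j J)) <= c.
  have sub : cluster j J `<=` psi @^-1` slab r s.
    move=> z [l]; rewrite inE => /existsP[k /andP[/andP[Ek ek] ki] zi]; rewrite /slab/=.
    have zk : pdist z (Z0 k w) <= 2 * eta j.
      apply: le_trans (pdist_triangle _ (grid l) _) _; rewrite [X in _ + X]pdistC.
      by rewrite mulr_natl mulr2n; apply: lerD; exact: ltW.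
    have := lpsi z (Z0 k w); have := ler_wpM2l K0 zk; have := tpsi k Ek.
    have := rest_dist_lip r (psi z) (state w T k); have := pdist_triangle (psi z) (psi (Z0 k w)) (state w T k).
    move: ek hj; rewrite /s' /state; lra.
  have mS : measurable (psi @^-1` slab r s) by apply: measurable_preimage => //; exact: measurable_slab.
  have := volume_preserving_slab (draw_density hf0 hf0_Loo law) hc mpsi vpsi.
  rewrite -[X in (X <= _)%E]fineK ?fin_num_measure// lee_fin; apply: le_trans.
  by rewrite fine_le ?fin_num_measure// le_measure ?inE.
have h4 : freq Z0 (cluster j J) N w <= c + dl.
  apply: le_trans (h3 J N _) _; last by rewrite lerD2r.
  by apply: leq_trans N3; exact: leq_bigmax.
have N0' : 0 < N%:R :> R by rewrite ltr0n.
pose b (k : 'I_N) : R := \1_(cluster j J) (Z0 k w) + \1_(uncovered j m) (Z0 k w) + \1_(fast E0) (Z0 k w).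
have i0 (A : set phase) z : 0 <= \1_A z :> R by rewrite indicE ler0n.
have b0 k : 0 <= b k by rewrite !addr_ge0.
have cut k : s * (1 - b k) - e / 2 <= cutdist r (state w T k).
  have [b1|b1] := leP 1 (b k).
    apply: le_trans (cutdist_ge0 r _); have : 0 <= s * (b k - 1) by rewrite mulr_ge0// subr_ge0.
    rewrite !mulrBr; lra.
  have nil (A : set phase) : (\1_A (Z0 k w) : R) <= b k -> ~ A (Z0 k w).
    by move=> h ZA; move: (le_lt_trans h b1); rewrite indicE mem_set// ltxx.
  have /nil ncl : (\1_(cluster j J) (Z0 k w) : R) <= b k by rewrite /b -addrA lerDl addr_ge0.
  have /nil nun : (\1_(uncovered j m) (Z0 k w) : R) <= b k by rewrite /b addrAC lerDr addr_ge0.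
  have /nil nfa : (\1_(fast E0) (Z0 k w) : R) <= b k by rewrite /b lerDr addr_ge0.
  have Ek : energy V (Z0 k w) <= E0%:R by rewrite leNgt; apply/negP.
  have [i _ ki] : cluster j [set: 'I_m] (Z0 k w) by apply: contrapT.
  have es : s' <= rest_dist r (state w T k).
    rewrite leNgt; apply/negP => ek; apply: ncl; exists i => //.
    by rewrite inE; apply/existsP; exists k; rewrite /slow Ek ek ki.
  apply: (@le_trans _ _ s').
    by rewrite /s' lerD2r ler_piMr// gerBl.
  by rewrite /cutdist le_min es /s'; lra.
have B : N%:R^-1 * \sum_k b k <= c + 5 * dl.
  rewrite !big_split/= !mulrDr; move: h1 h2 h4; rewrite /freq.
  set a1 := _ * _; set a2 := _ * _; set a3 := _ * _; lra.
apply: (@le_trans _ _ (s * (1 - N%:R^-1 * \sum_k b k) - e / 2)).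
  have : s * (N%:R^-1 * \sum_k b k) <= s * (c + 5 * dl) by rewrite ler_wpM2l.
  have : s * dl <= dl by rewrite ler_piMl// ltW.
  rewrite !mulrBr !mulr1 mulrDr /dl; lra.
rewrite /mean_cut ler_pdivlMl//.
apply: (@le_trans _ _ (\sum_k (s * (1 - b k) - e / 2))); last exact: ler_sum.
have alg (n x y u : R) : 0 < n -> n * (x * (1 - n^-1 * y) - u) = x * (n - y) - n * u.
  by move=> n_gt0; field; rewrite gt_eqF.
rewrite (alg _ _ _ _ N0') sumrB sumr_const card_ord -mulr_sumr sumrB sumr_const card_ord.
by rewrite -[(e / 2) *+ N]mulr_natl.
Qed.

Lemma rest_distance_liminf : {ae Pr, forall w, forall t, 0 <= t ->
  ((Theta r f0)%:E <= limn_einf (fun N => DNEq V S P (fun k : 'I_N => (q N w k t, v N w k t))))%E}.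
Proof.
apply: filterS frequencies_ae => w Fw t t0.
set u := fun N : nat => _.
apply/lee_subgt0Pr => e e0; have [n0 hn0] := mean_cut_liminf Fw t0 e0.
rewrite limn_einf_lim; apply: lime_ge; first exact: is_cvg_einfs.
exists (maxn n0 1) => // n /= hn; apply: le_ereal_inf_tmp => _ [N /= nN <-].
have [N1 N2] : (n0 <= N)%N /\ (0 < N)%N.
  by move: (leq_trans hn nN); rewrite geq_max => /andP[].
apply: (@le_trans _ _ (mean_cut r (@state N w t))%:E); first by rewrite -EFinB lee_fin hn0.
by apply: DNEq_ge => y; exact: hEq.
Qed.

End almost_sure.

(** * Distance to the equilibria *)

Theorem proposition5p11 (R : realType) (d : nat) (hd : (0 < d)%N)
    (V Sigma : 'rV[R]_d -> R) (Phi0 : R -> 'rV[R]_d -> R) (p P : R -> R)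
    (r : R) (f0 : @phase R d -> R)
    (dO : measure_display) (Omega : measurableType dO)
    (Pr : probability Omega R) (Z0 : nat -> {RV Pr >-> @phase R d})
    (q v : forall N : nat, Omega -> 'I_N -> R -> 'rV[R]_d)
    (hf0 : prob_density f0) (hf0_Loo : (normLoo_phase f0 < +oo)%E)
    (hf0_energy :
       (\int[@leb_phase R d]_z
          ((V z.1 + enorm z.2 ^+ 2 / 2) * f0 z)%:E < +oo)%E)
    (h2 : H2 V Sigma Phi0 p) (h3 : H3 Sigma Phi0 p P) (h4 : H4 V Phi0 P)
    (h5 : H5 Sigma P) (hM : HM V Sigma)
    (hSigma : radial Sigma)
    (hr : 0 <= r) (hV : [set x | grad V x = 0] `<=` eball r)
    (hZ0_indep : mutually_independent Z0)
    (hZ0_law : forall k, has_density (Z0 k) f0)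
    (hqv : forall N : nat, (0 < N)%N -> forall w : Omega,
       is_solution V Sigma Phi0 p (fun k : 'I_N => Z0 k w) (q N w) (v N w)) :
  let D N t w := DNEq V Sigma P (fun k : 'I_N => (q N w k t, v N w k t)) in
  let C t := Cst V Sigma Phi0 p t in
  {ae Pr, forall w, forall t, 0 <= t ->
     ((Theta r f0)%:E <= limn_einf (fun N => D N t w))%E} /\
  ((normLoo (opnorm \o weak_hess V) < +oo)%E ->
   forall (N : nat) (t eps : R), (0 < N)%N -> 0 <= t ->
     0 < eps -> eps < Theta r f0 ->
     ((Theta r f0)%:E - C t * ((Num.sqrt N%:R)^-1)%:E
        <= \int[Pr]_w D N t w)%E /\
     (Pr [set w | D N t w <= (Theta r f0 - eps)%:E]
        <= (1 + C t) * ((eps * Num.sqrt N%:R)^-1)%:E)%E).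
Proof.
move=> D C.
case: h2 => -[hPhi cPhi] [hp _] cSigma [locV cV V0].
case: h3 => _ [cP iP _] hP _; case: hM => coercive hxV hxS.
have P0 := memory_nonpos cP iP hP.
have rest N (y : 'I_N -> phase) (h : EqN V Sigma P y) :=
  equilibrium_in_ball (C20_C1 cSigma) hSigma P0 hxV hxS hV h.
split; first exact: (rest_distance_liminf hd hf0 hf0_Loo cV V0 locV coercive cSigma hp hPhi cPhi hr rest hZ0_indep hZ0_law hqv).
move=> hessV [//|N] t eps _ t0 eps0 _.
have weakV : (forall i, has_weak_partial i V) /\ (forall i j, has_weak_partial i (weak_partial j V)).
  by case: locV => _ w1 w2; split => [i|i j]; [exact: (w1 i).1|exact: (w2 i j).1].
exact: (rest_distance_bounds hd hf0 hf0_Loo cV cSigma hp hPhi cPhi weakV hr rest hZ0_indep hZ0_law hqv hessV N t0 eps0).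
Qed.
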